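(* Let $b\in\mathbb{C}$ be arbitrary, let $\vartheta=\tfrac12-b$, $X=x^2/4$, and let $M$ be a positive integer. Then the generalised Bessel function with $a=-\tfrac12$, namely ${}_0\Psi_1(x)=\sum_{n=0}^\infty\frac{x^n}{\Gamma(-\frac12 n+b)\,n!}$, satisfies $$ {}_0\Psi_1(x)=\hat H^{opt}_{0,1}(x)+\frac{X^\vartheta e^{-X}}{2\pi}\left\{\sum_{j=0}^{M-1}\left(\cos(2\pi\vartheta)\,A_j(\tfrac12)-\frac{2\sin(2\pi\vartheta)\,B_j(\tfrac12)}{\sqrt{2\pi X}}\right)(-X)^{-j}+O(X^{-M})\right\} $$ as $x\to+\infty$, where $\hat H^{opt}_{0,1}(x)$ is the optimally truncated algebraic expansion $$\hat H^{opt}_{0,1}(x)=2\sum_{k=0}^{m_o-1}\frac{x^{-2(k+1-b)}}{k!\,\Gamma(2b-1-2k)},\qquad m_o=X+2b-\tfrac32+\alpha,$$ with $m_o$ an integer and $|\alpha|$ bounded, and the coefficients $A_j(\tfrac12)$ and $B_j(\tfrac12)$ (the latter depending on $\alpha$) are those defined in the context.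
   Context: Coefficients: with $(c)_j=\Gamma(c+j)/\Gamma(c)=c(c+1)\cdots(c+j-1)$ the Pochhammer symbol, $$A_j(\tfrac12)=2\sqrt\pi\,\frac{(b)_j(b-\frac12)_j}{j!},\qquad B_j(\tfrac12)=\sum_{k=0}^j(-2)^k(\tfrac12)_k\,A_{j-k}(\tfrac12)\,G_{2k,j-k}(\tfrac12).$$ Here, with $\gamma_j=\alpha-j$, where $\alpha=m_o-X-2b+\tfrac32$ is the bounded quantity (depending on $x$) defined by the choice of the integer $m_o$, the coefficients $G_{k,j}(\tfrac12)$ are defined by the expansion about $w=0$ $$\frac{\tau^{\gamma_j-1}}{1-\tau}\,\frac{d\tau}{dw}=-\frac1w+\sum_{k=0}^\infty G_{k,j}(\tfrac12)\,w^k,\qquad \tfrac12w^2=\tau-\log\tau-1,$$ the branch of $w(\tau)$ being chosen such that $w\sim\tau-1$ as $\tau\to1$ (so that $\tau=1+w+\tfrac13w^2+\tfrac1{36}w^3-\cdots$). For example $G_{0,j}(\tfrac12)=\tfrac23-\gamma_j$ and $36\,G_{2,j}(\tfrac12)=\tfrac1{15}(46-225\gamma_j+270\gamma_j^2-90\gamma_j^3)$. Convention: $1/\Gamma$ is the entire reciprocal gamma function (so terms vanish when the argument is a non-positive integer). *)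

(* Defs.v *)
From Stdlib Require Import Reals Factorial ClassicalEpsilon.
From Coquelicot Require Import Coquelicot.
Open Scope R_scope.

Fixpoint Csum (f : nat -> C) (n : nat) : C :=
  match n with
  | O => RtoC 0
  | S m => (Csum f m + f m)%C
  end.

Definition CLim_seq (u : nat -> C) : C :=
  (real (Lim_seq (fun n => Re (u n))), real (Lim_seq (fun n => Im (u n)))).

Definition CSeries (a : nat -> C) : C :=
  (Series (fun n => Re (a n)), Series (fun n => Im (a n))).

Definition Cexp (z : C) : C := (exp (Re z) * cos (Im z), exp (Re z) * sin (Im z)).

Definition Ccos (z : C) : C := ((Cexp (Ci * z) + Cexp (- (Ci * z))) / 2)%C.

Definition Csin (z : C) : C := ((Cexp (Ci * z) - Cexp (- (Ci * z))) / (2 * Ci))%C.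

(* Principal power x^z with positive real base x; only meaningful for 0 < x. *)
Definition Rcpow (x : R) (z : C) : C := Cexp (z * RtoC (ln x))%C.

(* (c)_j = c (c+1) ... (c+j-1) *)
Fixpoint poch (c : C) (j : nat) : C :=
  match j with
  | O => RtoC 1
  | S i => (poch c i * (c + RtoC (INR i)))%C
  end.

(* The entire function 1/Gamma, by Gauss's product
   1/Gamma(z) = lim_n  z (z+1) ... (z+n) / (n! n^z). *)
Definition rGamma (z : C) : C :=
  CLim_seq (fun n => poch z (S n) / (RtoC (INR (fact n)) * Rcpow (INR n) z))%C.

(* sum_n x^n / (Gamma(a n + b) n!) *)
Definition Psi01 (a : R) (b : C) (x : R) : C :=
  CSeries (fun n => RtoC (x ^ n) * rGamma (RtoC (a * INR n) + b)
                    / RtoC (INR (fact n)))%C.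

Definition Xof (x : R) : R := x ^ 2 / 4.

(* The sum runs over k = 0, ..., m-1. *)
Definition Hopt (b : C) (m : nat) (x : R) : C :=
  (2 * Csum (fun k =>
         Rcpow x (- (2 * (RtoC (INR k) + 1 - b)))
         * rGamma (2 * b - 1 - RtoC (2 * INR k))
         / RtoC (INR (fact k))) m)%C.

(* tau is, near w = 0, the branch of w^2/2 = tau - log tau - 1 with
   tau - 1 ~ w.  This determines the germ of tau at 0. *)
Definition is_tau_branch (tau : R -> R) : Prop :=
  locally 0 (fun w => 0 < tau w /\ w ^ 2 / 2 = tau w - ln (tau w) - 1)
  /\ is_lim (fun w => (tau w - 1) / w) 0 1.

(* tau^(gamma-1)/(1-tau) dtau/dw = -1/w + sum_k g_k w^k  for small w <> 0.
   Restricting to real w still determines the g_k. *)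
Definition is_G_expansion (gamma : C) (g : nat -> C) : Prop :=
  exists tau : R -> R, is_tau_branch tau /\
    locally' 0 (fun w : R =>
      @is_pseries C_AbsRing C_NormedModule g (RtoC w)
        (Rcpow (tau w) (gamma - 1) / RtoC (1 - tau w) * RtoC (Derive tau w)
         + 1 / RtoC w)%C).

Definition Gseq (gamma : C) : nat -> C :=
  epsilon (inhabits (fun _ : nat => RtoC 0)) (is_G_expansion gamma).

(* G_{k,j}(1/2), with gamma_j = alpha - j *)
Definition Gcoef (alpha : C) (k j : nat) : C :=
  Gseq (alpha - RtoC (INR j))%C k.

(* A_j(1/2) *)
Definition Acoef (b : C) (j : nat) : C :=
  (RtoC (2 * sqrt PI) * (poch b j * poch (b - RtoC (1 / 2)) j)
   / RtoC (INR (fact j)))%C.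

(* B_j(1/2) *)
Definition Bcoef (b alpha : C) (j : nat) : C :=
  Csum (fun k => RtoC ((-2) ^ k) * poch (RtoC (1 / 2)) k
                 * Acoef b (j - k) * Gcoef alpha (2 * k) (j - k))%C (S j).

(* Main.v *)
(** For negative argument the Bessel function [Psi] is a Laplace-type integral
with a real saddle point, so that [Psi b (- x)] is exponentially small.  The
algebraic expansion is governed by the exact identity
[Psi(x) - H_m(x) = - cos(2 pi b) Psi(- x) - sin(2 pi b) / pi * N_m(x)],
where [N_m(x)] is the principal value of the integral over [tau > 0] of
[tau^(m - b) Psi(- x sqrt tau) / (1 - tau)].  For [0 < Re b < 1], [m = 0] it follows by
collapsing the contour onto the imaginary axis and evaluating the principal
value of each exponential by Cauchy's theorem; it extends to all [b] and [m] by
differentiation in [x], the moments of [Psi], and the three-term recurrence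
in [b].  Inserting the expansion of [Psi(- x)] into [N_m], each term has
exponent [X (tau - log tau - 1)]: the optimal [m] moves the saddle point onto
the pole [tau = 1].  Substituting [w^2 / 2 = tau - log tau - 1], the [1 / w] part is
odd and has vanishing principal value, and the Gaussian moments of the even
coefficients give the [B_j]. *)

Require Import Defs.
From Stdlib Require Import Wf_nat Reals Factorial Lra Lia Psatz FunctionalExtensionality ClassicalEpsilon.
From Coquelicot Require Import Coquelicot.
Open Scope R_scope.
Set Bullet Behavior "Strict Subproofs".

(** The shift [alpha] varies with [x] and is only bounded, so every estimate leading to the B_j must
    be uniform over a disc of exponents. For this reason the branch [tauf] and the coefficients [ps]
    are built from explicit recursions with geometric bounds ([32], [160 + 3 * G]) and identified
    only afterwards, by uniqueness of germs, with the G-coefficients picked by [epsilon]. The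
    function 1/Gamma is given by Gauss's product. It is identified with a line integral, for every
    abscissa c > 0, through its recurrence and its growth at infinity. The freedom in c then does
    the work of contour shifts: arbitrary exponential decay, the passage through the saddle point,
    and the limit c -> 0 onto the imaginary axis. A principal value is folded onto y > 0 with tau =
    e^(2 y), where the difference k(-y) - k(y) cancels the zero of sinh. The price is that bounds
    need the derivative of k. So the remainder in the expansion of Psi(- x) carries a derivative
    bound, differentiation costs a factor X, and the expansion is taken to M + 1 terms; its term j =
    M joins the error. *)

Notation RV := R_CompleteNormedModule.

(** * Modulus and exponential of complex numbers *)

Lemma C_ext (z w : C) : Re z = Re w -> Im z = Im w -> z = w.
Proof. destruct z, w; simpl; intros; subst; auto. Qed.

Lemma Cmod_le_sum (z : C) : Cmod z <= Rabs (Re z) + Rabs (Im z).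
Proof.
  destruct z as [a b]; unfold Cmod; simpl.
  apply Rsqr_incr_0_var. 2: generalize (Rabs_pos a) (Rabs_pos b); lra.
  rewrite Rsqr_sqrt by nra.
  unfold Rsqr. generalize (Rabs_pos a) (Rabs_pos b).
  assert (Rabs a * Rabs a = a * a) by (rewrite <- Rabs_mult; apply Rabs_pos_eq; nra).
  assert (Rabs b * Rabs b = b * b) by (rewrite <- Rabs_mult; apply Rabs_pos_eq; nra).
  nra.
Qed.

Lemma Im_le_Cmod (z : C) : Rabs (Im z) <= Cmod z.
Proof. eapply Rle_trans; [|apply Rmax_Cmod]. apply Rmax_r. Qed.

Lemma Re_le_Cmod (z : C) : Rabs (Re z) <= Cmod z.
Proof. eapply Rle_trans; [|apply Rmax_Cmod]. apply Rmax_l. Qed.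

Lemma Cmod_minus_sym (z w : C) : Cmod (z - w) = Cmod (w - z).
Proof. replace (z - w)%C with (- (w - z))%C by ring. apply Cmod_opp. Qed.

Lemma Cmod_triang_minus (z w : C) : Cmod (z - w) <= Cmod z + Cmod w.
Proof. unfold Cminus. eapply Rle_trans; [apply Cmod_triangle|]. rewrite Cmod_opp. lra. Qed.

Lemma Cmod_triang_rev (z w : C) : Cmod z - Cmod w <= Cmod (z - w).
Proof.
  assert (H := Cmod_triangle (z - w) w).
  replace (z - w + w)%C with z in H by ring. lra.
Qed.

Lemma Cmod_RtoC (x : R) : Cmod (RtoC x) = Rabs x.
Proof. apply Cmod_R. Qed.

Lemma RtoC_div (x y : R) : y <> 0 -> RtoC (x / y) = (RtoC x / RtoC y)%C.
Proof. intros. unfold Rdiv. rewrite RtoC_mult, RtoC_inv; auto. Qed.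

Lemma RtoC_neq0 (x : R) : x <> 0 -> RtoC x <> 0%C.
Proof. intros H E. apply H. injection E; auto. Qed.

Lemma Cexp_add (a b : C) : Cexp (a + b) = (Cexp a * Cexp b)%C.
Proof.
  destruct a as [a1 a2], b as [b1 b2]. unfold Cexp, Cmult, Cplus; simpl.
  rewrite exp_plus, cos_plus, sin_plus. f_equal; ring.
Qed.

Lemma Cexp_0 : Cexp 0 = 1%C.
Proof. unfold Cexp; simpl. rewrite exp_0, cos_0, sin_0. apply C_ext; simpl; ring. Qed.

Lemma Cexp_R (x : R) : Cexp (RtoC x) = RtoC (exp x).
Proof. unfold Cexp; simpl. rewrite cos_0, sin_0. apply C_ext; simpl; ring. Qed.

Lemma Cmod_Cexp (z : C) : Cmod (Cexp z) = exp (Re z).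
Proof.
  unfold Cmod, Cexp; simpl.
  replace (_ + _) with ((exp (Re z))^2).
  - apply sqrt_pow2. left; apply exp_pos.
  - assert (H := sin2_cos2 (Im z)). unfold Rsqr in H.
    transitivity (exp (Re z) ^ 2 * (sin (Im z) * sin (Im z) + cos (Im z) * cos (Im z))).
    rewrite H; ring. ring.
Qed.

Lemma Cexp_neq0 (z : C) : Cexp z <> 0%C.
Proof. intros H. assert (E := Cmod_Cexp z). rewrite H, Cmod_0 in E. generalize (exp_pos (Re z)); lra. Qed.

Lemma Cexp_opp (z : C) : Cexp (- z) = (/ Cexp z)%C.
Proof.
  assert (H : (Cexp (-z) * Cexp z = 1)%C).
  { rewrite <- Cexp_add. replace (- z + z)%C with (RtoC 0) by ring. apply Cexp_0. }
  rewrite <- (Cmult_1_r (Cexp (-z))).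
  rewrite <- (Cinv_r (Cexp z)) by apply Cexp_neq0.
  rewrite Cmult_assoc, H. ring.
Qed.

Lemma Cexp_minus (z w : C) : Cexp (z - w) = (Cexp z / Cexp w)%C.
Proof. unfold Cminus. rewrite Cexp_add, Cexp_opp. reflexivity. Qed.

(** * Componentwise calculus of complex-valued functions *)

Definition contC {T : UniformSpace} (f : T -> C) (t : T) : Prop :=
  continuous (fun s => Re (f s)) t /\ continuous (fun s => Im (f s)) t.

Definition dC (f : R -> C) (t : R) (l : C) : Prop :=
  is_derive (fun s => Re (f s)) t (Re l) /\ is_derive (fun s => Im (f s)) t (Im l).

Section Continuity.
Context {T : UniformSpace}.

Lemma cR_plus (f g : T -> R) t : continuous f t -> continuous g t -> continuous (fun s => f s + g s) t.
Proof. intros; apply (continuous_plus (V:=R_NormedModule)); auto. Qed.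
Lemma cR_opp (f : T -> R) t : continuous f t -> continuous (fun s => - f s) t.
Proof. intros; apply (continuous_opp (V:=R_NormedModule)); auto. Qed.
Lemma cR_minus (f g : T -> R) t : continuous f t -> continuous g t -> continuous (fun s => f s - g s) t.
Proof. intros; apply (continuous_minus (V:=R_NormedModule)); auto. Qed.
Lemma cR_mult (f g : T -> R) t : continuous f t -> continuous g t -> continuous (fun s => f s * g s) t.
Proof. intros; apply (continuous_mult (K:=R_AbsRing)); auto. Qed.
Lemma cR_const (c : R) (t : T) : continuous (fun _ : T => c) t.
Proof. apply continuous_const. Qed.
Lemma cR_comp (f : T -> R) (g : R -> R) t : continuous f t -> continuous g (f t) -> continuous (fun s => g (f s)) t.
Proof. intros; apply continuous_comp; auto. Qed.
Lemma cR_exp (f : T -> R) t : continuous f t -> continuous (fun s => exp (f s)) t.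
Proof. intros; apply cR_comp; auto. apply (ex_derive_continuous (V:=R_NormedModule)). eexists; apply is_derive_exp. Qed.
Lemma cR_cos (f : T -> R) t : continuous f t -> continuous (fun s => cos (f s)) t.
Proof. intros; apply cR_comp; auto. apply continuous_cos. Qed.
Lemma cR_sin (f : T -> R) t : continuous f t -> continuous (fun s => sin (f s)) t.
Proof. intros; apply cR_comp; auto. apply continuous_sin. Qed.
Lemma cR_atan (f : T -> R) t : continuous f t -> continuous (fun s => atan (f s)) t.
Proof. intros; apply cR_comp; auto. apply (ex_derive_continuous (V:=R_NormedModule)). eexists; apply is_derive_atan. Qed.
Lemma cR_ln (f : T -> R) t : 0 < f t -> continuous f t -> continuous (fun s => ln (f s)) t.
Proof. intros; apply cR_comp; auto. apply (ex_derive_continuous (V:=R_NormedModule)). eexists; apply is_derive_ln; auto. Qed.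
Lemma cR_inv (f : T -> R) t : f t <> 0 -> continuous f t -> continuous (fun s => / f s) t.
Proof. intros; apply cR_comp; auto. apply (ex_derive_continuous (V:=R_NormedModule)). eexists; apply is_derive_inv; auto. apply is_derive_id. Qed.
Lemma cR_div (f g : T -> R) t : g t <> 0 -> continuous f t -> continuous g t -> continuous (fun s => f s / g s) t.
Proof. intros; apply cR_mult; auto; apply cR_inv; auto. Qed.
Lemma cR_pow (f : T -> R) n t : continuous f t -> continuous (fun s => f s ^ n) t.
Proof. intros; induction n; simpl. apply cR_const. apply cR_mult; auto. Qed.
Lemma cR_abs (f : T -> R) t : continuous f t -> continuous (fun s => Rabs (f s)) t.
Proof. intros; apply (cR_comp f Rabs); auto. apply continuous_Rabs. Qed.
Lemma cR_sqrt (f : T -> R) t : continuous f t -> continuous (fun s => sqrt (f s)) t.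
Proof. intros; apply cR_comp; auto. apply continuous_sqrt. Qed.

Lemma cC_mk (f g : T -> R) t : continuous f t -> continuous g t -> contC (fun s => (f s, g s)) t.
Proof. split; auto. Qed.
Lemma cC_Re (f : T -> C) t : contC f t -> continuous (fun s => Re (f s)) t.
Proof. intros [A B]; auto. Qed.
Lemma cC_Im (f : T -> C) t : contC f t -> continuous (fun s => Im (f s)) t.
Proof. intros [A B]; auto. Qed.
Lemma cC_const (c : C) (t : T) : contC (fun _ : T => c) t.
Proof. split; apply continuous_const. Qed.
Lemma cC_RtoC (f : T -> R) t : continuous f t -> contC (fun s => RtoC (f s)) t.
Proof. split; simpl; auto. apply cR_const. Qed.
Lemma cC_plus (f g : T -> C) t : contC f t -> contC g t -> contC (fun s => f s + g s)%C t.
Proof. intros [A B] [A' B']; split; simpl; apply cR_plus; auto. Qed.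
Lemma cC_opp (f : T -> C) t : contC f t -> contC (fun s => - f s)%C t.
Proof. intros [A B]; split; simpl; apply cR_opp; auto. Qed.
Lemma cC_minus (f g : T -> C) t : contC f t -> contC g t -> contC (fun s => f s - g s)%C t.
Proof. intros; apply cC_plus; auto; apply cC_opp; auto. Qed.
Lemma cC_mult (f g : T -> C) t : contC f t -> contC g t -> contC (fun s => f s * g s)%C t.
Proof.
  intros [A B] [A' B']; split; simpl.
  apply cR_minus; apply cR_mult; auto. apply cR_plus; apply cR_mult; auto.
Qed.
Lemma cC_Cexp (f : T -> C) t : contC f t -> contC (fun s => Cexp (f s)) t.
Proof.
  intros [A B]; split; simpl.
  apply cR_mult. apply cR_exp; auto. apply cR_cos; auto.
  apply cR_mult. apply cR_exp; auto. apply cR_sin; auto.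
Qed.
Lemma cC_inv (f : T -> C) t : f t <> 0%C -> contC f t -> contC (fun s => / f s)%C t.
Proof.
  intros N [A B].
  assert (P : (Re (f t)) ^ 2 + (Im (f t)) ^ 2 <> 0).
  { intros E. apply N. apply C_ext; simpl; nra. }
  split; simpl.
  - apply cR_div; auto. apply (cR_plus (fun s => Re (f s) ^ 2) (fun s => Im (f s) ^ 2)); apply cR_pow; auto.
  - apply cR_div; auto. apply cR_opp; auto. apply (cR_plus (fun s => Re (f s) ^ 2) (fun s => Im (f s) ^ 2)); apply cR_pow; auto.
Qed.
Lemma cC_div (f g : T -> C) t : g t <> 0%C -> contC f t -> contC g t -> contC (fun s => f s / g s)%C t.
Proof. intros; apply cC_mult; auto; apply cC_inv; auto. Qed.
Lemma cC_pow (f : T -> C) n t : contC f t -> contC (fun s => f s ^ n)%C t.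
Proof. intros; induction n; simpl. apply cC_const. apply cC_mult; auto. Qed.
Lemma cR_Cmod (f : T -> C) t : contC f t -> continuous (fun s => Cmod (f s)) t.
Proof.
  intros [A B]. unfold Cmod. apply cR_sqrt.
  apply (cR_plus (fun s => Re (f s) ^ 2) (fun s => Im (f s) ^ 2)); apply cR_pow; auto.
Qed.
End Continuity.

Lemma cC_comp {T U : UniformSpace} (f : T -> U) (g : U -> C) t :
  continuous f t -> contC g (f t) -> contC (fun s => g (f s)) t.
Proof.
  intros A [B1 B2]; split.
  apply (continuous_comp f (fun s => Re (g s))); auto.
  apply (continuous_comp f (fun s => Im (g s))); auto.
Qed.

Lemma cR_fst {U V : UniformSpace} (t : U * V) : continuous (fun s : U * V => fst s) t.
Proof. apply continuous_fst. Qed.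
Lemma cR_snd {U V : UniformSpace} (t : U * V) : continuous (fun s : U * V => snd s) t.
Proof. apply continuous_snd. Qed.
Lemma cR_id (t : R) : continuous (fun s : R => s) t.
Proof. apply continuous_id. Qed.

Ltac contstep :=
  match goal with
  | |- continuous fst _ => apply cR_fst
  | |- continuous snd _ => apply cR_snd
  | |- contC RtoC ?x => change (contC (fun t : R => RtoC t) x)
  | |- contC (fun _ => (_ + _)%C) _ => apply cC_plus
  | |- contC (fun _ => (_ - _)%C) _ => apply cC_minus
  | |- contC (fun _ => (_ * _)%C) _ => apply cC_mult
  | |- contC (fun _ => (- _)%C) _ => apply cC_opp
  | |- contC (fun _ => (_ / _)%C) _ => apply cC_div
  | |- contC (fun _ => (/ _)%C) _ => apply cC_inv
  | |- contC (fun _ => (_ ^ _)%C) _ => apply cC_pow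
  | |- contC (fun _ => Cexp _) _ => apply cC_Cexp
  | |- contC (fun _ => RtoC _) _ => apply cC_RtoC
  | |- contC (fun _ => ?c) _ => apply cC_const
  | |- contC (fun _ => (_, _)) _ => apply cC_mk
  | |- continuous (fun _ => Re _) _ => apply cC_Re
  | |- continuous (fun _ => Im _) _ => apply cC_Im
  | |- continuous (fun _ => Cmod _) _ => apply cR_Cmod
  | |- continuous (fun _ => ?c) _ => apply cR_const
  | |- continuous (fun s => s) _ => apply cR_id
  | |- continuous (fun s => fst s) _ => apply cR_fst
  | |- continuous (fun s => snd s) _ => apply cR_snd
  | |- continuous (fun _ => _ + _) _ => apply cR_plus
  | |- continuous (fun _ => _ - _) _ => apply cR_minus
  | |- continuous (fun _ => _ * _) _ => apply cR_mult
  | |- continuous (fun _ => - _) _ => apply cR_opp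
  | |- continuous (fun _ => _ / _) _ => apply cR_div
  | |- continuous (fun _ => / _) _ => apply cR_inv
  | |- continuous (fun _ => _ ^ _) _ => apply cR_pow
  | |- continuous (fun _ => exp _) _ => apply cR_exp
  | |- continuous (fun _ => cos _) _ => apply cR_cos
  | |- continuous (fun _ => sin _) _ => apply cR_sin
  | |- continuous (fun _ => atan _) _ => apply cR_atan
  | |- continuous (fun _ => ln _) _ => apply cR_ln
  | |- continuous (fun _ => sqrt _) _ => apply cR_sqrt
  | |- continuous (fun _ => Rabs _) _ => apply cR_abs
  | |- continuous ?f ?x => lazymatch f with fun _ => _ => fail | _ => change (continuous (fun t : R => f t) x) end
  end.
Ltac cont := repeat (first [assumption | contstep]).

Lemma dC_const (c : C) t : dC (fun _ => c) t 0%C.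
Proof. split; simpl; apply (is_derive_const (V:=R_NormedModule)). Qed.

Lemma dC_RtoC (f : R -> R) t l : is_derive f t l -> dC (fun s => RtoC (f s)) t (RtoC l).
Proof. split; simpl; auto. apply (is_derive_const (V:=R_NormedModule)). Qed.

Lemma dC_plus f g t l k : dC f t l -> dC g t k -> dC (fun s => f s + g s)%C t (l + k)%C.
Proof. intros [A B] [A' B']; split; simpl; apply (is_derive_plus (V:=R_NormedModule)); auto. Qed.

Lemma dC_opp f t l : dC f t l -> dC (fun s => - f s)%C t (- l)%C.
Proof. intros [A B]; split; simpl; apply (is_derive_opp (V:=R_NormedModule)); auto. Qed.

Lemma dC_minus f g t l k : dC f t l -> dC g t k -> dC (fun s => f s - g s)%C t (l - k)%C.
Proof. intros; apply dC_plus; auto; apply dC_opp; auto. Qed.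

Lemma dR_id t : is_derive (fun s : R => s) t 1.
Proof. apply (is_derive_id (K:=R_AbsRing)). Qed.
Lemma dR_mult (f g : R -> R) t l k : is_derive f t l -> is_derive g t k ->
  is_derive (fun s => f s * g s) t (l * g t + f t * k).
Proof. intros. apply (is_derive_mult (K:=R_AbsRing)); auto. intros; apply Rmult_comm. Qed.

Lemma dC_mult f g t l k : dC f t l -> dC g t k -> dC (fun s => f s * g s)%C t (l * g t + f t * k)%C.
Proof.
  intros [A B] [A' B']; split; simpl.
  - evar_last. apply (is_derive_minus (V:=R_NormedModule)); apply dR_mult; eassumption.
    simpl. unfold minus, plus, opp; simpl. unfold Re, Im. ring.
  - evar_last. apply (is_derive_plus (V:=R_NormedModule)); apply dR_mult; eassumption.
    simpl. unfold minus, plus, opp; simpl. unfold Re, Im. ring.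
Qed.

Lemma dR_comp (g f : R -> R) t l k : is_derive f t l -> is_derive g (f t) k ->
  is_derive (fun s => g (f s)) t (l * k).
Proof. intros. apply (is_derive_comp g f); auto. Qed.

Lemma dC_Cexp f t l : dC f t l -> dC (fun s => Cexp (f s)) t (l * Cexp (f t))%C.
Proof.
  intros [A B]. split; simpl.
  - evar_last. apply dR_mult. eapply dR_comp; [exact A|apply is_derive_exp].
    eapply dR_comp; [exact B|apply is_derive_cos]. unfold Re, Im. ring.
  - evar_last. apply dR_mult. eapply dR_comp; [exact A|apply is_derive_exp].
    eapply dR_comp; [exact B|apply is_derive_sin]. unfold Re, Im. ring.
Qed.

Lemma dC_ext f g t l : (forall s, f s = g s) -> dC f t l -> dC g t l.
Proof. intros E. replace g with f; auto. apply functional_extensionality; auto. Qed.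

Lemma dC_ext_loc f g t l : locally t (fun s => f s = g s) -> dC f t l -> dC g t l.
Proof.
  intros E [A B]. split; [refine (is_derive_ext_loc _ _ _ _ _ A)|refine (is_derive_ext_loc _ _ _ _ _ B)];
  (eapply filter_imp; [|exact E]); intros s Es; cbv beta in Es |- *; f_equal; exact Es.
Qed.

Lemma dC_comp (g : R -> C) (f : R -> R) t l k : is_derive f t l -> dC g (f t) k ->
  dC (fun s => g (f s)) t (RtoC l * k)%C.
Proof.
  intros A [B1 B2]. split; simpl.
  - evar_last. apply (dR_comp (fun s => Re (g s)) f); eassumption. unfold Re, Im; simpl. ring.
  - evar_last. apply (dR_comp (fun s => Im (g s)) f); eassumption. unfold Re, Im; simpl. ring.
Qed.

Lemma dC_cont f t l : dC f t l -> contC f t.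
Proof.
  intros [A B]. split; apply (ex_derive_continuous (V:=R_NormedModule)); eexists; eassumption.
Qed.

Lemma dC_inv (f : R -> C) (t : R) (l : C) : f t <> 0%C -> dC f t l -> dC (fun s => / f s)%C t (- l / (f t * f t))%C.
Proof.
  intros N [A B].
  assert (P : (Re (f t)) ^ 2 + (Im (f t)) ^ 2 <> 0).
  { intros E. apply N. apply C_ext; simpl; nra. }
  assert (D : is_derive (fun s => Re (f s) ^ 2 + Im (f s) ^ 2) t (2 * Re l * Re (f t) + 2 * Im l * Im (f t))).
  { evar_last. apply (is_derive_plus (V:=R_NormedModule)); (apply is_derive_pow; eassumption).
    unfold plus; simpl. ring. }
  assert (Q : Re (f t * f t)%C ^ 2 + Im (f t * f t)%C ^ 2 = (Re (f t) ^ 2 + Im (f t) ^ 2)^2).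
  { unfold Re, Im; simpl. ring. }
  assert (P' : fst (f t) * fst (f t) + snd (f t) * snd (f t) <> 0).
  { intros E; apply P; unfold Re, Im; nra. }
  split.
  - evar_last. apply (is_derive_div (fun s => Re (f s)) (fun s => Re (f s) ^ 2 + Im (f s) ^ 2) t _ _ A D P).
    unfold Re, Im in *; simpl in *. rewrite Q. field. auto.
  - assert (A' : is_derive (fun s => - Im (f s)) t (- Im l)) by (apply (is_derive_opp (V:=R_NormedModule)); auto).
    evar_last. apply (is_derive_div (fun s => - Im (f s)) (fun s => Re (f s) ^ 2 + Im (f s) ^ 2) t _ _ A' D P).
    unfold opp, Re, Im in *; simpl in *. rewrite Q. field. auto.
Qed.

Lemma R_mvt_bound (h dh : R -> R) (D a b : R) : a <= b ->
  (forall t, a <= t <= b -> is_derive h t (dh t) /\ Rabs (dh t) <= D) ->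
  Rabs (h b - h a) <= D * (b - a).
Proof.
  intros Hab H.
  destruct (MVT_gen h a b dh) as [c [Hc E]].
  - intros x Hx. rewrite Rmin_left, Rmax_right in Hx by lra. apply H. lra.
  - intros x Hx. rewrite Rmin_left, Rmax_right in Hx by lra.
    apply continuity_pt_filterlim. apply (ex_derive_continuous (V:=R_NormedModule)). eexists. apply H. lra.
  - rewrite Rmin_left, Rmax_right in Hc by lra. rewrite E.
    rewrite Rabs_mult, (Rabs_pos_eq (b - a)) by lra. apply Rmult_le_compat_r. lra. apply H. auto.
Qed.

(** The mean value theorem fails for complex values, so it is applied to both parts separately; this
    is the origin of the factor 2, and the same splitting gives the 2 in [CInt_bound]. *)
Lemma dC_mvt (f df : R -> C) (D a b : R) : a <= b ->
  (forall t, a <= t <= b -> dC f t (df t) /\ Cmod (df t) <= D) ->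
  Cmod (f b - f a) <= 2 * D * (b - a).
Proof.
  intros Hab H. eapply Rle_trans; [apply Cmod_le_sum|].
  assert (A := R_mvt_bound (fun t => Re (f t)) (fun t => Re (df t)) D a b Hab).
  assert (B := R_mvt_bound (fun t => Im (f t)) (fun t => Im (df t)) D a b Hab).
  simpl in *. unfold Re, Im in *. unfold Rminus in *.
  enough (Rabs (fst (f b) + - fst (f a)) <= D * (b + - a) /\ Rabs (snd (f b) + - snd (f a)) <= D * (b + - a)) by lra.
  split; [apply A|apply B]; intros t Ht; destruct (H t Ht) as [[P Q] R]; split; auto;
  (eapply Rle_trans; [|exact R]). apply Re_le_Cmod. apply Im_le_Cmod.
Qed.

(** Mean value bound for t -> e^(t z) on the segment from 0 to z. *)
Lemma Cexp_sub1_bound (z : C) : Cmod (Cexp z - 1) <= 2 * Cmod z * exp (Cmod z).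
Proof.
  assert (H := dC_mvt (fun t => Cexp (RtoC t * z)) (fun t => z * Cexp (RtoC t * z))%C
     (Cmod z * exp (Cmod z)) 0 1 ltac:(lra)).
  simpl in H. rewrite Cmult_1_l, Cmult_0_l, Cexp_0 in H.
  eapply Rle_trans; [apply H|]. 2: right; ring.
  intros t Ht. split.
  - evar_last. apply dC_Cexp. apply dC_mult. apply dC_RtoC. apply dR_id. apply dC_const.
    simpl. ring.
  - rewrite Cmod_mult, Cmod_Cexp. apply Rmult_le_compat_l. apply Cmod_ge_0.
    assert (Re (RtoC t * z) <= Cmod z).
    { simpl. assert (Q := Re_le_Cmod z). assert (R := Cmod_ge_0 z).
      replace (t * fst z - 0 * snd z) with (t * Re z) by (unfold Re; ring).
      unfold Rabs in Q; destruct Rcase_abs; nra. }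
    destruct (Rle_lt_or_eq_dec _ _ H0). left; apply exp_increasing; auto. right; f_equal; auto.
Qed.

Lemma exp_le (x y : R) : x <= y -> exp x <= exp y.
Proof. intros [H|H]. left; apply exp_increasing; auto. right; f_equal; auto. Qed.

(** * Integrals over compact intervals: substitution, parameters, Fubini *)

Definition CInt (f : R -> C) (a b : R) : C :=
  (RInt (fun t => Re (f t)) a b, RInt (fun t => Im (f t)) a b).

Lemma ex_RInt_cont (f : R -> R) a b : a <= b -> (forall x, a <= x <= b -> continuous f x) -> ex_RInt f a b.
Proof. intros H K. apply (ex_RInt_continuous (V:=RV)). intros z Hz. rewrite Rmin_left, Rmax_right in Hz by lra. auto. Qed.

Lemma RInt_ext_le (f g : R -> R) a b : a <= b -> (forall x, a <= x <= b -> f x = g x) -> RInt f a b = RInt g a b.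
Proof. intros H K. apply RInt_ext. rewrite Rmin_left, Rmax_right by lra. intros; apply K; lra. Qed.

Lemma CInt_ext f g a b : a <= b -> (forall x, a <= x <= b -> f x = g x) -> CInt f a b = CInt g a b.
Proof. intros H K. unfold CInt. f_equal; apply RInt_ext_le; auto; intros; rewrite K; auto. Qed.

Definition contOn (f : R -> C) a b := forall x, a <= x <= b -> contC f x.

Lemma contOn_exRe f a b : a <= b -> contOn f a b -> ex_RInt (fun t => Re (f t)) a b.
Proof. intros H K. apply ex_RInt_cont; auto. intros; apply (K x); auto. Qed.
Lemma contOn_exIm f a b : a <= b -> contOn f a b -> ex_RInt (fun t => Im (f t)) a b.
Proof. intros H K. apply ex_RInt_cont; auto. intros; apply (K x); auto. Qed.
#[export] Hint Resolve contOn_exRe contOn_exIm : core.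

Lemma R_RInt_plus f g a b : ex_RInt f a b -> ex_RInt g a b ->
  RInt (fun t => f t + g t) a b = RInt f a b + RInt g a b.
Proof. intros. apply (RInt_plus (V:=RV)); auto. Qed.
Lemma R_RInt_minus f g a b : ex_RInt f a b -> ex_RInt g a b ->
  RInt (fun t => f t - g t) a b = RInt f a b - RInt g a b.
Proof. intros. apply (RInt_minus (V:=RV)); auto. Qed.
Lemma R_RInt_scal f (c : R) a b : ex_RInt f a b ->
  RInt (fun t => c * f t) a b = c * RInt f a b.
Proof. intros. apply (RInt_scal (V:=RV)); auto. Qed.
Lemma R_ex_minus f g a b : ex_RInt f a b -> ex_RInt g a b -> ex_RInt (fun t => f t - g t) a b.
Proof. intros. apply (ex_RInt_minus (V:=R_NormedModule)); auto. Qed.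
Lemma R_ex_scal f (c : R) a b : ex_RInt f a b -> ex_RInt (fun t => c * f t) a b.
Proof. intros. apply (ex_RInt_scal (V:=R_NormedModule)); auto. Qed.

Lemma CInt_plus f g a b : a <= b -> contOn f a b -> contOn g a b ->
  CInt (fun t => f t + g t)%C a b = (CInt f a b + CInt g a b)%C.
Proof. intros. unfold CInt. apply C_ext; simpl; apply R_RInt_plus; auto. Qed.

Lemma CInt_scal f (c : C) a b : a <= b -> contOn f a b ->
  CInt (fun t => c * f t)%C a b = (c * CInt f a b)%C.
Proof.
  intros H K. assert (A := contOn_exRe f a b H K). assert (B := contOn_exIm f a b H K).
  unfold CInt. apply C_ext; simpl.
  - change (RInt (fun t => fst c * Re (f t) - snd c * Im (f t)) a b = fst c * RInt (fun t => Re (f t)) a b - snd c * RInt (fun t => Im (f t)) a b).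
    rewrite R_RInt_minus, !R_RInt_scal; auto; apply R_ex_scal; auto.
  - change (RInt (fun t => fst c * Im (f t) + snd c * Re (f t)) a b = fst c * RInt (fun t => Im (f t)) a b + snd c * RInt (fun t => Re (f t)) a b).
    rewrite R_RInt_plus, !R_RInt_scal; auto; apply R_ex_scal; auto.
Qed.

Lemma CInt_Chasles f a b c : a <= b -> b <= c -> contOn f a c ->
  (CInt f a b + CInt f b c)%C = CInt f a c.
Proof.
  intros H1 H2 K.
  assert (K1 : contOn f a b) by (intros x Hx; apply K; lra).
  assert (K2 : contOn f b c) by (intros x Hx; apply K; lra).
  unfold CInt. apply C_ext; simpl; apply (RInt_Chasles (V:=RV)); auto.
Qed.

Lemma CInt_bound f g a b : a <= b -> contOn f a b -> ex_RInt g a b ->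
  (forall x, a <= x <= b -> Cmod (f x) <= g x) -> Cmod (CInt f a b) <= 2 * RInt g a b.
Proof.
  intros H K G D. eapply Rle_trans; [apply Cmod_le_sum|]. unfold CInt; simpl.
  assert (P : forall h, ex_RInt h a b -> (forall x, a <= x <= b -> Rabs (h x) <= g x) -> Rabs (RInt h a b) <= RInt g a b).
  { intros h E B. apply Rabs_le. split.
    - rewrite <- (Rmult_1_l (RInt g a b)), Ropp_mult_distr_l, <- R_RInt_scal by auto.
      apply RInt_le; auto. apply R_ex_scal; auto. intros x Hx. specialize (B x ltac:(lra)).
      apply Rabs_le_between in B. lra.
    - apply RInt_le; auto. intros x Hx. specialize (B x ltac:(lra)).
      apply Rabs_le_between in B. lra. }
  assert (Q1 := P _ (contOn_exRe f a b H K)). assert (Q2 := P _ (contOn_exIm f a b H K)).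
  assert (forall x, a <= x <= b -> Rabs (Re (f x)) <= g x).
  { intros x Hx. eapply Rle_trans; [apply Re_le_Cmod|auto]. }
  assert (forall x, a <= x <= b -> Rabs (Im (f x)) <= g x).
  { intros x Hx. eapply Rle_trans; [apply Im_le_Cmod|auto]. }
  specialize (Q1 H0). specialize (Q2 H1). lra.
Qed.

Lemma R_FTC (F f : R -> R) a b : a <= b -> (forall x, a <= x <= b -> is_derive F x (f x)) ->
  (forall x, a <= x <= b -> continuous f x) -> RInt f a b = F b - F a.
Proof.
  intros H D K. apply is_RInt_unique. apply (is_RInt_derive (V:=RV));
  rewrite Rmin_left, Rmax_right by lra; auto.
Qed.

Lemma C_FTC (F f : R -> C) a b : a <= b -> (forall x, a <= x <= b -> dC F x (f x)) ->
  contOn f a b -> CInt f a b = (F b - F a)%C.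
Proof.
  intros H D K. unfold CInt. apply C_ext; simpl.
  - apply (R_FTC (fun t => Re (F t)) (fun t => Re (f t))); auto. intros; apply (D x); auto. intros x Hx; apply (K x Hx).
  - apply (R_FTC (fun t => Im (F t)) (fun t => Im (f t))); auto. intros; apply (D x); auto. intros x Hx; apply (K x Hx).
Qed.

Lemma CInt_subst (f : R -> C) (p dp : R -> R) a b : a <= b -> p a <= p b ->
  (forall x, a <= x <= b -> p a <= p x <= p b) -> contOn f (p a) (p b) ->
  (forall x, a <= x <= b -> is_derive p x (dp x) /\ continuous dp x) ->
  CInt (fun x => RtoC (dp x) * f (p x))%C a b = CInt f (p a) (p b).
Proof.
  intros H Hp Hm K D. unfold CInt. f_equal.
  - rewrite <- (RInt_comp (V:=RV) (fun t => Re (f t)) p dp a b).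
    + apply RInt_ext_le; auto. intros x Hx. unfold scal; simpl; unfold mult; simpl. unfold Re; ring.
    + rewrite Rmin_left, Rmax_right by lra. intros x Hx. apply (K (p x)). auto.
    + rewrite Rmin_left, Rmax_right by lra. auto.
  - rewrite <- (RInt_comp (V:=RV) (fun t => Im (f t)) p dp a b).
    + apply RInt_ext_le; auto. intros x Hx. unfold scal; simpl; unfold mult; simpl. unfold Im; ring.
    + rewrite Rmin_left, Rmax_right by lra. intros x Hx. apply (K (p x)). auto.
    + rewrite Rmin_left, Rmax_right by lra. auto.
Qed.

(** Joint continuity gives at each point of [a, b] a gauge valid in both variables; compactness of
    the interval extracts from these gauges one neighbourhood of the parameter. *)
Lemma unif_param {T : UniformSpace} (h : T -> R -> R) (t0 : T) a b (eps : R) : 0 < eps ->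
  (forall x, a <= x <= b -> continuous (fun p : T * R => h (fst p) (snd p)) (t0, x)) ->
  locally t0 (fun t => forall x, a <= x <= b -> Rabs (h t x - h t0 x) < eps).
Proof.
  intros He K.
  assert (D : forall x, exists d : posreal, a <= x <= b ->
     forall t y, ball t0 d t -> Rabs (y - x) < d -> Rabs (h t y - h t0 x) < eps / 2).
  { intros x. destruct (Rle_dec a x) as [H1|H1]; [|exists (mkposreal 1 Rlt_0_1); intros; lra].
    destruct (Rle_dec x b) as [H2|H2]; [|exists (mkposreal 1 Rlt_0_1); intros; lra].
    assert (C := K x (conj H1 H2)).
    assert (C' := proj1 (filterlim_locally _ _) C (mkposreal (eps/2) ltac:(lra))).
    destruct C' as [d Hd]. exists d. intros _ t y Ht Hy.
    apply (Hd (t, y)). split; auto. }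
  destruct (compactness_value_1d a b (fun x => proj1_sig (constructive_indefinite_description _ (D x)))) as [d Hd].
  exists d. intros t Ht x Hx.
  destruct (Rlt_dec (Rabs (h t x - h t0 x)) eps) as [|N]; auto. exfalso.
  apply (Hd x Hx). intros [u [Hu [Hxu Hdu]]].
  destruct (constructive_indefinite_description _ (D u)) as [du P]; simpl in *.
  apply N.
  assert (A := P Hu t x (ball_le _ _ _ Hdu _ Ht) Hxu).
  assert (B := P Hu t0 x (ball_center _ _) Hxu).
  replace (h t x - h t0 x) with ((h t x - h t0 u) - (h t0 x - h t0 u)) by ring.
  eapply Rle_lt_trans; [apply Rabs_triang|]. rewrite Rabs_Ropp. lra.
Qed.

Lemma RInt_param_cont {T : UniformSpace} (h : T -> R -> R) (t0 : T) a b : a <= b ->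
  (forall x, a <= x <= b -> continuous (fun p : T * R => h (fst p) (snd p)) (t0, x)) ->
  locally t0 (fun t => ex_RInt (h t) a b) ->
  continuous (fun t => RInt (h t) a b) t0.
Proof.
  intros H K E. apply filterlim_locally. intros eps.
  assert (e2 : 0 < eps / (b - a + 1)). { apply Rdiv_lt_0_compat. apply eps. lra. }
  generalize (unif_param h t0 a b _ e2 K). intros U.
  assert (E0 : ex_RInt (h t0) a b) by (apply (locally_singleton _ _ E)).
  generalize (filter_and _ _ U E). apply filter_imp. intros t [U1 E1].
  change (Rabs (RInt (h t) a b - RInt (h t0) a b) < eps).
  rewrite <- R_RInt_minus by auto.
  eapply Rle_lt_trans.
  - apply (abs_RInt_le_const _ a b (eps / (b - a + 1))); auto. apply R_ex_minus; auto.
    intros; left; apply U1; auto.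
  - apply (Rmult_lt_reg_r (b - a + 1)). lra. destruct eps as [e He]; simpl in *.
    replace ((b - a) * (e / (b - a + 1)) * (b - a + 1)) with ((b - a) * e) by (field; lra). nra.
Qed.

Lemma CInt_param_cont {T : UniformSpace} (F : T -> R -> C) (t0 : T) a b : a <= b ->
  (forall x, a <= x <= b -> contC (fun p : T * R => F (fst p) (snd p)) (t0, x)) ->
  locally t0 (fun t => contOn (F t) a b) ->
  contC (fun t => CInt (F t) a b) t0.
Proof.
  intros H K E. split; simpl.
  - apply (RInt_param_cont (fun t x => Re (F t x))); auto. intros; apply (K x); auto.
    eapply filter_imp; [|exact E]. intros t Ht. auto.
  - apply (RInt_param_cont (fun t x => Im (F t x))); auto. intros; apply (K x); auto.
    eapply filter_imp; [|exact E]. intros t Ht. auto.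
Qed.

Lemma continuous_slice1 {U V W : UniformSpace} (F : U -> V -> W) x y :
  continuous (fun p : U * V => F (fst p) (snd p)) (x, y) -> continuous (fun u => F u y) x.
Proof.
  intros H. apply (continuous_comp (fun u => (u, y)) (fun p : U * V => F (fst p) (snd p))); auto.
  apply filterlim_locally. intros eps. exists eps. intros z Hz. split; auto. apply ball_center.
Qed.

Lemma continuous_slice2 {U V W : UniformSpace} (F : U -> V -> W) x y :
  continuous (fun p : U * V => F (fst p) (snd p)) (x, y) -> continuous (fun v => F x v) y.
Proof.
  intros H. apply (continuous_comp (fun v => (x, v)) (fun p : U * V => F (fst p) (snd p))); auto.
  apply filterlim_locally. intros eps. exists eps. intros z Hz. split; auto. apply ball_center.
Qed.

Lemma continuous_swap {U V W : UniformSpace} (F : U -> V -> W) x y :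
  continuous (fun p : U * V => F (fst p) (snd p)) (x, y) ->
  continuous (fun p : V * U => F (snd p) (fst p)) (y, x).
Proof.
  intros H. apply (continuous_comp (fun p : V * U => (snd p, fst p)) (fun p : U * V => F (fst p) (snd p))); auto.
  apply filterlim_locally. intros eps. exists eps. intros z [Hz1 Hz2]. split; auto.
Qed.

(** As functions of the upper limit b both sides have the same derivative, the right one by
    differentiation under the integral sign. Continuity on the whole plane supplies the
    neighbourhoods which that differentiation asks for, also at the edges of the rectangle. *)
Lemma Fubini_global (F : R -> R -> R) a b c d : a <= b -> c <= d ->
  (forall x y, continuous (fun p : R * R => F (fst p) (snd p)) (x, y)) ->
  RInt (fun x => RInt (F x) c d) a b = RInt (fun y => RInt (fun x => F x y) a b) c d.
Proof.
  intros Hab Hcd K.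
  assert (E1 : forall x u v, ex_RInt (F x) u v).
  { intros. apply (ex_RInt_continuous (V:=RV)). intros.
    apply (continuous_slice2 (fun x y => F x y)); auto. }
  assert (E2 : forall y u v, ex_RInt (fun x => F x y) u v).
  { intros. apply (ex_RInt_continuous (V:=RV)). intros.
    apply (continuous_slice1 (fun x y => F x y)); auto. }
  assert (C2 : forall u, forall y, continuous (fun y => RInt (fun x => F x y) a u) y).
  { intros u y. destruct (Rle_dec a u) as [L|L].
    - apply (RInt_param_cont (fun y x => F x y)); auto.
      + intros; apply (continuous_swap F); auto.
      + apply filter_forall; auto.
    - apply (continuous_ext (fun y => - RInt (fun x => F x y) u a)).
      + intros z. rewrite <- (opp_RInt_swap (fun x => F x z)); [|auto].
        unfold opp; simpl; ring.
      + apply cR_opp. apply (RInt_param_cont (fun y x => F x y)); [lra| |].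
        * intros; apply (continuous_swap F); auto.
        * apply filter_forall; auto. }
  assert (DF : forall u y, is_derive (fun z => RInt (fun x => F x y) a z) u (F u y)).
  { intros u y. apply (is_derive_RInt (V:=RV) (fun x => F x y) _ a).
    - apply filter_forall. intros z. apply (RInt_correct (V:=RV)). auto.
    - apply (continuous_slice1 (fun x y => F x y)); auto. }
  rewrite (R_FTC (fun t => RInt (fun y => RInt (fun x => F x y) a t) c d) (fun x => RInt (F x) c d)).
  - rewrite (RInt_ext_le (fun y => RInt (fun x => F x y) a a) (fun _ => 0)); auto.
    + rewrite RInt_const. unfold scal; simpl; unfold mult; simpl. ring.
    + intros. apply (RInt_point (V:=RV)).
  - auto.
  - intros t _.
    evar_last.
    + apply (is_derive_RInt_param (fun u y => RInt (fun x => F x y) a u) c d t).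
      * apply filter_forall. intros. eexists. apply DF.
      * intros y _. apply (continuity_2d_pt_ext F).
        intros u v. symmetry. apply is_derive_unique. apply DF.
        apply continuity_2d_pt_filterlim. apply K.
      * apply filter_forall. intros u. apply (ex_RInt_continuous (V:=RV)). auto.
    + apply RInt_ext_le; auto. intros. apply is_derive_unique. apply DF.
  - intros. apply (RInt_param_cont F); auto. apply filter_forall; auto.
Qed.

(** The retraction of the line onto [a, b]. Composing with it extends a function that is continuous
    on a rectangle to the whole plane without changing its integrals, which puts it in the scope of
    [Fubini_global]. *)
Definition clamp a b x := Rmax a (Rmin b x).
Lemma clamp_in a b x : a <= b -> a <= clamp a b x <= b.
Proof. intros. unfold clamp. unfold Rmax, Rmin. repeat destruct Rle_dec; lra. Qed.
Lemma clamp_id a b x : a <= x <= b -> clamp a b x = x.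
Proof. intros. unfold clamp, Rmax, Rmin. repeat destruct Rle_dec; lra. Qed.
Lemma clamp_cont a b x : continuous (clamp a b) x.
Proof.
  apply (continuous_ext (fun x => (a + ((b + x) - Rabs (b - x)) / 2 + Rabs (a - ((b + x) - Rabs (b - x)) / 2)) / 2)).
  - intros t. unfold clamp, Rmax, Rmin, Rabs. repeat destruct Rle_dec; repeat destruct Rcase_abs; lra.
  - cont; lra.
Qed.

Lemma Fubini_rect (F : R -> R -> R) a b c d : a <= b -> c <= d ->
  (forall x y, a <= x <= b -> c <= y <= d -> continuous (fun p : R * R => F (fst p) (snd p)) (x, y)) ->
  RInt (fun x => RInt (F x) c d) a b = RInt (fun y => RInt (fun x => F x y) a b) c d.
Proof.
  intros Hab Hcd K.
  assert (Q := Fubini_global (fun x y => F (clamp a b x) (clamp c d y)) a b c d Hab Hcd).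
  etransitivity; [|etransitivity; [apply Q|]].
  - apply RInt_ext_le; auto. intros x Hx. apply RInt_ext_le; auto. intros y Hy.
    rewrite !clamp_id; auto.
  - intros x y.
    apply (continuous_comp (fun p : R * R => (clamp a b (fst p), clamp c d (snd p))) (fun p : R * R => F (fst p) (snd p))).
    + apply filterlim_locally. intros eps.
      assert (A := proj1 (filterlim_locally _ _) (clamp_cont a b x) eps).
      assert (B := proj1 (filterlim_locally _ _) (clamp_cont c d y) eps).
      destruct A as [d1 A]. destruct B as [d2 B].
      assert (M : 0 < Rmin d1 d2) by (apply Rmin_pos; [apply d1|apply d2]).
      exists (mkposreal _ M). intros [u v] [Hu Hv]. simpl in *.
      split; simpl; [apply A|apply B].
      eapply ball_le; [|exact Hu]. apply Rmin_l. eapply ball_le; [|exact Hv]. apply Rmin_r.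
    + apply K; apply clamp_in; auto.
  - apply RInt_ext_le; auto. intros y Hy. apply RInt_ext_le; auto. intros x Hx.
    rewrite !clamp_id; auto.
Qed.

Lemma C_Fubini_rect (F : R -> R -> C) a b c d : a <= b -> c <= d ->
  (forall x y, a <= x <= b -> c <= y <= d -> contC (fun p : R * R => F (fst p) (snd p)) (x, y)) ->
  CInt (fun x => CInt (F x) c d) a b = CInt (fun y => CInt (fun x => F x y) a b) c d.
Proof.
  intros Hab Hcd K. unfold CInt at 1 3. f_equal; simpl.
  - apply (Fubini_rect (fun x y => Re (F x y))); auto. intros; apply (K x y); auto.
  - apply (Fubini_rect (fun x y => Im (F x y))); auto. intros; apply (K x y); auto.
Qed.

(** * Improper integrals along an exhausting sequence of compact intervals *)

Record window := mkW {
  wl : nat -> R; wr : nat -> R;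
  wlr : forall n, wl n <= wr n;
  wl_dec : forall n, wl (S n) <= wl n;
  wr_inc : forall n, wr n <= wr (S n) }.

Definition inW w x := exists n, wl w n <= x <= wr w n.

Lemma wl_mono w n m : (n <= m)%nat -> wl w m <= wl w n.
Proof. induction 1. lra. eapply Rle_trans; [apply wl_dec|auto]. Qed.
Lemma wr_mono w n m : (n <= m)%nat -> wr w n <= wr w m.
Proof. induction 1. lra. eapply Rle_trans; [eauto|apply wr_inc]. Qed.

Lemma inW_l w n : inW w (wl w n).
Proof. exists n. split. lra. apply wlr. Qed.
Lemma inW_r w n : inW w (wr w n).
Proof. exists n. split. apply wlr. lra. Qed.
#[export] Hint Resolve inW_l inW_r wlr : core.

Lemma inW_ev w x : inW w x -> exists N, forall n, (N <= n)%nat -> wl w n <= x <= wr w n.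
Proof.
  intros [N H]. exists N. intros n Hn. split.
  eapply Rle_trans; [apply wl_mono; eauto|tauto]. eapply Rle_trans; [apply H|apply wr_mono; auto].
Qed.

Lemma inW_btw w a b x : inW w a -> inW w b -> a <= x <= b -> inW w x.
Proof.
  intros A B H. destruct (inW_ev w a A) as [N HN]. destruct (inW_ev w b B) as [M HM].
  exists (N + M)%nat. specialize (HN (N + M)%nat ltac:(lia)). specialize (HM (N + M)%nat ltac:(lia)). lra.
Qed.

(** Plays the part of integrability for a nonnegative function: its integrals over the windows
    increase, so boundedness already gives convergence. *)
Definition Rok w (g : R -> R) :=
  (forall x, inW w x -> continuous g x) /\ (forall x, inW w x -> 0 <= g x) /\
  exists B, forall n, RInt g (wl w n) (wr w n) <= B.

(** [Lim_seq] is total and [real] sends an infinite limit to 0, so the value is meaningful only once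
    convergence is known, through [Rok_lim], [R_exhaust] or an explicit limit. *)
Definition RIntW w g := real (Lim_seq (fun n => RInt g (wl w n) (wr w n))).
Definition IntW w (f : R -> C) : C := (RIntW w (fun t => Re (f t)), RIntW w (fun t => Im (f t))).

(** Absolute convergence with the majorant [g] kept as data: truncation errors, continuity in a
    parameter and the exchange of integrals are all measured by the tail of [g]. *)
Definition Cok w (f : R -> C) (g : R -> R) :=
  Rok w g /\ (forall x, inW w x -> contC f x) /\ (forall x, inW w x -> Cmod (f x) <= g x).

Lemma cont_exW w (g : R -> R) a b : (forall x, inW w x -> continuous g x) -> inW w a -> inW w b -> a <= b -> ex_RInt g a b.
Proof. intros. apply ex_RInt_cont; auto. intros. apply H. eapply inW_btw; [exact H0|exact H1|auto]. Qed.

Lemma RInt_ge0 (g : R -> R) a b : a <= b -> ex_RInt g a b -> (forall x, a <= x <= b -> 0 <= g x) -> 0 <= RInt g a b.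
Proof. intros. apply RInt_ge_0; auto. intros; apply H1; lra. Qed.

Lemma nested_diff (h g : R -> R) c a b d : c <= a -> a <= b -> b <= d ->
  (forall x, c <= x <= d -> continuous h x) -> (forall x, c <= x <= d -> continuous g x) ->
  (forall x, c <= x <= d -> Rabs (h x) <= g x) ->
  Rabs (RInt h c d - RInt h a b) <= RInt g c d - RInt g a b.
Proof.
  intros H1 H2 H3 Kh Kg D.
  assert (E : forall f, (forall x, c <= x <= d -> continuous f x) ->
    RInt f c d - RInt f a b = RInt f c a + RInt f b d).
  { intros f K.
    rewrite <- (RInt_Chasles (V:=RV) f c a d), <- (RInt_Chasles (V:=RV) f a b d);
    try (apply ex_RInt_cont; [lra|intros; apply K; lra]).
    unfold plus; simpl; ring. }
  rewrite !E by auto.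
  assert (P : forall u v, c <= u -> u <= v -> v <= d -> Rabs (RInt h u v) <= RInt g u v).
  { intros u v A B C'.
    assert (ex_RInt h u v) by (apply ex_RInt_cont; [lra|intros; apply Kh; lra]).
    assert (ex_RInt g u v) by (apply ex_RInt_cont; [lra|intros; apply Kg; lra]).
    apply Rabs_le. split.
    - rewrite <- (Rmult_1_l (RInt g u v)), Ropp_mult_distr_l, <- R_RInt_scal by auto.
      apply RInt_le; auto. apply R_ex_scal; auto. intros x Hx. specialize (D x ltac:(lra)).
      apply Rabs_le_between in D. lra.
    - apply RInt_le; auto. intros x Hx. specialize (D x ltac:(lra)).
      apply Rabs_le_between in D. lra. }
  eapply Rle_trans; [apply Rabs_triang|]. apply Rplus_le_compat; apply P; lra.
Qed.

Lemma Rok_mono w g n m : Rok w g -> (n <= m)%nat -> RInt g (wl w n) (wr w n) <= RInt g (wl w m) (wr w m).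
Proof.
  intros [K [P _]] H.
  assert (Q := nested_diff g g (wl w m) (wl w n) (wr w n) (wr w m) (wl_mono _ _ _ H) (wlr _ _) (wr_mono _ _ _ H)).
  assert (W : forall x, wl w m <= x <= wr w m -> inW w x) by (intros; exists m; auto).
  specialize (Q ltac:(auto) ltac:(auto)).
  assert (R1 := Rabs_pos (RInt g (wl w m) (wr w m) - RInt g (wl w n) (wr w n))).
  specialize (Q ltac:(intros; rewrite Rabs_pos_eq; auto; lra)). lra.
Qed.

Lemma Rok_lim w g : Rok w g -> is_lim_seq (fun n => RInt g (wl w n) (wr w n)) (RIntW w g).
Proof.
  intros H. assert (M := fun n m => Rok_mono w g n m H). destruct H as [K [P [B HB]]].
  unfold RIntW. apply Lim_seq_correct'.
  apply (ex_finite_lim_seq_incr _ B); auto.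
Qed.

Lemma Rok_le_lim w g n : Rok w g -> RInt g (wl w n) (wr w n) <= RIntW w g.
Proof.
  intros H. assert (L := Rok_lim w g H).
  apply (is_lim_seq_incr_compare _ _ L). intros k. apply Rok_mono; auto.
Qed.

Lemma Rok_le_lim' w g a b : Rok w g -> inW w a -> inW w b -> a <= b -> RInt g a b <= RIntW w g.
Proof.
  intros H A B L. destruct (inW_ev _ _ A) as [N HN]. destruct (inW_ev _ _ B) as [M HM].
  set (k := (N + M)%nat). specialize (HN k ltac:(lia)). specialize (HM k ltac:(lia)).
  eapply Rle_trans; [|apply (Rok_le_lim w g k H)]. destruct H as [K [P _]].
  assert (W : forall x, wl w k <= x <= wr w k -> inW w x) by (intros; exists k; auto).
  assert (Q := nested_diff g g (wl w k) a b (wr w k) ltac:(lra) L ltac:(lra) ltac:(auto) ltac:(auto)).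
  assert (R1 := Rabs_pos (RInt g (wl w k) (wr w k) - RInt g a b)).
  specialize (Q ltac:(intros; rewrite Rabs_pos_eq; auto; lra)). lra.
Qed.

(** Since [h + g] is again nonnegative with bounded integrals, [h] converges as a difference of two
    monotone limits. The second part, a quantitative truncation bound by the tail of [g], is what
    makes later limits uniform. *)
Lemma R_exhaust w (h g : R -> R) : Rok w g -> (forall x, inW w x -> continuous h x) ->
  (forall x, inW w x -> Rabs (h x) <= g x) ->
  is_lim_seq (fun n => RInt h (wl w n) (wr w n)) (RIntW w h) /\
  forall n a b, inW w a -> inW w b -> a <= wl w n -> wr w n <= b ->
    Rabs (RInt h a b - RIntW w h) <= RIntW w g - RInt g (wl w n) (wr w n).
Proof.
  intros Hg Kh D.
  assert (Kg : forall x, inW w x -> continuous g x) by apply Hg.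
  assert (Pg : forall x, inW w x -> 0 <= g x) by apply Hg.
  assert (Hs : Rok w (fun x => h x + g x)).
  { destruct Hg as [K [P [B HB]]]. split; [|split].
    - intros. apply cR_plus; auto.
    - intros x Hx. specialize (D x Hx). apply Rabs_le_between in D. lra.
    - exists (2 * B). intros n.
      assert (E1 : ex_RInt h (wl w n) (wr w n)) by (eapply cont_exW; eauto).
      assert (E2 : ex_RInt g (wl w n) (wr w n)) by (eapply cont_exW; eauto).
      rewrite R_RInt_plus by auto. specialize (HB n).
      assert (RInt h (wl w n) (wr w n) <= RInt g (wl w n) (wr w n)).
      { apply RInt_le; auto. intros x Hx. specialize (D x ltac:(exists n; lra)).
        apply Rabs_le_between in D. lra. }
      lra. }
  assert (L : is_lim_seq (fun n => RInt h (wl w n) (wr w n)) (RIntW w h)).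
  { unfold RIntW. apply Lim_seq_correct'.
    exists (RIntW w (fun x => h x + g x) - RIntW w g).
    apply (is_lim_seq_ext (fun n => RInt (fun x => h x + g x) (wl w n) (wr w n) - RInt g (wl w n) (wr w n))).
    - intros n. rewrite R_RInt_plus. ring. eapply cont_exW; eauto. eapply cont_exW; eauto.
    - apply is_lim_seq_minus'; apply Rok_lim; auto. }
  split; auto.
  intros n a b A B La Lb.
  assert (Lab : a <= b) by (generalize (wlr w n); lra).
  apply (is_lim_seq_le_loc (fun k => Rabs (RInt h a b - RInt h (wl w k) (wr w k)))
           (fun k => RInt g (wl w k) (wr w k) - RInt g (wl w n) (wr w n))
           (Rabs (RInt h a b - RIntW w h)) (RIntW w g - RInt g (wl w n) (wr w n))).
  - destruct (inW_ev _ _ A) as [N HN]. destruct (inW_ev _ _ B) as [M HM].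
    exists (N + M)%nat. intros k Hk. specialize (HN k ltac:(lia)). specialize (HM k ltac:(lia)).
    assert (W : forall x, wl w k <= x <= wr w k -> inW w x) by (intros; exists k; auto).
    rewrite Rabs_minus_sym.
    eapply Rle_trans; [apply (nested_diff h g); auto; lra|].
    assert (W' : forall x, a <= x <= b -> inW w x) by (intros; apply W; lra).
    assert (Q := nested_diff g g a (wl w n) (wr w n) b La (wlr _ _) Lb ltac:(auto) ltac:(auto)).
    assert (R1 := Rabs_pos (RInt g a b - RInt g (wl w n) (wr w n))).
    specialize (Q ltac:(intros; rewrite Rabs_pos_eq; auto; lra)). lra.
  - apply (is_lim_seq_abs _ (Finite _)). apply is_lim_seq_minus'; auto. apply is_lim_seq_const.
  - apply is_lim_seq_minus'. apply Rok_lim; auto. apply is_lim_seq_const.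
Qed.

Definition limC (u : nat -> C) (l : C) :=
  is_lim_seq (fun n => Re (u n)) (Re l) /\ is_lim_seq (fun n => Im (u n)) (Im l).

Lemma limC_unique u l l' : limC u l -> limC u l' -> l = l'.
Proof.
  intros [A B] [A' B']. apply C_ext.
  - apply is_lim_seq_unique in A. apply is_lim_seq_unique in A'. congruence.
  - apply is_lim_seq_unique in B. apply is_lim_seq_unique in B'. congruence.
Qed.

Lemma limC_ext_loc u v l : eventually (fun n => u n = v n) -> limC u l -> limC v l.
Proof.
  intros E [A B]. split; [eapply is_lim_seq_ext_loc; [|exact A]|eapply is_lim_seq_ext_loc; [|exact B]];
  (eapply filter_imp; [|exact E]); intros n H; cbv beta in H |- *; f_equal; exact H.
Qed.
Lemma limC_ext u v l : (forall n, u n = v n) -> limC u l -> limC v l.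
Proof. intros E. apply limC_ext_loc. apply filter_forall; auto. Qed.

Lemma limC_Cmod0 u l : is_lim_seq (fun n => Cmod (u n - l)) 0 -> limC u l.
Proof.
  intros H. split; apply is_lim_seq_spec; intros eps; apply is_lim_seq_spec in H; destruct (H eps) as [N HN];
  exists N; intros n Hn; specialize (HN n Hn); rewrite Rminus_0_r, Rabs_pos_eq in HN by apply Cmod_ge_0;
  (eapply Rle_lt_trans; [|exact HN]).
  - apply (Re_le_Cmod (u n - l)).
  - apply (Im_le_Cmod (u n - l)).
Qed.

Lemma limC_to0 u l : limC u l -> is_lim_seq (fun n => Cmod (u n - l)) 0.
Proof.
  intros [A B].
  apply (is_lim_seq_le_le (fun _ => 0) _ (fun n => Rabs (Re (u n) - Re l) + Rabs (Im (u n) - Im l))).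
  - intros n. split. apply Cmod_ge_0. apply (Cmod_le_sum (u n - l)).
  - apply is_lim_seq_const.
  - replace (Finite 0) with (Finite (Rabs (Re l - Re l) + Rabs (Im l - Im l))).
    apply is_lim_seq_plus'; apply (is_lim_seq_abs _ (Finite _)); apply is_lim_seq_minus'; auto; apply is_lim_seq_const.
    unfold Rminus; rewrite !Rplus_opp_r, Rabs_R0. f_equal; ring.
Qed.

Lemma limC_const c : limC (fun _ => c) c.
Proof. split; apply is_lim_seq_const. Qed.
Lemma limC_plus u v l k : limC u l -> limC v k -> limC (fun n => u n + v n)%C (l + k)%C.
Proof. intros [A B] [A' B']. split; simpl; apply is_lim_seq_plus'; auto. Qed.
Lemma limC_mult u v l k : limC u l -> limC v k -> limC (fun n => u n * v n)%C (l * k)%C.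
Proof.
  intros [A B] [A' B']. split; simpl.
  apply is_lim_seq_minus'; apply is_lim_seq_mult'; auto. apply is_lim_seq_plus'; apply is_lim_seq_mult'; auto.
Qed.
Lemma limC_opp u l : limC u l -> limC (fun n => - u n)%C (- l)%C.
Proof. intros [A B]. split; [exact (proj1 (is_lim_seq_opp _ _) A)|exact (proj1 (is_lim_seq_opp _ _) B)]. Qed.
Lemma limC_minus u v l k : limC u l -> limC v k -> limC (fun n => u n - v n)%C (l - k)%C.
Proof. intros. apply limC_plus; auto. apply limC_opp; auto. Qed.
Lemma limC_RtoC u l : is_lim_seq u (Finite l) -> limC (fun n => RtoC (u n)) (RtoC l).
Proof. split; simpl; auto. apply is_lim_seq_const. Qed.

Lemma limC_cont {T : UniformSpace} (f : T -> C) (u : nat -> T) (t : T) :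
  contC f t -> filterlim u eventually (locally t) -> limC (fun n => f (u n)) (f t).
Proof.
  intros [A B] U. split.
  - apply (filterlim_comp _ _ _ u (fun s => Re (f s)) _ _ _ U A).
  - apply (filterlim_comp _ _ _ u (fun s => Im (f s)) _ _ _ U B).
Qed.

Lemma limC_contR (f : R -> C) (u : nat -> R) (t : R) :
  contC f t -> is_lim_seq u (Finite t) -> limC (fun n => f (u n)) (f t).
Proof. intros. apply (limC_cont f u t); auto. Qed.

Lemma limC_inv u (l : C) : l <> 0%C -> limC u l -> limC (fun n => / u n)%C (/ l)%C.
Proof.
  intros N [A B].
  assert (P : Re l ^ 2 + Im l ^ 2 <> 0).
  { intros E. apply N. apply C_ext; simpl; nra. }
  assert (L : is_lim_seq (fun n => Re (u n) ^ 2 + Im (u n) ^ 2) (Finite (Re l ^ 2 + Im l ^ 2))).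
  { apply is_lim_seq_plus'; simpl; repeat apply is_lim_seq_mult'; auto; apply is_lim_seq_const. }
  assert (A2 : is_lim_seq (fun n => - Im (u n)) (- Im l)) by (exact (proj1 (is_lim_seq_opp _ _) B)).
  split.
  - apply (is_lim_seq_div' (fun n => Re (u n)) (fun n => Re (u n) ^ 2 + Im (u n) ^ 2)); auto.
  - apply (is_lim_seq_div' (fun n => - Im (u n)) (fun n => Re (u n) ^ 2 + Im (u n) ^ 2)); auto.
Qed.
Lemma limC_div u v (l k : C) : k <> 0%C -> limC u l -> limC v k -> limC (fun n => u n / v n)%C (l / k)%C.
Proof. intros. apply limC_mult; auto. apply limC_inv; auto. Qed.

Lemma limC_Cmod_le u l B : limC u l -> (forall n, Cmod (u n) <= B) -> Cmod l <= B.
Proof.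
  intros H D. assert (L := limC_to0 _ _ H).
  apply (is_lim_seq_le (fun n => Cmod l) (fun n => B + Cmod (u n - l)) (Finite (Cmod l)) (Finite B)).
  - intros n. specialize (D n). assert (Q := Cmod_triang_rev l (u n)). rewrite (Cmod_minus_sym l (u n)) in Q. lra.
  - apply is_lim_seq_const.
  - replace (Finite B) with (Finite (B + 0)) by (f_equal; ring). apply is_lim_seq_plus'; auto. apply is_lim_seq_const.
Qed.

Lemma C_exhaust w f g n a b : Cok w f g -> inW w a -> inW w b -> a <= wl w n -> wr w n <= b ->
  Cmod (CInt f a b - IntW w f) <= 2 * (RIntW w g - RInt g (wl w n) (wr w n)).
Proof.
  intros [Hg [K D]] A B La Lb. eapply Rle_trans; [apply Cmod_le_sum|].
  assert (Q1 := proj2 (R_exhaust w (fun t => Re (f t)) g Hg ltac:(intros x Hx; apply (K x Hx))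
     ltac:(intros x Hx; eapply Rle_trans; [apply Re_le_Cmod|auto])) n a b A B La Lb).
  assert (Q2 := proj2 (R_exhaust w (fun t => Im (f t)) g Hg ltac:(intros x Hx; apply (K x Hx))
     ltac:(intros x Hx; eapply Rle_trans; [apply Im_le_Cmod|auto])) n a b A B La Lb).
  unfold Cminus, Cplus, Copp, CInt, IntW, Re, Im in *; simpl in *. unfold Rminus in *. lra.
Qed.

Lemma IntW_lim w f g : Cok w f g -> limC (fun n => CInt f (wl w n) (wr w n)) (IntW w f).
Proof.
  intros [Hg [K D]]. split; simpl.
  - refine (proj1 (R_exhaust w (fun t => Re (f t)) g Hg _ _)).
    intros x Hx; apply (K x Hx). intros x Hx; eapply Rle_trans; [apply Re_le_Cmod|auto].
  - refine (proj1 (R_exhaust w (fun t => Im (f t)) g Hg _ _)).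
    intros x Hx; apply (K x Hx). intros x Hx; eapply Rle_trans; [apply Im_le_Cmod|auto].
Qed.

Lemma Cok_contOn w f g a b : Cok w f g -> inW w a -> inW w b -> contOn f a b.
Proof. intros [_ [K _]] A B x Hx. apply K. eapply inW_btw; [exact A|exact B|auto]. Qed.

Lemma IntW_bound w f g : Cok w f g -> Cmod (IntW w f) <= 2 * RIntW w g.
Proof.
  intros H. apply (limC_Cmod_le _ _ _ (IntW_lim w f g H)). intros n.
  eapply Rle_trans; [apply (CInt_bound f g); auto|].
  - eapply Cok_contOn; eauto.
  - eapply cont_exW; eauto. apply H.
  - intros x Hx. apply H. exists n; auto.
  - assert (Q := Rok_le_lim w g n (proj1 H)). lra.
Qed.

Lemma Rok_ge0 w g : Rok w g -> 0 <= RIntW w g.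
Proof.
  intros H. eapply Rle_trans; [|apply (Rok_le_lim w g 0 H)]. destruct H as [K [P _]].
  apply RInt_ge0; auto. eapply cont_exW; eauto. intros; apply P. exists O; auto.
Qed.

Lemma IntW_is w f g l : Cok w f g -> limC (fun n => CInt f (wl w n) (wr w n)) l -> IntW w f = l.
Proof. intros H L. eapply limC_unique; [eapply IntW_lim; eauto|auto]. Qed.

Lemma IntW_ext w f1 f2 : (forall x, inW w x -> f1 x = f2 x) -> IntW w f1 = IntW w f2.
Proof.
  intros E. unfold IntW, RIntW. f_equal; f_equal; apply Lim_seq_ext; intros n; apply RInt_ext_le; auto;
  intros x Hx; rewrite E; auto; exists n; auto.
Qed.

Lemma IntW_plus w f1 f2 g1 g2 : Cok w f1 g1 -> Cok w f2 g2 ->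
  IntW w (fun t => f1 t + f2 t)%C = (IntW w f1 + IntW w f2)%C.
Proof.
  intros H1 H2. eapply limC_unique.
  2: { apply limC_plus; eapply IntW_lim; eauto. }
  apply (limC_ext (fun n => CInt (fun t => f1 t + f2 t)%C (wl w n) (wr w n))).
  { intros n. apply CInt_plus; auto; eapply Cok_contOn; eauto. }
  apply (IntW_lim w _ (fun t => g1 t + g2 t)).
  destruct H1 as [[K1 [P1 [B1 Q1]]] [C1 D1]], H2 as [[K2 [P2 [B2 Q2]]] [C2 D2]].
  split; [split; [|split]|split].
  - intros. apply cR_plus; auto.
  - intros x Hx. generalize (P1 x Hx) (P2 x Hx); lra.
  - exists (B1 + B2). intros n. rewrite R_RInt_plus. generalize (Q1 n) (Q2 n); lra.
    eapply cont_exW; eauto. eapply cont_exW; eauto.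
  - intros. apply cC_plus; auto.
  - intros x Hx. eapply Rle_trans; [apply Cmod_triangle|]. generalize (D1 x Hx) (D2 x Hx); lra.
Qed.

Lemma Rok_plus w g1 g2 : Rok w g1 -> Rok w g2 -> Rok w (fun t => g1 t + g2 t).
Proof.
  intros [K1 [P1 [B1 Q1]]] [K2 [P2 [B2 Q2]]]. split; [|split].
  - intros. apply cR_plus; auto.
  - intros x Hx. generalize (P1 x Hx) (P2 x Hx); lra.
  - exists (B1 + B2). intros n. rewrite R_RInt_plus. generalize (Q1 n) (Q2 n); lra.
    eapply cont_exW; eauto. eapply cont_exW; eauto.
Qed.

Lemma Rok_scal w g c : 0 <= c -> Rok w g -> Rok w (fun t => c * g t).
Proof.
  intros Hc [K1 [P1 [B1 Q1]]]. split; [|split].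
  - intros. apply cR_mult; auto. apply cR_const.
  - intros x Hx. generalize (P1 x Hx); nra.
  - exists (c * B1). intros n. rewrite R_RInt_scal. generalize (Q1 n); nra.
    eapply cont_exW; eauto.
Qed.

Lemma Rok_le w g h : Rok w g -> (forall x, inW w x -> continuous h x) -> (forall x, inW w x -> 0 <= h x <= g x) -> Rok w h.
Proof.
  intros [K1 [P1 [B1 Q1]]] K H. split; [|split]; auto.
  - intros x Hx; apply H; auto.
  - exists B1. intros n. eapply Rle_trans; [|apply (Q1 n)]. apply RInt_le; auto.
    eapply cont_exW; eauto. eapply cont_exW; eauto. intros x Hx. apply H. exists n; lra.
Qed.

Lemma Rok_FTC w (G g : R -> R) B : (forall x, inW w x -> is_derive G x (g x)) ->
  (forall x, inW w x -> continuous g x) -> (forall x, inW w x -> 0 <= g x) ->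
  (forall x, inW w x -> Rabs (G x) <= B) -> Rok w g.
Proof.
  intros D K P H. split; [|split]; auto. exists (2 * B). intros n.
  rewrite (R_FTC G g); auto.
  - assert (A1 := H _ (inW_l w n)). assert (A2 := H _ (inW_r w n)).
    apply Rabs_le_between in A1. apply Rabs_le_between in A2. lra.
  - intros x Hx. apply D. exists n; auto.
  - intros x Hx. apply K. exists n; auto.
Qed.

Lemma RIntW_scal w g c : Rok w g -> RIntW w (fun t => c * g t) = c * RIntW w g.
Proof.
  intros H. assert (L := Rok_lim w g H).
  unfold RIntW at 1. rewrite (is_lim_seq_unique _ (Finite (c * RIntW w g))); auto.
  apply (is_lim_seq_ext (fun n => c * RInt g (wl w n) (wr w n))).
  - intros n. rewrite R_RInt_scal; auto. eapply cont_exW; eauto. apply H.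
  - apply is_lim_seq_mult'; auto. apply is_lim_seq_const.
Qed.

Lemma RIntW_le w g h : Rok w g -> Rok w h -> (forall x, inW w x -> g x <= h x) -> RIntW w g <= RIntW w h.
Proof.
  intros H1 H2 D.
  apply (is_lim_seq_le (fun n => RInt g (wl w n) (wr w n)) (fun n => RInt h (wl w n) (wr w n)) (Finite _) (Finite _)).
  - intros n. apply RInt_le; auto. eapply cont_exW; eauto. apply H1. eapply cont_exW; eauto. apply H2.
    intros x Hx. apply D. exists n; lra.
  - apply Rok_lim; auto.
  - apply Rok_lim; auto.
Qed.

Lemma RIntW_ext w g h : (forall x, inW w x -> g x = h x) -> RIntW w g = RIntW w h.
Proof.
  intros E. unfold RIntW. f_equal. apply Lim_seq_ext. intros n. apply RInt_ext_le; auto. intros; apply E. exists n; auto.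
Qed.

Lemma Cok_ext w f1 f2 g : (forall x, inW w x -> contC f2 x) -> (forall x, inW w x -> f1 x = f2 x) -> Cok w f1 g -> Cok w f2 g.
Proof. intros K E [A [B D]]. split; [|split]; auto. intros x Hx. rewrite <- E; auto. Qed.

Lemma Cok_plus w f1 f2 g1 g2 : Cok w f1 g1 -> Cok w f2 g2 -> Cok w (fun t => f1 t + f2 t)%C (fun t => g1 t + g2 t).
Proof.
  intros [A1 [C1 D1]] [A2 [C2 D2]]. split; [apply Rok_plus; auto|split].
  - intros. apply cC_plus; auto.
  - intros x Hx. eapply Rle_trans; [apply Cmod_triangle|]. generalize (D1 x Hx) (D2 x Hx); lra.
Qed.

Lemma Cok_scal w f g c : Cok w f g -> Cok w (fun t => c * f t)%C (fun t => Cmod c * g t).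
Proof.
  intros [A1 [C1 D1]]. split; [apply Rok_scal; auto; apply Cmod_ge_0|split].
  - intros. apply cC_mult; auto. apply cC_const.
  - intros x Hx. rewrite Cmod_mult. apply Rmult_le_compat_l. apply Cmod_ge_0. auto.
Qed.

Lemma IntW_scal w f g c : Cok w f g -> IntW w (fun t => c * f t)%C = (c * IntW w f)%C.
Proof.
  intros H. eapply limC_unique.
  - eapply IntW_lim. apply (Cok_scal w f g c H).
  - apply (limC_ext (fun n => c * CInt f (wl w n) (wr w n))%C).
    + intros n. symmetry. apply CInt_scal; auto. eapply Cok_contOn; eauto.
    + apply limC_mult. apply limC_const. eapply IntW_lim; eauto.
Qed.

Lemma IntW_minus w f1 f2 g1 g2 : Cok w f1 g1 -> Cok w f2 g2 ->
  IntW w (fun t => f1 t - f2 t)%C = (IntW w f1 - IntW w f2)%C.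
Proof.
  intros H1 H2. rewrite (IntW_ext w _ (fun t => f1 t + (-1) * f2 t)%C) by (intros; ring).
  rewrite (IntW_plus w f1 _ g1 _ H1 (Cok_scal w f2 g2 (-1)%C H2)).
  rewrite (IntW_scal w f2 g2 _ H2). ring.
Qed.

Lemma IntW_FTC w F f g l1 l2 : Cok w f g -> (forall x, inW w x -> dC F x (f x)) ->
  limC (fun n => F (wl w n)) l1 -> limC (fun n => F (wr w n)) l2 -> IntW w f = (l2 - l1)%C.
Proof.
  intros H D L1 L2. eapply IntW_is; eauto.
  apply (limC_ext (fun n => F (wr w n) - F (wl w n))%C).
  - intros n. symmetry. apply C_FTC; auto. intros x Hx. apply D. exists n; auto. eapply Cok_contOn; eauto.
  - apply limC_minus; auto.
Qed.

(** The last hypothesis says that the images of the windows of [w1] exhaust those of [w2]. The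
    images themselves need not be windows of [w2]; [C_exhaust] bounds the mismatch by the tail of
    [g]. *)
Lemma IntW_subst w1 w2 f g p dp : Cok w2 f g ->
  (forall x, inW w1 x -> inW w2 (p x)) ->
  (forall x, inW w1 x -> is_derive p x (dp x) /\ continuous dp x /\ 0 <= dp x) ->
  (forall n, exists m, p (wl w1 m) <= wl w2 n /\ wr w2 n <= p (wr w1 m)) ->
  Cok w1 (fun x => RtoC (dp x) * f (p x))%C (fun x => dp x * g (p x)) /\
  IntW w1 (fun x => RtoC (dp x) * f (p x))%C = IntW w2 f.
Proof.
  intros H M D EX.
  assert (Mono : forall a b, inW w1 a -> inW w1 b -> a <= b -> p a <= p b).
  { intros a b A B L.
    destruct (MVT_gen p a b dp) as [c [Hc E]].
    - intros x Hx. rewrite Rmin_left, Rmax_right in Hx by lra. apply D. eapply inW_btw; [exact A|exact B|lra].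
    - intros x Hx. rewrite Rmin_left, Rmax_right in Hx by lra. apply continuity_pt_filterlim.
      apply (ex_derive_continuous (V:=R_NormedModule)). eexists. apply D. eapply inW_btw; [exact A|exact B|lra].
    - rewrite Rmin_left, Rmax_right in Hc by lra.
      assert (0 <= dp c). { apply D. eapply inW_btw; [exact A|exact B|lra]. } nra. }
  assert (PC : forall x, inW w1 x -> continuous p x).
  { intros x Hx. apply (ex_derive_continuous (V:=R_NormedModule)). eexists. apply D; auto. }
  assert (H' := H). destruct H' as [[K [P [B Q]]] [C1 D1]].
  assert (OK : Cok w1 (fun x => RtoC (dp x) * f (p x))%C (fun x => dp x * g (p x))).
  { split; [split; [|split]|split].
    - intros x Hx. apply cR_mult. apply D; auto. apply cR_comp; auto.
    - intros x Hx. apply Rmult_le_pos. apply D; auto. auto.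
    - exists (RIntW w2 g). intros n.
      rewrite (RInt_ext_le _ (fun x => scal (dp x) (g (p x)))); auto.
      rewrite (RInt_comp (V:=RV) g p dp).
      + apply Rok_le_lim'; auto. apply H.
      + rewrite Rmin_left, Rmax_right by auto. intros x Hx. apply K. apply M. exists n; auto.
      + rewrite Rmin_left, Rmax_right by auto. intros x Hx. split; apply D; exists n; auto.
    - intros x Hx. apply cC_mult. apply cC_RtoC. apply D; auto. apply cC_comp; auto.
    - intros x Hx. rewrite Cmod_mult, Cmod_RtoC, Rabs_pos_eq by (apply D; auto).
      apply Rmult_le_compat_l; auto. apply D; auto. }
  split; auto.
  eapply IntW_is; [exact OK|].
  apply (limC_ext (fun n => CInt f (p (wl w1 n)) (p (wr w1 n)))).
  { intros n. symmetry. apply CInt_subst; auto.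
    - intros x Hx. assert (inW w1 x) by (exists n; auto). split; apply Mono; auto; lra.
    - eapply Cok_contOn; eauto.
    - intros x Hx. split; apply D; exists n; auto. }
  apply limC_Cmod0.
  apply is_lim_seq_spec. intros eps.
  assert (L := Rok_lim w2 g (proj1 H)). apply is_lim_seq_spec in L.
  destruct (L (mkposreal (eps / 2) ltac:(destruct eps; simpl; lra))) as [N HN].
  specialize (HN N ltac:(lia)). simpl in HN. destruct (EX N) as [m Hm].
  exists m. intros n Hn. rewrite Rminus_0_r, Rabs_pos_eq by apply Cmod_ge_0.
  eapply Rle_lt_trans.
  - apply (C_exhaust w2 f g N); auto.
    + eapply Rle_trans; [|apply Hm]. apply Mono; auto. apply wl_mono; auto.
    + eapply Rle_trans; [apply Hm|]. apply Mono; auto. apply wr_mono; auto.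
  - assert (Q1 := Rok_le_lim w2 g N (proj1 H)). rewrite Rabs_minus_sym, Rabs_pos_eq in HN by lra. lra.
Qed.

(** A majorant common to all parameters near [t0] makes the tails uniformly small, which leaves
    continuity of an integral over one compact window. *)
Lemma IntW_param_cont {T : UniformSpace} w (F : T -> R -> C) g (t0 : T) :
  (forall x, inW w x -> contC (fun p : T * R => F (fst p) (snd p)) (t0, x)) ->
  locally t0 (fun t => Cok w (F t) g) ->
  contC (fun t => IntW w (F t)) t0.
Proof.
  intros K H.
  assert (H0 := locally_singleton _ _ H).
  assert (Hg : Rok w g) by apply H0.
  assert (Key : forall eps : posreal, locally t0 (fun t => Cmod (IntW w (F t) - IntW w (F t0)) < eps)).
  { intros eps. assert (L := Rok_lim w g Hg). apply is_lim_seq_spec in L.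
    destruct (L (mkposreal (eps / 8) ltac:(destruct eps; simpl; lra))) as [N HN].
    specialize (HN N ltac:(lia)). simpl in HN.
    assert (Q1 := Rok_le_lim w g N Hg). rewrite Rabs_minus_sym, Rabs_pos_eq in HN by lra.
    assert (Kc : contC (fun t => CInt (F t) (wl w N) (wr w N)) t0).
    { apply CInt_param_cont; auto.
      - intros x Hx. apply K. exists N; auto.
      - eapply filter_imp; [|exact H]. intros t Ht. exact (Cok_contOn w (F t) g _ _ Ht (inW_l w N) (inW_r w N)). }
    destruct Kc as [K1 K2].
    assert (e4 : 0 < eps / 4) by (destruct eps; simpl; lra).
    generalize (proj1 (filterlim_locally _ _) K1 (mkposreal _ e4)).
    generalize (proj1 (filterlim_locally _ _) K2 (mkposreal _ e4)).
    intros B2 B1. generalize (filter_and _ _ H (filter_and _ _ B1 B2)).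
    apply filter_imp. intros t [A [B1' B2']].
    change (Rabs (Re (CInt (F t) (wl w N) (wr w N)) - Re (CInt (F t0) (wl w N) (wr w N))) < eps / 4) in B1'.
    change (Rabs (Im (CInt (F t) (wl w N) (wr w N)) - Im (CInt (F t0) (wl w N) (wr w N))) < eps / 4) in B2'.
    assert (X1 := C_exhaust w (F t) g N _ _ A (inW_l w N) (inW_r w N) ltac:(lra) ltac:(lra)).
    assert (X2 := C_exhaust w (F t0) g N _ _ H0 (inW_l w N) (inW_r w N) ltac:(lra) ltac:(lra)).
    set (I1 := CInt (F t) (wl w N) (wr w N)) in *. set (I2 := CInt (F t0) (wl w N) (wr w N)) in *.
    replace (IntW w (F t) - IntW w (F t0))%C with ((I1 - I2) + ((I2 - IntW w (F t0)) - (I1 - IntW w (F t))))%C by ring.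
    eapply Rle_lt_trans; [apply Cmod_triangle|].
    assert (Y := Cmod_triang_minus (I2 - IntW w (F t0)) (I1 - IntW w (F t))).
    assert (Z := Cmod_le_sum (I1 - I2)).
    change (Re (I1 - I2)) with (Re I1 - Re I2) in Z. change (Im (I1 - I2)) with (Im I1 - Im I2) in Z.
    lra. }
  split; apply filterlim_locally; intros eps; generalize (Key eps); apply filter_imp; intros t Ht.
  - change (Rabs (Re (IntW w (F t) - IntW w (F t0))) < eps). eapply Rle_lt_trans; [apply Re_le_Cmod|auto].
  - change (Rabs (Im (IntW w (F t) - IntW w (F t0))) < eps). eapply Rle_lt_trans; [apply Im_le_Cmod|auto].
Qed.

Lemma contC_slice1 {U V : UniformSpace} (F : U -> V -> C) x y :
  contC (fun p : U * V => F (fst p) (snd p)) (x, y) -> contC (fun u => F u y) x.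
Proof. intros [A B]. split; [apply (continuous_slice1 (fun u v => Re (F u v)))|apply (continuous_slice1 (fun u v => Im (F u v)))]; auto. Qed.
Lemma contC_slice2 {U V : UniformSpace} (F : U -> V -> C) x y :
  contC (fun p : U * V => F (fst p) (snd p)) (x, y) -> contC (fun v => F x v) y.
Proof. intros [A B]. split; [apply (continuous_slice2 (fun u v => Re (F u v)))|apply (continuous_slice2 (fun u v => Im (F u v)))]; auto. Qed.
Lemma contC_swap {U V : UniformSpace} (F : U -> V -> C) x y :
  contC (fun p : U * V => F (fst p) (snd p)) (x, y) -> contC (fun p : V * U => F (snd p) (fst p)) (y, x).
Proof. intros [A B]. split; [apply (continuous_swap (fun u v => Re (F u v)))|apply (continuous_swap (fun u v => Im (F u v)))]; auto. Qed.

(* Dominated continuity with the slice variable confined to a window: clamp it to a compact neighbourhood. *)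
Lemma IntW_slice_cont wx wy (F : R -> R -> C) g h x :
  inW wx x ->
  (forall x y, inW wx x -> inW wy y -> contC (fun p : R * R => F (fst p) (snd p)) (x, y)) ->
  (forall x, inW wx x -> continuous g x) -> (forall x, inW wx x -> 0 <= g x) -> Rok wy h ->
  (forall x y, inW wx x -> inW wy y -> Cmod (F x y) <= g x * h y) ->
  locally x (fun z => inW wx z) ->
  contC (fun x => IntW wy (F x)) x.
Proof.
  intros Hx K Kg Pg Hh D Loc.
  apply (IntW_param_cont wy F (fun y => (g x + 1) * h y)).
  - intros y Hy. apply K; auto.
  - assert (G1 := proj1 (filterlim_locally _ _) (Kg x Hx) (mkposreal 1 Rlt_0_1)).
    generalize (filter_and _ _ Loc G1). apply filter_imp. intros z [Hz Gz].
    change (Rabs (g z - g x) < 1) in Gz. apply Rabs_lt_between in Gz.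
    split; [|split].
    + apply Rok_scal; auto. generalize (Pg x Hx); lra.
    + intros y Hy. apply (contC_slice2 F). auto.
    + intros y Hy. eapply Rle_trans; [apply D; auto|]. apply Rmult_le_compat_r. apply Hh; auto. lra.
Qed.

Definition openW w := forall x, inW w x -> locally x (fun z => inW w z).

(** With a product majorant, either iterated integral differs from the integral over the n-th
    rectangle by at most a multiple of the tail of one factor times the full integral of the other.
    [openW] provides the two-sided neighbourhoods in which the inner integrals are continuous. *)
Theorem Fubini wx wy (F : R -> R -> C) g h :
  openW wx -> openW wy -> Rok wx g -> Rok wy h ->
  (forall x y, inW wx x -> inW wy y -> contC (fun p : R * R => F (fst p) (snd p)) (x, y)) ->
  (forall x y, inW wx x -> inW wy y -> Cmod (F x y) <= g x * h y) ->
  IntW wx (fun x => IntW wy (F x)) = IntW wy (fun y => IntW wx (fun x => F x y)) /\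
  Cok wx (fun x => IntW wy (F x)) (fun x => 2 * RIntW wy h * g x) /\
  Cok wy (fun y => IntW wx (fun x => F x y)) (fun y => 2 * RIntW wx g * h y).
Proof.
  intros Ox Oy Hg Hh K D.
  assert (CokY : forall x, inW wx x -> Cok wy (F x) (fun y => g x * h y)).
  { intros x Hx. split; [|split].
    - apply Rok_scal; auto. apply Hg; auto.
    - intros y Hy. apply (contC_slice2 F); auto.
    - intros; apply D; auto. }
  assert (CokX : forall y, inW wy y -> Cok wx (fun x => F x y) (fun x => h y * g x)).
  { intros y Hy. split; [|split].
    - apply Rok_scal; auto. apply Hh; auto.
    - intros x Hx. apply (contC_slice1 F); auto.
    - intros; rewrite Rmult_comm; apply D; auto. }
  assert (OX : Cok wx (fun x => IntW wy (F x)) (fun x => 2 * RIntW wy h * g x)).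
  { split; [|split].
    - apply Rok_scal; auto. generalize (Rok_ge0 _ _ Hh); lra.
    - intros x Hx. apply (IntW_slice_cont wx wy F g h); auto; apply Hg.
    - intros x Hx. eapply Rle_trans; [apply (IntW_bound wy (F x) _ (CokY x Hx))|].
      rewrite RIntW_scal by auto. right; ring. }
  assert (OY : Cok wy (fun y => IntW wx (fun x => F x y)) (fun y => 2 * RIntW wx g * h y)).
  { split; [|split].
    - apply Rok_scal; auto. generalize (Rok_ge0 _ _ Hg); lra.
    - intros y Hy. apply (IntW_slice_cont wy wx (fun y x => F x y) h g); auto; try apply Hh.
      + intros; apply (contC_swap F); auto.
      + intros. rewrite Rmult_comm; auto.
    - intros y Hy. eapply Rle_trans; [apply (IntW_bound wx _ _ (CokX y Hy))|].
      rewrite RIntW_scal by auto. right; ring. }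
  split; [|split; auto].
  eapply limC_unique; [eapply IntW_lim; exact OX|].
  assert (LY := IntW_lim _ _ _ OY).
  assert (Lg := Rok_lim _ _ Hg). assert (Lh := Rok_lim _ _ Hh).
  assert (Pg := Rok_ge0 _ _ Hg). assert (Ph := Rok_ge0 _ _ Hh).
  set (Ig := RIntW wx g) in *. set (Ih := RIntW wy h) in *.
  replace (IntW wy (fun y => IntW wx (fun x => F x y))) with (0 + IntW wy (fun y => IntW wx (fun x => F x y)))%C by ring.
  apply (limC_ext (fun n => (CInt (fun x => IntW wy (F x)) (wl wx n) (wr wx n) - CInt (fun y => IntW wx (fun x => F x y)) (wl wy n) (wr wy n)) + CInt (fun y => IntW wx (fun x => F x y)) (wl wy n) (wr wy n))%C).
  { intros; ring. }
  apply limC_plus; auto.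
  apply limC_Cmod0.
  apply (is_lim_seq_le_le (fun _ => 0) _ (fun n => 4 * (Ih - RInt h (wl wy n) (wr wy n)) * Ig + 4 * (Ig - RInt g (wl wx n) (wr wx n)) * Ih)).
  2: apply is_lim_seq_const.
  2: { replace (Finite 0) with (Finite (4 * (Ih - Ih) * Ig + 4 * (Ig - Ig) * Ih)) by (f_equal; ring).
       apply is_lim_seq_plus'; (apply is_lim_seq_mult'; [|apply is_lim_seq_const]); apply is_lim_seq_mult'; try apply is_lim_seq_const;
       apply is_lim_seq_minus'; auto; apply is_lim_seq_const. }
  intros n. split; [apply Cmod_ge_0|].
  set (a := wl wx n). set (b := wr wx n). set (c := wl wy n). set (d := wr wy n).
  assert (Hab : a <= b) by apply wlr. assert (Hcd : c <= d) by apply wlr.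
  assert (Wx : forall x, a <= x <= b -> inW wx x) by (intros; exists n; auto).
  assert (Wy : forall y, c <= y <= d -> inW wy y) by (intros; exists n; auto).
  assert (FR := C_Fubini_rect F a b c d Hab Hcd ltac:(intros; apply K; auto)).
  set (J := CInt (fun x => CInt (F x) c d) a b) in *.
  assert (Kx : contOn (fun x => CInt (F x) c d) a b).
  { intros x Hx. apply CInt_param_cont; auto.
    generalize (Ox x (Wx x Hx)). apply filter_imp. intros z Hz y Hy. apply (contC_slice2 F); auto. }
  assert (Ky : contOn (fun y => CInt (fun x => F x y) a b) c d).
  { intros y Hy. apply (CInt_param_cont (fun y x => F x y)); auto.
    - intros; apply (contC_swap F); auto.
    - generalize (Oy y (Wy y Hy)). apply filter_imp. intros z Hz x Hx. apply (contC_slice1 F); auto. }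
  assert (B1 : Cmod (CInt (fun x => IntW wy (F x)) a b - J) <= 4 * (Ih - RInt h c d) * Ig).
  { unfold J.
    replace (CInt (fun x => IntW wy (F x)) a b - CInt (fun x => CInt (F x) c d) a b)%C
      with (CInt (fun x => IntW wy (F x) + (-1) * CInt (F x) c d)%C a b).
    2: { rewrite CInt_plus, CInt_scal; auto. ring. eapply Cok_contOn; eauto; unfold a, b; auto.
         intros x Hx; apply cC_mult; auto; apply cC_const. }
    eapply Rle_trans; [apply (CInt_bound _ (fun x => 2 * (Ih - RInt h c d) * g x)); auto|].
    - intros x Hx. apply cC_plus. apply OX; auto. apply cC_mult; auto; apply cC_const.
    - apply R_ex_scal. apply (cont_exW wx); unfold a, b; auto; apply Hg.
    - intros x Hx.
      replace (IntW wy (F x) + -1 * CInt (F x) c d)%C with (- (CInt (F x) c d - IntW wy (F x)))%C by ring.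
      rewrite Cmod_opp.
      eapply Rle_trans; [apply (C_exhaust wy _ _ n _ _ (CokY x (Wx x Hx))); unfold c, d; auto; lra|].
      rewrite RIntW_scal, R_RInt_scal; auto. fold c d Ih. right; ring.
      apply (cont_exW wy); auto; apply Hh.
    - rewrite R_RInt_scal by (apply (cont_exW wx); unfold a, b; auto; apply Hg).
      assert (Q := Rok_le_lim wx g n Hg). fold a b Ig in Q.
      assert (Q2 := Rok_le_lim wy h n Hh). fold c d Ih in Q2. nra. }
  assert (B2 : Cmod (CInt (fun y => IntW wx (fun x => F x y)) c d - J) <= 4 * (Ig - RInt g a b) * Ih).
  { rewrite FR.
    replace (CInt (fun y => IntW wx (fun x => F x y)) c d - CInt (fun y => CInt (fun x => F x y) a b) c d)%C
      with (CInt (fun y => IntW wx (fun x => F x y) + (-1) * CInt (fun x => F x y) a b)%C c d).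
    2: { rewrite CInt_plus, CInt_scal; auto. ring. eapply Cok_contOn; eauto; unfold c, d; auto.
         intros x Hx; apply cC_mult; auto; apply cC_const. }
    eapply Rle_trans; [apply (CInt_bound _ (fun y => 2 * (Ig - RInt g a b) * h y)); auto|].
    - intros x Hx. apply cC_plus. apply OY; auto. apply cC_mult; auto; apply cC_const.
    - apply R_ex_scal. apply (cont_exW wy); unfold c, d; auto; apply Hh.
    - intros y Hy.
      replace (IntW wx (fun x => F x y) + -1 * CInt (fun x => F x y) a b)%C with (- (CInt (fun x => F x y) a b - IntW wx (fun x => F x y)))%C by ring.
      rewrite Cmod_opp.
      eapply Rle_trans; [apply (C_exhaust wx _ _ n _ _ (CokX y (Wy y Hy))); unfold a, b; auto; lra|].
      rewrite RIntW_scal, R_RInt_scal; auto. fold a b Ig. right; ring.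
      apply (cont_exW wx); auto; apply Hg.
    - rewrite R_RInt_scal by (apply (cont_exW wy); unfold c, d; auto; apply Hh).
      assert (Q := Rok_le_lim wx g n Hg). fold a b Ig in Q.
      assert (Q2 := Rok_le_lim wy h n Hh). fold c d Ih in Q2. nra. }
  set (I1 := CInt (fun x => IntW wy (F x)) a b) in *. set (I2 := CInt (fun y => IntW wx (fun x => F x y)) c d) in *.
  replace (I1 - I2 - 0)%C with ((I1 - J) - (I2 - J))%C by ring.
  eapply Rle_trans; [apply Cmod_triang_minus|]. lra.
Qed.

(** * The windows of the real line and of the positive half-line *)

Lemma WR_lr n : - INR n <= INR n. Proof. generalize (pos_INR n); lra. Qed.
Lemma WR_l n : - INR (S n) <= - INR n. Proof. rewrite S_INR; lra. Qed.
Lemma WR_r n : INR n <= INR (S n). Proof. rewrite S_INR; lra. Qed.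
Definition WR := mkW (fun n => - INR n) INR WR_lr WR_l WR_r.

Lemma W0_lr n : / (INR n + 1) <= INR n + 1.
Proof.
  assert (H := pos_INR n). apply (Rmult_le_reg_l (INR n + 1)). lra. rewrite Rinv_r by lra. nra.
Qed.
Lemma W0_l n : / (INR (S n) + 1) <= / (INR n + 1).
Proof. assert (H := pos_INR n). rewrite S_INR. apply Rinv_le_contravar; lra. Qed.
Lemma W0_r n : INR n + 1 <= INR (S n) + 1. Proof. rewrite S_INR; lra. Qed.
Definition W0 := mkW (fun n => / (INR n + 1)) (fun n => INR n + 1) W0_lr W0_l W0_r.

Lemma inWR x : inW WR x.
Proof.
  destruct (INR_unbounded (Rabs x)) as [n H]. exists n; simpl.
  assert (Q := Rle_abs x). assert (Q' := Rle_abs (- x)). rewrite Rabs_Ropp in Q'. lra.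
Qed.

Lemma inW0 x : inW W0 x <-> 0 < x.
Proof.
  split.
  - intros [n [H _]]. simpl in H. assert (0 < / (INR n + 1)). apply Rinv_0_lt_compat. generalize (pos_INR n); lra. lra.
  - intros H. destruct (INR_unbounded (x + / x)) as [n Hn]. exists n; simpl.
    assert (0 < / x) by (apply Rinv_0_lt_compat; auto). split; [|lra].
    rewrite <- (Rinv_inv x). apply Rinv_le_contravar; auto. lra.
Qed.

#[export] Hint Resolve inWR : core.

Lemma openWR : openW WR.
Proof. intros x _. apply filter_forall. auto. Qed.
Lemma openW0 : openW W0.
Proof.
  intros x Hx. apply inW0 in Hx. generalize (open_gt 0 x Hx). apply filter_imp. intros y Hy; apply inW0; auto.
Qed.
#[export] Hint Resolve openWR openW0 : core.

Lemma Rok_ex w g n : Rok w g -> ex_RInt g (wl w n) (wr w n).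
Proof. intros [K _]. apply (cont_exW w g); auto. Qed.

Lemma RIntW_plus w g h : Rok w g -> Rok w h -> RIntW w (fun t => g t + h t) = RIntW w g + RIntW w h.
Proof.
  intros H1 H2. unfold RIntW at 1.
  rewrite (is_lim_seq_unique _ (Finite (RIntW w g + RIntW w h))); auto.
  apply (is_lim_seq_ext (fun n => RInt g (wl w n) (wr w n) + RInt h (wl w n) (wr w n))).
  - intros n. rewrite R_RInt_plus; auto; apply Rok_ex; auto.
  - apply is_lim_seq_plus'; apply Rok_lim; auto.
Qed.

Lemma RIntW_minus w g h : Rok w g -> Rok w h -> RIntW w (fun t => g t - h t) = RIntW w g - RIntW w h.
Proof.
  intros H1 H2. unfold RIntW at 1.
  rewrite (is_lim_seq_unique _ (Finite (RIntW w g - RIntW w h))); auto.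
  apply (is_lim_seq_ext (fun n => RInt g (wl w n) (wr w n) - RInt h (wl w n) (wr w n))).
  - intros n. rewrite R_RInt_minus; auto; apply Rok_ex; auto.
  - apply is_lim_seq_minus'; apply Rok_lim; auto.
Qed.

Lemma IntW_real w g : Rok w g -> IntW w (fun t => RtoC (g t)) = RtoC (RIntW w g).
Proof.
  intros H. unfold IntW. apply C_ext; simpl; auto.
  unfold RIntW. rewrite (Lim_seq_ext _ (fun _ => 0)). rewrite Lim_seq_const; auto.
  intros n. rewrite RInt_const. unfold scal; simpl; unfold mult; simpl; ring.
Qed.

Lemma Cok_real w g : Rok w g -> Cok w (fun t => RtoC (g t)) g.
Proof.
  intros H. split; [auto|split].
  - intros; apply cC_RtoC; apply H; auto.
  - intros x Hx. rewrite Cmod_RtoC, Rabs_pos_eq. lra. apply H; auto.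
Qed.

Lemma Rok_exp_abs c : 0 < c -> Rok WR (fun u => exp (- c * Rabs u)).
Proof.
  intros Hc.
  (* The derivative of a logistic function is a smooth majorant with a bounded antiderivative on the
     whole line; it is at least a quarter of e^(- c |u|), which has a corner at 0. *)
  assert (A : Rok WR (fun u => exp (c * u) / (1 + exp (c * u)) ^ 2)).
  { apply (Rok_FTC WR (fun u => - / (c * (1 + exp (c * u)))) _ (/ c)).
    - intros x _. assert (E := exp_pos (c * x)). auto_derive.
      + apply Rgt_not_eq. apply Rmult_lt_0_compat; lra.
      + field. split; lra.
    - intros x _. assert (E := exp_pos (c * x)). cont. apply Rgt_not_eq. apply pow_lt. lra.
    - intros x _. assert (E := exp_pos (c * x)). apply Rmult_le_pos. lra. left. apply Rinv_0_lt_compat. apply pow_lt; lra.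
    - intros x _. assert (E := exp_pos (c * x)). rewrite Rabs_Ropp, Rabs_pos_eq.
      apply Rinv_le_contravar; nra. left. apply Rinv_0_lt_compat. nra. }
  apply (Rok_le _ _ _ (Rok_scal _ _ 4 ltac:(lra) A)).
  - intros; cont.
  - intros x _. split. left; apply exp_pos.
    assert (E := exp_pos (c * x)).
    assert (P : 0 < (1 + exp (c * x)) ^ 2) by (apply pow_lt; lra).
    apply (Rmult_le_reg_r ((1 + exp (c * x)) ^ 2)); auto.
    replace (4 * (exp (c * x) / (1 + exp (c * x)) ^ 2) * (1 + exp (c * x)) ^ 2) with (4 * exp (c * x)) by (field; lra).
    unfold Rabs. destruct Rcase_abs.
    + replace (- c * - x) with (c * x) by ring.
      assert (exp (c * x) <= 1). { rewrite <- exp_0. apply exp_le. nra. } nra.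
    + replace (- c * x) with (- (c * x)) by ring. rewrite exp_Ropp.
      assert (1 <= exp (c * x)). { rewrite <- exp_0. apply exp_le. nra. }
      apply (Rmult_le_reg_l (exp (c * x))); auto.
      rewrite <- Rmult_assoc, Rinv_r by lra. nra.
Qed.

Lemma Rok_exp0 c : 0 < c -> Rok W0 (fun u => exp (- c * u)).
Proof.
  intros Hc. apply (Rok_FTC W0 (fun u => - exp (- c * u) / c) _ (/ c)).
  - intros x _. auto_derive; auto. field. lra.
  - intros; cont.
  - intros; left; apply exp_pos.
  - intros x Hx. apply inW0 in Hx. unfold Rdiv. rewrite Rabs_mult, Rabs_Ropp, !Rabs_pos_eq.
    2: left; apply Rinv_0_lt_compat; auto. 2: left; apply exp_pos.
    assert (exp (- c * x) <= 1). { rewrite <- exp_0. apply exp_le. nra. }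
    assert (0 < / c) by (apply Rinv_0_lt_compat; auto). nra.
Qed.

Lemma lim_exp_n C c : 0 < c -> is_lim_seq (fun n => C * exp (- c * INR n)) 0.
Proof.
  intros Hc. apply (is_lim_seq_ext (fun n => C * (exp (- c)) ^ n)).
  - intros n. f_equal. induction n; [simpl; rewrite Rmult_0_r, exp_0; auto|].
    rewrite S_INR, Rmult_plus_distr_l, exp_plus, Rmult_1_r, <- IHn. simpl; ring.
  - replace (Finite 0) with (Finite (C * 0)) by (f_equal; ring).
    apply is_lim_seq_mult'. apply is_lim_seq_const. apply is_lim_seq_geom.
    rewrite Rabs_pos_eq by (left; apply exp_pos). rewrite <- exp_0. apply exp_increasing. lra.
Qed.

Lemma limC_0_bound u b : is_lim_seq b 0 -> (forall n, Cmod (u n) <= b n) -> limC u 0%C.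
Proof.
  intros L H. apply limC_Cmod0. apply (is_lim_seq_le_le (fun _ => 0) _ b); auto.
  - intros n. split. apply Cmod_ge_0. replace (u n - 0)%C with (u n) by ring. auto.
  - apply is_lim_seq_const.
Qed.

Lemma limC_0_bound_ev u b : is_lim_seq b 0 -> eventually (fun n => Cmod (u n) <= b n) -> limC u 0%C.
Proof.
  intros L H. apply limC_Cmod0. apply (is_lim_seq_le_le_loc (fun _ => 0) _ b); auto.
  - eapply filter_imp; [|exact H]. intros n Hn. split. apply Cmod_ge_0. replace (u n - 0)%C with (u n) by ring. auto.
  - apply is_lim_seq_const.
Qed.

(** * Strip shift: Cauchy's theorem on growing rectangles *)

Lemma strip_shift (F F' : R -> R -> C) (v0 v1 : R) (g : R -> R) : v0 <= v1 ->
  (forall u v, v0 <= v <= v1 -> dC (fun u => F u v) u (F' u v)) ->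
  (forall u v, v0 <= v <= v1 -> dC (fun v => F u v) v (Ci * F' u v)%C) ->
  (forall u v, v0 <= v <= v1 -> contC (fun p : R * R => F' (fst p) (snd p)) (u, v)) ->
  Rok WR g -> (forall u v, v0 <= v <= v1 -> Cmod (F u v) <= g u) ->
  is_lim_seq (fun n => g (INR n)) 0 -> is_lim_seq (fun n => g (- INR n)) 0 ->
  Cok WR (fun u => F u v0) g /\ Cok WR (fun u => F u v1) g /\
  IntW WR (fun u => F u v0) = IntW WR (fun u => F u v1).
Proof.
  intros Hv Du Dv K Hg B L1 L2.
  assert (O : forall v, v0 <= v <= v1 -> Cok WR (fun u => F u v) g).
  { intros v H. split; [auto|split].
    - intros x _. apply (dC_cont _ _ _ (Du x v H)).
    - intros; apply B; auto. }
  split; [|split]; try (apply O; lra).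
  symmetry. eapply limC_unique; [eapply IntW_lim; apply O; lra|].
  replace (IntW WR (fun u => F u v0)) with (0 + IntW WR (fun u => F u v0))%C by ring.
  apply (limC_ext (fun n => (CInt (fun u => F u v1) (- INR n) (INR n) - CInt (fun u => F u v0) (- INR n) (INR n)) + CInt (fun u => F u v0) (- INR n) (INR n))%C).
  { intros; simpl; ring. }
  apply limC_plus; [|eapply (IntW_lim WR); apply O; lra].
  apply (limC_0_bound _ (fun n => 2 * ((v1 - v0) * (g (INR n) + g (- INR n))))).
  { replace (Finite 0) with (Finite (2 * ((v1 - v0) * (0 + 0)))) by (f_equal; ring).
    repeat apply is_lim_seq_mult'; try apply is_lim_seq_const. apply is_lim_seq_plus'; auto. }
  intros n. set (a := - INR n). set (b := INR n). assert (Hab : a <= b) by apply WR_lr.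
  assert (Co : forall v, v0 <= v <= v1 -> contOn (fun u => F u v) a b).
  { intros v H x _. apply O; auto. }
  (* The difference of the two horizontal integrals is the double integral of dF/dv = i F'.
     Exchanging the order integrates F' = dF/du exactly and leaves i times the two vertical sides,
     which are small by the values of [g] at n and - n. *)
  replace (CInt (fun u => F u v1) a b - CInt (fun u => F u v0) a b)%C
    with (CInt (fun u => CInt (fun v => Ci * F' u v)%C v0 v1) a b).
  2: { rewrite (CInt_ext _ (fun u => F u v1 + (-1) * F u v0)%C); auto.
       - rewrite CInt_plus, CInt_scal; auto; [ring|apply Co; lra|apply Co; lra|].
         intros x Hx. apply cC_mult. apply cC_const. apply (Co v0); auto; lra.
       - intros x Hx. rewrite (C_FTC (fun v => F x v)); auto. ring.
         intros y Hy. apply cC_mult. apply cC_const. apply (contC_slice2 F'); auto. }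
  rewrite C_Fubini_rect; auto.
  2: { intros x y Hx Hy. apply cC_mult. apply cC_const. apply K; auto. }
  rewrite (CInt_ext _ (fun y => Ci * (F b y - F a y))%C); auto.
  2: { intros y Hy. rewrite CInt_scal; auto.
       - f_equal. apply (C_FTC (fun u => F u y) (fun u => F' u y)); auto. intros x _. apply (contC_slice1 F'); auto.
       - intros x _. apply (contC_slice1 F'); auto. }
  eapply Rle_trans; [apply (CInt_bound _ (fun _ => g b + g a)); auto|].
  - intros y Hy. apply cC_mult. apply cC_const. apply cC_minus; [apply (dC_cont _ _ _ (Dv b y Hy))|apply (dC_cont _ _ _ (Dv a y Hy))].
  - apply (ex_RInt_const (V:=R_NormedModule)).
  - intros y Hy. rewrite Cmod_mult, Cmod_Ci, Rmult_1_l.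
    eapply Rle_trans; [apply Cmod_triang_minus|]. generalize (B b y Hy) (B a y Hy); lra.
  - rewrite RInt_const. unfold scal; simpl; unfold mult; simpl. right; ring.
Qed.

(** * The Gamma integral in logarithmic coordinates *)

(** The concave function u -> A u - b e^u is largest at u = ln (A / b); the tangent line of exp at
    that point gives the bound. *)
Lemma gexp_bound A b u : 0 < A -> 0 < b -> A * u - b * exp u <= A * (ln (A / b) - 1).
Proof.
  intros HA Hb. set (s := ln (A / b)).
  assert (P : 0 < A / b) by (apply Rdiv_lt_0_compat; auto).
  assert (E : exp u >= A / b * (1 + (u - s))).
  { replace (exp u) with (exp s * exp (u - s)) by (rewrite <- exp_plus; f_equal; ring).
    unfold s at 1. rewrite exp_ln by auto. apply Rle_ge. apply Rmult_le_compat_l. lra. apply exp_ineq1_le. }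
  assert (b * (A / b * (1 + (u - s))) = A * (1 + (u - s))) by (field; lra).
  assert (b * exp u >= A * (1 + (u - s))) by nra. lra.
Qed.

(** For u < 0 the factor e^(a u) decays by itself. For u >= 0, [gexp_bound] with a + 1 in place of a
    leaves a spare factor e^(- u). Hence the rate min(a, 1). *)
Lemma gamma_dom a b : 0 < a -> 0 < b ->
  exists K c, 0 < K /\ 0 < c /\ forall u, exp (a * u - b * exp u) <= K * exp (- c * Rabs u).
Proof.
  intros Ha Hb. set (c := Rmin a 1). assert (Hc : 0 < c) by (apply Rmin_pos; lra).
  assert (c <= a) by apply Rmin_l. assert (c <= 1) by apply Rmin_r.
  set (M := (a + 1) * (ln ((a + 1) / b) - 1)).
  exists (exp M + 1), c. assert (HM := exp_pos M). split; [lra|split; auto].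
  intros u. assert (HE := exp_pos (- c * Rabs u)).
  unfold Rabs in *. destruct Rcase_abs.
  - apply Rle_trans with (1 * exp (- c * - u)); [|nra]. rewrite Rmult_1_l. apply exp_le.
    assert (0 < exp u) by apply exp_pos. nra.
  - apply Rle_trans with (exp M * exp (- c * u)); [|nra]. rewrite <- exp_plus. apply exp_le.
    assert (Q := gexp_bound (a + 1) b u ltac:(lra) Hb). fold M in Q. nra.
Qed.

Lemma Rok_gamma a b : 0 < a -> 0 < b -> Rok WR (fun u => exp (a * u - b * exp u)).
Proof.
  intros Ha Hb. destruct (gamma_dom a b Ha Hb) as [K [c [HK [Hc H]]]].
  apply (Rok_le _ _ _ (Rok_scal _ _ K ltac:(lra) (Rok_exp_abs c Hc))).
  - intros; cont.
  - intros x _. split. left; apply exp_pos. auto.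
Qed.

Definition Gam (w : C) : C := IntW WR (fun v => Cexp (w * RtoC v - RtoC (exp v)))%C.
Definition rG (s : R) : R := RIntW WR (fun v => exp (s * v - exp v)).

Lemma Rok_rG s : 0 < s -> Rok WR (fun v => exp (s * v - exp v)).
Proof.
  intros H. assert (Q := Rok_gamma s 1 H ltac:(lra)).
  replace (fun v => exp (s * v - exp v)) with (fun v => exp (s * v - 1 * exp v)); auto.
  apply functional_extensionality; intros; f_equal; ring.
Qed.

Lemma Cok_Gam w : 0 < Re w -> Cok WR (fun v => Cexp (w * RtoC v - RtoC (exp v)))%C (fun v => exp (Re w * v - exp v)).
Proof.
  intros H. split; [apply Rok_rG; auto|split].
  - intros; cont.
  - intros x _. rewrite Cmod_Cexp. right. f_equal. simpl. unfold Re. ring.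
Qed.

Lemma rG_pos_ends s : 0 < s -> exists K c, 0 < c /\ forall u, exp (s * u - exp u) <= K * exp (- c * Rabs u).
Proof.
  intros H. destruct (gamma_dom s 1 H ltac:(lra)) as [K [c [HK [Hc B]]]]. exists K, c. split; auto.
  intros u. replace (exp u) with (1 * exp u) by ring. auto.
Qed.

Lemma Gam_S w : 0 < Re w -> Gam (w + 1) = (w * Gam w)%C.
Proof.
  intros H.
  assert (C1 := Cok_Gam w H). assert (C2 := Cok_Gam (w + 1) ltac:(simpl; unfold Re in *; lra)).
  destruct (rG_pos_ends _ H) as [K [c [Hc B]]].
  assert (E : IntW WR (fun v => w * Cexp (w * RtoC v - RtoC (exp v)) + (-1) * Cexp ((w + 1) * RtoC v - RtoC (exp v)))%C = (0 - 0)%C).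
  { eapply (IntW_FTC WR (fun v => Cexp (w * RtoC v - RtoC (exp v)))).
    - apply Cok_plus; apply Cok_scal; [exact C1|exact C2].
    - intros x _. evar_last.
      + apply dC_Cexp. apply dC_minus. apply dC_mult. apply dC_const. apply dC_RtoC. apply dR_id.
        apply dC_RtoC. apply is_derive_exp.
      + replace ((w + 1) * RtoC x - RtoC (exp x))%C with (w * RtoC x - RtoC (exp x) + RtoC x)%C by ring.
        rewrite (Cexp_add _ (RtoC x)), Cexp_R. ring.
    - apply (limC_0_bound _ (fun n => K * exp (- c * INR n))). apply lim_exp_n; auto.
      intros n. simpl wl. rewrite Cmod_Cexp. eapply Rle_trans; [|eapply Rle_trans; [apply (B (- INR n))|]].
      + right; f_equal; simpl; unfold Re; ring.
      + rewrite Rabs_Ropp, (Rabs_pos_eq (INR n)) by apply pos_INR. lra.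
    - apply (limC_0_bound _ (fun n => K * exp (- c * INR n))). apply lim_exp_n; auto.
      intros n. simpl wr. rewrite Cmod_Cexp. eapply Rle_trans; [|eapply Rle_trans; [apply (B (INR n))|]].
      + right; f_equal; simpl; unfold Re; ring.
      + rewrite (Rabs_pos_eq (INR n)) by apply pos_INR. lra. }
  rewrite (IntW_plus _ _ _ _ _ (Cok_scal _ _ _ w C1) (Cok_scal _ _ _ (-1)%C C2)) in E.
  rewrite (IntW_scal _ _ _ _ C1), (IntW_scal _ _ _ _ C2) in E. fold (Gam w) (Gam (w + 1)) in E.
  replace (Gam (w + 1)) with (w * Gam w - (w * Gam w + -1 * Gam (w + 1)))%C by ring. rewrite E. ring.
Qed.

Lemma Gam_R s : 0 < s -> Gam (RtoC s) = RtoC (rG s).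
Proof.
  intros H. unfold Gam, rG. rewrite <- IntW_real by (apply Rok_rG; auto). apply IntW_ext. intros x _.
  assert (E : (RtoC s * RtoC x - RtoC (exp x))%C = RtoC (s * x - exp x)) by (rewrite RtoC_minus, RtoC_mult; reflexivity).
  rewrite E. apply Cexp_R.
Qed.

Lemma rG_S s : 0 < s -> rG (s + 1) = s * rG s.
Proof.
  intros H. assert (E := Gam_S (RtoC s) H). rewrite <- RtoC_plus in E. rewrite !Gam_R in E by lra.
  rewrite <- RtoC_mult in E. injection E; auto.
Qed.

Lemma is_lim_seq_exp_neg u : is_lim_seq u p_infty -> is_lim_seq (fun n => exp (- u n)) 0.
Proof.
  intros H. apply (is_lim_seq_le_le (fun _ => 0) _ (fun n => / exp (u n))).
  - intros n. split. left; apply exp_pos. rewrite exp_Ropp. lra.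
  - apply is_lim_seq_const.
  - replace (Finite 0) with (Rbar_inv p_infty) by reflexivity. apply is_lim_seq_inv; [|discriminate].
    apply (is_lim_seq_le_p_loc u); auto. exists O. intros n _. generalize (exp_ineq1_le (u n)); lra.
Qed.

Lemma rG_1 : rG 1 = 1.
Proof.
  assert (E : Gam (RtoC 1) = (0 - (- (1)))%C).
  { unfold Gam. eapply (IntW_FTC WR (fun v => RtoC (- exp (- exp v)))).
    - apply Cok_Gam. simpl. lra.
    - intros x _. evar_last. apply dC_RtoC. auto_derive; auto. rewrite Cmult_1_l, <- RtoC_minus, Cexp_R.
      f_equal. rewrite Rmult_1_l. unfold Rminus. rewrite exp_plus. ring.
    - replace (- (1))%C with (RtoC (- exp (- 0))). apply limC_RtoC.
      apply (is_lim_seq_continuous (fun t => - exp (- t)) (fun n => exp (- INR n)) 0).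
      + apply continuity_pt_filterlim. apply (cR_opp (fun t => exp (- t))). cont.
      + apply is_lim_seq_exp_neg. apply is_lim_seq_INR.
      + rewrite Ropp_0, exp_0, RtoC_opp. reflexivity.
    - replace (RtoC 0) with (RtoC (- 0)) by (f_equal; ring). apply limC_RtoC.
      apply (is_lim_seq_opp (fun n => exp (- exp (INR n))) 0). apply is_lim_seq_exp_neg.
      apply (is_lim_seq_le_p_loc INR); [|apply is_lim_seq_INR].
      exists O. intros n _. generalize (exp_ineq1_le (INR n)); lra. }
  rewrite Gam_R in E by lra. injection E. intros. lra.
Qed.

Lemma rG_fact n : rG (INR n + 1) = INR (fact n).
Proof.
  induction n.
  - simpl. rewrite Rplus_0_l. apply rG_1.
  - rewrite S_INR, rG_S, IHn. rewrite fact_simpl, mult_INR, S_INR. ring. generalize (pos_INR n); lra.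
Qed.

(** * Growth of Gamma from the concentration of its integrand *)

Section Moments.
Variable n : nat.
Hypothesis Hn : (1 <= n)%nat.
Let nr := INR n.
Let L := ln nr.
Let nr_ge1 : 1 <= nr. Proof. unfold nr. change 1 with (INR 1). apply le_INR; auto. Qed.
(** In t = e^v this is the Gamma density for n! multiplied by (t / n)^j; [mj j] is its integral,
    n^(- j) Gamma(n + 1 + j). *)
Let mf (j v : R) := exp ((nr + 1) * v - exp v) * exp (j * (v - L)).
Let mj (j : R) := exp (- j * L) * rG (nr + 1 + j).

Lemma mf_eq j v : mf j v = exp (- j * L) * exp ((nr + 1 + j) * v - exp v).
Proof. unfold mf. rewrite <- !exp_plus. f_equal. ring. Qed.

Lemma mf_ok j : 0 < nr + 1 + j -> Rok WR (mf j) /\ RIntW WR (mf j) = mj j.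
Proof.
  intros H. replace (mf j) with (fun v => exp (- j * L) * exp ((nr + 1 + j) * v - exp v)).
  2: { apply functional_extensionality. intros; rewrite mf_eq; auto. }
  split. apply Rok_scal. left; apply exp_pos. apply Rok_rG; auto.
  rewrite RIntW_scal by (apply Rok_rG; auto). reflexivity.
Qed.

Lemma mj_S j : 0 < nr + 1 + j -> mj (j + 1) = mj j * ((nr + 1 + j) / nr).
Proof.
  intros H. unfold mj. replace (nr + 1 + (j + 1)) with (nr + 1 + j + 1) by ring. rewrite rG_S by auto.
  replace (- (j + 1) * L) with (- j * L + - L) by ring. rewrite exp_plus, exp_Ropp.
  unfold L at 2. rewrite exp_ln by lra. field. lra.
Qed.

Lemma mj_0 : mj 0 = INR (fact n).
Proof.
  unfold mj. replace (- 0 * L) with 0 by ring. rewrite exp_0, Rplus_0_r.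
  unfold nr. rewrite rG_fact. ring.
Qed.

Lemma mj_pos j : 0 < nr + 1 + j -> 0 <= mj j.
Proof. intros. unfold mj. apply Rmult_le_pos. left; apply exp_pos. apply (Rok_ge0 WR). apply Rok_rG; auto. Qed.

Lemma mj_up k : mj (INR k) <= (1 + INR k) ^ k * INR (fact n).
Proof.
  induction k.
  - simpl. rewrite mj_0. lra.
  - rewrite S_INR. assert (Pk := pos_INR k). rewrite mj_S by lra.
    assert (F := INR_fact_lt_0 n).
    assert (P0 := mj_pos (INR k) ltac:(lra)).
    assert (B1 : (nr + 1 + INR k) / nr <= 1 + (INR k + 1)).
    { apply (Rmult_le_reg_r nr). lra. unfold Rdiv. rewrite Rmult_assoc, Rinv_l by lra. nra. }
    assert (B2 : (1 + INR k) ^ k <= (1 + (INR k + 1)) ^ k) by (apply pow_incr; lra).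
    assert (0 <= (1 + INR k) ^ k) by (apply pow_le; lra).
    apply Rle_trans with ((1 + (INR k + 1)) ^ k * INR (fact n) * (1 + (INR k + 1))).
    + apply Rmult_le_compat; auto. apply Rmult_le_pos. lra. left; apply Rinv_0_lt_compat; lra.
      eapply Rle_trans; [exact IHk|]. apply Rmult_le_compat_r; lra.
    + simpl. right; ring.
Qed.

(** Each step down divides by a factor (n - i) / n, and 2 k <= n keeps these factors at least
    1/2. *)
Lemma mj_down k : (2 * k <= n)%nat -> mj (- INR k) <= 2 ^ k * INR (fact n).
Proof.
  induction k; intros H.
  - simpl. rewrite Ropp_0, mj_0. lra.
  - specialize (IHk ltac:(lia)). rewrite S_INR.
    assert (Hk : 2 * (INR k + 1) <= nr). { unfold nr. rewrite <- S_INR. change 2 with (INR 2). rewrite <- mult_INR. apply le_INR; lia. }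
    assert (Pk := pos_INR k).
    assert (E := mj_S (- (INR k + 1)) ltac:(lra)).
    replace (- (INR k + 1) + 1) with (- INR k) in E by ring.
    assert (P0 := mj_pos (- (INR k + 1)) ltac:(lra)).
    assert (B1 : / 2 <= (nr + 1 + - (INR k + 1)) / nr).
    { apply (Rmult_le_reg_r nr). lra. unfold Rdiv. rewrite Rmult_assoc, Rinv_l by lra. lra. }
    simpl. nra.
Qed.

(** Expanding the square gives three of the moments [mj], and the functional equation evaluates them
    exactly. The point is that the result is of order 1/n relative to [mj j]. *)
Lemma var_ok j : 0 < nr + 1 + j ->
  Rok WR (fun v => mf j v * (exp (v - L) - 1) ^ 2) /\
  RIntW WR (fun v => mf j v * (exp (v - L) - 1) ^ 2) = mj j * ((nr + (j + 1) * (j + 2)) / nr ^ 2).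
Proof.
  intros H.
  destruct (mf_ok j H) as [A0 B0]. destruct (mf_ok (j + 1) ltac:(lra)) as [A1 B1]. destruct (mf_ok (j + 2) ltac:(lra)) as [A2 B2].
  assert (E : forall v, mf j v * (exp (v - L) - 1) ^ 2 = (mf (j + 2) v + mf j v) - 2 * mf (j + 1) v).
  { intros v. unfold mf. replace ((j + 2) * (v - L)) with (j * (v - L) + (v - L) + (v - L)) by ring.
    replace ((j + 1) * (v - L)) with (j * (v - L) + (v - L)) by ring. rewrite !exp_plus. ring. }
  split.
  - apply (Rok_le _ _ _ (Rok_plus _ _ _ A2 A0)).
    + intros. apply cR_mult. apply A0; auto. cont.
    + intros x _. split. apply Rmult_le_pos. apply A0; auto. apply pow2_ge_0.
      rewrite E. assert (0 <= mf (j + 1) x) by (apply A1; auto). lra.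
  - rewrite (RIntW_ext _ _ _ (fun v _ => E v)).
    rewrite (RIntW_minus _ _ _ (Rok_plus _ _ _ A2 A0) (Rok_scal _ _ 2 ltac:(lra) A1)).
    rewrite RIntW_plus, RIntW_scal by auto. rewrite B0, B1, B2.
    replace (j + 2) with (j + 1 + 1) by ring. rewrite !mj_S by lra. field. lra.
Qed.

(** The difference is n^w times the integral of the density against (t / n)^w - 1. This is at most
    |w| |ln (t / n)| up to a power of t / n, and the variance of t / n turns it into O(1 / sqrt n).
    The exponent k exceeds |w| by 1 because ln (t / n) is replaced by t / n - 1 at the cost of one
    more power. *)
Lemma Gam_shift_bound (w : C) (k : nat) : Cmod w + 1 <= INR k -> (2 * k <= n)%nat ->
  Cmod (Gam (w + RtoC (nr + 1)) - Rcpow nr w * RtoC (INR (fact n))) <=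
  exp (Re w * L) * INR (fact n) * (2 * Cmod w * ((1 + INR k) ^ k + 2 ^ k) * (2 + (INR k + 2) ^ 2)) / sqrt nr.
Proof.
  intros Hk Hkn. set (W := Cmod w). assert (HW : 0 <= W) by apply Cmod_ge_0. fold W in Hk.
  assert (Hk2 : 2 * INR k <= nr). { unfold nr. change 2 with (INR 2). rewrite <- mult_INR. apply le_INR; lia. }
  assert (HRe : - INR k <= Re w). { assert (Q := Re_le_Cmod w). fold W in Q. apply Rabs_le_between in Q. lra. }
  assert (s0 : 0 < sqrt nr) by (apply sqrt_lt_R0; lra).
  assert (ss : sqrt nr * sqrt nr = nr) by (apply sqrt_sqrt; lra).
  assert (E : (Gam (w + RtoC (nr + 1)) - Rcpow nr w * RtoC (INR (fact n)))%C =
    IntW WR (fun v => Cexp ((w + RtoC (nr + 1)) * RtoC v - RtoC (exp v)) - Rcpow nr w * RtoC (exp ((nr + 1) * v - exp v)))%C).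
  { unfold nr at 4. rewrite <- rG_fact. fold nr. unfold rG. rewrite <- IntW_real by (apply Rok_rG; lra).
    rewrite <- (IntW_scal _ _ _ _ (Cok_real _ _ (Rok_rG (nr + 1) ltac:(lra)))).
    unfold Gam. symmetry. eapply IntW_minus.
    - apply Cok_Gam. simpl. unfold Re in *. lra.
    - apply Cok_scal. apply Cok_real. apply Rok_rG. lra. }
  rewrite E.
  destruct (mf_ok (INR k) ltac:(lra)) as [A1 B1]. destruct (mf_ok (- INR k) ltac:(lra)) as [A2 B2].
  destruct (var_ok (INR k) ltac:(lra)) as [V1 D1]. destruct (var_ok (- INR k) ltac:(lra)) as [V2 D2].
  set (P := exp (Re w * L)). assert (HP : 0 < P) by apply exp_pos.
  assert (OK1 := Rok_scal _ _ (P * W * sqrt nr) ltac:(repeat apply Rmult_le_pos; lra) (Rok_plus _ _ _ V1 V2)).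
  assert (si : 0 < / sqrt nr) by (apply Rinv_0_lt_compat; auto).
  assert (OK2 := Rok_scal _ _ (P * W * / sqrt nr) ltac:(repeat apply Rmult_le_pos; lra) (Rok_plus _ _ _ A1 A2)).
  assert (OK := Rok_plus _ _ _ OK1 OK2).
  eapply Rle_trans; [eapply IntW_bound; split; [exact OK|split]|].
  - intros; cont.
  - intros v _. set (y := v - L).
    assert (E1 : (Cexp ((w + RtoC (nr + 1)) * RtoC v - RtoC (exp v)) - Rcpow nr w * RtoC (exp ((nr + 1) * v - exp v)))%C
      = (Rcpow nr w * RtoC (exp ((nr + 1) * v - exp v)) * (Cexp (w * RtoC y) - 1))%C).
    { replace ((w + RtoC (nr + 1)) * RtoC v - RtoC (exp v))%C with (w * RtoC L + RtoC ((nr + 1) * v - exp v) + w * RtoC y)%C.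
      - rewrite !Cexp_add, Cexp_R. unfold Rcpow. fold L. ring.
      - unfold y. rewrite !RtoC_minus, RtoC_mult. ring. }
    rewrite E1, !Cmod_mult, Cmod_RtoC, (Rabs_pos_eq (exp _)) by (left; apply exp_pos).
    assert (E2 : Cmod (Rcpow nr w) = P). { unfold Rcpow. rewrite Cmod_Cexp. unfold P, L. f_equal. simpl. unfold Re; ring. }
    rewrite E2.
    assert (E3 : Cmod (Cexp (w * RtoC y) - 1) <= W * (sqrt nr * (exp y - 1) ^ 2 + / sqrt nr) * (exp (INR k * y) + exp (- INR k * y))).
    { eapply Rle_trans; [apply Cexp_sub1_bound|]. rewrite Cmod_mult, Cmod_RtoC. fold W.
      assert (Y : Rabs y <= Rabs (exp y - 1) * exp (Rabs y)).
      { unfold Rabs at 1 3. destruct (Rcase_abs y).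
        - assert (Q := exp_ineq1_le (- y)). assert (R1 : exp y * exp (- y) = 1) by (rewrite <- exp_plus, Rplus_opp_r; apply exp_0).
          assert (exp y < 1) by (rewrite <- exp_0; apply exp_increasing; auto).
          rewrite Rabs_left by lra. nra.
        - assert (Q := exp_ineq1_le y). rewrite Rabs_pos_eq by lra. assert (1 <= exp y) by lra. nra. }
      assert (Z : exp (W * Rabs y) * exp (Rabs y) <= exp (INR k * y) + exp (- INR k * y)).
      { rewrite <- exp_plus. assert (Ra := Rabs_pos y).
        apply Rle_trans with (exp (INR k * Rabs y)). apply exp_le; nra.
        assert (X1 := exp_pos (INR k * y)). assert (X2 := exp_pos (- INR k * y)).
        unfold Rabs. destruct Rcase_abs. replace (INR k * - y) with (- INR k * y) by ring. lra. lra. }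
      (* The weight sqrt n balances the two terms: the square integrates to order 1/n, so both
         contribute 1 / sqrt n. *)
      assert (AM : 2 * Rabs (exp y - 1) <= sqrt nr * (exp y - 1) ^ 2 + / sqrt nr).
      { rewrite <- (pow2_abs (exp y - 1)). set (q := Rabs (exp y - 1)).
        apply (Rmult_le_reg_l (sqrt nr)); auto.
        replace (sqrt nr * (sqrt nr * q ^ 2 + / sqrt nr)) with ((sqrt nr * q) ^ 2 + 1) by (field; lra).
        generalize (pow2_ge_0 (sqrt nr * q - 1)). nra. }
      assert (X0 := exp_pos (W * Rabs y)). assert (X1 := exp_pos (Rabs y)).
      assert (Q0 := Rabs_pos (exp y - 1)).
      apply Rle_trans with (W * (2 * Rabs (exp y - 1)) * (exp (W * Rabs y) * exp (Rabs y))).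
      - apply Rle_trans with (2 * W * exp (W * Rabs y) * (Rabs (exp y - 1) * exp (Rabs y))); [|right; ring].
        apply Rle_trans with (2 * W * exp (W * Rabs y) * Rabs y); [right; ring|].
        apply Rmult_le_compat_l; auto. repeat apply Rmult_le_pos; lra.
      - apply Rmult_le_compat; auto. repeat apply Rmult_le_pos; lra. apply Rmult_le_pos; lra.
        apply Rmult_le_compat_l; auto. }
    eapply Rle_trans.
    { apply Rmult_le_compat_l. 2: exact E3. apply Rmult_le_pos. lra. left; apply exp_pos. }
    unfold mf. fold y. right. ring.
  - rewrite RIntW_plus by auto. rewrite !RIntW_scal, !RIntW_plus by (auto; apply Rok_plus; auto).
    rewrite B1, B2, D1, D2.
    assert (M1 := mj_up k). assert (M2 := mj_down k Hkn).
    assert (P1 := mj_pos (INR k) ltac:(lra)). assert (P2 := mj_pos (- INR k) ltac:(lra)).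
    assert (Pk := pos_INR k).
    assert (T : forall j, Rabs j <= INR k -> (nr + (j + 1) * (j + 2)) / nr ^ 2 <= (1 + (INR k + 2) ^ 2) * / nr).
    { intros j Hj. apply Rabs_le_between in Hj. apply (Rmult_le_reg_r (nr ^ 2)). apply pow_lt; lra.
      replace ((nr + (j + 1) * (j + 2)) / nr ^ 2 * nr ^ 2) with (nr + (j + 1) * (j + 2)) by (field; lra).
      replace ((1 + (INR k + 2) ^ 2) * / nr * nr ^ 2) with (nr * (1 + (INR k + 2) ^ 2)) by (field; lra).
      assert ((j + 1) * (j + 2) <= (INR k + 2) ^ 2) by nra.
      assert (0 <= (INR k + 2) ^ 2) by apply pow2_ge_0. nra. }
    assert (T1 := T (INR k) ltac:(rewrite Rabs_pos_eq; lra)).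
    assert (T2 := T (- INR k) ltac:(rewrite Rabs_Ropp, Rabs_pos_eq; lra)).
    set (F := INR (fact n)) in *. set (c1 := (1 + INR k) ^ k) in *. set (c2 := 2 ^ k) in *.
    set (q := (INR k + 2) ^ 2) in *. assert (Hq : 0 <= q) by apply pow2_ge_0.
    assert (ni : 0 < / nr) by (apply Rinv_0_lt_compat; lra).
    assert (U1 : mj (INR k) * ((nr + (INR k + 1) * (INR k + 2)) / nr ^ 2) <= c1 * F * ((1 + q) * / nr)).
    { apply Rle_trans with (mj (INR k) * ((1 + q) * / nr)).
      apply Rmult_le_compat_l; auto. apply Rmult_le_compat_r; auto. apply Rmult_le_pos; lra. }
    assert (U2 : mj (- INR k) * ((nr + (- INR k + 1) * (- INR k + 2)) / nr ^ 2) <= c2 * F * ((1 + q) * / nr)).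
    { apply Rle_trans with (mj (- INR k) * ((1 + q) * / nr)).
      apply Rmult_le_compat_l; auto. apply Rmult_le_compat_r; auto. apply Rmult_le_pos; lra. }
    assert (SQ : sqrt nr * / nr = / sqrt nr). { rewrite <- ss at 2. field. lra. }
    assert (PW : 0 <= P * W) by (apply Rmult_le_pos; lra).
    apply Rle_trans with (2 * (P * W * sqrt nr * (c1 * F * ((1 + q) * / nr) + c2 * F * ((1 + q) * / nr)) + P * W * / sqrt nr * (c1 * F + c2 * F))).
    + apply Rmult_le_compat_l. lra. apply Rplus_le_compat.
      * apply Rmult_le_compat_l. apply Rmult_le_pos; lra. lra.
      * apply Rmult_le_compat_l. apply Rmult_le_pos; lra. lra.
    + right. unfold Rdiv.
      replace (P * W * sqrt nr * (c1 * F * ((1 + q) * / nr) + c2 * F * ((1 + q) * / nr))) with (P * W * (c1 + c2) * F * (1 + q) * (sqrt nr * / nr)) by ring.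
      rewrite SQ. ring.
Qed.
End Moments.

Lemma lim_inv_sqrt K : is_lim_seq (fun n => K / sqrt (INR n)) 0.
Proof.
  replace (Finite 0) with (Finite (K * 0)) by (f_equal; ring). apply is_lim_seq_mult'. apply is_lim_seq_const.
  replace (Finite 0) with (Rbar_inv p_infty) by reflexivity. apply is_lim_seq_inv; [|discriminate].
  apply (filterlim_comp _ _ _ INR sqrt eventually (Rbar_locally p_infty)). apply is_lim_seq_INR. apply filterlim_sqrt_p.
Qed.

(* [Gamma(w+n+1) ~ n! n^w]: the Gamma(n+1) density concentrates at [n], with relative variance [O(1/n)]. *)
Lemma Gam_asym (w : C) :
  limC (fun n => Gam (w + RtoC (INR n + 1)) / (RtoC (INR (fact n)) * Rcpow (INR n) w))%C 1%C.
Proof.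
  destruct (INR_unbounded (Cmod w + 1)) as [k Hk].
  set (K := 2 * Cmod w * ((1 + INR k) ^ k + 2 ^ k) * (2 + (INR k + 2) ^ 2)).
  apply limC_Cmod0.
  apply (is_lim_seq_le_le_loc (fun _ => 0) _ (fun n => K / sqrt (INR n))).
  - exists (2 * k + 1)%nat. intros n Hn. split. apply Cmod_ge_0.
    assert (B := Gam_shift_bound n ltac:(lia) w k ltac:(lra) ltac:(lia)). fold K in B.
    assert (F := INR_fact_lt_0 n).
    assert (N1 : RtoC (INR (fact n)) <> 0%C) by (apply RtoC_neq0; lra).
    assert (N2 := Cexp_neq0 (w * RtoC (ln (INR n)))). fold (Rcpow (INR n) w) in N2.
    replace (Gam (w + RtoC (INR n + 1)) / (RtoC (INR (fact n)) * Rcpow (INR n) w) - 1)%C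
      with ((Gam (w + RtoC (INR n + 1)) - Rcpow (INR n) w * RtoC (INR (fact n))) / (RtoC (INR (fact n)) * Rcpow (INR n) w))%C
      by (field; auto).
    rewrite Cmod_div by (apply Cmult_neq_0; auto).
    rewrite Cmod_mult, Cmod_RtoC, (Rabs_pos_eq (INR (fact n))) by lra.
    assert (E : Cmod (Rcpow (INR n) w) = exp (Re w * ln (INR n))). { unfold Rcpow. rewrite Cmod_Cexp. f_equal. simpl. unfold Re; ring. }
    rewrite E. assert (P := exp_pos (Re w * ln (INR n))).
    apply (Rmult_le_reg_r (INR (fact n) * exp (Re w * ln (INR n)))). nra.
    unfold Rdiv at 1. rewrite Rmult_assoc, Rinv_l, Rmult_1_r by nra.
    eapply Rle_trans; [exact B|]. right. unfold Rdiv. ring.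
  - apply is_lim_seq_const.
  - apply lim_inv_sqrt.
Qed.

(** * The Gaussian integral and integrals folded at the origin *)

Lemma Rok_gauss A c : 0 < c -> Rok WR (fun r => exp (A * Rabs r - c * r ^ 2)).
Proof.
  intros Hc.
  apply (Rok_le _ _ _ (Rok_scal _ _ (exp ((A + 1) ^ 2 / (4 * c))) ltac:(left; apply exp_pos) (Rok_exp_abs 1 ltac:(lra)))).
  - intros; cont.
  - intros r _. split. left; apply exp_pos.
    rewrite <- exp_plus. apply exp_le. rewrite <- (pow2_abs r). set (a := Rabs r).
    assert (c * (a - (A + 1) / (2 * c)) ^ 2 >= 0) by (generalize (pow2_ge_0 (a - (A + 1) / (2 * c))); nra).
    assert (c * (a - (A + 1) / (2 * c)) ^ 2 = c * a ^ 2 - (A + 1) * a + (A + 1) ^ 2 / (4 * c)) by (field; lra).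
    lra.
Qed.

Lemma lim_gauss_end K A c : 0 < c -> is_lim_seq (fun n => K * exp (A * INR n - c * INR n ^ 2)) 0.
Proof.
  intros Hc.
  apply (is_lim_seq_le_le (fun n => - (Rabs K * exp ((A + 1) ^ 2 / (4 * c)) * exp (- 1 * INR n))) _ (fun n => Rabs K * exp ((A + 1) ^ 2 / (4 * c)) * exp (- 1 * INR n))).
  - intros n. set (a := INR n).
    assert (exp (A * a - c * a ^ 2) <= exp ((A + 1) ^ 2 / (4 * c)) * exp (- 1 * a)).
    { rewrite <- exp_plus. apply exp_le.
      assert (c * (a - (A + 1) / (2 * c)) ^ 2 >= 0) by (generalize (pow2_ge_0 (a - (A + 1) / (2 * c))); nra).
      assert (c * (a - (A + 1) / (2 * c)) ^ 2 = c * a ^ 2 - (A + 1) * a + (A + 1) ^ 2 / (4 * c)) by (field; lra).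
      lra. }
    assert (P := exp_pos (A * a - c * a ^ 2)).
    assert (Q := Rle_abs K). assert (Q' := Rle_abs (- K)). rewrite Rabs_Ropp in Q'.
    rewrite Rmult_assoc. assert (R0 := Rabs_pos K). set (e1 := exp (A * a - c * a ^ 2)) in *.
    set (e2 := exp ((A + 1) ^ 2 / (4 * c)) * exp (-1 * a)) in *.
    assert (Rabs K * e1 <= Rabs K * e2) by (apply Rmult_le_compat_l; auto).
    split; nra.
  - replace (Finite 0) with (Finite (- 0)) by (f_equal; ring).
    apply (proj1 (is_lim_seq_opp (fun n => Rabs K * exp ((A + 1) ^ 2 / (4 * c)) * exp (- 1 * INR n)) 0)).
    apply (lim_exp_n _ 1). lra.
  - apply (lim_exp_n _ 1). lra.
Qed.

Definition gint (x : R) := RInt (fun t => exp (- t ^ 2)) 0 x.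

Lemma gint_ex a b : ex_RInt (fun t => exp (- t ^ 2)) a b.
Proof. apply (ex_RInt_continuous (V:=RV)). intros. cont. Qed.

Lemma gint_derive x : is_derive gint x (exp (- x ^ 2)).
Proof.
  apply (is_derive_RInt (V:=RV) (fun t => exp (- t ^ 2)) _ 0).
  - apply filter_forall. intros. apply (RInt_correct (V:=RV)). apply gint_ex.
  - cont.
Qed.

(** Laplace's trick: the derivative in x of the left side vanishes after the substitution u t in the
    second integral, and at x = 0 the value is atan 1. *)
Lemma gint_polar x : 0 <= x -> gint x ^ 2 + RInt (fun t => exp (- (x ^ 2 * (1 + t ^ 2))) / (1 + t ^ 2)) 0 1 = PI / 4.
Proof.
  intros Hx.
  assert (D : forall t : R, is_derive (fun x : R => gint x ^ 2 + RInt (fun t => exp (- (x ^ 2 * (1 + t ^ 2))) / (1 + t ^ 2)) 0 1) t 0).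
  { intros u. evar_last.
    - apply (is_derive_plus (V:=R_NormedModule)).
      + apply is_derive_pow. apply gint_derive.
      + apply (is_derive_RInt_param (fun x t => exp (- (x ^ 2 * (1 + t ^ 2))) / (1 + t ^ 2))).
        * apply filter_forall. intros y t _. auto_derive. nra.
        * intros t _. apply (continuity_2d_pt_ext (fun x t => - (2 * x) * exp (- (x ^ 2 * (1 + t ^ 2))))).
          -- intros a b. symmetry. apply is_derive_unique. auto_derive. nra. simpl. field. nra.
          -- apply continuity_2d_pt_filterlim. change (continuous (fun z : R * R => - (2 * fst z) * exp (- (fst z ^ 2 * (1 + snd z ^ 2)))) (u, t)). cont.
        * apply filter_forall. intros y. apply (ex_RInt_continuous (V:=RV)). intros z _. cont. nra.
    - assert (E : RInt (fun t => Derive (fun x => exp (- (x ^ 2 * (1 + t ^ 2))) / (1 + t ^ 2)) u) 0 1 = -2 * exp (- u ^ 2) * gint u).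
      { assert (E := RInt_comp_lin (V:=RV) (fun t => exp (- t ^ 2)) u 0 0 1 ltac:(apply gint_ex)).
        replace (u * 0 + 0) with 0 in E by ring. replace (u * 1 + 0) with u in E by ring. fold (gint u) in E.
        rewrite <- E. rewrite <- R_RInt_scal.
        - apply RInt_ext_le; [lra|]. intros t _.
          rewrite (is_derive_unique _ _ (- (2 * u) * exp (- (u ^ 2 * (1 + t ^ 2))))).
          + unfold scal; simpl; unfold mult; simpl.
            replace (- (u * (u * 1) * (1 + t * (t * 1)))) with (- (u * (u * 1)) + - ((u * t + 0) * ((u * t + 0) * 1))) by ring.
            rewrite exp_plus. ring.
          + auto_derive. nra. simpl. field. nra.
        - apply (ex_RInt_comp_lin (V:=R_NormedModule) (fun t => exp (- t ^ 2))). apply gint_ex. }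
      rewrite E. unfold plus; simpl. ring. }
  assert (E : forall y, 0 <= y -> (fun x => gint x ^ 2 + RInt (fun t => exp (- (x ^ 2 * (1 + t ^ 2))) / (1 + t ^ 2)) 0 1) y =
     (fun x => gint x ^ 2 + RInt (fun t => exp (- (x ^ 2 * (1 + t ^ 2))) / (1 + t ^ 2)) 0 1) 0).
  { intros y Hy. assert (B := R_mvt_bound _ (fun _ => 0) 0 0 y Hy (fun t _ => conj (D t) (Req_le _ _ Rabs_R0))).
    rewrite Rmult_0_l in B. assert (Q := Rabs_pos ((fun x => gint x ^ 2 + RInt (fun t => exp (- (x ^ 2 * (1 + t ^ 2))) / (1 + t ^ 2)) 0 1) y - (fun x => gint x ^ 2 + RInt (fun t => exp (- (x ^ 2 * (1 + t ^ 2))) / (1 + t ^ 2)) 0 1) 0)).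
    apply Rminus_diag_uniq. apply Rabs_eq_0. lra. }
  specialize (E x Hx). cbv beta in E. rewrite E.
  unfold gint. rewrite (RInt_point (V:=RV)). unfold zero; simpl.
  rewrite (RInt_ext_le _ (fun t => / (1 + t ^ 2))); [|lra|].
  2: { intros t _. replace (- (0 * (0 * 1) * (1 + t * (t * 1)))) with 0 by ring. rewrite exp_0. unfold Rdiv. simpl. ring. }
  rewrite (R_FTC atan); [|lra| |].
  - rewrite atan_1, atan_0. simpl. field.
  - intros t _. evar_last. apply is_derive_atan. f_equal. unfold Rsqr; ring.
  - intros t _. cont. nra.
Qed.

Lemma gint_pos x : 0 <= x -> 0 <= gint x.
Proof. intros. apply RInt_ge0; auto. apply gint_ex. intros; left; apply exp_pos. Qed.

Lemma gint_lim : is_lim_seq (fun n => gint (INR n)) (sqrt PI / 2).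
Proof.
  assert (L : is_lim_seq (fun n => gint (INR n) ^ 2) (PI / 4)).
  { apply (is_lim_seq_le_le (fun n => PI / 4 - 1 * exp (0 * INR n - 1 * INR n ^ 2)) _ (fun _ => PI / 4)).
    - intros n. assert (E := gint_polar (INR n) (pos_INR n)).
      assert (X : ex_RInt (fun t => exp (- (INR n ^ 2 * (1 + t ^ 2))) / (1 + t ^ 2)) 0 1).
      { apply ex_RInt_cont; [lra|]. intros z _. cont. nra. }
      assert (B : 0 <= RInt (fun t => exp (- (INR n ^ 2 * (1 + t ^ 2))) / (1 + t ^ 2)) 0 1 <= 1 * exp (0 * INR n - 1 * INR n ^ 2)).
      { split.
        - apply RInt_ge0; [lra|auto|]. intros t _. apply Rmult_le_pos. left; apply exp_pos. left; apply Rinv_0_lt_compat; nra.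
        - eapply Rle_trans. apply (RInt_le _ (fun _ => exp (0 * INR n - 1 * INR n ^ 2))); [lra|auto|apply (ex_RInt_const (V:=R_NormedModule))|].
          + intros t _. assert (Q := pow2_ge_0 (INR n)). assert (Q2 := pow2_ge_0 t).
            apply Rle_trans with (exp (- (INR n ^ 2 * (1 + t ^ 2))) / 1).
            * apply Rmult_le_compat_l. left; apply exp_pos. apply Rinv_le_contravar; nra.
            * unfold Rdiv. rewrite Rinv_1, Rmult_1_r. apply exp_le. nra.
          + rewrite RInt_const. unfold scal; simpl; unfold mult; simpl. right; ring. }
      lra.
    - replace (Finite (PI / 4)) with (Finite (PI / 4 - 0)) by (f_equal; ring).
      apply is_lim_seq_minus'. apply is_lim_seq_const. apply lim_gauss_end. lra.
    - apply is_lim_seq_const. }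
  apply (is_lim_seq_ext (fun n => sqrt (gint (INR n) ^ 2))).
  - intros n. apply sqrt_pow2. apply gint_pos. apply pos_INR.
  - replace (sqrt PI / 2) with (sqrt (PI / 4)).
    + apply (is_lim_seq_continuous sqrt _ (PI / 4)); auto.
      apply continuity_pt_filterlim. apply continuous_sqrt.
    + replace (PI / 4) with (PI * (/ 2) ^ 2) by field. rewrite sqrt_mult, sqrt_pow2; generalize PI_RGT_0; lra.
Qed.

Lemma gauss_ext1 : Rok WR (fun r => exp (- r ^ 2)).
Proof.
  apply (Rok_le _ _ _ (Rok_gauss 0 1 ltac:(lra))). intros; cont.
  intros r _. split. left; apply exp_pos. right. f_equal. ring.
Qed.

Lemma gauss_int : RIntW WR (fun r => exp (- r ^ 2)) = sqrt PI.
Proof.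
  assert (L := Rok_lim _ _ gauss_ext1).
  assert (L2 : is_lim_seq (fun n => RInt (fun r => exp (- r ^ 2)) (wl WR n) (wr WR n)) (sqrt PI)).
  { apply (is_lim_seq_ext (fun n => 2 * gint (INR n))).
    - intros n. simpl wl; simpl wr.
      rewrite <- (RInt_Chasles (V:=RV) (fun r => exp (- r ^ 2)) (- INR n) 0 (INR n)) by apply gint_ex.
      unfold plus; simpl. change (RInt (fun r => exp (- (r * (r * 1)))) 0 (INR n)) with (gint (INR n)).
      assert (E := RInt_comp_lin (V:=RV) (fun t => exp (- t ^ 2)) (-1) 0 0 (INR n) ltac:(apply gint_ex)).
      replace (-1 * 0 + 0) with 0 in E by ring. replace (-1 * INR n + 0) with (- INR n) in E by ring.
      rewrite <- (opp_RInt_swap (V:=RV)) by apply gint_ex.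
      change (fun r : R => exp (- (r * (r * 1)))) with (fun t : R => exp (- t ^ 2)).
      rewrite <- E. unfold opp; simpl.
      rewrite (RInt_ext_le (fun y => scal (-1) (exp (- ((-1 * y + 0) * ((-1 * y + 0) * 1))))) (fun t => -1 * exp (- t ^ 2))).
      + rewrite R_RInt_scal by apply gint_ex. unfold gint. ring.
      + apply pos_INR.
      + intros t _. unfold scal; simpl; unfold mult; simpl. f_equal. f_equal. ring.
    - replace (Finite (sqrt PI)) with (Finite (2 * (sqrt PI / 2))) by (f_equal; field).
      apply is_lim_seq_mult'. apply is_lim_seq_const. apply gint_lim. }
  apply is_lim_seq_unique in L. apply is_lim_seq_unique in L2. congruence.
Qed.

Definition half : C := RtoC (/ 2).
Lemma half_2 : (2 * half = 1)%C.
Proof. unfold half. rewrite <- RtoC_mult. f_equal. field. Qed.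

Lemma CInt_dC (f : R -> C) a b x : a < x < b -> (forall t, a < t < b -> contC f t) ->
  dC (fun y => CInt f x y) x (f x).
Proof.
  intros Hx K.
  assert (Loc : locally x (fun y => a < y < b)).
  { apply filter_and; [apply (open_gt a x)|apply (open_lt b x)]; lra. }
  split; simpl.
  - apply (is_derive_RInt (V:=RV) (fun t => Re (f t)) _ x); [|apply (K x); auto].
    revert Loc. apply filter_imp. intros y Hy. apply (RInt_correct (V:=RV)).
    apply (ex_RInt_continuous (V:=RV)). intros z Hz. apply (K z).
    unfold Rmin, Rmax in Hz; destruct Rle_dec; lra.
  - apply (is_derive_RInt (V:=RV) (fun t => Im (f t)) _ x); [|apply (K x); auto].
    revert Loc. apply filter_imp. intros y Hy. apply (RInt_correct (V:=RV)).
    apply (ex_RInt_continuous (V:=RV)). intros z Hz. apply (K z).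
    unfold Rmin, Rmax in Hz; destruct Rle_dec; lra.
Qed.

Lemma limC_subseq u l (p : nat -> nat) : (forall n, (n <= p n)%nat) -> limC u l -> limC (fun n => u (p n)) l.
Proof.
  intros H [A B]. assert (F : filterlim p eventually eventually).
  { intros P [N HN]. exists N. intros n Hn. apply HN. specialize (H n). lia. }
  split; [apply (is_lim_seq_subseq (fun n => Re (u n)))|apply (is_lim_seq_subseq (fun n => Im (u n)))]; auto.
Qed.

Lemma CInt_fold f n : 0 <= n -> contOn f (- n) n ->
  CInt f (- n) n = CInt (fun r => f r + f (- r)%R)%C 0 n.
Proof.
  intros Hn K. rewrite <- (CInt_Chasles f (- n) 0 n) by (auto; lra).
  assert (K1 : contOn (fun r => f (- r)) 0 n).
  { intros r Hr. apply (cC_comp Ropp f). cont. apply K. lra. }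
  rewrite CInt_plus; auto. 2: { intros r Hr; apply K; lra. }
  rewrite Cplus_comm. f_equal.
  unfold CInt. f_equal.
  - assert (E := RInt_comp_lin (V:=RV) (fun t => Re (f t)) (-1) 0 n 0).
    replace (-1 * n + 0) with (- n) in E by ring. replace (-1 * 0 + 0) with 0 in E by ring.
    rewrite <- E.
    + rewrite <- opp_RInt_swap. rewrite <- RInt_opp.
      * apply RInt_ext_le; auto. intros r Hr. unfold opp, scal; simpl; unfold mult; simpl. replace (-1 * r + 0) with (- r) by ring. ring.
      * apply ex_RInt_cont; auto. intros r Hr. unfold scal; simpl; unfold mult; simpl.
        apply cR_mult. cont. apply (cR_comp (fun r => -1 * r + 0) (fun t => Re (f t))). cont. apply K. lra.
      * apply ex_RInt_cont; auto. intros r Hr. unfold scal; simpl; unfold mult; simpl.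
        apply cR_mult. cont. apply (cR_comp (fun r => -1 * r + 0) (fun t => Re (f t))). cont. apply K. lra.
    + apply contOn_exRe. lra. intros r Hr; apply K; lra.
  - assert (E := RInt_comp_lin (V:=RV) (fun t => Im (f t)) (-1) 0 n 0).
    replace (-1 * n + 0) with (- n) in E by ring. replace (-1 * 0 + 0) with 0 in E by ring.
    rewrite <- E.
    + rewrite <- opp_RInt_swap. rewrite <- RInt_opp.
      * apply RInt_ext_le; auto. intros r Hr. unfold opp, scal; simpl; unfold mult; simpl. replace (-1 * r + 0) with (- r) by ring. ring.
      * apply ex_RInt_cont; auto. intros r Hr. unfold scal; simpl; unfold mult; simpl.
        apply cR_mult. cont. apply (cR_comp (fun r => -1 * r + 0) (fun t => Im (f t))). cont. apply K. lra.
      * apply ex_RInt_cont; auto. intros r Hr. unfold scal; simpl; unfold mult; simpl.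
        apply cR_mult. cont. apply (cR_comp (fun r => -1 * r + 0) (fun t => Im (f t))). cont. apply K. lra.
    + apply contOn_exIm. lra. intros r Hr; apply K; lra.
Qed.

Lemma lim_inv_S : is_lim_seq (fun n => / (INR n + 1)) 0.
Proof.
  replace (Finite 0) with (Rbar_inv p_infty) by reflexivity. apply is_lim_seq_inv; [|discriminate].
  apply (is_lim_seq_le_p_loc INR); [|apply is_lim_seq_INR]. exists O. intros; lra.
Qed.

Lemma IntW_fold f g : Cok WR f g ->
  Cok W0 (fun r => f r + f (- r)%R)%C (fun r => g r + g (- r)) /\
  IntW WR f = IntW W0 (fun r => f r + f (- r)%R)%C.
Proof.
  intros H. assert (H' := H). destruct H' as [Hg [K D]].
  assert (Kg : forall x, continuous g x) by (intros; apply Hg; auto).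
  assert (Pg : forall x, 0 <= g x) by (intros; apply Hg; auto).
  assert (KF : forall r, contC (fun r => f r + f (- r)%R)%C r).
  { intros r. apply cC_plus. auto. apply (cC_comp Ropp f). cont. auto. }
  assert (GF : forall n, 0 <= n -> RInt g (- n) n = RInt (fun r => g r + g (- r)) 0 n).
  { intros n Hn. assert (E := CInt_fold (fun r => RtoC (g r)) n Hn ltac:(intros x _; apply cC_RtoC; auto)).
    apply (f_equal Re) in E. unfold CInt in E; simpl in E. exact E. }
  assert (O : Cok W0 (fun r => f r + f (- r)%R)%C (fun r => g r + g (- r))).
  { split; [split; [|split]|split].
    - intros r _. apply cR_plus; auto. apply (cR_comp Ropp g); auto. cont.
    - intros r _. generalize (Pg r) (Pg (- r)); lra.
    - exists (RIntW WR g). intros n. simpl wl; simpl wr.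
      assert (Pn := pos_INR n). assert (Q : 0 < / (INR n + 1)) by (apply Rinv_0_lt_compat; lra).
      assert (Q2 := W0_lr n).
      eapply Rle_trans; [|apply (Rok_le_lim WR g (S n) Hg)]. change (wl WR (S n)) with (- INR (S n)). change (wr WR (S n)) with (INR (S n)). rewrite GF by apply pos_INR. rewrite S_INR.
      rewrite <- (RInt_Chasles (V:=RV) (fun r => g r + g (- r)) 0 (/ (INR n + 1)) (INR n + 1)).
      + assert (0 <= RInt (fun r => g r + g (- r)) 0 (/ (INR n + 1))).
        { apply RInt_ge0. lra. apply ex_RInt_cont; [lra|]. intros; apply cR_plus; auto. apply (cR_comp Ropp g); auto. cont.
          intros r _. generalize (Pg r) (Pg (- r)); lra. }
        unfold plus; simpl. lra.
      + apply ex_RInt_cont; [lra|]. intros; apply cR_plus; auto. apply (cR_comp Ropp g); auto. cont.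
      + apply ex_RInt_cont; [lra|]. intros; apply cR_plus; auto. apply (cR_comp Ropp g); auto. cont.
    - intros; apply KF.
    - intros r _. eapply Rle_trans; [apply Cmod_triangle|]. apply Rplus_le_compat; apply D; auto. }
  split; auto. symmetry. apply (IntW_is _ _ _ _ O).
  (* The right end of the n-th window of [W0] is n + 1, hence the shift by one. That window also
     omits [0, 1 / (n + 1)], whose contribution tends to 0 because the folded integrand is
     continuous at 0. *)
  assert (L := limC_subseq _ _ S ltac:(intros; lia) (IntW_lim WR f g H)). cbv beta in L.
  apply (limC_ext (fun n => CInt f (wl WR (S n)) (wr WR (S n)) - CInt (fun r => f r + f (- r)%R)%C 0 (/ (INR n + 1)))%C).
  { intros n. change (wl WR (S n)) with (- INR (S n)). change (wr WR (S n)) with (INR (S n)). rewrite CInt_fold; [|apply pos_INR|intros x _; auto]. rewrite S_INR.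
    change (wl W0 n) with (/ (INR n + 1)). change (wr W0 n) with (INR n + 1).
    assert (Pn := pos_INR n). assert (Q : 0 < / (INR n + 1)) by (apply Rinv_0_lt_compat; lra). assert (Q2 := W0_lr n).
    rewrite <- (CInt_Chasles _ 0 (/ (INR n + 1)) (INR n + 1)); [ring|lra|lra|]. intros x _; auto. }
  replace (IntW WR f) with (IntW WR f - 0)%C by ring. apply limC_minus; auto.
  assert (CD : dC (fun y => CInt (fun r => f r + f (- r)%R)%C 0 y) 0 (f 0%R + f (- 0)%R)%C).
  { apply (CInt_dC (fun r => f r + f (- r)%R)%C (-1) 1); auto. lra. }
  assert (Z : CInt (fun r => f r + f (- r)%R)%C 0 0 = 0%C).
  { unfold CInt. rewrite !(RInt_point (V:=RV)). reflexivity. }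
  rewrite <- Z. apply (limC_contR (fun y => CInt (fun r => f r + f (- r)%R)%C 0 y)). apply (dC_cont _ _ _ CD). apply lim_inv_S.
Qed.

Lemma Rok_W0_of_WR (g : R -> R) : (forall x, 0 < x -> continuous g x) -> (forall x, 0 < x -> 0 <= g x) ->
  Rok WR (fun v => exp v * g (exp v)) -> Rok W0 g.
Proof.
  intros K P H. split; [|split].
  - intros x Hx; apply K; apply inW0; auto.
  - intros x Hx; apply P; apply inW0; auto.
  - exists (RIntW WR (fun v => exp v * g (exp v))). intros n. simpl wl; simpl wr.
    assert (Pn := pos_INR n). set (L := ln (INR n + 1)).
    assert (LP : 0 <= L). { unfold L. rewrite <- ln_1. destruct Pn. left; apply ln_increasing; lra. right. rewrite <- H0. f_equal; ring. }
    assert (E1 : exp L = INR n + 1) by (apply exp_ln; lra).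
    assert (E2 : exp (- L) = / (INR n + 1)) by (rewrite exp_Ropp, E1; auto).
    rewrite <- E1 at 2. rewrite <- E2.
    rewrite <- (RInt_comp (V:=RV) g exp exp).
    + apply (Rok_le_lim' WR (fun v => exp v * g (exp v))); auto. lra.
    + intros x _. apply K. apply exp_pos.
    + intros x _. split. apply is_derive_exp. cont.
Qed.

Lemma Rok_pow mu A : -1 < mu -> Rok W0 (fun r => exp (mu * ln r + A * r - r ^ 2)).
Proof.
  intros Hmu. apply Rok_W0_of_WR.
  - intros x Hx. cont.
  - intros; left; apply exp_pos.
  - apply (Rok_le _ _ _ (Rok_scal _ _ (exp ((A + 1) ^ 2 / 4)) ltac:(left; apply exp_pos) (Rok_rG (mu + 1) ltac:(lra)))).
    + intros; cont. apply exp_pos.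
    + intros v _. rewrite <- !exp_plus, ln_exp. split. left; apply exp_pos. apply exp_le.
      set (e := exp v). generalize (pow2_ge_0 (e - (A + 1) / 2)). intros.
      replace ((e - (A + 1) / 2) ^ 2) with (e ^ 2 - (A + 1) * e + (A + 1) ^ 2 / 4) in H by field. lra.
Qed.

(** Euler's integral after the substitution r = e^(v / 2): the integrand is r^(2 w - 1) e^(- r^2).
    It serves the Gaussian value of Gamma(1/2) and the reflection formula. *)
Lemma Gam_axis w : 0 < Re w ->
  Cok W0 (fun r => Cexp ((- r ^ 2, 0)%R + (2 * w - 1) * RtoC (ln r)))%C (fun r => exp ((2 * Re w - 1) * ln r + 0 * r - r ^ 2)) /\
  IntW W0 (fun r => Cexp ((- r ^ 2, 0)%R + (2 * w - 1) * RtoC (ln r)))%C = (half * Gam w)%C.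
Proof.
  intros Hw.
  assert (O : Cok W0 (fun r => Cexp ((- r ^ 2, 0)%R + (2 * w - 1) * RtoC (ln r)))%C (fun r => exp ((2 * Re w - 1) * ln r + 0 * r - r ^ 2))).
  { split; [|split].
    - apply Rok_pow. lra.
    - intros r Hr. apply inW0 in Hr. cont.
    - intros r Hr. rewrite Cmod_Cexp. right. f_equal. simpl. unfold Re; ring. }
  split; auto.
  destruct (IntW_subst WR W0 _ _ (fun v => exp (/ 2 * v)) (fun v => / 2 * exp (/ 2 * v)) O) as [A E].
  - intros x _. apply inW0. apply exp_pos.
  - intros x _. split; [|split].
    + auto_derive; auto. ring.
    + cont; lra.
    + generalize (exp_pos (/ 2 * x)); lra.
  - intros n. destruct (INR_unbounded (2 * (INR n + 1))) as [m Hm]. exists m. simpl.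
    assert (Pn := pos_INR n).
    assert (X : INR n + 1 <= exp (/ 2 * INR m)). { eapply Rle_trans; [|apply exp_ineq1_le]. lra. }
    split; auto. replace (/ 2 * - INR m) with (- (/ 2 * INR m)) by field. rewrite exp_Ropp. apply Rinv_le_contravar; lra.
  - rewrite <- E. unfold Gam. rewrite <- (IntW_scal _ _ _ _ (Cok_Gam w Hw)). apply IntW_ext. intros v _.
    rewrite ln_exp, RtoC_mult. fold half.
    rewrite <- (Cexp_R (/ 2 * v)), <- Cmult_assoc, <- Cexp_add. apply f_equal. apply f_equal.
    replace (exp (/ 2 * v) ^ 2) with (exp v).
    + change ((- exp v, 0)%R : C) with (RtoC (- exp v)). rewrite RtoC_opp, RtoC_mult. fold half.
      transitivity ((2 * half) * w * RtoC v - RtoC (exp v))%C. ring. rewrite half_2. ring.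
    + simpl. rewrite Rmult_1_r, <- exp_plus. f_equal. field.
Qed.

Lemma rG_half : rG (1 / 2) = sqrt PI.
Proof.
  destruct (Gam_axis (RtoC (1 / 2)) ltac:(simpl; lra)) as [O E]. destruct (IntW_fold _ _ (Cok_real _ _ gauss_ext1)) as [_ F].
  rewrite IntW_real, gauss_int in F by apply gauss_ext1.
  rewrite (IntW_ext _ _ (fun r => 2 * Cexp ((- r ^ 2, 0)%R + (2 * RtoC (1 / 2) - 1) * RtoC (ln r)))%C) in F.
  - rewrite (IntW_scal _ _ _ _ O), E, Gam_R in F by lra. apply (f_equal Re) in F. simpl in F. lra.
  - intros r _. replace ((- r ^ 2, 0)%R + (2 * RtoC (1 / 2) - 1) * RtoC (ln r))%C with (RtoC (- r ^ 2)) by (apply C_ext; simpl; field).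
    rewrite Cexp_R. replace ((- r) ^ 2) with (r ^ 2) by ring. ring.
Qed.

Lemma dC_pair1 (v u : R) : dC (fun u : R => (u, v) : C) u 1%C.
Proof. split; simpl. apply dR_id. apply (is_derive_const (V:=R_NormedModule)). Qed.
Lemma dC_pair2 (u v : R) : dC (fun v : R => (u, v) : C) v Ci.
Proof. split; simpl. apply (is_derive_const (V:=R_NormedModule)). apply dR_id. Qed.

Lemma RtoC_2 : RtoC 2 = (1 + 1)%C.
Proof. rewrite <- RtoC_plus. f_equal. Qed.

Lemma limR_squeeze0 u b : is_lim_seq b 0 -> (forall n, 0 <= u n <= b n) -> is_lim_seq u 0.
Proof. intros H1 H2. apply (is_lim_seq_le_le (fun _ => 0) _ b); auto. apply is_lim_seq_const. Qed.

Lemma IntW_subst_lin (f : R -> C) g c d : 0 < c -> Cok WR f g ->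
  Cok WR (fun x => RtoC c * f (c * x + d)%R)%C (fun x => c * g (c * x + d)) /\
  IntW WR (fun x => RtoC c * f (c * x + d)%R)%C = IntW WR f.
Proof.
  intros Hc H. apply (IntW_subst WR WR f g (fun x => c * x + d) (fun _ => c)); auto.
  - intros x _. split; [|split]. auto_derive; auto; ring. cont. lra.
  - intros n. destruct (INR_unbounded ((INR n + Rabs d) / c)) as [m Hm]. exists m. simpl.
    assert (X : INR n + Rabs d < c * INR m).
    { apply (Rmult_lt_compat_l c) in Hm; auto. replace (c * ((INR n + Rabs d) / c)) with (INR n + Rabs d) in Hm by (field; lra). lra. }
    assert (Q := Rle_abs d). assert (Q' := Rle_abs (- d)). rewrite Rabs_Ropp in Q'. lra.
Qed.

(** Cauchy's theorem in the strip between the real axis and height v; the modulus of e^(- z^2) there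
    exceeds the Gaussian by at most e^(v^2). *)
Lemma gauss_shift v : Cok WR (fun u => Cexp (- ((u, v) * (u, v))))%C (fun u => exp (v ^ 2) * exp (0 * Rabs u - 1 * u ^ 2)) /\
  IntW WR (fun u => Cexp (- ((u, v) * (u, v))))%C = RtoC (sqrt PI).
Proof.
  set (F := fun u v : R => Cexp (- ((u, v) * (u, v)))%C).
  assert (B : forall u w, w ^ 2 <= v ^ 2 -> Cmod (F u w) <= exp (v ^ 2) * exp (0 * Rabs u - 1 * u ^ 2)).
  { intros u w H. unfold F. rewrite Cmod_Cexp, <- exp_plus. apply exp_le. simpl. nra. }
  assert (OK : Rok WR (fun u => exp (v ^ 2) * exp (0 * Rabs u - 1 * u ^ 2))).
  { apply Rok_scal. left; apply exp_pos. apply Rok_gauss; lra. }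
  assert (I0 : IntW WR (fun u => F u 0) = RtoC (sqrt PI)).
  { rewrite <- gauss_int, <- IntW_real by apply gauss_ext1. apply IntW_ext. intros u _. unfold F. rewrite <- Cexp_R.
    f_equal. apply C_ext; simpl; ring. }
  assert (S : forall a b, a <= b -> (forall w, a <= w <= b -> w ^ 2 <= v ^ 2) ->
     Cok WR (fun u => F u a) (fun u => exp (v ^ 2) * exp (0 * Rabs u - 1 * u ^ 2)) /\
     Cok WR (fun u => F u b) (fun u => exp (v ^ 2) * exp (0 * Rabs u - 1 * u ^ 2)) /\
     IntW WR (fun u => F u a) = IntW WR (fun u => F u b)).
  { intros a b Hab Hw. apply (strip_shift F (fun u v => - ((u, v) + (u, v)) * F u v)%C); auto.
    - intros u w _. unfold F. evar_last. apply dC_Cexp, dC_opp, dC_mult; apply dC_pair1. cbv beta. ring.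
    - intros u w _. unfold F. evar_last. apply dC_Cexp, dC_opp, dC_mult; apply dC_pair2. cbv beta. ring.
    - intros u w _. unfold F. cont.
    - apply (is_lim_seq_ext (fun n => exp (v ^ 2) * exp (0 * INR n - 1 * INR n ^ 2))).
      intros n. rewrite (Rabs_pos_eq (INR n)) by apply pos_INR. auto. apply lim_gauss_end; lra.
    - apply (is_lim_seq_ext (fun n => exp (v ^ 2) * exp (0 * INR n - 1 * INR n ^ 2))).
      intros n. rewrite Rabs_Ropp, (Rabs_pos_eq (INR n)) by apply pos_INR. f_equal. f_equal. ring. apply lim_gauss_end; lra. }
  destruct (Rle_dec 0 v) as [H|H].
  - destruct (S 0 v H) as [_ [A E]]. intros; nra. split; auto. rewrite <- I0. symmetry. auto.
  - destruct (S v 0 ltac:(lra)) as [A [_ E]]. intros; nra. split; auto. rewrite <- I0. auto.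
Qed.

(** * [Gamma(w) s^{-w}] as a Laplace integral, [s = e^l] in the right half-plane *)

Lemma cos_ge_abs v t : Rabs v <= Rabs t -> Rabs t < PI / 2 -> cos t <= cos v.
Proof.
  intros H1 H2. assert (E : forall x, cos (Rabs x) = cos x).
  { intros x. unfold Rabs. destruct Rcase_abs; auto. apply cos_neg. }
  rewrite <- (E t), <- (E v). assert (P := PI_RGT_0). generalize (Rabs_pos v). intros.
  destruct H1. left. apply cos_decreasing_1; lra. right; congruence.
Qed.

(** In logarithmic coordinates, turning the ray of integration by the argument of s is a vertical
    shift of the line by Im l, and scaling by |s| is a translation by Re l. Throughout the strip cos
    stays at least cos (Im l) > 0, which keeps the double exponential decay. *)
Lemma gamma_scale (w l : C) : 0 < Re w -> Rabs (Im l) < PI / 2 ->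
  Cok WR (fun v => Cexp (w * RtoC v - Cexp l * RtoC (exp v)))%C (fun v => exp (Re w * v - Re (Cexp l) * exp v)) /\
  IntW WR (fun v => Cexp (w * RtoC v - Cexp l * RtoC (exp v)))%C = (Gam w * Cexp (- (w * l)))%C.
Proof.
  intros Hw Hl. set (t := Im l).
  assert (Hc : 0 < cos t). { apply Rabs_lt_between in Hl. fold t in Hl. apply cos_gt_0; lra. }
  assert (OK0 : Rok WR (fun v => exp (Re w * v - Re (Cexp l) * exp v))).
  { apply Rok_gamma; auto. simpl. apply Rmult_lt_0_compat; auto. apply exp_pos. }
  assert (CK : Cok WR (fun v => Cexp (w * RtoC v - Cexp l * RtoC (exp v)))%C (fun v => exp (Re w * v - Re (Cexp l) * exp v))).
  { split; [auto|split]. intros; cont. intros v _. rewrite Cmod_Cexp. right; f_equal. simpl. unfold Re; simpl; ring. }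
  split; auto.
  set (F := fun u v : R => Cexp (w * (u, v) - Cexp (u, v))%C).
  set (K := exp (2 * Rabs (Im w))).
  set (g := fun u => K * exp (Re w * u - cos t * exp u)).
  assert (OK : Rok WR g). { apply Rok_scal. left; apply exp_pos. apply Rok_gamma; auto. }
  assert (HPI : PI / 2 <= 2) by (generalize PI_4; lra).
  assert (B : forall u v, Rabs v <= Rabs t -> Cmod (F u v) <= g u).
  { intros u v Hv. unfold F, g, K. rewrite Cmod_Cexp, <- exp_plus. apply exp_le.
    assert (Q := cos_ge_abs v t Hv Hl). assert (E := exp_pos u).
    assert (- Im w * v <= 2 * Rabs (Im w)).
    { apply Rle_trans with (Rabs (Im w * v)). rewrite <- Ropp_mult_distr_l. generalize (Rle_abs (- (Im w * v))). rewrite Rabs_Ropp. lra.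
      rewrite Rabs_mult. generalize (Rabs_pos (Im w)) (Rabs_pos v). fold t in Hl. nra. }
    simpl. unfold Re, Im in *; simpl in *. nra. }
  destruct (gamma_dom (Re w) (cos t) Hw Hc) as [K1 [c1 [HK1 [Hc1 D]]]].
  assert (L1 : is_lim_seq (fun n => g (INR n)) 0).
  { apply (limR_squeeze0 _ (fun n => K * K1 * exp (- c1 * INR n))). apply lim_exp_n; auto.
    intros n. unfold g. assert (KP : 0 < K) by apply exp_pos. split. apply Rmult_le_pos; left; auto; apply exp_pos.
    rewrite Rmult_assoc. apply Rmult_le_compat_l. lra. rewrite <- (Rabs_pos_eq (INR n)) at 3 by apply pos_INR. auto. }
  assert (L2 : is_lim_seq (fun n => g (- INR n)) 0).
  { apply (limR_squeeze0 _ (fun n => K * K1 * exp (- c1 * INR n))). apply lim_exp_n; auto.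
    intros n. unfold g. assert (KP : 0 < K) by apply exp_pos. split. apply Rmult_le_pos; left; auto; apply exp_pos.
    rewrite Rmult_assoc. apply Rmult_le_compat_l. lra.
    assert (Q := D (- INR n)). rewrite Rabs_Ropp, (Rabs_pos_eq (INR n)) in Q by apply pos_INR. auto. }
  assert (S : forall a b, a <= b -> (forall v, a <= v <= b -> Rabs v <= Rabs t) ->
     Cok WR (fun u => F u a) g /\ Cok WR (fun u => F u b) g /\ IntW WR (fun u => F u a) = IntW WR (fun u => F u b)).
  { intros a b Hab Hv. apply (strip_shift F (fun u v => (w - Cexp (u, v)) * F u v)%C); auto.
    - intros u v _. unfold F. evar_last. apply dC_Cexp, dC_minus. apply dC_mult. apply dC_const. apply dC_pair1.
      apply dC_Cexp. apply dC_pair1. cbv beta. ring.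
    - intros u v _. unfold F. evar_last. apply dC_Cexp, dC_minus. apply dC_mult. apply dC_const. apply dC_pair2.
      apply dC_Cexp. apply dC_pair2. cbv beta. ring.
    - intros u v _. unfold F. cont. }
  assert (I0 : IntW WR (fun u => F u 0) = Gam w).
  { unfold Gam. apply IntW_ext. intros u _. unfold F. rewrite <- Cexp_R. reflexivity. }
  assert (It : Cok WR (fun u => F u t) g /\ IntW WR (fun u => F u t) = Gam w).
  { destruct (Rle_dec 0 t) as [H|H].
    - destruct (S 0 t H) as [_ [A E]]. intros. rewrite !Rabs_pos_eq; lra. split; auto. rewrite <- I0; auto.
    - destruct (S t 0 ltac:(lra)) as [A [_ E]]. intros. rewrite (Rabs_left t) by lra. unfold Rabs; destruct Rcase_abs; lra. split; auto. rewrite <- I0; auto. }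
  destruct It as [A E].
  destruct (IntW_subst_lin _ _ 1 (Re l) ltac:(lra) A) as [A2 E2].
  rewrite E in E2. rewrite <- E2.
  rewrite <- (Cmult_1_r (IntW WR (fun v => Cexp (w * RtoC v - Cexp l * RtoC (exp v)))))%C.
  rewrite <- Cexp_0. replace (RtoC 0) with (w * l + - (w * l))%C by ring. rewrite Cexp_add, Cmult_assoc. f_equal.
  rewrite Cmult_comm, <- (IntW_scal _ _ _ _ CK). apply IntW_ext. intros v _.
  unfold F. rewrite <- !Cexp_add. f_equal.
  assert (X : (1 * v + Re l, t) = (RtoC v + l)%C). { apply C_ext; simpl; unfold t, Re, Im; ring. }
  rewrite X, Cexp_add, Cexp_R. ring.
Qed.

(** * Integrals along the vertical line [s = c (1 + i r)], [c > 0] *)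

(** The principal logarithm of 1 + i r. *)
Definition cl (r : R) : C := (ln (1 + r ^ 2) / 2, atan r).
Definition LIs (c r : R) : C := (c, c * r).
(** The integrand e^(s^2 + x s) s^lam at s = c (1 + i r), with log s = ln c + log (1 + i r). The
    factor ds/dr = i c is left to the prefactor c / PI in [Kc] and [Psi_LI]. *)
Definition LIg (c x : R) (lam : C) (r : R) : C :=
  Cexp (LIs c r * LIs c r + RtoC x * LIs c r + lam * (RtoC (ln c) + cl r))%C.
Definition LI (c x : R) (lam : C) : C := IntW WR (LIg c x lam).

Lemma Cexp_cl r : Cexp (cl r) = (1, r).
Proof.
  unfold Cexp, cl; simpl. rewrite cos_atan, sin_atan.
  assert (P : 0 < 1 + r * (r * 1)) by nra.
  assert (Q : 0 < sqrt (1 + r * (r * 1))) by (apply sqrt_lt_R0; auto).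
  assert (E : exp (ln (1 + r * (r * 1)) / 2) = sqrt (1 + r * (r * 1))).
  { rewrite <- Rpower_sqrt by auto. unfold Rpower. f_equal. field. }
  unfold Rsqr. rewrite E. replace (1 + r * r) with (1 + r * (r * 1)) by ring. f_equal; field; lra.
Qed.

Lemma Cexp_logs c r : 0 < c -> Cexp (RtoC (ln c) + cl r) = LIs c r.
Proof.
  intros H. rewrite Cexp_add, Cexp_R, exp_ln, Cexp_cl by auto. apply C_ext; simpl; ring.
Qed.

Lemma LIs_neq0 c r : 0 < c -> LIs c r <> 0%C.
Proof. intros H E. injection E. intros. lra. Qed.

Lemma dC_LIs c r : dC (LIs c) r (Ci * RtoC c)%C.
Proof.
  unfold LIs. split; simpl.
  - evar_last. apply (is_derive_const (V:=R_NormedModule)). unfold zero; simpl; ring.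
  - auto_derive; auto. ring.
Qed.

Lemma dC_cl r : dC cl r (Ci / (1, r))%C.
Proof.
  unfold cl. split; simpl.
  - auto_derive. nra. field. nra.
  - evar_last. apply is_derive_atan. unfold Rsqr. field. nra.
Qed.

Lemma contC_cl r : contC cl r.
Proof. apply (dC_cont _ _ _ (dC_cl r)). Qed.

Lemma ln1r2_bound r : 0 <= ln (1 + r ^ 2) / 2 <= Rabs r.
Proof.
  assert (P : 1 <= 1 + r ^ 2) by (generalize (pow2_ge_0 r); lra). split.
  - assert (0 <= ln (1 + r ^ 2)). { rewrite <- ln_1. destruct P. left; apply ln_increasing; lra. right; f_equal; lra. } lra.
  - apply Rmult_le_reg_r with 2. lra. unfold Rdiv. rewrite Rmult_assoc, Rinv_l, Rmult_1_r by lra.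
    rewrite <- (ln_exp (Rabs r * 2)).
    assert (1 + r ^ 2 <= exp (Rabs r * 2)).
    { replace (Rabs r * 2) with (Rabs r + Rabs r) by ring. rewrite exp_plus.
      assert (Q := exp_ineq1_le (Rabs r)). generalize (Rabs_pos r). rewrite <- (pow2_abs r). nra. }
    destruct H. left; apply ln_increasing; lra. right; f_equal; auto.
Qed.

Lemma atan_lt2 r : Rabs (atan r) < 2.
Proof. assert (Q := atan_bound r). assert (HPI : PI / 2 <= 2) by (generalize PI_4; lra). apply Rabs_def1; lra. Qed.

Definition LIbound (c x : R) (lam : C) (r : R) : R :=
  exp (c ^ 2 + x * c + Re lam * ln c + 2 * Rabs (Im lam)) * exp (Rabs (Re lam) * Rabs r - c ^ 2 * r ^ 2).

Lemma LIg_cont c x lam r : contC (LIg c x lam) r.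
Proof.
  unfold LIg. apply cC_Cexp. apply cC_plus. apply cC_plus.
  - apply cC_mult; apply (dC_cont _ _ _ (dC_LIs c r)).
  - apply cC_mult. apply cC_const. apply (dC_cont _ _ _ (dC_LIs c r)).
  - apply cC_mult. apply cC_const. apply cC_plus. apply cC_const. apply contC_cl.
Qed.

Lemma LIg_ok c x lam : 0 < c -> Cok WR (LIg c x lam) (LIbound c x lam).
Proof.
  intros Hc. split; [|split].
  - apply Rok_scal. left; apply exp_pos. apply Rok_gauss. apply pow_lt; auto.
  - intros; apply LIg_cont.
  - intros r _. unfold LIg, LIbound. rewrite Cmod_Cexp, <- exp_plus. apply exp_le.
    assert (A := ln1r2_bound r). assert (B := atan_lt2 r).
    assert (T1 : Re lam * (ln (1 + r ^ 2) / 2) <= Rabs (Re lam) * Rabs r).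
    { apply Rle_trans with (Rabs (Re lam) * (ln (1 + r ^ 2) / 2)).
      apply Rmult_le_compat_r. lra. apply Rle_abs. apply Rmult_le_compat_l. apply Rabs_pos. lra. }
    assert (T2 : - (Im lam * atan r) <= 2 * Rabs (Im lam)).
    { eapply Rle_trans; [apply Rle_abs|]. rewrite Rabs_Ropp, Rabs_mult. generalize (Rabs_pos (Im lam)). nra. }
    unfold LIs, cl, Re, Im in *; simpl in *. nra.
Qed.

Lemma LIg_S c x lam r : 0 < c -> LIg c x (lam + 1) r = (LIs c r * LIg c x lam r)%C.
Proof.
  intros H. rewrite <- (Cexp_logs c r H) at 1. unfold LIg. rewrite <- Cexp_add. f_equal. ring.
Qed.

Lemma lim_LIbound c x lam : 0 < c -> is_lim_seq (fun n => LIbound c x lam (INR n)) 0 /\ is_lim_seq (fun n => LIbound c x lam (- INR n)) 0.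
Proof.
  intros Hc. assert (0 < c ^ 2) by (apply pow_lt; auto). unfold LIbound. split.
  - eapply is_lim_seq_ext; [|apply (lim_gauss_end (exp (c ^ 2 + x * c + Re lam * ln c + 2 * Rabs (Im lam))) (Rabs (Re lam)) (c ^ 2)); auto].
    intros n. cbv beta. rewrite (Rabs_pos_eq (INR n)) by apply pos_INR. reflexivity.
  - eapply is_lim_seq_ext; [|apply (lim_gauss_end (exp (c ^ 2 + x * c + Re lam * ln c + 2 * Rabs (Im lam))) (Rabs (Re lam)) (c ^ 2)); auto].
    intros n. cbv beta. rewrite Rabs_Ropp, (Rabs_pos_eq (INR n)) by apply pos_INR. replace ((- INR n) ^ 2) with (INR n ^ 2) by ring. reflexivity.
Qed.

(** The integral of the s-derivative of e^(s^2 + x s) s^(lam + 1) along the line is zero; the three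
    terms are 2 s^2, x s and lam + 1 times the integrand. *)
Lemma LI_rec c x lam : 0 < c ->
  (2 * LI c x (lam + 2) + RtoC x * LI c x (lam + 1) + (lam + 1) * LI c x lam = 0)%C.
Proof.
  intros Hc.
  assert (H0 := LIg_ok c x lam Hc). assert (H1 := LIg_ok c x (lam + 1)%C Hc). assert (H2 := LIg_ok c x (lam + 2)%C Hc).
  assert (E : IntW WR (fun r => 2 * LIg c x (lam + 2) r + RtoC x * LIg c x (lam + 1) r + (lam + 1) * LIg c x lam r)%C = (0 - 0)%C).
  { eapply (IntW_FTC WR (fun r => / (Ci * RtoC c) * LIg c x (lam + 1) r)%C).
    - apply Cok_plus; [apply Cok_plus|]; apply Cok_scal; eauto.
    - intros r _. assert (N := LIs_neq0 c r Hc).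
      assert (Nc : RtoC c <> 0%C) by (apply RtoC_neq0; lra).
      assert (Ni : Ci <> 0%C) by (intros X; injection X; lra).
      evar_last.
      + apply dC_mult. apply dC_const. unfold LIg. apply dC_Cexp. apply dC_plus. apply dC_plus.
        apply dC_mult; apply dC_LIs. apply dC_mult. apply dC_const. apply dC_LIs.
        apply dC_mult. apply dC_const. apply dC_plus. apply dC_const. apply dC_cl.
      + cbv beta. fold (LIg c x (lam + 1)%C r).
        replace (lam + 2)%C with (lam + 1 + 1)%C by ring. rewrite (LIg_S c x (lam + 1)%C r Hc), (LIg_S c x lam r Hc).
        assert (X : (Ci / (1, r))%C = (Ci * RtoC c / LIs c r)%C).
        { replace (LIs c r) with (RtoC c * (1, r))%C by (apply C_ext; simpl; ring). field. split; auto.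
          intros Y; injection Y; lra. }
        rewrite X, RtoC_2. field. auto.
    - destruct (lim_LIbound c x (lam + 1)%C Hc) as [_ L].
      replace (RtoC 0) with (/ (Ci * RtoC c) * 0)%C by ring. apply limC_mult. apply limC_const.
      eapply limC_0_bound; [exact L|]. intros n. apply H1; auto.
    - destruct (lim_LIbound c x (lam + 1)%C Hc) as [L _].
      replace (RtoC 0) with (/ (Ci * RtoC c) * 0)%C by ring. apply limC_mult. apply limC_const.
      eapply limC_0_bound; [exact L|]. intros n. apply H1; auto. }
  rewrite (IntW_plus _ _ _ _ _ (Cok_plus _ _ _ _ _ (Cok_scal _ _ _ 2%C H2) (Cok_scal _ _ _ (RtoC x) H1)) (Cok_scal _ _ _ (lam + 1)%C H0)) in E.
  rewrite (IntW_plus _ _ _ _ _ (Cok_scal _ _ _ 2%C H2) (Cok_scal _ _ _ (RtoC x) H1)) in E.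
  rewrite (IntW_scal _ _ _ _ H2), (IntW_scal _ _ _ _ H1), (IntW_scal _ _ _ _ H0) in E. unfold LI. rewrite E. ring.
Qed.

(** Completing the square, s^2 + x s = (s + x/2)^2 - x^2/4 turns the line into a shifted Gaussian at
    height - (c + x/2). *)
Lemma LI_0 c x : 0 < c -> LI c x 0 = RtoC (exp (- x ^ 2 / 4) * sqrt PI / c).
Proof.
  intros Hc. destruct (gauss_shift (- (c + x / 2))) as [A E].
  destruct (IntW_subst_lin _ _ c 0 Hc A) as [A2 E2]. rewrite E in E2.
  assert (Nc : RtoC c <> 0%C) by (apply RtoC_neq0; lra).
  unfold LI. rewrite (IntW_ext _ _ (fun r => RtoC (exp (- x ^ 2 / 4) / c)%R * (RtoC c * Cexp (- (((c * r + 0)%R, (- (c + x / 2))%R) * ((c * r + 0)%R, (- (c + x / 2))%R)))))%C).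
  - rewrite (IntW_scal _ _ _ _ A2), E2, <- RtoC_mult. f_equal. field. lra.
  - intros r _. rewrite Cmult_assoc, <- RtoC_mult.
    replace (exp (- x ^ 2 / 4) / c * c) with (exp (- x ^ 2 / 4)) by (field; lra).
    rewrite <- Cexp_R, <- Cexp_add. unfold LIg. f_equal. apply C_ext; simpl; field.
Qed.

Lemma LI_1 c x : 0 < c -> LI c x 1 = RtoC (- x / 2 * (exp (- x ^ 2 / 4) * sqrt PI / c)).
Proof.
  (* At lam = -1 the coefficient lam + 1 vanishes, so the recurrence relates [LI c x 1] to the
     Gaussian [LI c x 0] alone. *)
  intros Hc. assert (E := LI_rec c x (-1)%C Hc). replace (-1 + 2)%C with (RtoC 1) in E by (apply C_ext; simpl; ring).
  replace (-1 + 1)%C with (RtoC 0) in E by (apply C_ext; simpl; ring). rewrite (LI_0 c x Hc) in E.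
  replace (LI c x 1) with (/ 2 * (2 * LI c x 1 + RtoC x * RtoC (exp (- x ^ 2 / 4) * sqrt PI / c) + 0 * LI c x (-1)) - / 2 * RtoC x * RtoC (exp (- x ^ 2 / 4) * sqrt PI / c))%C by field.
  rewrite E. rewrite RtoC_mult. replace (RtoC (- x / 2)) with (- (/ 2 * RtoC x))%C. ring.
  unfold Rdiv. rewrite RtoC_mult, RtoC_opp, RtoC_inv by lra. ring.
Qed.

(** * The reciprocal Gamma function as Hankel's integral, with t = s^2 on a vertical line in s *)

Definition Kc (c : R) (z : C) : C := (RtoC (c / PI) * LI c 0 (1 - 2 * z))%C.

Lemma Cexp_half_ln4 : Cexp (RtoC (/ 2) * RtoC (ln 4)) = RtoC 2.
Proof.
  rewrite <- RtoC_mult, Cexp_R. f_equal. replace 4 with (2 * 2) by ring. rewrite ln_mult by lra.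
  replace (/ 2 * (ln 2 + ln 2)) with (ln 2) by field. apply exp_ln. lra.
Qed.

Lemma Rok_gamma2 a b : 0 < a -> 0 < b -> Rok WR (fun u => exp (a * u - b * exp (2 * u))).
Proof.
  intros Ha Hb. destruct (gamma_dom (a / 2) b ltac:(lra) Hb) as [K [c [HK [Hc H]]]].
  apply (Rok_le _ _ _ (Rok_scal _ _ K ltac:(lra) (Rok_exp_abs (2 * c) ltac:(lra)))).
  - intros; cont.
  - intros x _. split. left; apply exp_pos.
    specialize (H (2 * x)). replace (a / 2 * (2 * x)) with (a * x) in H by field.
    rewrite Rabs_mult, (Rabs_pos_eq 2) in H by lra. replace (- (2 * c) * Rabs x) with (- c * (2 * Rabs x)) by ring. auto.
Qed.

(** The substitution v -> 2 v - ln 4 in the integral of Gamma(z + 1/2). *)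
Lemma dup_int z : 0 < Re z ->
  Cok WR (fun v => Cexp ((2 * z + 1) * RtoC v - RtoC (exp (2 * v) / 4)))%C (fun v => exp ((2 * Re z + 1) * v - / 4 * exp (2 * v))) /\
  IntW WR (fun v => Cexp ((2 * z + 1) * RtoC v - RtoC (exp (2 * v) / 4)))%C = (Cexp (z * RtoC (ln 4)) * Gam (z + RtoC (/ 2)))%C.
Proof.
  intros Hz. assert (H : 0 < Re (z + RtoC (/ 2))) by (simpl; unfold Re in *; lra).
  destruct (IntW_subst_lin _ _ 2 (- ln 4) ltac:(lra) (Cok_Gam _ H)) as [A E]. fold (Gam (z + RtoC (/ 2))) in E.
  assert (X : forall v, Cexp ((2 * z + 1) * RtoC v - RtoC (exp (2 * v) / 4))%C =
    (Cexp (z * RtoC (ln 4)) * (RtoC 2 * Cexp ((z + RtoC (/ 2)) * RtoC (2 * v + - ln 4) - RtoC (exp (2 * v + - ln 4)))))%C).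
  { intros v.
    assert (D : forall w, (RtoC 2 * Cexp w)%C = Cexp (RtoC (/ 2) * RtoC (ln 4) + w)) by (intros; rewrite Cexp_add, Cexp_half_ln4; auto).
    rewrite D, <- Cexp_add. f_equal.
    rewrite exp_plus, exp_Ropp, exp_ln by lra.
    replace (RtoC (2 * v + - ln 4)) with (RtoC 2 * RtoC v - RtoC (ln 4))%C by (rewrite <- RtoC_mult, <- RtoC_minus; auto).
    replace (exp (2 * v) / 4) with (exp (2 * v) * / 4) by reflexivity.
    assert (Y : (RtoC 2 * RtoC (/ 2) = 1)%C) by (rewrite <- RtoC_mult; f_equal; field).
    transitivity (2 * z * RtoC v + (RtoC 2 * RtoC (/ 2)) * RtoC v - RtoC (exp (2 * v) * / 4))%C. rewrite Y; ring. ring. }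
  split.
  - split; [|split].
    + apply Rok_gamma2; lra.
    + intros; cont. lra.
    + intros v _. rewrite Cmod_Cexp. right. f_equal. simpl. unfold Re. field.
  - rewrite (IntW_ext _ _ _ (fun v _ => X v)). rewrite (IntW_scal _ _ _ _ A), E. reflexivity.
Qed.

(** Write Gamma(2 z) s^(- 2 z) as a Laplace integral over v and exchange the order. The inner line
    integral is then the elementary [LI c (- exp v) 1], and what remains in v is the integral of
    [dup_int]. *)
Lemma LI_Gam c z : 0 < c -> 0 < Re z ->
  (Gam (2 * z) * LI c 0 (1 - 2 * z) = RtoC (sqrt PI / (2 * c)) * (Cexp (z * RtoC (ln 4)) * Gam (z + RtoC (/ 2))))%C.
Proof.
  intros Hc Hz.
  assert (Hz2 : 0 < Re (2 * z)%C) by (simpl; unfold Re in *; lra).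
  set (F := fun r v : R => (LIg c 0 1 r * Cexp (2 * z * RtoC v - LIs c r * RtoC (exp v)))%C).
  destruct (Fubini WR WR F (LIbound c 0 1) (fun v => exp (Re (2 * z)%C * v - c * exp v))) as [E _]; auto.
  - apply LIg_ok; auto.
  - apply Rok_gamma; auto.
  - intros r v _ _. unfold F, LIs. apply cC_mult.
    + apply (cC_comp fst (LIg c 0 1)). apply cR_fst. apply LIg_cont.
    + cont.
  - intros r v _ _. unfold F. rewrite Cmod_mult, Cmod_Cexp. apply Rmult_le_compat; try apply Cmod_ge_0; try (left; apply exp_pos).
    apply LIg_ok; auto. right; f_equal. simpl. unfold Re; ring.
  - rewrite (IntW_ext _ _ (fun r => Gam (2 * z) * LIg c 0 (1 - 2 * z) r)%C) in E.
    2: { intros r _. unfold F.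
         assert (Hl : Rabs (Im (RtoC (ln c) + cl r)) < PI / 2).
         { simpl. assert (Q := Ratan.atan_bound r). rewrite Rplus_0_l. apply Rabs_def1; lra. }
         destruct (gamma_scale (2 * z) (RtoC (ln c) + cl r)%C Hz2 Hl) as [A1 E1].
         rewrite (Cexp_logs c r Hc) in A1, E1.
         rewrite (IntW_scal _ _ _ _ A1), E1.
         transitivity (Gam (2 * z) * (LIg c 0 1 r * Cexp (- (2 * z * (RtoC (ln c) + cl r)))))%C; [ring|].
         apply f_equal. unfold LIg. rewrite <- Cexp_add. apply f_equal. ring. }
    rewrite (IntW_scal _ _ _ _ (LIg_ok c 0 (1 - 2 * z) Hc)) in E. unfold LI. rewrite E.
    destruct (dup_int z Hz) as [A2 E2]. rewrite <- E2, <- (IntW_scal _ _ _ _ A2). apply IntW_ext. intros v _.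
    rewrite (IntW_ext _ _ (fun r => Cexp (2 * z * RtoC v) * LIg c (- exp v) 1 r)%C).
    2: { intros r _. unfold F, LIg. rewrite <- !Cexp_add. f_equal. rewrite RtoC_opp. ring. }
    rewrite (IntW_scal _ _ _ _ (LIg_ok c (- exp v) 1 Hc)). fold (LI c (- exp v) 1). rewrite LI_1 by auto.
    replace (- - exp v / 2 * (exp (- (- exp v) ^ 2 / 4) * sqrt PI / c)) with (sqrt PI / (2 * c) * exp (v + - (exp (2 * v) / 4))).
    + replace ((2 * z + 1) * RtoC v - RtoC (exp (2 * v) / 4))%C with (2 * z * RtoC v + RtoC (v + - (exp (2 * v) / 4)))%C.
      rewrite Cexp_add, Cexp_R, RtoC_mult. ring. rewrite RtoC_plus, RtoC_opp. ring.
    + replace (- (- exp v) ^ 2 / 4) with (- (exp (2 * v) / 4)). rewrite exp_plus. field. lra.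
      replace (2 * v) with (v + v) by ring. rewrite exp_plus. field.
Qed.

(** Legendre's duplication formula with [Kc] in the place of 1/Gamma. It is the only link needed
    between the line integral and Gamma on the right half-plane. *)
Lemma K_Gam c z : 0 < c -> 0 < Re z ->
  (Gam (2 * z) * Kc c z = RtoC (sqrt PI / (2 * PI)) * (Cexp (z * RtoC (ln 4)) * Gam (z + RtoC (/ 2))))%C.
Proof.
  intros Hc Hz. unfold Kc. rewrite Cmult_assoc, (Cmult_comm (Gam _)), <- Cmult_assoc, LI_Gam by auto.
  rewrite Cmult_assoc, <- RtoC_mult. f_equal. f_equal. assert (P := PI_RGT_0). field. lra.
Qed.

Lemma K_rec c z : 0 < c -> Kc c z = (z * Kc c (z + 1))%C.
Proof.
  intros Hc. assert (E := LI_rec c 0 (1 - 2 * (z + 1))%C Hc). unfold Kc.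
  replace (1 - 2 * (z + 1) + 2)%C with (1 - 2 * z)%C in E by ring.
  assert (X : LI c 0 (1 - 2 * z) = (z * LI c 0 (1 - 2 * (z + 1)))%C).
  { replace (1 - 2 * (z + 1) + 1)%C with (- (2 * z))%C in E by (rewrite RtoC_2; ring).
    replace (LI c 0 (1 - 2 * z)) with (/ 2 * (2 * LI c 0 (1 - 2 * z) + 0 * LI c 0 (- (2 * z)) + - (2 * z) * LI c 0 (1 - 2 * (z + 1))) + z * LI c 0 (1 - 2 * (z + 1)))%C.
    rewrite E. ring. field. }
  rewrite X. ring.
Qed.

Lemma K_poch c z n : 0 < c -> Kc c z = (poch z n * Kc c (z + RtoC (INR n)))%C.
Proof.
  intros Hc. induction n.
  - simpl. rewrite Cplus_0_r. ring.
  - rewrite IHn, (K_rec c (z + RtoC (INR n))%C Hc), S_INR, RtoC_plus. simpl poch.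
    replace (z + RtoC (INR n) + 1)%C with (z + (RtoC (INR n) + 1))%C by ring. ring.
Qed.

(** The exact value 2^(2 n + 1) n! Gamma(n + 3/2) = sqrt PI (2 n + 1)! is compared with Gamma(n +
    3/2) ~ n! sqrt n from [Gam_asym]. *)
Lemma wallis_lim : is_lim_seq (fun n => 2 ^ (2 * n + 1) * INR (fact n) * INR (fact n) * sqrt (INR n) / INR (fact (2 * n + 1))) (sqrt PI).
Proof.
  assert (E : forall n, 2 ^ (2 * n + 1) * INR (fact n) * rG (INR n + 1 + 1 / 2) = sqrt PI * INR (fact (2 * n + 1))).
  { induction n.
    - simpl. replace (0 + 1 + 1 / 2) with (1 / 2 + 1) by ring. rewrite rG_S, rG_half by lra. field.
    - replace (2 * S n + 1)%nat with (S (S (2 * n + 1))) by lia.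
      rewrite (fact_simpl (S (2 * n + 1))), (fact_simpl (2 * n + 1)), (fact_simpl n), !mult_INR.
      rewrite S_INR. replace (INR n + 1 + 1 + 1 / 2) with (INR n + 1 + 1 / 2 + 1) by ring.
      assert (P := pos_INR n). rewrite rG_S by lra.
      replace (sqrt PI * (INR (S (S (2 * n + 1))) * (INR (S (2 * n + 1)) * INR (fact (2 * n + 1)))))
        with (INR (S (S (2 * n + 1))) * INR (S (2 * n + 1)) * (sqrt PI * INR (fact (2 * n + 1)))) by ring.
      rewrite <- IHn. rewrite !S_INR, plus_INR, mult_INR. simpl. field. }
  assert (A := proj1 (Gam_asym (RtoC (1 / 2)))). simpl (Re 1) in A.
  assert (A' : is_lim_seq (fun n => rG (INR n + 1 + 1 / 2) / (INR (fact n) * sqrt (INR n))) 1).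
  { eapply is_lim_seq_ext_loc; [|exact A]. exists 1%nat. intros n Hn.
    assert (Pn : 0 < INR n) by (apply lt_0_INR; lia). assert (Fn := INR_fact_lt_0 n).
    assert (Sn : 0 < sqrt (INR n)) by (apply sqrt_lt_R0; auto).
    rewrite <- RtoC_plus, Gam_R by lra. unfold Rcpow. rewrite <- RtoC_mult, Cexp_R.
    replace (1 / 2 * ln (INR n)) with (/ 2 * ln (INR n)) by field. fold (Rpower (INR n) (/ 2)). rewrite Rpower_sqrt by auto.
    rewrite <- RtoC_mult, <- RtoC_div by nra. simpl. f_equal. f_equal. field. }
  apply (is_lim_seq_ext_loc (fun n => sqrt PI / (rG (INR n + 1 + 1 / 2) / (INR (fact n) * sqrt (INR n))))).
  - exists 1%nat. intros n Hn.
    assert (Pn : 0 < INR n) by (apply lt_0_INR; lia). assert (Fn := INR_fact_lt_0 n).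
    assert (Fn2 := INR_fact_lt_0 (2 * n + 1)).
    assert (Sn : 0 < sqrt (INR n)) by (apply sqrt_lt_R0; auto).
    specialize (E n). assert (P2 : 0 < 2 ^ (2 * n + 1)) by (apply pow_lt; lra).
    assert (SP : 0 < sqrt PI) by (apply sqrt_lt_R0; apply PI_RGT_0).
    assert (G : rG (INR n + 1 + 1 / 2) <> 0). { intros Z. rewrite Z in E. assert (0 < sqrt PI * INR (fact (2 * n + 1))) by (apply Rmult_lt_0_compat; auto). lra. }
    apply (Rmult_eq_reg_r (INR (fact (2 * n + 1)) * rG (INR n + 1 + 1 / 2))).
    + transitivity (sqrt PI * INR (fact (2 * n + 1)) * INR (fact n) * sqrt (INR n)). field. repeat split; auto; lra.
      rewrite <- E. field. lra.
    + apply Rmult_integral_contrapositive_currified; auto. lra.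
  - replace (Finite (sqrt PI)) with (Finite (sqrt PI / 1)) by (f_equal; field).
    apply is_lim_seq_div'; auto. apply is_lim_seq_const.
Qed.

Lemma lim_ln_ratio : is_lim_seq (fun n => ln 2 + ln (INR n) - ln (INR (2 * n + 1))) 0.
Proof.
  apply (is_lim_seq_ext_loc (fun n => - ln (1 + / (2 * INR n)))).
  - exists 1%nat. intros n Hn. assert (Pn : 0 < INR n) by (apply lt_0_INR; lia).
    assert (0 < / (2 * INR n)) by (apply Rinv_0_lt_compat; lra).
    replace (INR (2 * n + 1)) with (2 * INR n * (1 + / (2 * INR n))).
    rewrite !ln_mult; try lra.
    rewrite plus_INR, mult_INR. simpl. field. lra.
  - replace (Finite 0) with (Rbar_opp (ln 1)) by (rewrite ln_1; simpl; f_equal; ring).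
    apply (proj1 (is_lim_seq_opp _ _)).
    apply (is_lim_seq_continuous ln (fun n => 1 + / (2 * INR n)) 1).
    + apply continuity_pt_filterlim. apply (ex_derive_continuous (V:=R_NormedModule)). eexists. apply is_derive_ln. lra.
    + replace (Finite 1) with (Finite (1 + 0)) by (f_equal; ring). apply is_lim_seq_plus'. apply is_lim_seq_const.
      replace (Finite 0) with (Rbar_inv p_infty) by reflexivity. apply is_lim_seq_inv; [|discriminate].
      apply (is_lim_seq_le_p_loc INR); [|apply is_lim_seq_INR]. exists O. intros n _. generalize (pos_INR n); lra.
Qed.

Lemma Rcpow_ne0 x z : Rcpow x z <> 0%C.
Proof. apply Cexp_neq0. Qed.

Lemma Rcpow_plus x z w : Rcpow x (z + w) = (Rcpow x z * Rcpow x w)%C.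
Proof. unfold Rcpow. rewrite <- Cexp_add. f_equal. ring. Qed.

Lemma limC_ne0 u (l : C) : l <> 0%C -> limC u l -> eventually (fun n => u n <> 0%C).
Proof.
  intros N L. assert (Q := limC_to0 _ _ L). apply is_lim_seq_spec in Q.
  assert (P : 0 < Cmod l) by (apply Cmod_gt_0; auto).
  destruct (Q (mkposreal _ P)) as [n Hn]. exists n. intros m Hm E. specialize (Hn m Hm). rewrite E in Hn. simpl in Hn.
  rewrite Rminus_0_r, Rabs_pos_eq in Hn by apply Cmod_ge_0. replace (0 - l)%C with (- l)%C in Hn by ring. rewrite Cmod_opp in Hn. lra.
Qed.

(** The duplication formula expresses [Kc] at z + n + 1 by a quotient of two Gamma values. Both are
    known asymptotically, the one at 2 z along the indices 2 n + 1; Wallis's product and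
    [lim_ln_ratio] account for the remaining constants. *)
Lemma K_asym c z : 0 < c ->
  limC (fun n => Kc c (z + RtoC (INR n + 1)) * (RtoC (INR (fact n)) * Rcpow (INR n) z))%C 1%C.
Proof.
  intros Hc.
  assert (A := Gam_asym (z + RtoC (/ 2))).
  assert (B := limC_subseq _ _ (fun n => (2 * n + 1)%nat) ltac:(intros; simpl; lia) (Gam_asym (2 * z))). cbv beta in B.
  assert (D : limC (fun n => Cexp (2 * z * RtoC (ln 2 + ln (INR n) - ln (INR (2 * n + 1)))))%C 1%C).
  { rewrite <- Cexp_0. replace (RtoC 0) with (2 * z * RtoC 0)%C by ring.
    apply (limC_contR (fun t => Cexp (2 * z * RtoC t))%C (fun n => ln 2 + ln (INR n) - ln (INR (2 * n + 1))) 0). cont. apply lim_ln_ratio. }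
  assert (SP : 0 < sqrt PI) by (apply sqrt_lt_R0; apply PI_RGT_0).
  assert (PP := PI_RGT_0). assert (SS : sqrt PI * sqrt PI = PI) by (apply sqrt_sqrt; lra).
  assert (W : limC (fun n => RtoC (sqrt PI / PI * (2 ^ (2 * n + 1) * INR (fact n) * INR (fact n) * sqrt (INR n) / INR (fact (2 * n + 1))))) 1%C).
  { replace (RtoC 1) with (RtoC (sqrt PI / PI * sqrt PI)). 2: { f_equal. rewrite <- SS at 2. field. lra. }
    apply limC_RtoC. apply is_lim_seq_mult'. apply is_lim_seq_const. apply wallis_lim. }
  assert (N1 : (1:C) <> 0%C) by (apply RtoC_neq0; lra).
  assert (L := limC_mult _ _ _ _ (limC_mult _ _ _ _ (limC_div _ _ _ _ N1 A B) D) W).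
  replace (1 / 1 * 1 * 1)%C with (RtoC 1) in L by field.
  eapply limC_ext_loc; [|exact L].
  assert (NB := limC_ne0 _ _ N1 B).
  destruct (INR_unbounded (Cmod z + 1)) as [m Hm].
  assert (EV : eventually (fun n => (m + 1 <= n)%nat)) by (exists (m + 1)%nat; auto).
  generalize (filter_and _ _ NB EV). apply filter_imp. intros n [Nn Hn].
  assert (Pn : 0 < INR n) by (apply lt_0_INR; lia).
  assert (Mn : INR m <= INR n) by (apply le_INR; lia).
  assert (Hz : 0 < Re (z + RtoC (INR n + 1))).
  { assert (Q := Re_le_Cmod z). apply Rabs_le_between in Q. simpl. unfold Re in *. lra. }
  assert (KG := K_Gam c _ Hc Hz).
  replace (2 * (z + RtoC (INR n + 1)))%C with (2 * z + RtoC (INR (2 * n + 1) + 1))%C in KG.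
  2: { rewrite plus_INR, mult_INR. rewrite Cmult_plus_distr_l, <- RtoC_mult. simpl. f_equal. f_equal. ring. }
  replace (z + RtoC (INR n + 1) + RtoC (/ 2))%C with (z + RtoC (/ 2) + RtoC (INR n + 1))%C in KG by ring.
  set (G2 := Gam (2 * z + RtoC (INR (2 * n + 1) + 1))) in *.
  set (G1 := Gam (z + RtoC (/ 2) + RtoC (INR n + 1))) in *.
  set (K := Kc c (z + RtoC (INR n + 1))) in *.
  assert (NG2 : G2 <> 0%C). { intros Z. apply Nn. rewrite Z. unfold Cdiv. ring. }
  assert (F1 := INR_fact_lt_0 n). assert (F2 := INR_fact_lt_0 (2 * n + 1)).
  assert (EK : K = (RtoC (sqrt PI / (2 * PI)) * (Cexp ((z + RtoC (INR n + 1)) * RtoC (ln 4)) * G1) / G2)%C).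
  { rewrite <- KG. field. auto. }
  rewrite EK. clear EK KG Nn.
  assert (R1 : Rcpow (INR n) (z + RtoC (/ 2)) = (Rcpow (INR n) z * RtoC (sqrt (INR n)))%C).
  { rewrite Rcpow_plus. f_equal. unfold Rcpow. rewrite <- RtoC_mult, Cexp_R. f_equal. apply Rpower_sqrt; auto. }
  assert (Sn : 0 < sqrt (INR n)) by (apply sqrt_lt_R0; auto).
  assert (E4 : Cexp ((z + RtoC (INR n + 1)) * RtoC (ln 4)) = (Cexp (2 * z * RtoC (ln 2)) * RtoC (2 * 2 ^ (2 * n + 1)))%C).
  { assert (L4 : ln 4 = ln 2 + ln 2) by (replace 4 with (2 * 2) by ring; apply ln_mult; lra).
    rewrite L4, Cmult_plus_distr_r, Cexp_add. f_equal.
    - f_equal. rewrite RtoC_plus. rewrite RtoC_2. ring.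
    - rewrite <- RtoC_mult, Cexp_R. f_equal.
      replace ((INR n + 1) * (ln 2 + ln 2)) with (INR (2 * n + 2) * ln 2) by (rewrite plus_INR, mult_INR; simpl; ring).
      fold (Rpower 2 (INR (2 * n + 2))). rewrite Rpower_pow by lra. replace (2 * n + 2)%nat with (S (2 * n + 1)) by lia. reflexivity. }
  rewrite R1, E4.
  assert (E5 : Cexp (2 * z * RtoC (ln 2 + ln (INR n) - ln (INR (2 * n + 1)))) =
     (Cexp (2 * z * RtoC (ln 2)) * (Rcpow (INR n) z * Rcpow (INR n) z) / Rcpow (INR (2 * n + 1)) (2 * z))%C).
  { unfold Rcpow. rewrite <- Cexp_add, <- Cexp_add, <- Cexp_minus. f_equal. rewrite RtoC_minus, RtoC_plus, RtoC_2. ring. }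
  rewrite E5.
  assert (N3 := Rcpow_ne0 (INR n) z). assert (N4 := Rcpow_ne0 (INR (2 * n + 1)) (2 * z)).
  set (a1 := Rcpow (INR n) z) in *. set (a2 := Rcpow (INR (2 * n + 1)) (2 * z)) in *. set (a3 := Cexp (2 * z * RtoC (ln 2))).
  replace (RtoC (sqrt PI / PI * (2 ^ (2 * n + 1) * INR (fact n) * INR (fact n) * sqrt (INR n) / INR (fact (2 * n + 1)))))
    with (RtoC (sqrt PI / (2 * PI)) * RtoC (2 * 2 ^ (2 * n + 1)) * RtoC (INR (fact n)) * RtoC (INR (fact n)) * RtoC (sqrt (INR n)) / RtoC (INR (fact (2 * n + 1))))%C.
  2: { rewrite <- !RtoC_mult, <- RtoC_div by lra. f_equal. field. lra. }
  field. repeat split; auto; apply RtoC_neq0; lra.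
Qed.

(** Iterating the recurrence gives [Kc 1 z] = (z)_(n+1) [Kc 1] (z + n + 1), and [K_asym] turns the
    last factor into the denominator of Gauss's product. *)
Lemma rGamma_lim z : limC (fun n => poch z (S n) / (RtoC (INR (fact n)) * Rcpow (INR n) z))%C (Kc 1 z).
Proof.
  assert (N1 : (1:C) <> 0%C) by (apply RtoC_neq0; lra).
  assert (A := K_asym 1 z Rlt_0_1). assert (NA := limC_ne0 _ _ N1 A).
  assert (L := limC_div _ _ _ _ N1 (limC_const (Kc 1 z)) A).
  replace (Kc 1 z / 1)%C with (Kc 1 z) in L by field.
  eapply limC_ext_loc; [|exact L]. revert NA. apply filter_imp. intros n NA.
  rewrite (K_poch 1 z (S n) Rlt_0_1), S_INR.
  assert (F1 := INR_fact_lt_0 n). assert (N3 := Rcpow_ne0 (INR n) z).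
  assert (N2 : Kc 1 (z + RtoC (INR n + 1)) <> 0%C). { intros Z. apply NA. rewrite Z. ring. }
  field. repeat split; auto; apply RtoC_neq0; lra.
Qed.

Lemma rGamma_K1 z : rGamma z = Kc 1 z.
Proof.
  destruct (rGamma_lim z) as [A B]. unfold rGamma, CLim_seq.
  apply is_lim_seq_unique in A. apply is_lim_seq_unique in B.
  apply C_ext; simpl; [transitivity (real (Finite (Re (Kc 1 z))))|transitivity (real (Finite (Im (Kc 1 z))))]; auto; f_equal; auto.
Qed.

Lemma rGamma_lim_any z l : limC (fun n => poch z (S n) / (RtoC (INR (fact n)) * Rcpow (INR n) z))%C l -> rGamma z = l.
Proof. intros H. rewrite rGamma_K1. eapply limC_unique; [apply rGamma_lim|auto]. Qed.

(** The limit in [K_asym] is the same for every c > 0, so every abscissa gives the same function.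
    This independence of c is what later moves the contour. *)
Lemma rGamma_Kc c z : 0 < c -> rGamma z = Kc c z.
Proof.
  intros Hc. apply rGamma_lim_any.
  assert (N1 : (1:C) <> 0%C) by (apply RtoC_neq0; lra).
  assert (A := K_asym c z Hc). assert (NA := limC_ne0 _ _ N1 A).
  assert (L := limC_div _ _ _ _ N1 (limC_const (Kc c z)) A).
  replace (Kc c z / 1)%C with (Kc c z) in L by field.
  eapply limC_ext_loc; [|exact L]. revert NA. apply filter_imp. intros n NA.
  rewrite (K_poch c z (S n) Hc), S_INR.
  assert (F1 := INR_fact_lt_0 n). assert (N3 := Rcpow_ne0 (INR n) z).
  assert (N2 : Kc c (z + RtoC (INR n + 1)) <> 0%C). { intros Z. apply NA. rewrite Z. ring. }
  field. repeat split; auto; apply RtoC_neq0; lra.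
Qed.

Lemma rGamma_rec z : rGamma z = (z * rGamma (z + 1))%C.
Proof. rewrite !rGamma_K1. apply K_rec. lra. Qed.

Lemma rGamma_S z : (z * rGamma (z + 1) = rGamma z)%C.
Proof. symmetry. apply rGamma_rec. Qed.

(** * Differentiation under the integral sign and Taylor bounds for the exponential *)

Lemma dC_IntW w (F F' : R -> R -> C) (h : R -> R) a b x0 : a < x0 < b ->
  (forall x, a < x < b -> exists g, Cok w (F x) g) ->
  (forall x y, a < x < b -> inW w y -> dC (fun x => F x y) x (F' x y)) ->
  (forall x y, a < x < b -> inW w y -> contC (fun p : R * R => F' (fst p) (snd p)) (x, y)) ->
  Rok w h -> (forall x y, a < x < b -> inW w y -> Cmod (F' x y) <= h y) ->
  dC (fun x => IntW w (F x)) x0 (IntW w (F' x0)).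
Proof.
  intros Hx0 OF D K Hh B.
  assert (OF' : forall x, a < x < b -> Cok w (F' x) h).
  { intros x Hx. split; [auto|split]; auto. intros y Hy. apply (contC_slice2 F'); auto. }
  assert (Loc : forall x, a < x < b -> locally x (fun y => a < y < b)).
  { intros x Hx. apply filter_and; [apply (open_gt a x)|apply (open_lt b x)]; lra. }
  assert (C' : forall x, a < x < b -> contC (fun x => IntW w (F' x)) x).
  { intros x Hx. apply (IntW_param_cont w F' h); auto. generalize (Loc x Hx). apply filter_imp. auto. }
  assert (Key : forall x1 x2, a < x1 -> x1 <= x2 -> x2 < b ->
    (IntW w (F x2) - IntW w (F x1))%C = CInt (fun x => IntW w (F' x)) x1 x2).
  { intros x1 x2 H1 H12 H2.
    destruct (OF x1 ltac:(lra)) as [g1 G1]. destruct (OF x2 ltac:(lra)) as [g2 G2].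
    eapply limC_unique. apply limC_minus; eapply IntW_lim; eauto.
    assert (Lh := Rok_lim w h Hh).
    apply limC_Cmod0.
    apply (limR_squeeze0 _ (fun n => 2 * (RInt (fun _ => 2 * (RIntW w h - RInt h (wl w n) (wr w n))) x1 x2))).
    { apply (is_lim_seq_ext (fun n => 4 * (x2 - x1) * (RIntW w h - RInt h (wl w n) (wr w n)))).
      - intros n. rewrite RInt_const. unfold scal; simpl; unfold mult; simpl. ring.
      - replace (Finite 0) with (Finite (4 * (x2 - x1) * (RIntW w h - RIntW w h))) by (f_equal; ring).
        apply is_lim_seq_mult'. apply is_lim_seq_const. apply is_lim_seq_minus'; auto. apply is_lim_seq_const. }
    intros n. split. apply Cmod_ge_0.
    set (c := wl w n). set (d := wr w n). assert (Hcd : c <= d) by apply wlr.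
    assert (Wy : forall y, c <= y <= d -> inW w y) by (intros; exists n; auto).
    assert (CF : forall x, a < x < b -> contOn (F x) c d).
    { intros x Hx. destruct (OF x Hx) as [g G]. intros y Hy. apply G; auto. }
    assert (E : (CInt (F x2) c d - CInt (F x1) c d)%C = CInt (fun x => CInt (F' x) c d) x1 x2).
    { rewrite C_Fubini_rect; auto. 2: { intros; apply K; auto; lra. }
      rewrite (CInt_ext (fun y => CInt (fun x => F' x y) x1 x2) (fun y => F x2 y + (-1) * F x1 y)%C); auto.
      - rewrite CInt_plus, CInt_scal; auto; try (apply CF; lra). ring.
        intros y Hy. apply cC_mult. apply cC_const. apply (CF x1); auto; lra.
      - intros y Hy. rewrite (C_FTC (fun x => F x y)); auto. ring.
        intros x Hx. apply D; auto; lra. intros x Hx. apply (contC_slice1 F'). apply K; auto; lra. }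
    rewrite E.
    replace (CInt (fun x => CInt (F' x) c d) x1 x2 - CInt (fun x => IntW w (F' x)) x1 x2)%C
      with (CInt (fun x => CInt (F' x) c d + (-1) * IntW w (F' x))%C x1 x2).
    2: { rewrite CInt_plus, CInt_scal; auto. ring.
         - intros x Hx. apply C'; lra.
         - intros x Hx. apply CInt_param_cont; auto. intros; apply K; auto; lra.
           generalize (Loc x ltac:(lra)). apply filter_imp. intros z Hz y Hy. apply OF'; auto.
         - intros x Hx. apply cC_mult. apply cC_const. apply C'; lra. }
    apply CInt_bound; auto.
    - intros x Hx. apply cC_plus.
      + apply CInt_param_cont; auto. intros; apply K; auto; lra.
        generalize (Loc x ltac:(lra)). apply filter_imp. intros z Hz y Hy. apply OF'; auto.
      + apply cC_mult. apply cC_const. apply C'; lra.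
    - apply (ex_RInt_const (V:=R_NormedModule)).
    - intros x Hx. replace (CInt (F' x) c d + -1 * IntW w (F' x))%C with (CInt (F' x) c d - IntW w (F' x))%C by ring.
      apply (C_exhaust w (F' x) h n); unfold c, d; auto; try lra. apply OF'; lra. }
  set (m := (a + x0) / 2). assert (Hm : a < m < x0) by (unfold m; lra).
  apply (dC_ext_loc (fun x => IntW w (F m) + CInt (fun x => IntW w (F' x)) m x)%C).
  - assert (L : locally x0 (fun y => m < y < b)).
    { apply filter_and; [apply (open_gt m x0)|apply (open_lt b x0)]; lra. }
    revert L. apply filter_imp. intros y Hy. rewrite <- (Key m y); try lra. ring.
  - apply (dC_ext_loc (fun x => (IntW w (F m) + CInt (fun x => IntW w (F' x)) m x0) + CInt (fun x => IntW w (F' x)) x0 x)%C).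
    + generalize (Loc x0 Hx0). apply filter_imp. intros y Hy.
      rewrite <- Cplus_assoc. f_equal. unfold CInt. apply C_ext; simpl.
      * apply (RInt_Chasles (V:=RV)); apply (ex_RInt_continuous (V:=RV));
        intros z Hz; apply (C' z); unfold Rmin, Rmax in Hz; destruct Rle_dec; lra.
      * apply (RInt_Chasles (V:=RV)); apply (ex_RInt_continuous (V:=RV));
        intros z Hz; apply (C' z); unfold Rmin, Rmax in Hz; destruct Rle_dec; lra.
    + replace (IntW w (F' x0)) with (0 + IntW w (F' x0))%C by ring. apply dC_plus. apply dC_const.
      apply (CInt_dC (fun x => IntW w (F' x)) a b); auto.
Qed.

Definition Texp (N : nat) (w : C) : C := Csum (fun n => w ^ n / RtoC (INR (fact n)))%C N.

Lemma Csum_ext f g n : (forall k, (k < n)%nat -> f k = g k) -> Csum f n = Csum g n.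
Proof. intros H. induction n; simpl; auto. rewrite IHn, H; auto. Qed.

Lemma Csum_scal (c : C) f n : Csum (fun k => c * f k)%C n = (c * Csum f n)%C.
Proof. induction n; simpl. ring. rewrite IHn. ring. Qed.

Lemma Csum_plus f g n : Csum (fun k => f k + g k)%C n = (Csum f n + Csum g n)%C.
Proof. induction n; simpl. ring. rewrite IHn. ring. Qed.

Lemma Csum_S_l f n : Csum f (S n) = (f O + Csum (fun k => f (S k)) n)%C.
Proof. induction n; simpl in *. ring. rewrite IHn. ring. Qed.

Lemma Cmult_reg_l' (a b c : C) : a <> 0%C -> (a * b = a * c)%C -> b = c.
Proof. intros N E. replace b with (/ a * (a * b))%C by (field; auto). rewrite E. field; auto. Qed.

Lemma Cpow_mult_distr' (a b : C) n : ((a * b) ^ n = a ^ n * b ^ n)%C.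
Proof. induction n; simpl. ring. rewrite IHn. ring. Qed.

Lemma RtoC_fact_ne0 n : RtoC (INR (fact n)) <> 0%C.
Proof. apply RtoC_neq0. generalize (INR_fact_lt_0 n); lra. Qed.

Lemma Texp_dC N w t : dC (fun t => Texp (S N) (RtoC t * w)) t (w * Texp N (RtoC t * w))%C.
Proof.
  unfold Texp. induction N.
  - simpl. evar_last. apply dC_plus. apply dC_const. apply dC_const. ring.
  - simpl Csum in *. evar_last.
    + apply dC_plus. exact IHN.
      apply (dC_mult (fun t => (RtoC t * w) ^ (S N))%C). 2: apply dC_const.
      instantiate (1 := (RtoC (INR (S N)) * w * (RtoC t * w) ^ N)%C).
      clear IHN. induction N.
      * simpl. evar_last. apply dC_mult. apply dC_mult. apply dC_RtoC. apply dR_id. apply dC_const. apply dC_const.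
        cbv beta. simpl. ring.
      * change (dC (fun t => (RtoC t * w) * (RtoC t * w) ^ (S N))%C t (RtoC (INR (S (S N))) * w * (RtoC t * w) ^ S N)%C).
        evar_last. apply dC_mult. 2: exact IHN. apply dC_mult. apply dC_RtoC. apply dR_id. apply dC_const.
        cbv beta. rewrite (S_INR (S N)), RtoC_plus.
        change ((RtoC t * w) ^ S N)%C with ((RtoC t * w) * (RtoC t * w) ^ N)%C. ring.
    + cbv beta. change (fact N + N * fact N)%nat with (fact (S N)). rewrite fact_simpl, mult_INR, RtoC_mult.
      assert (A := RtoC_fact_ne0 N). assert (B : RtoC (INR (S N)) <> 0%C) by (apply RtoC_neq0; rewrite S_INR; generalize (pos_INR N); lra).
      field. auto.
Qed.

Lemma Texp_0 N : Texp (S N) 0 = 1%C.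
Proof.
  unfold Texp. rewrite Csum_S_l. simpl.
  rewrite (Csum_ext _ (fun _ => 0 * 0)%C). rewrite Csum_scal. field.
  intros k _. unfold Cdiv. ring.
Qed.

(** Induction by integrating the derivative over [0, t]; each integration pays the factor 2 of
    [CInt_bound], whence 2^N. *)
Lemma Cexp_Taylor N w : forall t, 0 <= t <= 1 ->
  Cmod (Cexp (RtoC t * w) - Texp N (RtoC t * w)) <= (2 * Cmod w) ^ N * exp (Cmod w) * (t ^ N / INR (fact N)).
Proof.
  assert (HW := Cmod_ge_0 w).
  induction N; intros t Ht.
  - unfold Texp. simpl. replace (Cexp (RtoC t * w) - 0)%C with (Cexp (RtoC t * w)) by ring.
    rewrite Cmod_Cexp. replace (1 * exp (Cmod w) * (1 / 1)) with (exp (Cmod w)) by field. apply exp_le.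
    simpl. assert (Q := Re_le_Cmod w). apply Rabs_le_between in Q. unfold Re in *. nra.
  - assert (E : (Cexp (RtoC t * w) - Texp (S N) (RtoC t * w))%C = CInt (fun s => w * (Cexp (RtoC s * w) - Texp N (RtoC s * w)))%C 0 t).
    { rewrite (C_FTC (fun s => Cexp (RtoC s * w) - Texp (S N) (RtoC s * w))%C).
      - replace (RtoC 0 * w)%C with (RtoC 0) by ring. rewrite Cexp_0, Texp_0. ring.
      - lra.
      - intros s _. evar_last. apply dC_minus. apply dC_Cexp. apply dC_mult. apply dC_RtoC. apply dR_id. apply dC_const.
        apply Texp_dC. cbv beta. ring.
      - intros s _. apply cC_mult. apply cC_const. apply cC_minus. cont.
        unfold Texp. clear. induction N; simpl. apply cC_const. apply cC_plus; auto. apply cC_mult. apply cC_pow. cont. apply cC_const. }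
    rewrite E.
    eapply Rle_trans.
    + apply (CInt_bound _ (fun s => Cmod w * (2 * Cmod w) ^ N * exp (Cmod w) / INR (fact N) * s ^ N)); [lra| | |].
      * intros s _. apply cC_mult. apply cC_const. apply cC_minus. cont.
        unfold Texp. clear. induction N; simpl. apply cC_const. apply cC_plus; auto. apply cC_mult. apply cC_pow. cont. apply cC_const.
      * apply R_ex_scal. apply ex_RInt_cont; [lra|]. intros; cont.
      * intros s Hs. rewrite Cmod_mult. eapply Rle_trans. apply Rmult_le_compat_l; auto. apply IHN. lra.
        right. field. generalize (INR_fact_lt_0 N); lra.
    + rewrite R_RInt_scal. 2: { apply ex_RInt_cont; [lra|]. intros; cont. }
      rewrite (R_FTC (fun s => s ^ (S N) / INR (S N))); [|lra| |intros; cont].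
      * right. rewrite fact_simpl, mult_INR. assert (A := INR_fact_lt_0 N).
        assert (B : INR (S N) <> 0) by (rewrite S_INR; generalize (pos_INR N); lra).
        rewrite (pow_i (S N)) by lia. simpl pow. field. split; auto; lra.
      * intros s _. assert (B : INR (S N) <> 0) by (rewrite S_INR; generalize (pos_INR N); lra).
        auto_derive; auto. simpl pred. field; auto.
Qed.

Lemma pow_fact_le a N : 0 <= a -> a ^ N / INR (fact N) <= exp a.
Proof.
  intros H. eapply Rle_trans; [|apply (exp_ge_taylor a N H)].
  destruct N. simpl; lra. rewrite tech5.
  assert (0 <= sum_f_R0 (fun k : nat => a ^ k / INR (fact k)) N).
  { apply cond_pos_sum. intros n. apply Rmult_le_pos. apply pow_le; auto. left; apply Rinv_0_lt_compat, INR_fact_lt_0. }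
  lra.
Qed.

(** Since (2 |w|)^N / N! = 2^(- N) (4 |w|)^N / N!, a geometric rate in N is bought with the growth
    e^(5 |w|), which the Gaussian decay along the line absorbs. *)
Lemma Cexp_Texp N w : Cmod (Cexp w - Texp N w) <= (/ 2) ^ N * exp (5 * Cmod w).
Proof.
  assert (H := Cexp_Taylor N w 1 ltac:(lra)). rewrite Cmult_1_l in H. eapply Rle_trans; [exact H|].
  assert (HW := Cmod_ge_0 w).
  assert (Q := pow_fact_le (4 * Cmod w) N ltac:(lra)).
  replace (5 * Cmod w) with (4 * Cmod w + Cmod w) by ring. rewrite exp_plus, pow1.
  replace (2 * Cmod w) with (/ 2 * (4 * Cmod w)) by field. rewrite Rpow_mult_distr.
  assert (0 < (/ 2) ^ N) by (apply pow_lt; lra). assert (E := exp_pos (Cmod w)).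
  replace ((/ 2) ^ N * (4 * Cmod w) ^ N * exp (Cmod w) * (1 / INR (fact N))) with ((/ 2) ^ N * (((4 * Cmod w) ^ N / INR (fact N)) * exp (Cmod w))) by (unfold Rdiv; ring).
  apply Rmult_le_compat_l. lra. apply Rmult_le_compat_r; lra.
Qed.

(** * The line-integral representation of the generalised Bessel function *)

Lemma Csum_Re a n : sum_n (fun k => Re (a k)) n = Re (Csum a (S n)).
Proof.
  induction n.
  - rewrite sum_O. simpl. unfold Re. ring.
  - rewrite sum_Sn, IHn. reflexivity.
Qed.
Lemma Csum_Im a n : sum_n (fun k => Im (a k)) n = Im (Csum a (S n)).
Proof.
  induction n.
  - rewrite sum_O. simpl. unfold Im. ring.
  - rewrite sum_Sn, IHn. reflexivity.
Qed.

Lemma CSeries_lim a l : limC (Csum a) l -> CSeries a = l.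
Proof.
  intros [A B]. unfold CSeries. apply C_ext; simpl; unfold Series.
  - rewrite (Lim_seq_ext _ _ (Csum_Re a)), (Lim_seq_incr_1 (fun n => Re (Csum a n))), (is_lim_seq_unique _ _ A). reflexivity.
  - rewrite (Lim_seq_ext _ _ (Csum_Im a)), (Lim_seq_incr_1 (fun n => Im (Csum a n))), (is_lim_seq_unique _ _ B). reflexivity.
Qed.

Definition Psi (b : C) (x : R) : C := Psi01 (- (1 / 2)) b x.

Lemma LIg_pow c lam r n : 0 < c -> LIg c 0 (lam + RtoC (INR n)) r = (LIs c r ^ n * LIg c 0 lam r)%C.
Proof.
  intros Hc. induction n.
  - simpl. rewrite Cplus_0_r. ring.
  - rewrite S_INR, RtoC_plus, Cplus_assoc, LIg_S, IHn by auto. simpl. ring.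
Qed.

Lemma LIg_sum_ok c x lam N : 0 < c ->
  (exists g, Cok WR (fun r => LIg c 0 lam r * Texp N (RtoC x * LIs c r))%C g) /\
  IntW WR (fun r => LIg c 0 lam r * Texp N (RtoC x * LIs c r))%C =
   Csum (fun n => RtoC (x ^ n) / RtoC (INR (fact n)) * LI c 0 (lam + RtoC (INR n)))%C N.
Proof.
  intros Hc. induction N.
  - assert (O : Cok WR (fun r => LIg c 0 lam r * Texp 0 (RtoC x * LIs c r))%C (fun r => Cmod 0 * LIbound c 0 lam r)).
    { eapply Cok_ext; [| |apply (Cok_scal _ _ _ 0%C (LIg_ok c 0 lam Hc))].
      - intros r _. unfold Texp; simpl. apply cC_mult. apply LIg_cont. apply cC_const.
      - intros r _. unfold Texp; simpl. ring. }
    split. eexists; exact O. simpl.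
    rewrite (IntW_ext _ _ (fun r => 0 * LIg c 0 lam r)%C) by (intros; unfold Texp; simpl; ring).
    rewrite (IntW_scal _ _ _ _ (LIg_ok c 0 lam Hc)). ring.
  - destruct IHN as [[g Hg] E].
    set (k := (RtoC (x ^ N) / RtoC (INR (fact N)))%C).
    assert (O2 := Cok_scal _ _ _ k (LIg_ok c 0 (lam + RtoC (INR N)) Hc)).
    assert (X : forall r, (LIg c 0 lam r * Texp N (RtoC x * LIs c r) + k * LIg c 0 (lam + RtoC (INR N)) r)%C = (LIg c 0 lam r * Texp (S N) (RtoC x * LIs c r))%C).
    { intros r. rewrite LIg_pow by auto. unfold Texp; simpl. unfold k. rewrite Cpow_mult_distr', RtoC_pow. unfold Cdiv. ring. }
    split.
    + exists (fun r => g r + Cmod k * LIbound c 0 (lam + RtoC (INR N)) r).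
      assert (O3 := Cok_plus _ _ _ _ _ Hg O2).
      replace (fun r => LIg c 0 lam r * Texp (S N) (RtoC x * LIs c r))%C with (fun r => LIg c 0 lam r * Texp N (RtoC x * LIs c r) + k * LIg c 0 (lam + RtoC (INR N)) r)%C; auto.
      apply functional_extensionality; auto.
    + rewrite <- (IntW_ext _ _ _ (fun r _ => X r)), (IntW_plus _ _ _ _ _ Hg O2), E.
      rewrite (IntW_scal _ _ _ _ (LIg_ok c 0 (lam + RtoC (INR N)) Hc)). reflexivity.
Qed.

Lemma Cmod_LIs c r : 0 < c -> Cmod (LIs c r) <= c * (1 + Rabs r).
Proof.
  intros Hc. eapply Rle_trans; [apply Cmod_le_sum|]. unfold LIs; simpl. rewrite Rabs_mult, (Rabs_pos_eq c) by lra. lra.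
Qed.

(** Termwise integration of the series of e^(x s): by [Cexp_Texp] the error of the N-th partial sum
    is 2^(- N) times one fixed integrable majorant. *)
Lemma LI_sum_lim c x lam : 0 < c ->
  limC (Csum (fun n => RtoC (x ^ n) / RtoC (INR (fact n)) * LI c 0 (lam + RtoC (INR n)))%C) (LI c x lam).
Proof.
  intros Hc.
  set (A := 5 * (Rabs x * c)). assert (HA : 0 <= A) by (unfold A; generalize (Rabs_pos x); nra).
  set (K0 := exp (c ^ 2 + 0 * c + Re lam * ln c + 2 * Rabs (Im lam)) * exp A).
  set (G := fun r => K0 * exp ((Rabs (Re lam) + A) * Rabs r - c ^ 2 * r ^ 2)).
  assert (HG : Rok WR G). { apply Rok_scal. apply Rmult_le_pos; left; apply exp_pos. apply Rok_gauss. apply pow_lt; auto. }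
  apply limC_Cmod0. apply (limR_squeeze0 _ (fun N => 2 * RIntW WR G * (/ 2) ^ N)).
  { replace (Finite 0) with (Finite (2 * RIntW WR G * 0)) by (f_equal; ring). apply is_lim_seq_mult'. apply is_lim_seq_const.
    apply is_lim_seq_geom. rewrite Rabs_pos_eq; lra. }
  intros N. split. apply Cmod_ge_0.
  destruct (LIg_sum_ok c x lam N Hc) as [[g Hg] E]. rewrite <- E. unfold LI.
  rewrite Cmod_minus_sym, <- (IntW_minus _ _ _ _ _ (LIg_ok c x lam Hc) Hg).
  assert (P2 : 0 < (/ 2) ^ N) by (apply pow_lt; lra).
  replace (2 * RIntW WR G * (/ 2) ^ N) with (2 * RIntW WR (fun r => (/ 2) ^ N * G r)) by (rewrite RIntW_scal by auto; ring).
  apply IntW_bound. split; [apply Rok_scal; auto; lra|split].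
  - intros r Hr. apply cC_minus. apply LIg_cont. apply Hg; auto.
  - intros r _.
    replace (LIg c x lam r - LIg c 0 lam r * Texp N (RtoC x * LIs c r))%C with (LIg c 0 lam r * (Cexp (RtoC x * LIs c r) - Texp N (RtoC x * LIs c r)))%C.
    + rewrite Cmod_mult. eapply Rle_trans.
      { apply Rmult_le_compat; try apply Cmod_ge_0. apply (LIg_ok c 0 lam Hc); auto. apply Cexp_Texp. }
      unfold LIbound, G, K0. rewrite Cmod_mult, Cmod_RtoC.
      assert (Q := Cmod_LIs c r Hc). assert (Px := Rabs_pos x).
      assert (Q2 : exp (5 * (Rabs x * Cmod (LIs c r))) <= exp (A + A * Rabs r)). { apply exp_le. unfold A. nra. }
      rewrite exp_plus in Q2.
      set (e0 := exp (c ^ 2 + 0 * c + Re lam * ln c + 2 * Rabs (Im lam))). assert (0 < e0) by apply exp_pos.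
      replace ((Rabs (Re lam) + A) * Rabs r - c ^ 2 * r ^ 2) with ((Rabs (Re lam) * Rabs r - c ^ 2 * r ^ 2) + A * Rabs r) by ring.
      rewrite (exp_plus (_ - _)).
      set (e1 := exp (Rabs (Re lam) * Rabs r - c ^ 2 * r ^ 2)). assert (0 < e1) by apply exp_pos.
      apply Rle_trans with (e0 * e1 * ((/ 2) ^ N * (exp A * exp (A * Rabs r)))). 2: right; ring.
      apply Rmult_le_compat_l. nra. apply Rmult_le_compat_l; lra.
    + unfold LIg. replace (LIs c r * LIs c r + RtoC x * LIs c r + lam * (RtoC (ln c) + cl r))%C
        with ((LIs c r * LIs c r + RtoC 0 * LIs c r + lam * (RtoC (ln c) + cl r)) + RtoC x * LIs c r)%C by ring.
      rewrite (Cexp_add (_ + _ + _)). ring.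
Qed.

(** The coefficient 1/Gamma(b - n/2) is a line integral with the power s^(1 - 2 b + n), so the
    series in x sums to e^(x s) under the integral. *)
Lemma Psi_LI c b x : 0 < c -> Psi b x = (RtoC (c / PI) * LI c x (1 - 2 * b))%C.
Proof.
  intros Hc. unfold Psi, Psi01. apply CSeries_lim.
  eapply limC_ext; [|apply limC_mult; [apply limC_const|apply (LI_sum_lim c x (1 - 2 * b)%C Hc)]].
  intros N. cbv beta. rewrite <- Csum_scal. apply Csum_ext. intros n _.
  rewrite (rGamma_Kc c) by auto. unfold Kc.
  replace (1 - 2 * (RtoC (- (1 / 2) * INR n) + b))%C with (1 - 2 * b + RtoC (INR n))%C.
  - unfold Cdiv. ring.
  - replace (- (1 / 2) * INR n) with (- (/ 2 * INR n)) by field. rewrite RtoC_opp, RtoC_mult.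
    assert (Y : (RtoC 2 * RtoC (/ 2) = 1)%C) by (rewrite <- RtoC_mult; f_equal; field).
    transitivity (1 - 2 * b + (RtoC 2 * RtoC (/ 2)) * RtoC (INR n))%C. rewrite Y; ring. ring.
Qed.

Lemma Psi_rec b x : (2 * Psi (b - 1) x + RtoC x * Psi (b - half) x + (2 - 2 * b) * Psi b x = 0)%C.
Proof.
  rewrite !(Psi_LI 1) by lra. assert (E := LI_rec 1 x (1 - 2 * b) ltac:(lra)).
  replace (1 - 2 * (b - 1))%C with (1 - 2 * b + 2)%C by ring.
  replace (1 - 2 * (b - half))%C with (1 - 2 * b + 1)%C.
  2: { transitivity (1 - 2 * b + 2 * half)%C. rewrite half_2; ring. ring. }
  replace (2 - 2 * b)%C with (1 - 2 * b + 1)%C by (rewrite RtoC_2; ring).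
  transitivity (RtoC (1 / PI) * (2 * LI 1 x (1 - 2 * b + 2) + RtoC x * LI 1 x (1 - 2 * b + 1) + (1 - 2 * b + 1) * LI 1 x (1 - 2 * b)))%C. ring.
  rewrite E. ring.
Qed.

Lemma LIbound_mono c x x' lam r : 0 < c -> x <= x' -> LIbound c x lam r <= LIbound c x' lam r.
Proof.
  intros Hc H. unfold LIbound. apply Rmult_le_compat_r. left; apply exp_pos. apply exp_le. nra.
Qed.

(** Differentiation brings down a factor s, which raises the power 1 - 2 b by one, that is, lowers b
    by 1/2. *)
Lemma Psi_dC b x : dC (Psi b) x (Psi (b - half) x).
Proof.
  apply (dC_ext (fun x => RtoC (1 / PI) * LI 1 x (1 - 2 * b))%C). { intros; symmetry; apply Psi_LI; lra. }
  rewrite (Psi_LI 1) by lra.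
  replace (1 - 2 * (b - half))%C with (1 - 2 * b + 1)%C.
  2: { transitivity (1 - 2 * b + 2 * half)%C. rewrite half_2; ring. ring. }
  evar_last. apply dC_mult. apply dC_const.
  - apply (dC_IntW WR (fun x r => LIg 1 x (1 - 2 * b) r) (fun x r => LIg 1 x (1 - 2 * b + 1) r) (LIbound 1 (x + 1) (1 - 2 * b + 1)) (x - 1) (x + 1)).
    + lra.
    + intros. eexists. apply LIg_ok. lra.
    + intros y r _ _. rewrite LIg_S by lra. unfold LIg. evar_last. apply dC_Cexp. apply dC_plus. apply dC_plus. apply dC_const.
      apply dC_mult. apply dC_RtoC. apply dR_id. apply dC_const. apply dC_const.
      cbv beta. ring.
    + intros y r _ _. unfold LIg, LIs. apply cC_Cexp. apply cC_plus; [cont|]. apply cC_mult. apply cC_const. apply cC_plus. apply cC_const.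
      apply (cC_comp snd cl). cont. apply contC_cl.
    + apply LIg_ok. lra.
    + intros y r Hy _. eapply Rle_trans. apply (LIg_ok 1 y (1 - 2 * b + 1)); auto; lra. apply LIbound_mono; lra.
  - cbv beta. change (IntW WR (fun r : R => LIg 1 x (1 - 2 * b + 1) r)) with (LI 1 x (1 - 2 * b + 1)). ring.
Qed.

Lemma Psi_cont b x : contC (Psi b) x.
Proof. apply (dC_cont _ _ _ (Psi_dC b x)). Qed.

(** On the line with abscissa c the factor e^(- y s) has modulus e^(- c y), and c is free. *)
Lemma Psi_bound b c : 0 < c -> exists K, 0 <= K /\ forall y, Cmod (Psi b (- y)) <= K * exp (- c * y).
Proof.
  intros Hc. exists (c / PI * (2 * RIntW WR (LIbound c 0 (1 - 2 * b)))).
  assert (P := PI_RGT_0). assert (0 < c / PI) by (apply Rdiv_lt_0_compat; auto).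
  assert (O : Rok WR (LIbound c 0 (1 - 2 * b))) by (apply LIg_ok; auto).
  split. { assert (Q := Rok_ge0 _ _ O). apply Rmult_le_pos; lra. }
  intros y. rewrite (Psi_LI c) by auto. rewrite Cmod_mult, Cmod_RtoC, Rabs_pos_eq, Rmult_assoc by lra. apply Rmult_le_compat_l. lra.
  eapply Rle_trans. apply IntW_bound. apply LIg_ok; auto.
  rewrite (RIntW_ext _ _ (fun r => exp (- c * y) * LIbound c 0 (1 - 2 * b) r)).
  - rewrite RIntW_scal by auto. right; ring.
  - intros r _. unfold LIbound. rewrite <- !exp_plus. f_equal. ring.
Qed.

(* Taking the contour through the saddle point [s = y/2] removes the oscillation of the exponent. *)
Definition Wf (lam : C) (Z : R) : C := IntW WR (fun r => Cexp (RtoC (- Z * r ^ 2) + lam * cl r))%C.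

(** The abscissa is chosen equal to z, where s^2 - 2 z s = - z^2 (1 + r^2) is real on the whole
    line. *)
Lemma Psi_saddle b z : 0 < z -> Psi b (- (2 * z)) =
  (RtoC (z / PI * exp (- z ^ 2)) * Rcpow z (1 - 2 * b) * Wf (1 - 2 * b) (z ^ 2))%C.
Proof.
  intros Hz. rewrite (Psi_LI z) by auto.
  set (lam := (1 - 2 * b)%C).
  assert (N : (RtoC (exp (- z ^ 2)) * Rcpow z lam)%C <> 0%C).
  { apply Cmult_neq_0. apply RtoC_neq0. generalize (exp_pos (- z ^ 2)); lra. apply Rcpow_ne0. }
  assert (X : forall r, Cexp (RtoC (- z ^ 2 * r ^ 2) + lam * cl r)%C = (/ (RtoC (exp (- z ^ 2)) * Rcpow z lam) * LIg z (- (2 * z)) lam r)%C).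
  { intros r. apply (Cmult_reg_l' (RtoC (exp (- z ^ 2)) * Rcpow z lam)%C); auto.
    rewrite Cmult_assoc, Cinv_r, Cmult_1_l by auto. unfold Rcpow, LIg. rewrite <- Cexp_R, <- !Cexp_add. f_equal.
    assert (Y : (LIs z r * LIs z r + RtoC (- (2 * z)) * LIs z r)%C = RtoC (- z ^ 2 + - z ^ 2 * r ^ 2)).
    { apply C_ext; simpl; ring. }
    rewrite Y, RtoC_plus. ring. }
  unfold Wf. rewrite (IntW_ext _ _ _ (fun r _ => X r)), (IntW_scal _ _ _ _ (LIg_ok z (- (2 * z)) lam Hz)). fold (LI z (- (2 * z)) lam).
  rewrite RtoC_mult. field.
  split; intros E; apply N; rewrite E; ring.
Qed.

(** * Collapsing the contour onto the imaginary axis *)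

(** [Ep] and [Em] are e^(s^2 + x s) s^lam at s = i r and s = - i r with log s = ln r + i PI/2 and ln
    r - i PI/2. [Gp] and [Gm] below are the same integrand at c + i r and c - i r before the limit c
    -> 0. *)
Definition Ep (lam : C) (x r : R) : C := Cexp ((- r ^ 2, x * r)%R + lam * (ln r, PI / 2)%R)%C.
Definition Em (lam : C) (x r : R) : C := Cexp ((- r ^ 2, - (x * r))%R + lam * (ln r, - (PI / 2))%R)%C.

Definition Gp (lam : C) (x c r : R) : C :=
  Cexp ((c, r) * (c, r) + RtoC x * (c, r) + lam * (ln (c ^ 2 + r ^ 2) / 2, PI / 2 - atan (c / r))%R)%C.
Definition Gm (lam : C) (x c r : R) : C :=
  Cexp ((c, - r)%R * (c, - r)%R + RtoC x * (c, - r)%R + lam * (ln (c ^ 2 + r ^ 2) / 2, - (PI / 2 - atan (c / r)))%R)%C.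

Lemma cl_scaled c r : 0 < c -> 0 < r ->
  (RtoC (ln c) + cl (/ c * r + 0))%C = (ln (c ^ 2 + r ^ 2) / 2, PI / 2 - atan (c / r))%R /\
  (RtoC (ln c) + cl (/ c * - r + 0))%C = (ln (c ^ 2 + r ^ 2) / 2, - (PI / 2 - atan (c / r)))%R.
Proof.
  intros Hc Hr.
  assert (L : ln c + ln (1 + (/ c * r) ^ 2) / 2 = ln (c ^ 2 + r ^ 2) / 2).
  { replace (c ^ 2 + r ^ 2) with (c * c * (1 + (/ c * r) ^ 2)) by (field; lra).
    assert (0 < 1 + (/ c * r) ^ 2) by (generalize (pow2_ge_0 (/ c * r)); lra).
    rewrite !ln_mult; try lra; nra. }
  assert (Q : 0 < c / r) by (apply Rdiv_lt_0_compat; auto).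
  assert (A : atan (/ c * r) = PI / 2 - atan (c / r)).
  { rewrite <- atan_inv by auto. f_equal. field. lra. }
  unfold cl. split; apply C_ext; simpl.
  - rewrite Rplus_0_r. simpl in L. exact L.
  - rewrite Rplus_0_r, A. ring.
  - replace (/ c * - r + 0) with (- (/ c * r)) by ring. simpl in L. rewrite <- L.
    replace (- (/ c * r) * (- (/ c * r) * 1)) with (/ c * r * (/ c * r * 1)) by ring. reflexivity.
  - replace (/ c * - r + 0) with (- (/ c * r)) by ring. rewrite atan_opp, A. ring.
Qed.

Lemma Psi_fold b x c : 0 < c -> Psi b x = (RtoC (/ PI) * IntW W0 (fun r => Gp (1 - 2 * b) x c r + Gm (1 - 2 * b) x c r))%C.
Proof.
  intros Hc. set (lam := (1 - 2 * b)%C).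
  assert (Pc : 0 < / c) by (apply Rinv_0_lt_compat; auto).
  destruct (IntW_subst_lin _ _ (/ c) 0 Pc (LIg_ok c x lam Hc)) as [A E].
  destruct (IntW_fold _ _ A) as [A2 E2]. rewrite E2 in E.
  rewrite (Psi_LI c b x Hc). fold lam. unfold LI. rewrite <- E.
  assert (P := PI_RGT_0).
  replace (RtoC (/ PI)) with (RtoC (c / PI) * RtoC (/ c))%C by (rewrite <- RtoC_mult; f_equal; field; lra).
  rewrite <- Cmult_assoc. f_equal.
  assert (NC : RtoC c <> 0%C) by (apply RtoC_neq0; lra).
  rewrite (IntW_ext W0 (fun r => Gp lam x c r + Gm lam x c r)%C (fun r => RtoC c * (RtoC (/ c) * LIg c x lam (/ c * r + 0)%R + RtoC (/ c) * LIg c x lam (/ c * - r + 0)%R))%C).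
  - rewrite (IntW_scal _ _ _ _ A2). rewrite Cmult_assoc, <- RtoC_mult, Rinv_l by lra. ring.
  - intros r Hr. apply inW0 in Hr. rewrite <- Cmult_plus_distr_l, Cmult_assoc, <- RtoC_mult, Rinv_r, Cmult_1_l by lra.
    destruct (cl_scaled c r Hc Hr) as [E3 E4].
    unfold Gp, Gm, LIg. rewrite E3, E4. f_equal; f_equal; f_equal.
    + replace (LIs c (/ c * r + 0)) with ((c, r) : C). reflexivity. unfold LIs. f_equal. field. lra.
    + replace (LIs c (/ c * - r + 0)) with ((c, - r)%R : C). reflexivity. unfold LIs. f_equal. field. lra.
Qed.

(** A majorant uniform in 0 <= c <= 1. Near r = 0 it behaves like r to the power min (Re lam, 0),
    which is integrable because Re lam > -1. *)
Lemma G_bound lam x c r : -1 < Re lam -> 0 <= c <= 1 -> 0 < r ->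
  exp (Re ((c, r) * (c, r) + RtoC x * (c, r) + lam * (ln (c ^ 2 + r ^ 2) / 2, PI / 2 - atan (c / r))%R)%C) <=
    exp (1 + Rabs x + 2 * Rabs (Im lam)) * exp (Rmin (Re lam) 0 * ln r + Rabs (Re lam) * r - r ^ 2) /\
  exp (Re ((c, - r)%R * (c, - r)%R + RtoC x * (c, - r)%R + lam * (ln (c ^ 2 + r ^ 2) / 2, - (PI / 2 - atan (c / r)))%R)%C) <=
    exp (1 + Rabs x + 2 * Rabs (Im lam)) * exp (Rmin (Re lam) 0 * ln r + Rabs (Re lam) * r - r ^ 2).
Proof.
  intros Hl Hc Hr.
  set (L := ln (c ^ 2 + r ^ 2) / 2). set (t := PI / 2 - atan (c / r)).
  assert (Ht : Rabs t <= 2).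
  { assert (0 <= atan (c / r)). { rewrite <- atan_0. destruct (Req_dec c 0). right. subst. f_equal. field; lra.
      left. apply atan_increasing. apply Rdiv_lt_0_compat; lra. }
    assert (Q := Ratan.atan_bound (c / r)). assert (P4 := PI_4). unfold t. rewrite Rabs_pos_eq; lra. }
  assert (HL : Re lam * L <= Rmin (Re lam) 0 * ln r + Rabs (Re lam) * r).
  { assert (L1 : ln r <= L). { unfold L. assert (ln (r * r) <= ln (c ^ 2 + r ^ 2)).
      { assert (r * r <= c ^ 2 + r ^ 2) by nra. destruct H. left; apply ln_increasing; nra. right; f_equal; auto. }
      rewrite ln_mult in H by auto. lra. }
    assert (L2 : L <= r).
    { unfold L. assert (Q := ln1r2_bound r). rewrite Rabs_pos_eq in Q by lra.
      assert (ln (c ^ 2 + r ^ 2) <= ln (1 + r ^ 2)).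
      { assert (c ^ 2 + r ^ 2 <= 1 + r ^ 2) by nra. destruct H. left; apply ln_increasing; nra. right; f_equal; auto. }
      lra. }
    unfold Rmin, Rabs. destruct Rle_dec; destruct Rcase_abs; nra. }
  assert (HI : forall u, Rabs u <= 2 -> - Im lam * u <= 2 * Rabs (Im lam)).
  { intros u Hu. eapply Rle_trans; [apply Rle_abs|]. rewrite Rabs_mult, Rabs_Ropp. generalize (Rabs_pos (Im lam)). nra. }
  assert (H1 := HI t Ht). assert (H2 := HI (- t) ltac:(rewrite Rabs_Ropp; auto)).
  assert (X : x * c <= Rabs x). { assert (Q := Rle_abs x). generalize (Rabs_pos x). nra. }
  split; rewrite <- exp_plus; apply exp_le; simpl; fold L t; unfold Re, Im in *; simpl; nra.
Qed.

(** For c = 1 / (n + 1) the folded line integral is always PI times [Psi b x], so its limit at c = 0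
    has the same value. Writing [Rabs c] makes the family two-sided, so that ordinary continuity at
    0 applies. *)
Lemma Psi_axis b x : Re b < 1 ->
  Cok W0 (fun r => Ep (1 - 2 * b) x r + Em (1 - 2 * b) x r)%C (fun r => 2 * exp (1 + Rabs x + 2 * Rabs (Im (1 - 2 * b))) * exp (Rmin (Re (1 - 2 * b)) 0 * ln r + Rabs (Re (1 - 2 * b)) * r - r ^ 2)) /\
  Psi b x = (RtoC (/ PI) * IntW W0 (fun r => Ep (1 - 2 * b) x r + Em (1 - 2 * b) x r))%C.
Proof.
  intros Hb. set (lam := (1 - 2 * b)%C).
  assert (Hl : -1 < Re lam) by (unfold lam; simpl; unfold Re in *; lra).
  set (h := fun r => 2 * exp (1 + Rabs x + 2 * Rabs (Im lam)) * exp (Rmin (Re lam) 0 * ln r + Rabs (Re lam) * r - r ^ 2)).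
  assert (Hh : Rok W0 h).
  { apply Rok_scal. assert (Q := exp_pos (1 + Rabs x + 2 * Rabs (Im lam))); lra. apply Rok_pow. unfold Rmin; destruct Rle_dec; lra. }
  set (F := fun c r : R => (Gp lam x (Rabs c) r + Gm lam x (Rabs c) r)%C).
  assert (KF : forall c r, 0 < r -> contC (fun p : R * R => F (fst p) (snd p)) (c, r)).
  { intros c r Hr. unfold F, Gp, Gm. cont; simpl; try lra; try (generalize (Rabs_pos c); nra). }
  assert (OF : forall c, Rabs c <= 1 -> Cok W0 (F c) h).
  { intros c Hc. split; [auto|split].
    - intros r Hr. apply inW0 in Hr. apply (contC_slice2 F). auto.
    - intros r Hr. apply inW0 in Hr. unfold F, h. eapply Rle_trans; [apply Cmod_triangle|].
      unfold Gp, Gm. rewrite !Cmod_Cexp.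
      destruct (G_bound lam x (Rabs c) r Hl) as [A B]; auto. split; auto. apply Rabs_pos. lra. }
  assert (C0 : contC (fun c => IntW W0 (F c)) 0).
  { apply (IntW_param_cont W0 F h).
    - intros r Hr. apply inW0 in Hr. auto.
    - exists (mkposreal 1 Rlt_0_1). intros c Hc. apply OF. change (Rabs (c - 0) < 1) in Hc. rewrite Rminus_0_r in Hc. lra. }
  assert (F0 : forall r, 0 < r -> F 0 r = (Ep lam x r + Em lam x r)%C).
  { intros r Hr. unfold F, Gp, Gm, Ep, Em. rewrite Rabs_R0.
    replace (0 / r) with 0 by (field; lra). rewrite atan_0.
    replace (ln (0 ^ 2 + r ^ 2) / 2) with (ln r). 2: { replace (0 ^ 2 + r ^ 2) with (r * r) by ring. rewrite ln_mult by auto. field. }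
    rewrite Rminus_0_r.
    f_equal; f_equal; f_equal; apply C_ext; simpl; ring. }
  split.
  - apply (Cok_ext W0 (F 0)).
    + intros r Hr. apply inW0 in Hr. unfold Ep, Em. cont.
    + intros r Hr. apply F0. apply inW0; auto.
    + apply OF. rewrite Rabs_R0; lra.
  - assert (L := limC_contR _ _ _ C0 lim_inv_S).
    assert (P := PI_RGT_0). assert (NP : RtoC (/ PI) <> 0%C) by (apply RtoC_neq0; apply Rinv_neq_0_compat; lra).
    rewrite (IntW_ext W0 _ (F 0)). 2: { intros r Hr. symmetry. apply F0. apply inW0; auto. }
    apply (limC_unique (fun n => RtoC (/ PI) * IntW W0 (F (/ (INR n + 1))%R))%C).
    + apply (limC_ext (fun _ => Psi b x)). 2: apply limC_const.
      intros n. assert (Q : 0 < / (INR n + 1)) by (apply Rinv_0_lt_compat; generalize (pos_INR n); lra).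
      rewrite (Psi_fold b x _ Q). unfold F. rewrite (Rabs_pos_eq (/ (INR n + 1))) by lra. reflexivity.
    + apply limC_mult. apply limC_const. auto.
Qed.

Lemma rGamma_Psi b : rGamma b = Psi b 0.
Proof. rewrite (rGamma_Kc 1), (Psi_LI 1) by lra. reflexivity. Qed.

(** At x = 0 the two half-axes differ only by the phases of (i r)^lam and (- i r)^lam; their sum is
    2 cos (PI (1/2 - z)) and the integral left is [Gam_axis] for 1 - z. *)
Lemma rGamma_reflect z : Re z < 1 ->
  rGamma z = (RtoC (/ (2 * PI)) * (Cexp (Ci * RtoC PI * (half - z)) + Cexp (- (Ci * RtoC PI * (half - z)))) * Gam (1 - z))%C.
Proof.
  intros Hz. rewrite rGamma_Psi. destruct (Psi_axis z 0 Hz) as [_ ->].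
  assert (Hw : 0 < Re (1 - z)) by (simpl; unfold Re in *; lra).
  destruct (Gam_axis _ Hw) as [A E].
  rewrite (IntW_ext _ _ (fun r => (Cexp (Ci * RtoC PI * (half - z)) + Cexp (- (Ci * RtoC PI * (half - z)))) * Cexp ((- r ^ 2, 0)%R + (2 * (1 - z) - 1) * RtoC (ln r)))%C).
  - rewrite (IntW_scal _ _ _ _ A), E.
    replace (RtoC (/ (2 * PI))) with (RtoC (/ PI) * half)%C. ring.
    unfold half. rewrite <- RtoC_mult. f_equal. field. assert (P := PI_RGT_0); lra.
  - intros r _. rewrite Cmult_plus_distr_r, <- !Cexp_add. unfold Ep, Em. f_equal; apply f_equal; apply C_ext; simpl; field.
Qed.

(** * Principal values of exponentials against 1 / sinh *)

Definition kf (lam : C) (t y : R) : C := Cexp (lam * RtoC y - Ci * RtoC t * RtoC (exp y))%C.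
(* The principal value of [- k y / sinh y] over the real line, folded onto [y > 0]. *)
Definition PV (k : R -> C) : C := IntW W0 (fun y => (k (- y)%R - k y) / RtoC (sinh y))%C.
(** The part of the principal value of [kf] that has no closed form. It enters with both signs of t
    and cancels in [Dn_base]. *)
Definition Sch (lam : C) (t : R) : C := IntW WR (fun u => Cexp (lam * RtoC u - RtoC t * RtoC (exp u)) / RtoC (cosh u))%C.

Definition Csh (z : C) : C := ((Cexp z - Cexp (- z)) / 2)%C.
Definition Cch (z : C) : C := ((Cexp z + Cexp (- z)) / 2)%C.

Lemma Csh_eq u v : Csh (u, v) = (sinh u * cos v, cosh u * sin v).
Proof.
  unfold Csh, Cexp, sinh, cosh. apply C_ext; simpl; rewrite cos_neg, sin_neg; field.
Qed.

Lemma cosh2 u : cosh u ^ 2 = 1 + sinh u ^ 2.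
Proof.
  unfold cosh, sinh. assert (E : exp u * exp (- u) = 1) by (rewrite <- exp_plus, Rplus_opp_r; apply exp_0).
  transitivity ((exp u ^ 2 + exp (- u) ^ 2 + 2 * (exp u * exp (- u))) / 4). field. rewrite E.
  transitivity (1 + (exp u ^ 2 + exp (- u) ^ 2 - 2 * (exp u * exp (- u))) / 4). rewrite E. field. field.
Qed.

Lemma Csh_mod u v : Cmod (Csh (u, v)) = sqrt (sinh u ^ 2 + sin v ^ 2).
Proof.
  rewrite Csh_eq. unfold Cmod. f_equal. simpl fst; simpl snd.
  rewrite !Rpow_mult_distr, cosh2. assert (E := sin2_cos2 v). unfold Rsqr in E.
  replace (cos v ^ 2) with (1 - sin v ^ 2) by (simpl; lra). ring.
Qed.

Lemma Csh_ge1 u v : Rabs (sinh u) <= Cmod (Csh (u, v)).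
Proof.
  rewrite Csh_mod, <- (sqrt_Rsqr_abs (sinh u)). apply sqrt_le_1_alt. unfold Rsqr. generalize (pow2_ge_0 (sin v)). nra.
Qed.
Lemma Csh_ge2 u v : Rabs (sin v) <= Cmod (Csh (u, v)).
Proof.
  rewrite Csh_mod, <- (sqrt_Rsqr_abs (sin v)). apply sqrt_le_1_alt. unfold Rsqr. generalize (pow2_ge_0 (sinh u)). nra.
Qed.

Lemma sinh_abs u : Rabs (sinh u) = sinh (Rabs u).
Proof.
  unfold sinh. unfold Rabs at 2 3. destruct (Rcase_abs u).
  - assert (exp u < exp (- u)) by (apply exp_increasing; lra). rewrite Rabs_left by lra. rewrite Ropp_involutive. field.
  - assert (exp (- u) <= exp u) by (apply exp_le; lra). rewrite Rabs_pos_eq by lra. auto.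
Qed.

Lemma sinh_ge_half u : 0 <= u -> u / 2 <= sinh u.
Proof.
  intros H. unfold sinh. assert (Q := exp_ineq1_le u). assert (exp (- u) <= 1). { rewrite <- exp_0. apply exp_le; lra. } lra.
Qed.

Lemma sinh_ge_exp u : 1 <= u -> exp u / 4 <= sinh u.
Proof.
  intros H. unfold sinh. assert (Q := exp_ineq1_le (2 * u)).
  assert (E : exp (- u) * exp (2 * u) = exp u) by (rewrite <- exp_plus; f_equal; ring).
  assert (P := exp_pos (- u)). nra.
Qed.

Lemma sinh_pos u : 0 < u -> 0 < sinh u.
Proof. intros H. assert (Q := sinh_ge_half u). lra. Qed.

Lemma cosh_ge u : exp (Rabs u) / 2 <= cosh u.
Proof.
  unfold cosh. assert (P := exp_pos u). assert (Q := exp_pos (- u)). unfold Rabs; destruct Rcase_abs; lra.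
Qed.
Lemma cosh_pos u : 0 < cosh u.
Proof. assert (Q := cosh_ge u). generalize (exp_pos (Rabs u)). lra. Qed.

(** The derivative cos is at least 1/2 on [0, 1], as 1 <= PI/3. *)
Lemma sin_ge_half d : 0 <= d <= 1 -> d / 2 <= sin d.
Proof.
  intros H. destruct (MVT_gen sin 0 d cos) as [c [Hc E]].
  - intros; apply is_derive_sin.
  - intros x _. apply continuity_pt_filterlim. apply continuous_sin.
  - rewrite Rmin_left, Rmax_right in Hc by lra. rewrite sin_0 in E.
    assert (Q := cos_ge_abs c 1). rewrite (Rabs_pos_eq 1), (Rabs_pos_eq c) in Q by lra.
    assert (P3 := PI2_3_2). specialize (Q ltac:(lra) ltac:(lra)).
    assert (cos (PI / 3) <= cos 1). { apply cos_ge_abs; rewrite !Rabs_pos_eq; lra. }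
    rewrite cos_PI3 in H0. nra.
Qed.

Lemma sech_ok : Rok WR (fun u => / cosh u).
Proof.
  apply (Rok_le _ _ _ (Rok_scal _ _ 2 ltac:(lra) (Rok_exp_abs 1 ltac:(lra)))).
  - intros u _. apply cR_inv. generalize (cosh_pos u); lra. unfold cosh. cont. lra.
  - intros u _. assert (P := cosh_pos u). assert (Q := cosh_ge u). split. left; apply Rinv_0_lt_compat; auto.
    replace (- (1) * Rabs u) with (- Rabs u) by ring. rewrite exp_Ropp. assert (E := exp_pos (Rabs u)).
    replace (2 * / exp (Rabs u)) with (/ (exp (Rabs u) / 2)) by (field; lra). apply Rinv_le_contravar; lra.
Qed.

Lemma sech_int : RIntW WR (fun u => / cosh u) = PI.
Proof.
  assert (E : IntW WR (fun u => RtoC (/ cosh u)) = (RtoC PI - RtoC 0)%C).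
  { eapply (IntW_FTC WR (fun u => RtoC (2 * atan (exp u)))).
    - apply Cok_real. apply sech_ok.
    - intros u _. apply dC_RtoC. evar_last. apply (is_derive_scal (fun u => atan (exp u)) u 2).
      apply (is_derive_comp atan exp). apply is_derive_atan. apply is_derive_exp.
      unfold scal; simpl; unfold mult; simpl. unfold cosh. rewrite exp_Ropp. unfold Rsqr. assert (Q := exp_pos u). field.
      nra.
    - simpl wl. apply limC_RtoC. replace (Finite 0) with (Finite (2 * atan 0)) by (rewrite atan_0; f_equal; ring).
      apply is_lim_seq_mult'. apply is_lim_seq_const.
      apply (is_lim_seq_continuous atan (fun n => exp (- INR n)) 0).
      apply continuity_pt_filterlim. change (continuous atan 0). cont. apply is_lim_seq_exp_neg. apply is_lim_seq_INR.
    - simpl wr. apply limC_RtoC.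
      apply (is_lim_seq_ext (fun n => PI - 2 * atan (exp (- INR n)))).
      { intros n. rewrite exp_Ropp, atan_inv by apply exp_pos. field. }
      replace (Finite PI) with (Finite (PI - 2 * atan 0)) by (rewrite atan_0; f_equal; ring).
      apply is_lim_seq_minus'. apply is_lim_seq_const. apply is_lim_seq_mult'. apply is_lim_seq_const.
      apply (is_lim_seq_continuous atan (fun n => exp (- INR n)) 0).
      apply continuity_pt_filterlim. change (continuous atan 0). cont. apply is_lim_seq_exp_neg. apply is_lim_seq_INR. }
  rewrite IntW_real in E by apply sech_ok. apply (f_equal Re) in E. simpl in E. lra.
Qed.

Lemma IntW_conj w f g : Cok w f g -> IntW w (fun y => Cconj (f y)) = Cconj (IntW w f).
Proof.
  intros H. assert (L := IntW_lim _ _ _ H).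
  apply (IntW_is w _ g).
  - destruct H as [A [B D]]. split; [auto|split].
    + intros x Hx. destruct (B x Hx). split; simpl; auto. apply cR_opp. auto.
    + intros x Hx. rewrite Cmod_conj. auto.
  - destruct L as [L1 L2]. split.
    + eapply is_lim_seq_ext; [|exact L1]. intros n. reflexivity.
    + eapply is_lim_seq_ext; [|exact (proj1 (is_lim_seq_opp _ _) L2)]. intros n. unfold CInt; simpl.
      symmetry. apply (RInt_opp (V:=RV) (fun t => Im (f t))).
      apply contOn_exIm; auto. eapply Cok_contOn; eauto.
Qed.

Lemma Cconj_Cexp z : Cconj (Cexp z) = Cexp (Cconj z).
Proof. destruct z as [a b]. apply C_ext; simpl; rewrite ?cos_neg, ?sin_neg; ring. Qed.

Lemma Cconj_invol z : Cconj (Cconj z) = z.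
Proof. unfold Cconj; simpl. destruct z; simpl. f_equal. ring. Qed.

Section LemmaP.
Variables (lam : C) (t : R).
Hypotheses (Hlam : Rabs (Re lam) < 1) (Ht : 0 < t).
Let eta := 1 - Rabs (Re lam).
Let eta_pos : 0 < eta. Proof. unfold eta; lra. Qed.
Let NE (u v : R) : C := Cexp (lam * (u, v) - Ci * RtoC t * Cexp (u, v))%C.
(** Subtracting the value of the numerator at z = 0 removes the pole of 1 / sinh; as sinh is odd,
    the subtracted constant drops out when the integral is folded. On Im z = - PI/2 one has sinh z =
    - i cosh u and e^(- i t e^z) becomes the decaying e^(- t e^u). *)
Let Phi (u v : R) : C := ((NE u v - Cexp (- (Ci * RtoC t))) / Csh (u, v))%C.

Lemma NE_bound u v : - (PI / 2) <= v <= 0 -> Cmod (NE u v - Cexp (- (Ci * RtoC t))) <= (exp (2 * Rabs (Im lam)) + 1) * exp (Rabs (Re lam) * Rabs u).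
Proof.
  intros Hv. eapply Rle_trans; [apply Cmod_triang_minus|].
  unfold NE. rewrite !Cmod_Cexp. rewrite Rmult_plus_distr_r. apply Rplus_le_compat.
  - rewrite <- exp_plus. apply exp_le.
    assert (S : sin v <= 0). { assert (P := PI_RGT_0). assert (0 <= sin (- v)) by (apply sin_ge_0; lra). rewrite sin_neg in H. lra. }
    assert (E := exp_pos u). assert (P4 := PI_4).
    assert (A : Re lam * u <= Rabs (Re lam) * Rabs u). { rewrite <- Rabs_mult. apply Rle_abs. }
    assert (B : - Im lam * v <= 2 * Rabs (Im lam)).
    { eapply Rle_trans; [apply Rle_abs|]. rewrite Rabs_mult, Rabs_Ropp.
      assert (Rabs v <= 2) by (rewrite Rabs_left1; lra). generalize (Rabs_pos (Im lam)). nra. }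
    assert (D : t * (exp u * sin v) <= 0). { assert (0 <= exp u * (- sin v)) by nra. nra. }
    simpl. unfold Re, Im in *. nra.
  - replace (Re (- (Ci * RtoC t))) with 0 by (simpl; ring). rewrite Rmult_1_l. apply exp_le.
    apply Rmult_le_pos; apply Rabs_pos.
Qed.

Lemma Phi_far u v : 1 <= Rabs u -> - (PI / 2) <= v <= 0 -> Cmod (Phi u v) <= 4 * (exp (2 * Rabs (Im lam)) + 1) * exp (- eta * Rabs u).
Proof.
  intros Hu Hv. assert (B := NE_bound u v Hv).
  assert (S := Csh_ge1 u v). rewrite sinh_abs in S. assert (S2 := sinh_ge_exp _ Hu). assert (E := exp_pos (Rabs u)).
  unfold Phi. rewrite Cmod_div. 2: { intros Z. rewrite Z, Cmod_0 in S. lra. }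
  apply (Rmult_le_reg_r (Cmod (Csh (u, v)))). lra.
  unfold Rdiv. rewrite Rmult_assoc, Rinv_l, Rmult_1_r by lra. eapply Rle_trans; [exact B|].
  replace (exp (- eta * Rabs u)) with (exp (Rabs (Re lam) * Rabs u) * / exp (Rabs u)).
  2: { rewrite <- exp_Ropp, <- exp_plus. f_equal. unfold eta. ring. }
  set (K := exp (2 * Rabs (Im lam)) + 1). assert (0 < K) by (unfold K; generalize (exp_pos (2 * Rabs (Im lam))); lra).
  assert (X := exp_pos (Rabs (Re lam) * Rabs u)).
  apply Rle_trans with (4 * K * (exp (Rabs (Re lam) * Rabs u) * / exp (Rabs u)) * (exp (Rabs u) / 4)).
  - right. field. lra.
  - apply Rmult_le_compat_l; [|lra]. apply Rmult_le_pos; [lra|]. apply Rmult_le_pos; [lra|]. left; apply Rinv_0_lt_compat; auto.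
Qed.

(** Numerator and sinh both vanish to first order at 0. The bound does not degenerate as v -> 0,
    which supplies the majorant for the limit in [P_eval]. *)
Lemma Phi_near u v : u <> 0 -> Rabs u <= 1 -> -1 <= v <= 0 ->
  Cmod (Phi u v) <= (let A := Cmod lam + 2 * t * exp 2 in 8 * A * exp (2 * A)) * exp 1 * exp (- eta * Rabs u).
Proof.
  intros Hu0 Hu Hv. set (A := Cmod lam + 2 * t * exp 2). cbv zeta.
  assert (HA : 0 <= A). { unfold A. generalize (Cmod_ge_0 lam) (exp_pos 2). nra. }
  set (z := (u, v) : C).
  assert (Z1 : Cmod z <= Rabs u + - v). { eapply Rle_trans; [apply Cmod_le_sum|]. unfold z. change (Re (u, v)) with u. change (Im (u, v)) with v. rewrite (Rabs_left1 v); lra. }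
  assert (Z0 := Cmod_ge_0 z).
  set (W := (lam * z - Ci * RtoC t * (Cexp z - 1))%C).
  assert (HW : Cmod W <= Cmod z * A).
  { unfold W. eapply Rle_trans; [apply Cmod_triang_minus|]. rewrite !Cmod_mult, Cmod_Ci, Cmod_RtoC, (Rabs_pos_eq t) by lra.
    assert (Q := Cexp_sub1_bound z). assert (exp (Cmod z) <= exp 2) by (apply exp_le; lra).
    unfold A. assert (E2 := exp_pos 2). assert (2 * Cmod z * exp (Cmod z) <= 2 * Cmod z * exp 2) by nra.
    assert (1 * t * Cmod (Cexp z - 1) <= t * (2 * Cmod z * exp 2)) by nra. nra. }
  assert (N : Cmod (NE u v - Cexp (- (Ci * RtoC t))) <= 2 * Cmod z * A * exp (2 * A)).
  { replace (NE u v - Cexp (- (Ci * RtoC t)))%C with (Cexp (- (Ci * RtoC t)) * (Cexp W - 1))%C.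
    - rewrite Cmod_mult, Cmod_Cexp. replace (Re (- (Ci * RtoC t))) with 0 by (simpl; ring). rewrite exp_0, Rmult_1_l.
      eapply Rle_trans; [apply Cexp_sub1_bound|].
      assert (Cmod W <= 2 * A) by nra. assert (exp (Cmod W) <= exp (2 * A)) by (apply exp_le; auto).
      assert (P1 := exp_pos (Cmod W)). assert (W0 := Cmod_ge_0 W).
      apply Rmult_le_compat; nra.
    - unfold NE, W. fold z. transitivity (Cexp (- (Ci * RtoC t)) * Cexp (lam * z - Ci * RtoC t * (Cexp z - 1)) - Cexp (- (Ci * RtoC t)))%C. ring.
      rewrite <- Cexp_add. f_equal. apply f_equal. ring. }
  assert (S : Cmod z <= 4 * Cmod (Csh z)).
  { assert (S1 := Csh_ge1 u v). rewrite sinh_abs in S1. assert (S1' := sinh_ge_half (Rabs u) (Rabs_pos u)).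
    assert (S2 := Csh_ge2 u v). assert (S2' := sin_ge_half (- v) ltac:(lra)). rewrite sin_neg in S2'.
    rewrite Rabs_left1 in S2 by lra. fold z in S1, S2. lra. }
  assert (Zp : 0 < Cmod z). { apply Cmod_gt_0. intros Z. injection Z. auto. }
  unfold Phi. fold z. rewrite Cmod_div. 2: { intros Z. rewrite Z, Cmod_0 in S. lra. }
  apply (Rmult_le_reg_r (Cmod (Csh z))). lra.
  unfold Rdiv. rewrite Rmult_assoc, Rinv_l, Rmult_1_r by lra. eapply Rle_trans; [exact N|].
  assert (X : 1 <= exp 1 * exp (- eta * Rabs u)).
  { rewrite <- exp_plus. apply Rle_trans with (exp 0); [rewrite exp_0; lra|]. apply exp_le. assert (eta <= 1) by (unfold eta; generalize (Rabs_pos (Re lam)); lra). generalize (Rabs_pos u). nra. }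
  assert (E := exp_pos (2 * A)).
  set (Y := exp 1 * exp (- eta * Rabs u)) in *.
  replace (8 * A * exp (2 * A) * exp 1 * exp (- eta * Rabs u) * Cmod (Csh z)) with (2 * A * exp (2 * A) * (4 * Cmod (Csh z)) * Y) by (unfold Y; ring).
  assert (Q : 0 <= 2 * A * exp (2 * A)) by (repeat apply Rmult_le_pos; lra).
  replace (2 * Cmod z * A * exp (2 * A)) with (2 * A * exp (2 * A) * Cmod z) by ring.
  apply Rle_trans with (2 * A * exp (2 * A) * (4 * Cmod (Csh z)) * 1).
  - rewrite Rmult_1_r. apply Rmult_le_compat_l; auto.
  - apply Rmult_le_compat_l; auto. apply Rmult_le_pos; lra.
Qed.

(** Cauchy's theorem between the heights - PI/2 and - d. Staying at distance d > 0 from the real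
    axis keeps sinh z away from 0 in the whole strip. *)
Lemma Phi_strip d : 0 < d <= 1 -> exists g, Cok WR (fun u => Phi u (- d)) g /\
  IntW WR (fun u => Phi u (- d)) = IntW WR (fun u => Phi u (- (PI / 2))).
Proof.
  intros Hd.
  assert (PI3 := PI2_3_2). assert (PI4 := PI_4).
  assert (Sd : 0 < sin d) by (apply sin_gt_0; lra). assert (Sd1 := proj2 (SIN_bound d)).
  assert (SV : forall v, - (PI / 2) <= v <= - d -> sin d <= Rabs (sin v)).
  { intros v Hv. rewrite <- Rabs_Ropp, <- sin_neg. rewrite Rabs_pos_eq by (apply sin_ge_0; lra).
    apply sin_incr_1; lra. }
  assert (NZ : forall u v, - (PI / 2) <= v <= - d -> Csh (u, v) <> 0%C).
  { intros u v Hv Z. assert (Q := Csh_ge2 u v). rewrite Z, Cmod_0 in Q. specialize (SV v Hv). lra. }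
  set (K := exp (2 * Rabs (Im lam)) + 1). assert (HK : 1 < K) by (unfold K; generalize (exp_pos (2 * Rabs (Im lam))); lra).
  set (K2 := 4 * K * exp 1 / sin d).
  assert (HK2 : 4 * K <= K2).
  { unfold K2. apply (Rmult_le_reg_r (sin d)); auto. unfold Rdiv. rewrite (Rmult_assoc _ (/ sin d)), Rinv_l, Rmult_1_r by lra.
    assert (1 <= exp 1) by (generalize (exp_ineq1_le 1); lra). nra. }
  set (g := fun u => K2 * exp (- eta * Rabs u)).
  exists g.
  assert (S : Cok WR (fun u => Phi u (- (PI / 2))) g /\ Cok WR (fun u => Phi u (- d)) g /\ IntW WR (fun u => Phi u (- (PI / 2))) = IntW WR (fun u => Phi u (- d))).
  { apply (strip_shift Phi (fun u v => (lam - Ci * RtoC t * Cexp (u, v)) * NE u v / Csh (u, v) - (NE u v - Cexp (- (Ci * RtoC t))) * Cch (u, v) / (Csh (u, v) * Csh (u, v)))%C).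
    - lra.
    - intros u v Hv. unfold Phi, NE. assert (N := NZ u v Hv).
      evar_last. apply dC_mult. apply dC_minus. apply dC_Cexp. apply dC_minus. apply dC_mult. apply dC_const. apply dC_pair1.
      apply dC_mult. apply dC_const. apply dC_Cexp, dC_pair1. apply dC_const.
      apply dC_inv. exact N. unfold Csh. apply dC_mult. apply dC_minus. apply dC_Cexp, dC_pair1. apply dC_Cexp, dC_opp, dC_pair1. apply dC_const.
      cbv beta. fold (Csh (u, v)). unfold Cch. field. auto.
    - intros u v Hv. unfold Phi, NE. assert (N := NZ u v Hv).
      evar_last. apply dC_mult. apply dC_minus. apply dC_Cexp. apply dC_minus. apply dC_mult. apply dC_const. apply dC_pair2.
      apply dC_mult. apply dC_const. apply dC_Cexp, dC_pair2. apply dC_const.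
      apply dC_inv. exact N. unfold Csh. apply dC_mult. apply dC_minus. apply dC_Cexp, dC_pair2. apply dC_Cexp, dC_opp, dC_pair2. apply dC_const.
      cbv beta. fold (Csh (u, v)). unfold Cch. field. auto.
    - intros u v Hv. assert (N := NZ u v Hv). assert (N2 := Cmult_neq_0 _ _ N N). unfold NE, Cch.
      assert (CS : contC (fun p : R * R => Csh (fst p, snd p)) (u, v)).
      { unfold Csh. cont. apply RtoC_neq0; lra. }
      repeat (first [exact CS | contstep]); auto. apply RtoC_neq0; lra.
    - apply Rok_scal. lra. apply Rok_exp_abs; auto.
    - intros u v Hv. unfold g. destruct (Rle_dec 1 (Rabs u)) as [H|H].
      + eapply Rle_trans; [apply (Phi_far u v H); lra|]. fold K. apply Rmult_le_compat_r; auto. left; apply exp_pos.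
      + unfold Phi. assert (N := NZ u v Hv). rewrite Cmod_div by auto.
        assert (B := NE_bound u v ltac:(lra)). fold K in B.
        assert (S1 := Csh_ge2 u v). specialize (SV v Hv).
        apply (Rmult_le_reg_r (Cmod (Csh (u, v)))). lra.
        unfold Rdiv at 1. rewrite Rmult_assoc, Rinv_l, Rmult_1_r by lra. eapply Rle_trans; [exact B|].
        assert (Y : exp (Rabs (Re lam) * Rabs u) <= exp 1 * exp (- eta * Rabs u)).
        { rewrite <- exp_plus. apply exp_le. unfold eta. nra. }
        apply Rle_trans with (K * (exp 1 * exp (- eta * Rabs u))). apply Rmult_le_compat_l; lra.
        set (Z := exp 1 * exp (- eta * Rabs u)) in *. assert (0 < Z). { unfold Z. apply Rmult_lt_0_compat; apply exp_pos. }
        apply Rle_trans with (K2 * exp (- eta * Rabs u) * sin d).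
        * unfold K2.
          replace (4 * K * exp 1 / sin d * exp (- eta * Rabs u) * sin d) with (4 * (K * Z)) by (unfold Z; field; lra). nra.
        * apply Rmult_le_compat_l; [|lra]. apply Rmult_le_pos. lra. left; apply exp_pos.
    - apply (is_lim_seq_ext (fun n => K2 * exp (- eta * INR n))). intros n. unfold g. rewrite (Rabs_pos_eq (INR n)) by apply pos_INR; auto. apply lim_exp_n; auto.
    - apply (is_lim_seq_ext (fun n => K2 * exp (- eta * INR n))). intros n. unfold g. rewrite Rabs_Ropp, (Rabs_pos_eq (INR n)) by apply pos_INR; auto. apply lim_exp_n; auto. }
  destruct S as [_ [S1 S2]]. split; auto.
Qed.

Lemma Sch_ok : Cok WR (fun u => Cexp (lam * RtoC u - RtoC t * RtoC (exp u)) / RtoC (cosh u))%C (fun u => 2 * exp (- eta * Rabs u)).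
Proof.
  split; [|split].
  - apply Rok_scal. lra. apply Rok_exp_abs; auto.
  - intros u _. assert (P := cosh_pos u). apply cC_div. apply RtoC_neq0; lra. cont. apply cC_RtoC. unfold cosh. cont. lra.
  - intros u _. assert (P := cosh_pos u). assert (Q := cosh_ge u).
    rewrite Cmod_div by (apply RtoC_neq0; lra). rewrite Cmod_Cexp, Cmod_RtoC, (Rabs_pos_eq (cosh u)) by lra.
    assert (E := exp_pos (Rabs u)).
    apply (Rmult_le_reg_r (cosh u)); auto. unfold Rdiv. rewrite Rmult_assoc, Rinv_l, Rmult_1_r by lra.
    apply Rle_trans with (2 * exp (- eta * Rabs u) * (exp (Rabs u) / 2)).
    + replace (2 * exp (- eta * Rabs u) * (exp (Rabs u) / 2)) with (exp (- eta * Rabs u + Rabs u)) by (rewrite exp_plus; field).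
      apply exp_le. simpl. assert (A : Re lam * u <= Rabs (Re lam) * Rabs u). { rewrite <- Rabs_mult. apply Rle_abs. }
      assert (X := exp_pos u). unfold eta. unfold Re in *. nra.
    + apply Rmult_le_compat_l; auto. apply Rmult_le_pos. lra. left; apply exp_pos.
Qed.

Lemma Phi_end : IntW WR (fun u => Phi u (- (PI / 2))) = (Ci * (Cexp (- (Ci * RtoC (PI / 2) * lam)) * Sch lam t - RtoC PI * Cexp (- (Ci * RtoC t))))%C.
Proof.
  assert (O1 := Sch_ok). assert (O2 := Cok_real _ _ sech_ok).
  assert (SI : IntW WR (fun u => RtoC (/ cosh u)) = RtoC PI) by (rewrite IntW_real, sech_int; [reflexivity|apply sech_ok]).
  rewrite <- SI. unfold Sch.
  rewrite <- (IntW_scal _ _ _ _ O1).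
  rewrite (Cmult_comm (IntW WR (fun u => RtoC (/ cosh u)))), <- (IntW_scal _ _ _ _ O2).
  rewrite <- (IntW_minus _ _ _ _ _ (Cok_scal _ _ _ _ O1) (Cok_scal _ _ _ _ O2)).
  set (f := fun u : R => (Cexp (- (Ci * RtoC (PI / 2) * lam)) * (Cexp (lam * RtoC u - RtoC t * RtoC (exp u)) / RtoC (cosh u)) - Cexp (- (Ci * RtoC t)) * RtoC (/ cosh u))%C).
  assert (O : exists g, Cok WR f g).
  { eexists. assert (Q := Cok_plus _ _ _ _ _ (Cok_scal _ _ _ (Cexp (- (Ci * RtoC (PI / 2) * lam))) O1) (Cok_scal _ _ _ (- Cexp (- (Ci * RtoC t)))%C O2)).
    replace f with (fun u : R => (Cexp (- (Ci * RtoC (PI / 2) * lam)) * (Cexp (lam * RtoC u - RtoC t * RtoC (exp u)) / RtoC (cosh u)) + - Cexp (- (Ci * RtoC t)) * RtoC (/ cosh u))%C).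
    exact Q. apply functional_extensionality. intros u. unfold f. ring. }
  destruct O as [g O]. match goal with |- _ = (Ci * ?I)%C => change I with (IntW WR f) end.
  rewrite <- (IntW_scal _ _ _ _ O). apply IntW_ext. intros u _.
  assert (P := cosh_pos u). assert (NC : RtoC (cosh u) <> 0%C) by (apply RtoC_neq0; lra).
  unfold Phi, NE, f. rewrite Csh_eq, cos_neg, sin_neg, cos_PI2, sin_PI2.
  replace ((sinh u * 0)%R, (cosh u * - (1))%R) with (- Ci * RtoC (cosh u))%C by (apply C_ext; simpl; ring).
  replace (Cexp (u, - (PI / 2))) with (- Ci * RtoC (exp u))%C.
  2: { unfold Cexp; simpl. rewrite cos_neg, sin_neg, cos_PI2, sin_PI2. apply C_ext; simpl; ring. }
  rewrite RtoC_inv by lra.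
  assert (I2 : (Ci * Ci = - (1))%C) by (apply C_ext; simpl; ring).
  replace (lam * (u, (- (PI / 2))%R) - Ci * RtoC t * (- Ci * RtoC (exp u)))%C with (- (Ci * RtoC (PI / 2) * lam) + (lam * RtoC u - RtoC t * RtoC (exp u)))%C.
  - rewrite (Cexp_add (- (Ci * RtoC (PI / 2) * lam))).
    assert (IV : (/ (- Ci * RtoC (cosh u)) = Ci * / RtoC (cosh u))%C).
    { assert (NI : (- Ci * RtoC (cosh u))%C <> 0%C) by (apply Cmult_neq_0; auto; intros Z; injection Z; lra).
      apply (Cmult_reg_l' (- Ci * RtoC (cosh u))%C); auto.
      rewrite Cinv_r by auto. replace (- Ci * RtoC (cosh u) * (Ci * / RtoC (cosh u)))%C with (- (Ci * Ci) * (RtoC (cosh u) * / RtoC (cosh u)))%C by ring.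
      rewrite I2, Cinv_r by auto. ring. }
    unfold Cdiv. rewrite IV. ring.
  - replace ((u, - (PI / 2)) : C) with (RtoC u - Ci * RtoC (PI / 2))%C by (apply C_ext; simpl; ring).
    transitivity (- (Ci * RtoC (PI / 2) * lam) + (lam * RtoC u + (Ci * Ci) * RtoC t * RtoC (exp u)))%C. rewrite I2; ring. ring.
Qed.

(** Fold the line at height - d onto u > 0 and let d -> 0: at d = 0 the folded [Phi] is minus the
    integrand of [PV]. The value for each d > 0 is the one computed at height - PI/2. *)
Lemma P_eval : PV (kf lam t) = (- (Ci * (Cexp (- (Ci * RtoC (PI / 2) * lam)) * Sch lam t - RtoC PI * Cexp (- (Ci * RtoC t)))))%C.
Proof.
  rewrite <- Phi_end.
  set (F := fun c u : R => (Phi u (- Rabs c)%R + Phi (- u)%R (- Rabs c)%R)%C).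
  set (A := Cmod lam + 2 * t * exp 2).
  set (K := 4 * (exp (2 * Rabs (Im lam)) + 1) + 8 * A * exp (2 * A) * exp 1).
  assert (PI3 := PI2_3_2).
  assert (HA : 0 <= A). { unfold A. generalize (Cmod_ge_0 lam) (exp_pos 2). nra. }
  assert (P1 := exp_pos (2 * Rabs (Im lam))). assert (P2 := exp_pos (2 * A)). assert (P3 := exp_pos 1).
  assert (K1 : 0 <= 8 * A * exp (2 * A) * exp 1) by (repeat apply Rmult_le_pos; lra).
  assert (HK : 0 <= K) by (unfold K; lra).
  assert (B : forall u v, u <> 0 -> -1 <= v <= 0 -> Cmod (Phi u v) <= K * exp (- eta * Rabs u)).
  { intros u v Hu Hv. assert (E := exp_pos (- eta * Rabs u)). destruct (Rle_dec 1 (Rabs u)) as [H|H].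
    - eapply Rle_trans; [apply (Phi_far u v H); lra|]. apply Rmult_le_compat_r. lra. unfold K; lra.
    - eapply Rle_trans; [apply (Phi_near u v Hu); lra|]. cbv zeta. fold A. apply Rmult_le_compat_r. lra. unfold K; lra. }
  assert (NZ : forall u v, u <> 0 -> Csh (u, v) <> 0%C).
  { intros u v Hu Z. assert (Q := Csh_ge1 u v). rewrite Z, Cmod_0, sinh_abs in Q.
    assert (S := sinh_pos (Rabs u) (Rabs_pos_lt _ Hu)). lra. }
  assert (KF : forall c u, 0 < u -> contC (fun p : R * R => F (fst p) (snd p)) (c, u)).
  { intros c u Hu.
    assert (CS : contC (fun p : R * R => Csh (snd p, - Rabs (fst p))%R) (c, u)) by (unfold Csh; cont; apply RtoC_neq0; lra).
    assert (CS2 : contC (fun p : R * R => Csh (- snd p, - Rabs (fst p))%R) (c, u)) by (unfold Csh; cont; apply RtoC_neq0; lra).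
    unfold F, Phi, NE. repeat (first [exact CS | exact CS2 | contstep]); simpl; apply NZ; lra. }
  set (h := fun u => 2 * K * exp (- eta * u)).
  assert (Hh : Rok W0 h). { apply Rok_scal. lra. apply Rok_exp0; auto. }
  assert (OF : forall c, Rabs c <= 1 -> Cok W0 (F c) h).
  { intros c Hc. split; [auto|split].
    - intros u Hu. apply inW0 in Hu. apply (contC_slice2 F). auto.
    - intros u Hu. apply inW0 in Hu. unfold F, h. eapply Rle_trans; [apply Cmod_triangle|].
      assert (RC := Rabs_pos c).
      assert (B1 := B u (- Rabs c) ltac:(lra) ltac:(lra)). assert (B2 := B (- u) (- Rabs c) ltac:(lra) ltac:(lra)).
      rewrite Rabs_Ropp in B2. rewrite (Rabs_pos_eq u) in * by lra. lra. }
  assert (C0 : contC (fun c => IntW W0 (F c)) 0).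
  { apply (IntW_param_cont W0 F h).
    - intros r Hr. apply inW0 in Hr. auto.
    - exists (mkposreal 1 Rlt_0_1). intros c Hc. apply OF. change (Rabs (c - 0) < 1) in Hc. rewrite Rminus_0_r in Hc. lra. }
  assert (L := limC_contR _ _ _ C0 lim_inv_S).
  assert (E0 : IntW W0 (F 0) = IntW WR (fun u => Phi u (- (PI / 2)))).
  { eapply limC_unique. exact L. cbv beta.
    apply (limC_ext (fun _ => IntW WR (fun u => Phi u (- (PI / 2))))). 2: apply limC_const.
    intros n. assert (Pn := pos_INR n). assert (Q : 0 < / (INR n + 1)) by (apply Rinv_0_lt_compat; lra).
    assert (Q1 : / (INR n + 1) <= 1). { rewrite <- Rinv_1. apply Rinv_le_contravar; lra. }
    destruct (Phi_strip (/ (INR n + 1)) (conj Q Q1)) as [g [O E]]. rewrite <- E.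
    destruct (IntW_fold _ _ O) as [_ E2]. rewrite E2. unfold F. rewrite (Rabs_pos_eq (/ (INR n + 1))) by lra. reflexivity. }
  rewrite <- E0. unfold PV.
  rewrite (IntW_ext W0 _ (fun u => (-1) * F 0%R u)%C).
  - rewrite (IntW_scal _ _ _ _ (OF 0 ltac:(rewrite Rabs_R0; lra))). ring.
  - intros u Hu. apply inW0 in Hu. assert (S := sinh_pos u Hu).
    assert (NS : RtoC (sinh u) <> 0%C) by (apply RtoC_neq0; lra).
    unfold F, Phi. rewrite Rabs_R0, Ropp_0, !Csh_eq, cos_0, sin_0.
    replace ((sinh u * 1)%R, (cosh u * 0)%R) with (RtoC (sinh u)) by (apply C_ext; simpl; ring).
    replace (sinh (- u)) with (- sinh u) by (unfold sinh; rewrite Ropp_involutive; field).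
    replace ((- sinh u * 1)%R, (cosh (- u) * 0)%R) with (- RtoC (sinh u))%C by (apply C_ext; simpl; ring).
    assert (EN : forall y : R, NE y 0 = kf lam t y). { intros y. unfold NE, kf. rewrite <- (Cexp_R y). reflexivity. }
    rewrite !EN. field. auto.
Qed.
End LemmaP.

Lemma kf_cont lam t y : contC (kf lam t) y.
Proof. unfold kf. cont. Qed.

Lemma exp_ge1 x : 0 <= x -> 1 <= exp x.
Proof. intros H. rewrite <- exp_0 at 1. apply exp_le; auto. Qed.

(** For y < 1 the mean value bound on k(-y) - k(y) meets sinh y >= y/2; for y >= 1 the growth of k
    meets sinh y >= e^y / 4. Both cases fit under one exponential, which is the majorant for every
    principal value below. *)
Lemma PV_bound (k dk : R -> C) K c : 0 <= c ->
  (forall y, Rabs y <= 1 -> dC k y (dk y) /\ Cmod (dk y) <= K) ->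
  (forall y, 1 <= Rabs y -> Cmod (k y) <= K * exp ((1 - c) * Rabs y)) ->
  forall y, 0 < y -> Cmod ((k (- y)%R - k y) / RtoC (sinh y)) <= 8 * K * exp c * exp (- c * y).
Proof.
  intros Hc D B y Hy. assert (S := sinh_pos y Hy).
  assert (HK : 0 <= K) by (eapply Rle_trans; [apply Cmod_ge_0|apply (D 0); rewrite Rabs_R0; lra]).
  rewrite Cmod_div by (apply RtoC_neq0; lra). rewrite Cmod_RtoC, (Rabs_pos_eq (sinh y)) by lra.
  apply (Rmult_le_reg_r (sinh y)); auto. unfold Rdiv. rewrite Rmult_assoc, Rinv_l, Rmult_1_r by lra.
  assert (E1 : 1 <= exp c) by (rewrite <- exp_0 at 1; apply exp_le; lra).
  destruct (Rle_dec 1 y) as [H|H].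
  - assert (S4 := sinh_ge_exp y H).
    eapply Rle_trans; [apply Cmod_triang_minus|].
    assert (Q1 := B (- y)). assert (Q2 := B y). rewrite Rabs_Ropp in Q1. rewrite (Rabs_pos_eq y) in * by lra.
    apply Rle_trans with (8 * K * 1 * exp (- c * y) * (exp y / 4)).
    + replace (8 * K * 1 * exp (- c * y) * (exp y / 4)) with (2 * (K * exp ((1 - c) * y))).
      2: { replace ((1 - c) * y) with (- c * y + y) by ring. rewrite exp_plus. field. }
      specialize (Q1 H); specialize (Q2 H); lra.
    + assert (Ey := exp_pos (- c * y)). assert (Ey2 := exp_pos y). apply Rmult_le_compat; try lra. repeat apply Rmult_le_pos; lra.
      apply Rmult_le_compat_r. lra. apply Rmult_le_compat_l; lra.
  - assert (S2 := sinh_ge_half y ltac:(lra)).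
    assert (M := dC_mvt k dk K (- y) y ltac:(lra)). rewrite Cmod_minus_sym. eapply Rle_trans; [apply M|].
    + intros z Hz. apply D. apply Rabs_le; lra.
    + apply Rle_trans with (8 * K * 1 * (y / 2)). lra.
      assert (X : 1 <= exp c * exp (- c * y)).
      { rewrite <- exp_plus. rewrite <- exp_0 at 1. apply exp_le. nra. }
      apply (Rmult_le_compat_l (8 * K)) in X; [|lra]. apply Rmult_le_compat; lra.
Qed.

(** The dependence on t is kept explicit because [Dn_base] integrates over t = x r; linear growth in
    t is harmless against the Gaussian in r. *)
Lemma kf_diff_bound lam : Rabs (Re lam) < 1 -> exists K, 0 <= K /\ forall t y, 0 < y ->
  Cmod ((kf lam t (- y)%R - kf lam t y) / RtoC (sinh y)) <= K * (1 + Rabs t) * exp (- (1 - Rabs (Re lam)) * y).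
Proof.
  intros H. set (R0 := Rabs (Re lam)) in *. assert (HR : 0 <= R0) by apply Rabs_pos.
  assert (HL := Cmod_ge_0 lam). assert (E1 := exp_pos 1). assert (ER := exp_ge1 R0 HR). assert (Ec := exp_pos (1 - R0)).
  set (K := (Cmod lam + exp 1 + 1) * exp R0). assert (HK : 1 <= K) by (unfold K; nra).
  exists (8 * K * exp (1 - R0)). split; [repeat apply Rmult_le_pos; lra|]. intros t y Hy. assert (Ht := Rabs_pos t).
  assert (KM : forall z, Cmod (kf lam t z) <= exp (R0 * Rabs z)).
  { intros z. unfold kf. rewrite Cmod_Cexp. apply exp_le.
    assert (A : Re lam * z <= R0 * Rabs z). { unfold R0. rewrite <- Rabs_mult. apply Rle_abs. } simpl. unfold Re in *. nra. }
  replace (8 * K * exp (1 - R0) * (1 + Rabs t)) with (8 * (K * (1 + Rabs t)) * exp (1 - R0)) by ring.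
  apply (PV_bound _ (fun z => (lam - Ci * RtoC t * RtoC (exp z)) * kf lam t z)%C _ (1 - R0)); auto; [lra| |].
  - intros z Hz. split.
    + unfold kf. evar_last. apply dC_Cexp. apply dC_minus. apply dC_mult. apply dC_const. apply dC_RtoC. apply dR_id.
      apply dC_mult. apply dC_const. apply dC_RtoC. apply is_derive_exp. cbv beta. ring.
    + rewrite Cmod_mult. unfold K. replace ((Cmod lam + exp 1 + 1) * exp R0 * (1 + Rabs t)) with ((Cmod lam + exp 1 + 1) * (1 + Rabs t) * exp R0) by ring.
      apply Rmult_le_compat; try apply Cmod_ge_0.
      * eapply Rle_trans; [apply Cmod_triang_minus|]. rewrite !Cmod_mult, Cmod_Ci, !Cmod_RtoC, (Rabs_pos_eq (exp z)) by (left; apply exp_pos).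
        assert (exp z <= exp 1) by (apply exp_le; generalize (Rle_abs z); lra). nra.
      * eapply Rle_trans; [apply KM|]. apply exp_le. nra.
  - intros z Hz. eapply Rle_trans; [apply KM|]. replace ((1 - (1 - R0)) * Rabs z) with (R0 * Rabs z) by ring.
    assert (P := exp_pos (R0 * Rabs z)). assert (1 <= K * (1 + Rabs t)) by nra. nra.
Qed.

Lemma kf_diff_ok lam t : Rabs (Re lam) < 1 -> exists g, Cok W0 (fun y => (kf lam t (- y)%R - kf lam t y) / RtoC (sinh y))%C g.
Proof.
  intros H. destruct (kf_diff_bound lam H) as [K [HK B]].
  exists (fun y => K * (1 + Rabs t) * exp (- (1 - Rabs (Re lam)) * y)). split; [|split].
  - apply Rok_scal. generalize (Rabs_pos t). intros. apply Rmult_le_pos; lra. apply Rok_exp0. lra.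
  - intros y Hy. apply inW0 in Hy. assert (S := sinh_pos y Hy). apply cC_div. apply RtoC_neq0; lra.
    apply cC_minus. apply (cC_comp Ropp (kf lam t)). cont. apply kf_cont. apply kf_cont. unfold sinh. cont. lra.
  - intros y Hy. apply inW0 in Hy. apply B; auto.
Qed.

Lemma kf_conj lam t y : Cconj (kf lam t y) = kf (Cconj lam) (- t) y.
Proof. unfold kf. rewrite Cconj_Cexp. apply f_equal. apply C_ext; simpl; ring. Qed.

Lemma Sch_conj lam t : Rabs (Re lam) < 1 -> 0 < t -> Cconj (Sch lam t) = Sch (Cconj lam) t.
Proof.
  intros H Ht. unfold Sch. rewrite <- (IntW_conj _ _ _ (Sch_ok lam t H Ht)). apply IntW_ext. intros u _.
  assert (P := cosh_pos u). unfold Cdiv. rewrite <- RtoC_inv by lra.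
  assert (X : forall a r, Cconj (a * RtoC r) = (Cconj a * RtoC r)%C) by (intros; apply C_ext; simpl; ring).
  rewrite X, Cconj_Cexp. f_equal. apply f_equal. apply C_ext; simpl; ring.
Qed.

(** The strip argument needs t > 0; the opposite sign follows by complex conjugation with
    [Cconj lam]. *)
Lemma P_eval_conj lam t : Rabs (Re lam) < 1 -> 0 < t ->
  PV (kf lam (- t)) = (Ci * (Cexp (Ci * RtoC (PI / 2) * lam) * Sch lam t - RtoC PI * Cexp (Ci * RtoC t)))%C.
Proof.
  intros Hl Ht. set (l2 := Cconj lam).
  assert (Hl2 : Rabs (Re l2) < 1) by exact Hl.
  assert (E : PV (kf lam (- t)) = Cconj (PV (kf l2 t))).
  { destruct (kf_diff_ok l2 t Hl2) as [g O]. unfold PV. rewrite <- (IntW_conj _ _ _ O). apply IntW_ext. intros y Hy.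
    apply inW0 in Hy. assert (S := sinh_pos y Hy). unfold Cdiv. rewrite <- RtoC_inv by lra.
    assert (X : forall a b r, Cconj ((a - b) * RtoC r) = ((Cconj a - Cconj b) * RtoC r)%C) by (intros; apply C_ext; simpl; ring).
    rewrite X, !kf_conj. unfold l2. rewrite Cconj_invol. reflexivity. }
  rewrite E, (P_eval l2 t Hl2 Ht).
  assert (E2 := Sch_conj l2 t Hl2 Ht). unfold l2 in E2 at 2. rewrite Cconj_invol in E2. rewrite <- E2.
  replace (Cexp (Ci * RtoC (PI / 2) * lam)) with (Cconj (Cexp (- (Ci * RtoC (PI / 2) * l2)))).
  2: { rewrite Cconj_Cexp. apply f_equal. unfold l2. apply C_ext; simpl; ring. }
  replace (Cexp (Ci * RtoC t)) with (Cconj (Cexp (- (Ci * RtoC t)))).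
  2: { rewrite Cconj_Cexp. apply f_equal. apply C_ext; simpl; ring. }
  apply C_ext; simpl; ring.
Qed.

(** * The exact identity: its base case and its extension to all b and m *)

Definition gN (b : C) (m : nat) (x y : R) : C := (Cexp ((RtoC (2 * INR m + 1) - 2 * b) * RtoC y) * Psi b (- (x * exp y)))%C.
(* With [tau = e^(2 y)], this is the principal value over [tau > 0] of
   [tau^(m - b) Psi b (- x sqrt tau) / (1 - tau)]. *)
Definition Nn (b : C) (m : nat) (x : R) : C := PV (gN b m x).
Definition cb (b : C) : C := Ccos (RtoC (2 * PI) * b).
Definition sb (b : C) : C := Csin (RtoC (2 * PI) * b).
(** The defect of the exact identity. Working with the defect turns each extension into a linear
    relation between values of [Dn]. *)
Definition Dn (b : C) (m : nat) (x : R) : C :=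
  (Psi b x - Hopt b m x + cb b * Psi b (- x) + sb b / RtoC PI * Nn b m x)%C.

Lemma Cmod_axis (l : C) r v1 v : Rabs v = PI / 2 ->
  Cmod (Cexp ((- r ^ 2, v1)%R + l * (ln r, v)%R)%C) <= exp (PI / 2 * Rabs (Im l)) * exp (Re l * ln r - r ^ 2).
Proof.
  intros Hv. rewrite Cmod_Cexp, <- exp_plus. apply exp_le. rewrite <- Hv, <- Rabs_mult.
  generalize (Rle_abs (- (v * Im l))). rewrite Rabs_Ropp. unfold Re, Im; simpl. lra.
Qed.

(** The condition Re b < 1 allows the collapse onto the imaginary axis and Re b > 0 gives Re lam <
    1, so that each exponential has a convergent principal value. With U, V the half-axis integrals
    for - x, the three terms are Psi(- x) = (U + V) / PI, Psi(x) = (e1 V + U / e1) / PI and N = i (U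
    - V). *)
Lemma Dn_base b x : 0 < Re b < 1 -> 0 < x -> Dn b 0 x = 0%C.
Proof.
  intros Hb Hx. set (lam := (1 - 2 * b)%C).
  assert (Hl : Rabs (Re lam) < 1) by (apply Rabs_def1; unfold lam, Re in *; simpl; lra).
  destruct (Psi_axis b (- x) ltac:(lra)) as [Om Em_]. destruct (Psi_axis b x ltac:(lra)) as [_ Ex_]. fold lam in Om, Em_, Ex_.
  assert (HP := PI_RGT_0). assert (HPc : RtoC PI <> 0%C) by (apply RtoC_neq0; lra).
  assert (Emc : forall lam x r, 0 < r -> contC (Ep lam x) r /\ contC (Em lam x) r).
  { intros l z r Hr. unfold Ep, Em. split; cont. }
  assert (Cp : Cok W0 (Ep lam (- x)) (fun r => exp (PI / 2 * Rabs (Im lam)) * exp (Re lam * ln r + 0 * r - r ^ 2)) /\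
    Cok W0 (Em lam (- x)) (fun r => exp (PI / 2 * Rabs (Im lam)) * exp (Re lam * ln r + 0 * r - r ^ 2))).
  { assert (R1 : Rok W0 (fun r => exp (PI / 2 * Rabs (Im lam)) * exp (Re lam * ln r + 0 * r - r ^ 2))).
    { apply Rok_scal. left; apply exp_pos. apply Rok_pow. apply Rabs_def2 in Hl; lra. }
    split; (split; [auto|split]); intros r Hr; try (apply inW0 in Hr; apply (Emc lam (- x) r Hr)).
    all: rewrite Rmult_0_l, Rplus_0_r; apply Cmod_axis; rewrite ?Rabs_Ropp; apply Rabs_pos_eq; lra. }
  destruct Cp as [CU CV].
  set (U := IntW W0 (Ep lam (- x))). set (V := IntW W0 (Em lam (- x))).
  assert (EP0 : IntW W0 (fun r => Ep lam (- x) r + Em lam (- x) r)%C = (U + V)%C) by apply (IntW_plus _ _ _ _ _ CU CV).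
  set (e1 := Cexp (Ci * RtoC PI * lam)). assert (He1 : e1 <> 0%C) by apply Cexp_neq0.
  (* Changing the sign of x exchanges the two half-axes up to the phase e^(i PI lam) or its inverse,
     since only the argument of s changes. *)
  assert (EP1 : IntW W0 (fun r => Ep lam x r + Em lam x r)%C = (e1 * V + / e1 * U)%C).
  { unfold U, V. rewrite <- (IntW_scal _ _ _ e1 CV), <- (IntW_scal _ _ _ (/ e1)%C CU).
    rewrite <- (IntW_plus _ _ _ _ _ (Cok_scal _ _ _ e1 CV) (Cok_scal _ _ _ (/ e1)%C CU)).
    apply IntW_ext. intros r _. unfold e1, Ep, Em. rewrite <- Cexp_opp, <- !Cexp_add. f_equal; apply f_equal; apply C_ext; simpl; field. }
  assert (EN : Nn b 0 x = (Ci * (U - V))%C).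
  { destruct (kf_diff_bound lam Hl) as [K [HK KB]].
    set (Qp := fun r => Cexp ((- r ^ 2, 0)%R + lam * (ln r, PI / 2)%R)%C).
    set (Qm := fun r => Cexp ((- r ^ 2, 0)%R + lam * (ln r, - (PI / 2))%R)%C).
    (* The integrand of the principal value with Psi replaced by its axis integral; integrating over
       y first leaves the principal values of single exponentials [kf]. *)
    set (F := fun r y => (Qp r * ((kf lam (x * r) (- y)%R - kf lam (x * r) y) / RtoC (sinh y)) + Qm r * ((kf lam (- (x * r)) (- y)%R - kf lam (- (x * r)) y) / RtoC (sinh y)))%C).
    assert (QpE : forall r y, (Cexp (lam * RtoC y) * Ep lam (- (x * exp y)) r = Qp r * kf lam (x * r) y)%C).
    { intros. unfold Qp, kf, Ep. rewrite <- !Cexp_add. apply f_equal. apply C_ext; simpl; ring. }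
    assert (QmE : forall r y, (Cexp (lam * RtoC y) * Em lam (- (x * exp y)) r = Qm r * kf lam (- (x * r)) y)%C).
    { intros. unfold Qm, kf, Em. rewrite <- !Cexp_add. apply f_equal. apply C_ext; simpl; ring. }
    assert (GE : forall y, exists g, Cok W0 (fun r => Qp r * kf lam (x * r) y + Qm r * kf lam (- (x * r)) y)%C g /\
       gN b 0 x y = (RtoC (/ PI) * IntW W0 (fun r => Qp r * kf lam (x * r) y + Qm r * kf lam (- (x * r)) y))%C).
    { intros y. destruct (Psi_axis b (- (x * exp y)) ltac:(lra)) as [O1 O2]. fold lam in O1, O2.
      assert (EQ : (fun r => Qp r * kf lam (x * r) y + Qm r * kf lam (- (x * r)) y)%C = (fun r => Cexp (lam * RtoC y) * (Ep lam (- (x * exp y)) r + Em lam (- (x * exp y)) r))%C).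
      { apply functional_extensionality. intros r. rewrite <- QpE, <- QmE. ring. }
      eexists. rewrite EQ. split. apply (Cok_scal _ _ _ _ O1). rewrite (IntW_scal _ _ _ _ O1). unfold gN. rewrite O2.
      replace ((RtoC (2 * INR 0 + 1) - 2 * b) * RtoC y)%C with (lam * RtoC y)%C. ring. simpl INR. rewrite Rmult_0_r, Rplus_0_l. reflexivity. }
    set (h := fun r => (exp (PI / 2 * Rabs (Im lam)) * 2 * K) * exp (Re lam * ln r + x * r - r ^ 2)).
    assert (Qc : forall r, 0 < r -> contC Qp r /\ contC Qm r). { intros r Hr. unfold Qp, Qm. split; cont. }
    assert (Qb : forall r, 0 < r -> Cmod (Qp r) <= exp (PI / 2 * Rabs (Im lam)) * exp (Re lam * ln r - r ^ 2) /\ Cmod (Qm r) <= exp (PI / 2 * Rabs (Im lam)) * exp (Re lam * ln r - r ^ 2)).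
    { intros r Hr. split; apply Cmod_axis; rewrite ?Rabs_Ropp; apply Rabs_pos_eq; lra. }
    destruct (Fubini W0 W0 F h (fun y => exp (- (1 - Rabs (Re lam)) * y)) openW0 openW0) as [EF [CF1 CF2]].
    { apply Rok_scal. generalize (exp_pos (PI / 2 * Rabs (Im lam))); intros. apply Rmult_le_pos; lra. apply Rok_pow. apply Rabs_def2 in Hl; lra. }
    { apply Rok_exp0. lra. }
    { intros r y Hr Hy. apply inW0 in Hr. apply inW0 in Hy. assert (S := sinh_pos y Hy). unfold F, kf, sinh.
      apply cC_plus; apply cC_mult.
      apply (cC_comp fst Qp). cont. exact (proj1 (Qc r Hr)). cont. apply RtoC_neq0. unfold sinh in S; simpl; lra. lra.
      apply (cC_comp fst Qm). cont. exact (proj2 (Qc r Hr)). cont. apply RtoC_neq0. unfold sinh in S; simpl; lra. lra. }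
    { intros r y Hr Hy. apply inW0 in Hr. apply inW0 in Hy. unfold F, h. eapply Rle_trans. apply Cmod_triangle. rewrite !Cmod_mult.
      assert (B1 := KB (x * r) y Hy). assert (B2 := KB (- (x * r)) y Hy). rewrite Rabs_Ropp in B2.
      destruct (Qb r Hr) as [B3 B4]. set (ey := exp (- (1 - Rabs (Re lam)) * y)) in *. assert (Hey : 0 < ey) by apply exp_pos.
      assert (0 < x * r) by nra. rewrite Rabs_pos_eq in B1, B2 by lra.
      assert (B5 : 1 + x * r <= exp (x * r)) by apply exp_ineq1_le.
      replace (exp (Re lam * ln r + x * r - r ^ 2)) with (exp (Re lam * ln r - r ^ 2) * exp (x * r)) by (rewrite <- exp_plus; f_equal; ring).
      set (q := exp (PI / 2 * Rabs (Im lam))) in *. set (e2 := exp (Re lam * ln r - r ^ 2)) in *.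
      assert (Hq : 0 < q) by apply exp_pos. assert (He2 : 0 < e2) by apply exp_pos.
      assert (B6 : K * (1 + x * r) * ey <= K * exp (x * r) * ey). { apply Rmult_le_compat_r. lra. apply Rmult_le_compat_l; lra. }
      assert (A1 := Rmult_le_compat _ _ _ _ (Cmod_ge_0 _) (Cmod_ge_0 _) B3 (Rle_trans _ _ _ B1 B6)).
      assert (A2 := Rmult_le_compat _ _ _ _ (Cmod_ge_0 _) (Cmod_ge_0 _) B4 (Rle_trans _ _ _ B2 B6)).
      lra. }
    assert (E1 : Nn b 0 x = (RtoC (/ PI) * IntW W0 (fun y => IntW W0 (fun r => F r y)))%C).
    { unfold Nn, PV. rewrite <- (IntW_scal _ _ _ _ CF2). apply IntW_ext.
      intros y Hy. apply inW0 in Hy. destruct (GE y) as [g1 [O1 ->]]. destruct (GE (- y)) as [g2 [O2 ->]].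
      assert (S := sinh_pos y Hy). assert (Sc : RtoC (sinh y) <> 0%C) by (apply RtoC_neq0; lra).
      assert (O3 := Cok_scal _ _ _ (/ RtoC (sinh y))%C (Cok_plus _ _ _ _ _ O2 (Cok_scal _ _ _ (- 1)%C O1))).
      transitivity (RtoC (/ PI) * (/ RtoC (sinh y) * (IntW W0 (fun r => Qp r * kf lam (x * r) (- y) + Qm r * kf lam (- (x * r)) (- y)) + (- 1) * IntW W0 (fun r => Qp r * kf lam (x * r) y + Qm r * kf lam (- (x * r)) y))))%C.
      { field. auto. }
      apply f_equal. rewrite <- (IntW_scal _ _ _ _ O1), <- (IntW_plus _ _ _ _ _ O2 (Cok_scal _ _ _ (- 1)%C O1)).
      rewrite <- (IntW_scal _ _ _ _ (Cok_plus _ _ _ _ _ O2 (Cok_scal _ _ _ (- 1)%C O1))).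
      apply IntW_ext. intros r _. unfold F. field. auto. }
    rewrite E1, <- EF.
    rewrite (IntW_ext _ _ (fun r => (Ci * RtoC PI) * (Ep lam (- x) r + (- 1) * Em lam (- x) r))%C).
    - rewrite (IntW_scal _ _ _ _ (Cok_plus _ _ _ _ _ CU (Cok_scal _ _ _ (- 1)%C CV))).
      rewrite (IntW_plus _ _ _ _ _ CU (Cok_scal _ _ _ (- 1)%C CV)), (IntW_scal _ _ _ _ CV). fold U V.
      rewrite RtoC_inv by lra. field. auto.
    - intros r Hr. apply inW0 in Hr. unfold F.
      destruct (kf_diff_ok lam (x * r) Hl) as [g1 O1]. destruct (kf_diff_ok lam (- (x * r)) Hl) as [g2 O2].
      rewrite (IntW_plus _ _ _ _ _ (Cok_scal _ _ _ (Qp r) O1) (Cok_scal _ _ _ (Qm r) O2)), (IntW_scal _ _ _ _ O1), (IntW_scal _ _ _ _ O2).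
      fold (PV (kf lam (x * r))) (PV (kf lam (- (x * r)))). assert (0 < x * r) by nra.
      rewrite P_eval, P_eval_conj by auto.
      (* Both sides are e^(- r^2) r^lam: the quarter turns undo the phases of the two half-axes.
         Hence the [Sch] terms cancel. *)
      assert (QQ : (Qp r * Cexp (- (Ci * RtoC (PI / 2) * lam)) = Qm r * Cexp (Ci * RtoC (PI / 2) * lam))%C).
      { unfold Qp, Qm. rewrite <- !Cexp_add. apply f_equal. apply C_ext; simpl; ring. }
      assert (Q1 : Ep lam (- x) r = (Qp r * Cexp (- (Ci * RtoC (x * r))))%C).
      { unfold Qp, Ep. rewrite <- !Cexp_add. apply f_equal. apply C_ext; simpl; ring. }
      assert (Q2 : Em lam (- x) r = (Qm r * Cexp (Ci * RtoC (x * r)))%C).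
      { unfold Qm, Em. rewrite <- !Cexp_add. apply f_equal. apply C_ext; simpl; ring. }
      rewrite Q1, Q2.
      transitivity (Ci * RtoC PI * (Qp r * Cexp (- (Ci * RtoC (x * r))) + - (1) * (Qm r * Cexp (Ci * RtoC (x * r)))) + Ci * Sch lam (x * r) * (Qm r * Cexp (Ci * RtoC (PI / 2) * lam) - Qp r * Cexp (- (Ci * RtoC (PI / 2) * lam))))%C. ring.
      rewrite QQ. ring. }
  unfold Dn. rewrite EN, Em_, Ex_, EP0, EP1. unfold Hopt, cb, sb, Ccos, Csin. simpl Csum.
  assert (EO : e1 = (- / Cexp (Ci * (RtoC (2 * PI) * b)))%C).
  { unfold e1, lam. rewrite <- Cexp_opp. replace (Ci * RtoC PI * (1 - 2 * b))%C with (Ci * RtoC PI + - (Ci * (RtoC (2 * PI) * b)))%C by (apply C_ext; simpl; ring).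
    rewrite Cexp_add. replace (Cexp (Ci * RtoC PI)) with (- (1))%C. ring.
    apply C_ext; unfold Cexp; simpl; rewrite !Rmult_0_l, !Rmult_1_l, Rminus_0_l, Ropp_0, exp_0, Rplus_0_l, ?cos_PI, ?sin_PI; ring. }
  rewrite EO, Cexp_opp. set (o := Cexp (Ci * (RtoC (2 * PI) * b))). assert (Ho : o <> 0%C) by apply Cexp_neq0.
  rewrite RtoC_inv by lra. assert (Ci <> 0%C) by (intros E; inversion E; lra). field. repeat split; auto.
Qed.

Lemma gN_dC b m x y : dC (gN b m x) y ((RtoC (2 * INR m + 1) - 2 * b) * gN b m x y - RtoC (x * exp y) * (Cexp ((RtoC (2 * INR m + 1) - 2 * b) * RtoC y) * Psi (b - half) (- (x * exp y))))%C.
Proof.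
  unfold gN. evar_last.
  apply dC_mult. apply dC_Cexp. apply dC_mult. apply dC_const. apply dC_RtoC. apply dR_id.
  apply (dC_comp (Psi b) (fun y => - (x * exp y)) y (- (x * exp y))). auto_derive; auto; ring. apply Psi_dC.
  cbv beta. rewrite RtoC_opp. ring.
Qed.

Lemma gN_dCx b m x y : dC (fun x => gN b m x y) x (- gN (b - half) m x y)%C.
Proof.
  unfold gN. evar_last.
  apply dC_mult. apply dC_const. apply (dC_comp (Psi b) (fun x => - (x * exp y)) x (- exp y)). auto_derive; auto; ring. apply Psi_dC.
  cbv beta. replace ((RtoC (2 * INR m + 1) - 2 * (b - half)) * RtoC y)%C with ((RtoC (2 * INR m + 1) - 2 * b) * RtoC y + RtoC y)%C.
  - rewrite Cexp_add, Cexp_R, RtoC_opp. ring.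
  - transitivity ((RtoC (2 * INR m + 1) - 2 * b + 2 * half) * RtoC y)%C; [rewrite half_2|]; ring.
Qed.

Lemma gN_cont2 {T : UniformSpace} b m (u v : T -> R) t : continuous u t -> continuous v t -> contC (fun p => gN b m (u p) (v p)) t.
Proof. intros. unfold gN. apply cC_mult. cont. apply (cC_comp (fun p => - (u p * exp (v p))) (Psi b)). cont. apply Psi_cont. Qed.

(** At y -> - infinity the exponent 2 m + 1 - 2 Re b > -1 decides the decay, which is the condition
    Re b < m + 1; at y -> + infinity the bound e^(- x e^y) of Psi wins. Uniformity in x over
    [a1, a2] serves differentiation in x. *)
Lemma gN_bound b m a1 a2 : 0 < a1 -> Re b < INR m + 1 -> exists K c, 0 < c /\ 0 <= K /\ forall x y, a1 <= x <= a2 -> 0 < y ->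
  Cmod ((gN b m x (- y)%R - gN b m x y) / RtoC (sinh y)) <= K * exp (- c * y).
Proof.
  intros Ha Hb. destruct (Psi_bound b 1 ltac:(lra)) as [K1 [HK1 B1]]. destruct (Psi_bound (b - half) 1 ltac:(lra)) as [K2 [HK2 B2]].
  set (w := (RtoC (2 * INR m + 1) - 2 * b)%C). set (A := Re w).
  assert (HA : -1 < A) by (unfold A, w; simpl; unfold Re in *; lra).
  set (c := Rmin 1 (1 + A)). assert (Hc : 0 < c <= 1) by (unfold c; split; [apply Rmin_glb_lt; lra|apply Rmin_l]).
  assert (HcA : c <= 1 + A) by apply Rmin_r.
  set (G := exp ((Rabs A + 1) * (ln ((Rabs A + 1) / a1) - 1))). assert (HG : 0 < G) by apply exp_pos.
  set (EA := exp (Rabs A)). assert (HEA : 0 < EA) by apply exp_pos.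
  set (K := K1 * (G + 1) + Cmod w * (EA * K1) + Rabs a2 * exp 1 * (EA * K2)).
  assert (E1 := exp_pos 1). assert (Hw := Cmod_ge_0 w). assert (Ha2 := Rabs_pos a2).
  assert (Z1 : 0 <= K1 * (G + 1)) by (apply Rmult_le_pos; lra).
  assert (Z2 : 0 <= Cmod w * (EA * K1)) by (repeat apply Rmult_le_pos; lra).
  assert (Z3 : 0 <= Rabs a2 * exp 1 * (EA * K2)) by (repeat apply Rmult_le_pos; lra).
  assert (HK : 0 <= K) by (unfold K; lra).
  exists (8 * K * exp c), c. split; [lra|split]. { assert (0 < exp c) by apply exp_pos. repeat apply Rmult_le_pos; lra. }
  assert (RA := Rle_abs A). assert (PA := Rabs_pos A).
  assert (Ew : forall y, Cmod (Cexp (w * RtoC y)) = exp (A * y)).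
  { intros y. rewrite Cmod_Cexp. f_equal. unfold A. unfold Re, RtoC; simpl. ring. }
  intros x y Hx Hy.
  assert (HXE : forall z, 0 < x * exp z) by (intros; apply Rmult_lt_0_compat; [lra|apply exp_pos]).
  apply PV_bound with (dk := fun y => (w * gN b m x y - RtoC (x * exp y) * (Cexp (w * RtoC y) * Psi (b - half) (- (x * exp y))))%C); try lra.
  - intros z Hz. split. apply gN_dC.
    assert (Q : exp (A * z) <= EA). { apply exp_le. eapply Rle_trans; [apply Rle_abs|]. rewrite Rabs_mult. nra. }
    assert (Qz : 0 < exp z <= exp 1). { split. apply exp_pos. apply exp_le. generalize (Rle_abs z); lra. }
    assert (P1' : Cmod (gN b m x z) <= EA * K1).
    { unfold gN. fold w. rewrite Cmod_mult, Ew. apply Rmult_le_compat; auto. left; apply exp_pos. apply Cmod_ge_0.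
      eapply Rle_trans; [apply B1|]. rewrite <- (Rmult_1_r K1) at 2. apply Rmult_le_compat_l; auto. apply Rle_trans with (exp 0); [apply exp_le; specialize (HXE z); lra|rewrite exp_0; lra]. }
    eapply Rle_trans; [apply Cmod_triang_minus|]. rewrite !Cmod_mult, Ew, Cmod_RtoC.
    assert (P3 : Rabs (x * exp z) <= Rabs a2 * exp 1). { rewrite Rabs_pos_eq by nra. rewrite (Rabs_pos_eq a2) by lra. apply Rmult_le_compat; lra. }
    assert (P2' : exp (A * z) * Cmod (Psi (b - half) (- (x * exp z))) <= EA * K2).
    { apply Rmult_le_compat; auto. left; apply exp_pos. apply Cmod_ge_0.
      eapply Rle_trans; [apply B2|]. rewrite <- (Rmult_1_r K2) at 2. apply Rmult_le_compat_l; auto. apply Rle_trans with (exp 0); [apply exp_le; specialize (HXE z); lra|rewrite exp_0; lra]. }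
    unfold K. assert (X1 := Rmult_le_compat_l _ _ _ Hw P1').
    assert (X2 := Rmult_le_compat _ _ _ _ (Rabs_pos _) (Rmult_le_pos _ _ (Rlt_le _ _ (exp_pos (A * z))) (Cmod_ge_0 _)) P3 P2'). lra.
  - intros z Hz. unfold gN. fold w. rewrite Cmod_mult, Ew.
    assert (Bz := B1 (x * exp z)). assert (Ez := exp_pos z).
    assert (X : exp (A * z) * Cmod (Psi b (- (x * exp z))) <= K1 * exp (A * z + - 1 * (x * exp z))).
    { rewrite exp_plus. replace (K1 * (exp (A * z) * exp (-1 * (x * exp z)))) with (exp (A * z) * (K1 * exp (-1 * (x * exp z)))) by ring.
      apply Rmult_le_compat_l; auto. left; apply exp_pos. }
    eapply Rle_trans; [apply X|]. clear X.
    apply Rle_trans with (K1 * ((G + 1) * exp ((1 - c) * Rabs z))).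
    2: { rewrite <- Rmult_assoc. apply Rmult_le_compat_r. left; apply exp_pos. unfold K. lra. }
    apply Rmult_le_compat_l; auto.
    assert (X1 : 1 <= exp ((1 - c) * Rabs z)). { apply exp_ge1. apply Rmult_le_pos; lra. }
    destruct (Rle_dec 0 z) as [H|H].
    + rewrite (Rabs_pos_eq z) in * by auto.
      assert (GB := gexp_bound (Rabs A + 1) a1 z ltac:(lra) Ha).
      assert (exp (A * z + -1 * (x * exp z)) <= G). { apply exp_le. assert (a1 * exp z <= x * exp z) by (apply Rmult_le_compat_r; lra). assert (A * z <= (Rabs A + 1) * z) by (apply Rmult_le_compat_r; lra). lra. }
      nra.
    + rewrite Rabs_left in * by lra. apply Rle_trans with (1 * exp ((1 - c) * - z)).
      * rewrite Rmult_1_l. apply exp_le. nra.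
      * apply Rmult_le_compat_r; lra.
Qed.

Lemma gN_ok b m x : 0 < x -> Re b < INR m + 1 -> exists g, Cok W0 (fun y => (gN b m x (- y)%R - gN b m x y) / RtoC (sinh y))%C g.
Proof.
  intros Hx Hb. destruct (gN_bound b m x x Hx Hb) as [K [c [Hc [HK B]]]]. exists (fun y => K * exp (- c * y)). split; [|split].
  - apply Rok_scal; auto. apply Rok_exp0; auto.
  - intros y Hy. apply inW0 in Hy. assert (S := sinh_pos y Hy).
    assert (G : forall z, contC (gN b m x) z) by (intros; apply (dC_cont _ _ _ (gN_dC b m x z))).
    apply cC_div. apply RtoC_neq0; lra. apply cC_minus; auto. apply (cC_comp Ropp (gN b m x)); auto. cont. unfold sinh; cont; lra.
  - intros y Hy. apply inW0 in Hy. apply B; auto. lra.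
Qed.

Lemma Nn_dC b m x : 0 < x -> Re b < INR m + 1 -> dC (Nn b m) x (- Nn (b - half) m x)%C.
Proof.
  intros Hx Hb. assert (Hb' : Re (b - half) < INR m + 1) by (unfold half, Re in *; simpl; lra).
  destruct (gN_bound (b - half) m (x / 2) (2 * x) ltac:(lra) Hb') as [K [c [Hc [HK B]]]].
  evar_last.
  - apply (dC_IntW W0 (fun x y => (gN b m x (- y)%R - gN b m x y) / RtoC (sinh y))%C
      (fun x y => - (1) * ((gN (b - half) m x (- y)%R - gN (b - half) m x y) / RtoC (sinh y)))%C (fun y => K * exp (- c * y)) (x / 2) (2 * x)).
    + lra.
    + intros z Hz. apply gN_ok; auto. lra.
    + intros z y Hz Hy. apply inW0 in Hy. assert (S := sinh_pos y Hy). unfold Cdiv. evar_last.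
      apply dC_mult. apply dC_minus. apply gN_dCx. apply gN_dCx. apply dC_const. cbv beta. ring.
    + intros z y Hz Hy. apply inW0 in Hy. assert (S := sinh_pos y Hy). apply cC_mult. apply cC_const. apply cC_div. apply RtoC_neq0; simpl; lra.
      apply cC_minus; apply gN_cont2; cont. unfold sinh. cont. lra.
    + apply Rok_scal; auto. apply Rok_exp0; auto.
    + intros z y Hz Hy. apply inW0 in Hy. rewrite Cmod_mult, Cmod_opp, Cmod_1, Rmult_1_l. apply B; lra.
  - destruct (gN_ok (b - half) m x Hx Hb') as [g O]. rewrite (IntW_scal _ _ _ _ O). unfold Nn, PV. ring.
Qed.

Lemma rGamma_1 : rGamma 1 = 1%C.
Proof.
  apply rGamma_lim_any. apply (limC_ext_loc (fun n => RtoC (1 + / (INR n)))%C).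
  - exists 1%nat. intros n Hn. assert (Hp : 0 < INR n) by (apply lt_0_INR; lia).
    assert (E : forall k, poch 1 k = RtoC (INR (fact k))).
    { induction k. reflexivity. simpl poch. rewrite IHk, fact_simpl, mult_INR, S_INR. apply C_ext; simpl; ring. }
    rewrite E, fact_simpl, mult_INR, S_INR. unfold Rcpow. rewrite Cmult_1_l, Cexp_R, exp_ln by auto.
    assert (INR (fact n) <> 0) by apply INR_fact_neq_0.
    rewrite <- RtoC_mult, <- RtoC_div by (apply Rmult_integral_contrapositive; split; auto; lra). apply f_equal. field. split; auto; lra.
  - assert (Q : is_lim_seq (fun n => 1 + / INR n) (1 + 0)).
    { apply (is_lim_seq_plus' _ _ 1 0). apply is_lim_seq_const. apply (is_lim_seq_inv _ p_infty). apply is_lim_seq_INR. discriminate. }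
    rewrite Rplus_0_r in Q. apply (limC_RtoC _ _ Q).
Qed.

Lemma rGamma_nat m : rGamma (RtoC (INR m) + 1) = (/ RtoC (INR (fact m)))%C.
Proof.
  induction m. simpl. rewrite Cplus_0_l, rGamma_1. apply C_ext; simpl; field.
  assert (Hn : RtoC (INR (S m)) <> 0%C) by (apply RtoC_neq0, not_0_INR; lia).
  apply (Cmult_reg_l' (RtoC (INR (S m)))); auto. rewrite rGamma_S, S_INR, RtoC_plus, IHm, fact_simpl, mult_INR, RtoC_mult, <- RtoC_plus, <- S_INR.
  field. split; auto. apply RtoC_fact_ne0.
Qed.

(** Mellin transform of Psi on the negative axis: inserting the line integral and exchanging the
    order produces Gamma(w) x^(- w) times a line integral with s^(lam - w). Here lam - w = 1 - 2 (m
    + 1), so this is 1/Gamma(m + 1) = 1 / m!. *)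
Lemma Psi_moment b m x : 0 < x -> Re b < INR m + 1 ->
  let w := (RtoC (2 * INR m + 2) - 2 * b)%C in
  (exists g, Cok WR (fun y => Cexp (w * RtoC y) * Psi b (- (x * exp y)))%C g) /\
  IntW WR (fun y => Cexp (w * RtoC y) * Psi b (- (x * exp y)))%C = (Gam w * Rcpow x (- w) / RtoC (INR (fact m)))%C.
Proof.
  intros Hx Hb w. set (lam := (1 - 2 * b)%C).
  assert (Hw : 0 < Re w) by (unfold w; simpl; unfold Re in *; lra).
  set (F := fun y r => (Cexp (w * RtoC y) * LIg 1 (- (x * exp y)) lam r)%C).
  assert (O := LIg_ok 1 0 lam ltac:(lra)).
  destruct (Fubini WR WR F (fun y => exp (Re w * y - x * exp y)) (LIbound 1 0 lam) openWR openWR) as [EF [C1 C2]].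
  - apply Rok_gamma; auto.
  - apply O.
  - intros y r _ _. unfold F, LIg, LIs. apply cC_mult. cont. apply cC_Cexp. apply cC_plus; [cont|]. apply cC_mult. apply cC_const. apply cC_plus. apply cC_const.
    apply (cC_comp snd cl). cont. apply contC_cl.
  - intros y r _ _. unfold F. rewrite Cmod_mult, Cmod_Cexp.
    assert (B := proj2 (proj2 (LIg_ok 1 (- (x * exp y)) lam ltac:(lra))) r (inWR r)).
    eapply Rle_trans. apply Rmult_le_compat_l; [left; apply exp_pos|apply B]. right. unfold LIbound. rewrite <- !exp_plus. f_equal. simpl. unfold Re. ring.
  - assert (E0 : forall y, (Cexp (w * RtoC y) * Psi b (- (x * exp y)) = RtoC (1 / PI) * IntW WR (F y))%C).
    { intros y. rewrite (Psi_LI 1) by lra. unfold LI. fold lam. unfold F. rewrite (IntW_scal _ _ _ _ (LIg_ok 1 _ lam ltac:(lra))). ring. }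
    assert (E1 : (fun y => Cexp (w * RtoC y) * Psi b (- (x * exp y)))%C = (fun y => RtoC (1 / PI) * IntW WR (F y))%C) by (apply functional_extensionality; auto).
    rewrite E1. split. eexists. apply (Cok_scal _ _ _ _ C1).
    rewrite (IntW_scal _ _ _ _ C1), EF.
    rewrite (IntW_ext _ _ (fun r => (Gam w * Rcpow x (- w)) * LIg 1 0 (lam - w) r)%C).
    + rewrite (IntW_scal _ _ _ _ (LIg_ok 1 0 (lam - w) ltac:(lra))). unfold Cdiv. rewrite <- rGamma_nat, (rGamma_Kc 1) by lra.
      unfold Kc, LI. replace (1 - 2 * (RtoC (INR m) + 1))%C with (lam - w)%C. ring.
      unfold lam, w. apply C_ext; simpl; ring.
    + intros r _. unfold F.
      destruct (gamma_scale w (RtoC (ln x) + cl r) Hw) as [O2 E2].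
      { simpl. rewrite Rplus_0_l. assert (Q := Ratan.atan_bound r). apply Rabs_def1; lra. }
      rewrite (IntW_ext _ _ (fun y => LIg 1 0 lam r * Cexp (w * RtoC y - Cexp (RtoC (ln x) + cl r) * RtoC (exp y)))%C).
      * rewrite (IntW_scal _ _ _ _ O2), E2. unfold LIg, Rcpow.
        transitivity (Gam w * (Cexp (LIs 1 r * LIs 1 r + RtoC 0 * LIs 1 r + lam * (RtoC (ln 1) + cl r)) * Cexp (- (w * (RtoC (ln x) + cl r)))))%C. ring.
        rewrite <- Cmult_assoc, <- !Cexp_add. apply f_equal. apply f_equal. rewrite ln_1. ring.
      * intros y _. rewrite Cexp_logs by auto. unfold LIg. rewrite <- !Cexp_add. apply f_equal. apply C_ext; simpl; ring.
Qed.

(** With d tau / (1 - tau) = - e^y dy / sinh y, the identity tau^m / (1 - tau) - tau^(m + 1) / (1 -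
    tau) = tau^m removes the pole, and an ordinary moment of Psi is left. *)
Lemma Nn_step b m x : 0 < x -> Re b < INR m + 1 ->
  let w := (RtoC (2 * INR m + 2) - 2 * b)%C in
  (Nn b m x - Nn b (S m) x = 2 * (Gam w * Rcpow x (- w) / RtoC (INR (fact m))))%C.
Proof.
  intros Hx Hb w. destruct (Psi_moment b m x Hx Hb) as [[g O] E]. fold w in O, E. rewrite <- E.
  destruct (IntW_fold _ _ O) as [O' ->].
  destruct (gN_ok b m x Hx Hb) as [g1 O1]. destruct (gN_ok b (S m) x Hx) as [g2 O2]. rewrite S_INR; lra.
  unfold Nn, PV. rewrite <- (IntW_minus _ _ _ _ _ O1 O2), <- (IntW_scal _ _ _ _ O').
  apply IntW_ext. intros y Hy. apply inW0 in Hy. assert (S := sinh_pos y Hy).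
  assert (X : forall z, (Cexp (w * RtoC z) * Psi b (- (x * exp z)) = RtoC (exp z) * gN b m x z)%C).
  { intros z. unfold gN, w. rewrite <- Cexp_R, Cmult_assoc, <- Cexp_add. apply (f_equal (fun a => (a * _)%C)). apply f_equal. apply C_ext; simpl; ring. }
  assert (X2 : forall z, (gN b (Datatypes.S m) x z = RtoC (exp z) * (RtoC (exp z) * gN b m x z))%C).
  { intros z. unfold gN, w. rewrite <- Cexp_R, !Cmult_assoc, <- !Cexp_add. apply (f_equal (fun a => (a * _)%C)). apply f_equal. rewrite S_INR. apply C_ext; simpl; ring. }
  rewrite !X, !X2. set (s := sinh y) in *. assert (Ns : RtoC s <> 0%C) by (apply RtoC_neq0; lra).
  assert (D : (RtoC (exp y) - RtoC (exp (- y)) = 2 * RtoC s)%C) by (rewrite <- RtoC_minus, <- RtoC_mult; apply f_equal; unfold s, sinh; field).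
  assert (E1 : (RtoC (exp y) * RtoC (exp (- y)) = 1)%C) by (rewrite <- RtoC_mult, <- exp_plus, Rplus_opp_r, exp_0; reflexivity).
  set (e := RtoC (exp y)) in *. set (e' := RtoC (exp (- y))) in *.
  transitivity ((e * e' * (gN b m x (- y) - gN b m x y) - (e' * (e' * gN b m x (- y)) - e * (e * gN b m x y))) / RtoC s)%C.
  rewrite E1. field; auto.
  transitivity ((e - e') * (e * gN b m x y + e' * gN b m x (- y)) / RtoC s)%C; [|rewrite D]; field; auto.
Qed.

Lemma Cexp_period z k : Cexp (z + Ci * RtoC (2 * INR k * PI)) = Cexp z.
Proof.
  apply C_ext; unfold Cexp; simpl.
  all: replace (Re z + _) with (Re z) by (simpl; ring); replace (Im z + _) with (Im z + 2 * INR k * PI) by (simpl; ring).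
  now rewrite cos_period. now rewrite sin_period.
Qed.

Lemma Cexp_PI2 : Cexp (Ci * RtoC (PI / 2)) = Ci.
Proof. apply C_ext; unfold Cexp; simpl; rewrite !Rmult_0_l, !Rmult_1_l, Rminus_0_l, Ropp_0, exp_0, Rplus_0_l, ?cos_PI2, ?sin_PI2; ring. Qed.

(** The reflection formula, written so that the m-th term of [Hopt] matches the increment of [Nn] in
    [Nn_step]. *)
Lemma rGamma_sb b m : Re b < INR m + 1 -> rGamma (2 * b - 1 - RtoC (2 * INR m)) = (- (sb b / RtoC PI * Gam (RtoC (2 * INR m + 2) - 2 * b)))%C.
Proof.
  intros Hb. assert (HP := PI_RGT_0). rewrite rGamma_reflect by (simpl; unfold Re in *; lra).
  replace (1 - (2 * b - 1 - RtoC (2 * INR m)))%C with (RtoC (2 * INR m + 2) - 2 * b)%C by (apply C_ext; simpl; ring).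
  set (o := Cexp (Ci * (RtoC (2 * PI) * b))). assert (Ho : o <> 0%C) by apply Cexp_neq0.
  assert (E : Cexp (Ci * RtoC PI * (half - (2 * b - 1 - RtoC (2 * INR m)))) = (- Ci / o)%C).
  { replace (Ci * RtoC PI * (half - (2 * b - 1 - RtoC (2 * INR m))))%C with (Ci * RtoC (PI / 2) + Ci * RtoC (PI / 2) + Ci * RtoC (PI / 2) + - (Ci * (RtoC (2 * PI) * b)) + Ci * RtoC (2 * INR m * PI))%C by (unfold half; apply C_ext; simpl; field).
    rewrite Cexp_period, !Cexp_add, Cexp_PI2, Cexp_opp. fold o. replace (Ci * Ci)%C with (- (1))%C by (apply C_ext; simpl; ring). field; auto. }
  rewrite Cexp_opp, E. unfold sb, Csin. rewrite Cexp_opp. fold o. rewrite RtoC_inv, RtoC_mult by lra.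
  assert (HC : Ci <> 0%C) by (intros Z; inversion Z; lra). assert (RtoC PI <> 0%C) by (apply RtoC_neq0; lra).
  assert (IC : (/ Ci = - Ci)%C) by (apply (Cmult_reg_l' Ci); [auto|rewrite Cinv_r by auto; apply C_ext; simpl; ring]).
  set (G := Gam _).
  transitivity (- (/ Ci * ((o - / o) / (2 * RtoC PI) * G)))%C; [|field; auto].
  replace (/ (- Ci / o))%C with (- (/ Ci * o))%C by (field; auto). rewrite IC. field. auto.
Qed.

Lemma Dn_step b m x : 0 < x -> Re b < INR m + 1 -> Dn b (S m) x = Dn b m x.
Proof.
  intros Hx Hb. unfold Dn. assert (E := Nn_step b m x Hx Hb). cbv zeta in E.
  set (N1 := Nn b (S m) x) in *. replace N1 with (Nn b m x - (Nn b m x - N1))%C by ring. rewrite E.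
  unfold Hopt. simpl Csum. rewrite rGamma_sb by auto.
  replace (- (2 * (RtoC (INR m) + 1 - b)))%C with (- (RtoC (2 * INR m + 2) - 2 * b))%C by (apply C_ext; simpl; ring).
  assert (HP := PI_RGT_0). field. split. apply RtoC_neq0; lra. apply RtoC_fact_ne0.
Qed.

Lemma Dn_m b m n x : 0 < x -> Re b < INR m + 1 -> (m <= n)%nat -> Dn b n x = Dn b m x.
Proof.
  intros Hx Hb H. induction H as [|n H IH]. reflexivity. rewrite Dn_step; auto. apply le_INR in H. lra.
Qed.

Lemma cb_half b : cb (b - half) = (- cb b)%C /\ sb (b - half) = (- sb b)%C.
Proof.
  assert (E : Cexp (Ci * (RtoC (2 * PI) * (b - half))) = (- Cexp (Ci * (RtoC (2 * PI) * b)))%C).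
  { replace (Ci * (RtoC (2 * PI) * b))%C with (Ci * (RtoC (2 * PI) * (b - half)) + Ci * RtoC (PI / 2) + Ci * RtoC (PI / 2))%C by (unfold half; apply C_ext; simpl; field).
    rewrite !Cexp_add, Cexp_PI2. apply C_ext; simpl; ring. }
  unfold cb, sb, Ccos, Csin. rewrite !Cexp_opp, E. set (o := Cexp _). assert (o <> 0%C) by apply Cexp_neq0.
  assert (Ci <> 0%C) by (intros Z; inversion Z; lra). split; field; auto.
Qed.

Lemma cb_1 b : cb (b - 1) = cb b /\ sb (b - 1) = sb b.
Proof.
  replace (b - 1)%C with (b - half - half)%C by (rewrite <- half_2; ring).
  destruct (cb_half b) as [A B]. destruct (cb_half (b - half)) as [A' B']. rewrite A', B', A, B. split; ring.
Qed.

Lemma dC_unique f t l k : dC f t l -> dC f t k -> l = k.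
Proof.
  intros [A B] [A' B']. apply C_ext. rewrite <- (is_derive_unique _ _ _ A). apply (is_derive_unique _ _ _ A').
  rewrite <- (is_derive_unique _ _ _ B). apply (is_derive_unique _ _ _ B').
Qed.

(** The x-derivative of a defect that vanishes on x > 0 is zero, and it is the defect for b - 1/2:
    Psi(- x) and N each change sign under differentiation, and so do cos and sin of 2 PI b under the
    shift. With m = 0 there is no algebraic sum to differentiate. *)
Lemma Dn_half b : Re b < 1 -> (forall x, 0 < x -> Dn b 0 x = 0%C) -> forall x, 0 < x -> Dn (b - half) 0 x = 0%C.
Proof.
  intros Hb H x Hx. apply (dC_unique (Dn b 0) x).
  - unfold Dn, Hopt. simpl Csum. evar_last.
    apply dC_plus. apply dC_plus. apply dC_minus. apply Psi_dC. apply dC_const.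
    apply dC_mult. apply dC_const. apply (dC_comp (Psi b) Ropp x (- 1)). auto_derive; auto; ring. apply Psi_dC.
    apply dC_mult. apply dC_const. apply Nn_dC; auto. simpl; lra.
    cbv beta. destruct (cb_half b) as [-> ->]. replace (RtoC (-1)) with (- (1))%C by (apply C_ext; simpl; ring). assert (HP := PI_RGT_0). field. apply RtoC_neq0; lra.
  - apply (dC_ext_loc (fun _ => 0%C)). 2: apply dC_const.
    exists (mkposreal x Hx). intros y Hy. symmetry. apply H. apply Rabs_def2 in Hy. unfold minus, plus, opp in Hy; simpl in Hy; lra.
Qed.

Lemma Dn_0 n b x : - (INR n / 2) < Re b < 1 -> 0 < x -> Dn b 0 x = 0%C.
Proof.
  revert b x. induction n; intros b x Hb Hx.
  - simpl in Hb. apply Dn_base; auto. lra.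
  - rewrite S_INR in Hb. destruct (Rle_dec (1 / 2) (Re b)) as [H|H].
    + apply Dn_base; auto; lra.
    + replace b with (b + half - half)%C by ring. apply Dn_half; auto. simpl; unfold Re in *; simpl; lra.
      intros y Hy. apply IHn; auto. simpl; unfold Re in *; simpl; lra.
Qed.

Lemma Dn_lt1 b m x : Re b < 1 -> 0 < x -> Dn b m x = 0%C.
Proof.
  intros Hb Hx. rewrite (Dn_m b 0) by (simpl; lra || lia || auto).
  destruct (INR_unbounded (2 * Rabs (Re b))) as [n Hn]. apply (Dn_0 n); auto.
  generalize (Rle_abs (- Re b)). rewrite Rabs_Ropp. lra.
Qed.

(** The sum for b - 1 has one term fewer: multiplying by k kills k = 0 and shifts the index, and the
    recurrence of 1/Gamma rewrites the middle sum. The three coefficients 2 k, 2 b - 2 - 2 k and 2 -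
    2 b then cancel term by term. *)
Lemma Hopt_rec b m x : 0 < x -> (2 * Hopt (b - 1) m x + RtoC x * Hopt (b - half) (S m) x + (2 - 2 * b) * Hopt b (S m) x = 0)%C.
Proof.
  intros Hx. unfold Hopt.
  assert (E : Csum (fun k => RtoC (INR k) * (Rcpow x (- (2 * (RtoC (INR k) + 1 - b))) * rGamma (2 * b - 1 - RtoC (2 * INR k)) / RtoC (INR (fact k))))%C (S m) =
     Csum (fun k => Rcpow x (- (2 * (RtoC (INR k) + 1 - (b - 1)))) * rGamma (2 * (b - 1) - 1 - RtoC (2 * INR k)) / RtoC (INR (fact k)))%C m).
  { rewrite Csum_S_l. simpl (INR 0). rewrite Cmult_0_l, Cplus_0_l. apply Csum_ext. intros k _.
    assert (RtoC (INR (S k)) <> 0%C) by (apply RtoC_neq0, not_0_INR; lia). assert (F := RtoC_fact_ne0 k).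
    rewrite fact_simpl, mult_INR, (RtoC_mult (INR (S k))).
    replace (- (2 * (RtoC (INR (S k)) + 1 - b)))%C with (- (2 * (RtoC (INR k) + 1 - (b - 1))))%C by (rewrite S_INR; apply C_ext; simpl; ring).
    replace (2 * b - 1 - RtoC (2 * INR (S k)))%C with (2 * (b - 1) - 1 - RtoC (2 * INR k))%C by (rewrite S_INR; apply C_ext; simpl; ring).
    field. auto. }
  rewrite <- E.
  assert (E2 : (RtoC x * Csum (fun k => Rcpow x (- (2 * (RtoC (INR k) + 1 - (b - half)))) * rGamma (2 * (b - half) - 1 - RtoC (2 * INR k)) / RtoC (INR (fact k))) (S m) =
     Csum (fun k => (2 * b - 2 - 2 * RtoC (INR k)) * (Rcpow x (- (2 * (RtoC (INR k) + 1 - b))) * rGamma (2 * b - 1 - RtoC (2 * INR k)) / RtoC (INR (fact k)))) (S m))%C).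
  { rewrite <- Csum_scal. apply Csum_ext. intros k _.
    assert (F := RtoC_fact_ne0 k).
    replace (- (2 * (RtoC (INR k) + 1 - b)))%C with (1 + - (2 * (RtoC (INR k) + 1 - (b - half))))%C by (unfold half; apply C_ext; simpl; field).
    rewrite (rGamma_rec (2 * (b - half) - 1 - _)), Rcpow_plus.
    replace (2 * (b - half) - 1 - RtoC (2 * INR k) + 1)%C with (2 * b - 1 - RtoC (2 * INR k))%C by (unfold half; apply C_ext; simpl; field).
    replace (2 * (b - half) - 1 - RtoC (2 * INR k))%C with (2 * b - 2 - 2 * RtoC (INR k))%C by (unfold half; apply C_ext; simpl; field).
    unfold Rcpow at 2. rewrite Cmult_1_l, Cexp_R, exp_ln by auto. field; auto. }
  transitivity (2 * (2 * Csum (fun k => RtoC (INR k) * (Rcpow x (- (2 * (RtoC (INR k) + 1 - b))) * rGamma (2 * b - 1 - RtoC (2 * INR k)) / RtoC (INR (fact k))))%C (S m) +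
     RtoC x * Csum (fun k => Rcpow x (- (2 * (RtoC (INR k) + 1 - (b - half)))) * rGamma (2 * (b - half) - 1 - RtoC (2 * INR k)) / RtoC (INR (fact k))) (S m) +
     (2 - 2 * b) * Csum (fun k => (Rcpow x (- (2 * (RtoC (INR k) + 1 - b))) * rGamma (2 * b - 1 - RtoC (2 * INR k)) / RtoC (INR (fact k)))) (S m)))%C. ring.
  rewrite E2, <- !Csum_scal, <- !Csum_plus. rewrite <- Csum_scal. transitivity (Csum (fun _ => 0%C) (S m)).
  - apply Csum_ext. intros k _. set (a := (_ / _)%C). ring.
  - generalize (S m). induction n; simpl; auto. rewrite IHn. apply Cplus_0_l.
Qed.

Lemma Nn_rec b m x : 0 < x -> Re b < INR m + 2 ->
  (2 * Nn (b - 1) m x - RtoC x * Nn (b - half) (S m) x + (2 - 2 * b) * Nn b (S m) x = 0)%C.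
Proof.
  intros Hx Hb.
  destruct (gN_ok (b - 1) m x Hx) as [g1 O1]. simpl; unfold Re in *; lra.
  destruct (gN_ok (b - half) (S m) x Hx) as [g2 O2]. rewrite S_INR; simpl; unfold Re in *; lra.
  destruct (gN_ok b (S m) x Hx) as [g3 O3]. rewrite S_INR; simpl; unfold Re in *; lra.
  assert (PT : forall z, ((2 - 2 * b) * gN b (S m) x z = - (2) * gN (b - 1) m x z + RtoC x * gN (b - half) (S m) x z)%C).
  { intros z. assert (R := Psi_rec b (- (x * exp z))). unfold gN.
    set (w := ((RtoC (2 * INR (S m) + 1) - 2 * b) * RtoC z)%C).
    replace ((RtoC (2 * INR m + 1) - 2 * (b - 1)) * RtoC z)%C with w by (unfold w; rewrite S_INR; apply C_ext; simpl; ring).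
    replace ((RtoC (2 * INR (S m) + 1) - 2 * (b - half)) * RtoC z)%C with (w + RtoC z)%C by (unfold w, half; rewrite S_INR; apply C_ext; simpl; field).
    rewrite Cexp_add, Cexp_R. rewrite RtoC_opp, RtoC_mult in R.
    set (p1 := Psi (b - 1) _) in *. set (p2 := Psi (b - half) _) in *. set (p3 := Psi b _) in *.
    transitivity (Cexp w * ((2 * p1 + - (RtoC x * RtoC (exp z)) * p2 + (2 - 2 * b) * p3) - 2 * p1 + RtoC x * RtoC (exp z) * p2))%C. ring. rewrite R. ring. }
  assert (E : ((2 - 2 * b) * Nn b (S m) x = - (2) * Nn (b - 1) m x + RtoC x * Nn (b - half) (S m) x)%C).
  { unfold Nn, PV. rewrite <- (IntW_scal _ _ _ (- (2))%C O1), <- (IntW_scal _ _ _ (RtoC x) O2), <- (IntW_scal _ _ _ (2 - 2 * b)%C O3).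
    rewrite <- (IntW_plus _ _ _ _ _ (Cok_scal _ _ _ (- (2))%C O1) (Cok_scal _ _ _ (RtoC x) O2)).
    apply IntW_ext. intros y Hy. apply inW0 in Hy. assert (S := sinh_pos y Hy).
    unfold Cdiv. transitivity (((2 - 2 * b) * gN b (Datatypes.S m) x (- y) - (2 - 2 * b) * gN b (Datatypes.S m) x y) * / RtoC (sinh y))%C. ring. rewrite !PT. ring. }
  rewrite E. ring.
Qed.

Lemma Dn_rec b m x : 0 < x -> Re b < INR m + 2 ->
  (2 * Dn (b - 1) m x + RtoC x * Dn (b - half) (S m) x + (2 - 2 * b) * Dn b (S m) x = 0)%C.
Proof.
  intros Hx Hb. assert (H := Hopt_rec b m x Hx). assert (N := Nn_rec b m x Hx Hb).
  assert (P := Psi_rec b x). assert (Q := Psi_rec b (- x)). rewrite RtoC_opp in Q.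
  unfold Dn. destruct (cb_half b) as [-> ->]. destruct (cb_1 b) as [-> ->].
  transitivity ((2 * Psi (b - 1) x + RtoC x * Psi (b - half) x + (2 - 2 * b) * Psi b x)
   - (2 * Hopt (b - 1) m x + RtoC x * Hopt (b - half) (S m) x + (2 - 2 * b) * Hopt b (S m) x)
   + cb b * (2 * Psi (b - 1) (- x) + - RtoC x * Psi (b - half) (- x) + (2 - 2 * b) * Psi b (- x))
   + sb b / RtoC PI * (2 * Nn (b - 1) m x - RtoC x * Nn (b - half) (S m) x + (2 - 2 * b) * Nn b (S m) x))%C.
  - unfold Cdiv. ring.
  - rewrite H, N, P, Q. ring.
Qed.

(** At b = 1 the coefficient 2 - 2 b vanishes and the recurrence says nothing about [Dn]. Here the
    sine is zero and the identity reads Psi(x) + Psi(- x) = 2: the sum has derivative zero by the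
    case b = 1/2, and its value at 0 is 2 / Gamma(1). *)
Lemma Dn_b1 m x : 0 < x -> (1 <= m)%nat -> Dn 1 m x = 0%C.
Proof.
  intros Hx Hm. assert (HPI := PI_RGT_0). assert (HPc : RtoC PI <> 0%C) by (apply RtoC_neq0; lra).
  assert (S1 : Cexp (Ci * (RtoC (2 * PI) * 1)) = 1%C).
  { replace (Ci * (RtoC (2 * PI) * 1))%C with (0 + Ci * RtoC (2 * INR 1 * PI))%C by (simpl INR; apply C_ext; simpl; ring). rewrite Cexp_period. apply Cexp_0. }
  assert (Ci <> 0%C) by (intros Z; inversion Z; lra).
  assert (Ec : cb 1 = 1%C /\ sb 1 = 0%C). { unfold cb, sb, Ccos, Csin. rewrite Cexp_opp, S1. split; field; auto. }
  destruct Ec as [Ec Es]. destruct (cb_half 1) as [Ec2 Es2]. rewrite Ec in Ec2. rewrite Es in Es2.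
  assert (DH : forall t, 0 <= t -> (Psi (1 - half) t = Psi (1 - half) (- t))%C).
  { intros t [Ht| <-]. 2: rewrite Ropp_0; auto.
    assert (D := Dn_lt1 (1 - half) 0 t ltac:(simpl; lra) Ht). unfold Dn, Hopt in D. simpl Csum in D. rewrite Ec2, Es2 in D.
    transitivity (Psi (1 - half) (- t) + (Psi (1 - half) t - 2 * 0 + - (1) * Psi (1 - half) (- t) + - 0 / RtoC PI * Nn (1 - half) 0 t))%C.
    field; auto. rewrite D. ring. }
  assert (EP : (Psi 1 x + Psi 1 (- x) = 2)%C).
  { assert (M := dC_mvt (fun t => Psi 1 t + Psi 1 (- t))%C (fun t => Psi (1 - half) t + - (1) * Psi (1 - half) (- t))%C 0 0 x ltac:(lra)).
    assert (M' : Cmod ((Psi 1 x + Psi 1 (- x)) - (Psi 1 0 + Psi 1 (- 0))) <= 2 * 0 * (x - 0)).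
    { apply M. intros t Ht. split.
      - evar_last. apply dC_plus. apply Psi_dC. apply (dC_comp (Psi 1) Ropp t (- 1)). auto_derive; auto; ring. apply Psi_dC. replace (RtoC (-1)) with (- (1))%C by (apply C_ext; simpl; ring). reflexivity.
      - rewrite (DH t) by lra. assert (Z0 : forall q : C, (q + - (1) * q = 0)%C) by (intros; ring). rewrite Z0, Cmod_0. lra. }
    rewrite Ropp_0, <- rGamma_Psi, rGamma_1 in M'.
    assert (Z : (Psi 1 x + Psi 1 (- x) - (1 + 1))%C = 0%C). { apply Cmod_eq_0. apply Rle_antisym; [lra|apply Cmod_ge_0]. }
    transitivity (Psi 1 x + Psi 1 (- x) - (1 + 1) + 2)%C; [rewrite RtoC_2; ring|rewrite Z; ring]. }
  assert (EH : Hopt 1 m x = 2%C).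
  { unfold Hopt. destruct m as [|m]; [lia|]. rewrite Csum_S_l.
    assert (Z : Csum (fun k : nat => Rcpow x (- (2 * (RtoC (INR (S k)) + 1 - 1))) * rGamma (2 * 1 - 1 - RtoC (2 * INR (S k))) / RtoC (INR (fact (S k))))%C m = 0%C).
    { rewrite (Csum_ext _ (fun _ => 0 * 0)%C). rewrite Csum_scal; apply Cmult_0_l. intros k _.
      replace (rGamma (2 * 1 - 1 - RtoC (2 * INR (S k)))) with (RtoC 0). unfold Cdiv; rewrite !Cmult_0_r; apply Cmult_0_l.
      rewrite (rGamma_sb 1). rewrite Es. unfold Cdiv; ring. generalize (S_INR k) (pos_INR k). simpl; lra. }
    rewrite Z. simpl INR. replace (- (2 * (0 + 1 - 1)))%C with (RtoC 0) by (apply C_ext; simpl; ring). replace (2 * 1 - 1 - RtoC (2 * 0))%C with (RtoC 1) by (apply C_ext; simpl; ring).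
    rewrite rGamma_1. unfold Rcpow. rewrite Cmult_0_l, Cexp_0. simpl. field. }
  unfold Dn. rewrite Ec, Es, EH. transitivity ((Psi 1 x + Psi 1 (- x)) - 2 + 0 / RtoC PI * Nn 1 m x)%C. ring. rewrite EP. field; auto.
Qed.

(** Induction upwards in Re b: for b different from 1 the three-term recurrence is solved for
    [Dn b (S m)], whose companions have b lowered by 1 and 1/2. *)
Theorem Dn_zero b m x : Re b < INR m + 1 -> 0 < x -> Dn b m x = 0%C.
Proof.
  intros Hb Hx. assert (X : forall n b m, Re b < INR m + 1 -> Re b < 1 + INR n / 2 -> Dn b m x = 0%C).
  { clear b m Hb. induction n; intros b m Hb Hn. simpl in Hn. apply Dn_lt1; auto; lra.
    destruct (Rlt_dec (Re b) 1) as [H|H]. apply Dn_lt1; auto.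
    destruct m as [|m]; [simpl in Hb; lra|].
    destruct (Req_EM_T (Cmod (b - 1)) 0) as [E|E].
    - apply Cmod_eq_0 in E. replace b with (RtoC 1). apply Dn_b1; auto; lia. replace b with (b - 1 + 1)%C by ring. rewrite E; ring.
    - rewrite S_INR in *. assert (R := Dn_rec b m x Hx ltac:(lra)).
      rewrite (IHn (b - 1)%C m), (IHn (b - half)%C (S m)) in R by (rewrite ?S_INR; simpl; unfold Re in *; lra).
      apply (Cmult_reg_l' (2 - 2 * b)).
      + intros Z. apply E. replace (b - 1)%C with (- (half * (2 - 2 * b)))%C by (transitivity (- ((2 * half) * (1 - b)))%C; [ring|rewrite half_2; ring]).
        rewrite Z, Cmult_0_r, Cmod_opp. apply Cmod_0.
      + transitivity (2 * 0 + RtoC x * 0 + (2 - 2 * b) * Dn b (S m) x)%C. ring. rewrite R. ring. }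
  destruct (INR_unbounded (2 * Rabs (Re b))) as [n Hn]. apply (X n); auto. generalize (Rle_abs (Re b)). lra.
Qed.

(** * Power series of the saddle-point change of variable *)

(** Course-of-values recursion: [crec a0 step n] is a whole sequence that is correct up to index n,
    so [step] may look at all earlier terms. *)
Fixpoint crec {A} (a0 : A) (step : nat -> (nat -> A) -> A) (n : nat) : nat -> A :=
  match n with
  | O => fun _ => a0
  | S m => fun k => if Nat.leb k m then crec a0 step m k else step m (crec a0 step m)
  end.
Definition cseq {A} (a0 : A) step (n : nat) : A := crec a0 step n n.

Lemma crec_le {A} (a0 : A) step m k : (k <= m)%nat -> crec a0 step m k = cseq a0 step k.
Proof.
  intros H. induction m. replace k with O by lia. reflexivity.
  destruct (Nat.eq_dec k (S m)) as [->|N]. reflexivity.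
  simpl. destruct (Nat.leb_spec k m); [apply IHm|]; lia.
Qed.

Lemma cseq_S {A} (a0 : A) step m : (forall f g, (forall k, (k <= m)%nat -> f k = g k) -> step m f = step m g) ->
  cseq a0 step (S m) = step m (cseq a0 step).
Proof.
  intros H. unfold cseq at 1. change (crec a0 step (S m) (S m)) with (if Nat.leb (S m) m then crec a0 step m (S m) else step m (crec a0 step m)).
  destruct (Nat.leb_spec (S m) m); [lia|]. apply H. intros. apply crec_le; auto.
Qed.

(* [vs n] is the coefficient of [w^n] in [(tau - 1) / w]. *)
Definition vstep (m : nat) (f : nat -> R) : R := f m / INR (m + 3) - / 2 * sum_f_R0 (fun i => if Nat.eqb i m then 0 else f (S i) * f (m - i)%nat) m.
Definition vs : nat -> R := cseq 1 vstep.

Lemma vs_S m : vs (S m) = vstep m vs.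
Proof.
  apply cseq_S. intros f g H. unfold vstep. rewrite (H m) by lia. f_equal. f_equal. apply sum_eq. intros i Hi.
  destruct (Nat.eqb_spec i m); auto. rewrite !H by lia. auto.
Qed.

Lemma PS_mult_sq a n : (1 <= n)%nat -> PS_mult a a n = 2 * a O * a n + sum_f_R0 (fun i => if Nat.eqb i (n - 1) then 0 else a (S i) * a (n - 1 - i)%nat) (n - 1).
Proof.
  intros Hn. destruct n as [|m]; [lia|]. unfold PS_mult. rewrite decomp_sum by lia. simpl pred. replace (S m - 1)%nat with m by lia.
  replace (S m - 0)%nat with (S m) by lia.
  assert (E : sum_f_R0 (fun i => a (S i) * a (S m - S i)%nat) m = a (S m) * a O + sum_f_R0 (fun i => if Nat.eqb i m then 0 else a (S i) * a (m - i)%nat) m).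
  { destruct m as [|m]. simpl. ring. rewrite !tech5. rewrite (sum_eq _ (fun i => if Nat.eqb i (S m) then 0 else a (S i) * a (S m - i)%nat)).
    - rewrite Nat.eqb_refl, Nat.sub_diag. ring.
    - intros i Hi. destruct (Nat.eqb_spec i (S m)); [lia|]. reflexivity. }
  rewrite E. ring.
Qed.

(** With tau = 1 + w v, differentiating w^2 / 2 = tau - log tau - 1 gives 1 + w v = v^2 + w (v^2)' /
    2. This is the relation between the coefficients of w^(n + 1); [vstep] is the same relation
    solved for the new coefficient. *)
Lemma vs_sq n : PS_mult vs vs (S n) = 2 / INR (n + 3) * vs n.
Proof.
  rewrite PS_mult_sq by lia. replace (S n - 1)%nat with n by lia. rewrite (vs_S n). unfold vstep. change (vs 0) with 1.
  field. apply not_0_INR; lia.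
Qed.

Lemma sum_inv_sq n : sum_f_R0 (fun i => / INR (i + 2) ^ 2) n <= 1 - / INR (n + 2).
Proof.
  induction n. simpl; lra. rewrite tech5.
  assert (H : / INR (S n + 2) ^ 2 <= / INR (n + 2) - / INR (S n + 2)).
  { replace (S n + 2)%nat with (S (n + 2)) by lia. rewrite S_INR. assert (0 < INR (n + 2)) by (apply lt_0_INR; lia). set (t := INR (n + 2)) in *.
    replace (/ t - / (t + 1)) with (/ (t * (t + 1))) by (field; lra). apply Rinv_le_contravar; nra. }
  lra.
Qed.

Lemma sum_rev (f : nat -> R) m : sum_f_R0 (fun i => f (m - i)%nat) m = sum_f_R0 f m.
Proof.
  induction m. reflexivity. rewrite decomp_sum by lia. simpl pred. rewrite Nat.sub_0_r. rewrite (sum_eq _ (fun i => f (m - i)%nat)).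
  rewrite IHm, tech5. ring. intros; f_equal; lia.
Qed.

(** The factor (n + 1)^(- 2) makes the geometric bound stable under convolution. The constants 1/4
    and 32 are such that the linear term of the recursion uses a quarter of the bound and the
    convolution three quarters. *)
Lemma vs_bound n : (1 <= n)%nat -> Rabs (vs n) <= / 4 * 32 ^ n / INR (n + 1) ^ 2.
Proof.
  induction n as [n IH] using lt_wf_ind. intros Hn. destruct n as [|m]; [lia|]. rewrite vs_S. unfold vstep.
  assert (Hm : 0 <= INR m) by apply pos_INR.
  set (N := INR (S m + 1)). assert (EN : N = INR m + 2) by (unfold N; rewrite plus_INR, S_INR; simpl; ring).
  assert (P8 : 0 < 32 ^ m) by (apply pow_lt; lra).
  set (B := / 4 * 32 ^ S m / N ^ 2). assert (HN2 : 0 < N ^ 2) by (apply pow_lt; lra).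
  assert (HB : 0 < B). { unfold B. apply Rdiv_lt_0_compat; auto. simpl; lra. }
  assert (T1 : Rabs (vs m / INR (m + 3)) <= / 4 * B).
  { rewrite Rabs_div by (apply not_0_INR; lia). rewrite (Rabs_pos_eq (INR _)) by apply pos_INR.
    replace (INR (m + 3)) with (N + 1) by (rewrite EN, plus_INR; simpl; ring).
    destruct m as [|m].
    - unfold B. change (vs 0) with 1. rewrite Rabs_R1, EN. simpl. lra.
    - assert (Q := IH (S m) ltac:(lia) ltac:(lia)).
      replace (INR (S m + 1)) with (N - 1) in Q by (rewrite EN, plus_INR; simpl; ring).
      assert (HN : 3 <= N). { rewrite EN, S_INR. generalize (pos_INR m); lra. }
      apply Rle_trans with (/ 4 * 32 ^ S m / (N - 1) ^ 2 / (N + 1)). { apply Rmult_le_compat_r; auto. left. apply Rinv_0_lt_compat; lra. }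
      unfold B. replace (/ 4 * (/ 4 * 32 ^ S (S m) / N ^ 2)) with (/ 4 * 32 ^ S m * (8 / N ^ 2)) by (simpl; field; lra).
      unfold Rdiv at 1 2. rewrite Rmult_assoc. apply Rmult_le_compat_l. lra.
      rewrite <- Rinv_mult. unfold Rdiv. replace (8 * / N ^ 2) with (/ (N ^ 2 / 8)) by (field; lra). apply Rinv_le_contravar; nra. }
  assert (T2 : Rabs (/ 2 * sum_f_R0 (fun i => if Nat.eqb i m then 0 else vs (S i) * vs (m - i)%nat) m) <= 3 / 4 * B).
  { rewrite Rabs_mult, (Rabs_pos_eq (/ 2)) by lra.
    apply Rle_trans with (/ 2 * ((/ 2 * B) * 3)); [|lra]. apply Rmult_le_compat_l. lra.
    eapply Rle_trans. apply sum_f_R0_triangle.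
    apply Rle_trans with (sum_f_R0 (fun i => (/ 2 * B) * (/ INR (i + 2) ^ 2 + / INR (m - i + 1) ^ 2)) m).
    - apply sum_Rle. intros i Hi.
      assert (Z1 : 0 < INR (i + 2)) by (apply lt_0_INR; lia). assert (Z2 : 0 < INR (m - i + 1)) by (apply lt_0_INR; lia).
      set (a := INR (i + 2)) in *. set (c := INR (m - i + 1)) in *.
      assert (Ia : 0 < / a ^ 2) by (apply Rinv_0_lt_compat, pow_lt; auto). assert (Ic : 0 < / c ^ 2) by (apply Rinv_0_lt_compat, pow_lt; auto).
      destruct (Nat.eqb_spec i m) as [E|E].
      + rewrite Rabs_R0. apply Rmult_le_pos; lra.
      + rewrite Rabs_mult. assert (Q1 := IH (S i) ltac:(lia) ltac:(lia)). assert (Q2 := IH (m - i)%nat ltac:(lia) ltac:(lia)).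
        replace (INR (S i + 1)) with a in Q1 by (unfold a; f_equal; lia). fold c in Q2.
        assert (Sum : a + c = N + 1). { unfold a, c. rewrite EN, !plus_INR, minus_INR by lia. simpl. ring. }
        eapply Rle_trans. apply Rmult_le_compat; try apply Rabs_pos. apply Q1. apply Q2.
        replace (/ 4 * 32 ^ S i / a ^ 2 * (/ 4 * 32 ^ (m - i) / c ^ 2)) with (/ 8 * 32 ^ S m * (/ 2 * (/ a ^ 2 * / c ^ 2))).
        2: { replace (S m) with (S i + (m - i))%nat by lia. rewrite pow_add. field. split; lra. }
        unfold B. replace (/ 2 * (/ 4 * 32 ^ S m / N ^ 2) * (/ a ^ 2 + / c ^ 2)) with (/ 8 * 32 ^ S m * ((/ a ^ 2 + / c ^ 2) * / N ^ 2)) by (field; lra).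
        apply Rmult_le_compat_l. simpl; lra.
        (* The identity 1 / (a^2 c^2) = (1 / a^2 + 1 / c^2) / (a^2 + c^2), together with 2 (a^2 +
           c^2) >= (a + c)^2 and a + c = N + 1, separates the convolution into two sums of inverse
           squares. *)
        replace (/ 2 * (/ a ^ 2 * / c ^ 2)) with ((/ a ^ 2 + / c ^ 2) * / (2 * (a ^ 2 + c ^ 2))) by (field; split; [lra|split; [lra|nra]]).
        apply Rmult_le_compat_l. lra. apply Rinv_le_contravar; auto. apply Rle_trans with ((a + c) ^ 2). rewrite Sum; nra.
        generalize (pow2_ge_0 (a - c)). nra.
    - rewrite (sum_eq _ (fun i => (/ INR (i + 2) ^ 2 + / INR (m - i + 1) ^ 2) * (/ 2 * B))) by (intros; ring). rewrite <- scal_sum.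
      apply Rmult_le_compat_l. lra. rewrite plus_sum, (sum_rev (fun k => / INR (k + 1) ^ 2)).
      assert (X1 := sum_inv_sq m). assert (0 < / INR (m + 2)) by (apply Rinv_0_lt_compat, lt_0_INR; lia).
      assert (X2 : sum_f_R0 (fun k => / INR (k + 1) ^ 2) m <= 2).
      { destruct m as [|k]. simpl; lra. rewrite decomp_sum by lia. simpl pred. rewrite (sum_eq _ (fun i => / INR (i + 2) ^ 2)) by (intros; do 3 f_equal; lia).
        assert (X3 := sum_inv_sq k). assert (0 < / INR (k + 2)) by (apply Rinv_0_lt_compat, lt_0_INR; lia). simpl INR. lra. }
      lra. }
  unfold Rminus. eapply Rle_trans. apply Rabs_triang. rewrite Rabs_Ropp. fold B. lra.
Qed.

Lemma vs_le n : Rabs (vs n) <= 32 ^ n.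
Proof.
  destruct n as [|n]. change (vs 0) with 1. rewrite Rabs_R1. simpl; lra.
  eapply Rle_trans. apply vs_bound. lia. assert (0 < 32 ^ S n) by (apply pow_lt; lra).
  assert (1 <= INR (S n + 1)) by (rewrite plus_INR, S_INR; generalize (pos_INR n); simpl; lra).
  apply Rle_trans with (/ 4 * 32 ^ S n / 1). apply Rmult_le_compat_l. lra. apply Rinv_le_contravar. lra. nra. lra.
Qed.

(* [ps gam n] is the coefficient of [w^n] in [tau^gam * (w / (tau - 1))^2]. *)
Definition pstep (gam : C) (m : nat) (f : nat -> C) : C :=
  ((gam * f m - Csum (fun i => RtoC (INR (m + 2 + i) * vs (S i)) * f (m - i)%nat) (S m)) / RtoC (INR (S m)))%C.
Definition ps (gam : C) : nat -> C := cseq (RtoC 1) (pstep gam).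

Lemma ps_S gam m : ps gam (S m) = pstep gam m (ps gam).
Proof.
  apply cseq_S. intros f g H. unfold pstep. rewrite (H m) by lia. apply (f_equal (fun a => (gam * g m - a) / _)%C). apply Csum_ext. intros i Hi. rewrite H by lia. auto.
Qed.

Lemma Cmod_Csum f n : Cmod (Csum f (S n)) <= sum_f_R0 (fun i => Cmod (f i)) n.
Proof.
  induction n. simpl. rewrite Cplus_0_l. lra. rewrite tech5. simpl Csum. eapply Rle_trans. apply Cmod_triangle. apply Rplus_le_compat_r. apply IHn.
Qed.

(** Uniform for |gam| <= G. In each step the convolution uses at most half of the bound, as r >= 160
    dominates the ratio 32, and the term with [gam] at most the other half, as r >= 3 G. *)
Lemma ps_bound gam G n : Cmod gam <= G -> Cmod (ps gam n) <= (160 + 3 * G) ^ n.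
Proof.
  intros HG. assert (G0 := Rle_trans _ _ _ (Cmod_ge_0 _) HG). set (r := 160 + 3 * G).
  induction n as [n IH] using lt_wf_ind. destruct n as [|m].
  - unfold ps, cseq. simpl. rewrite Cmod_1. lra.
  - rewrite ps_S. unfold pstep. assert (Hm : 0 < INR (S m)) by (apply lt_0_INR; lia).
    rewrite Cmod_div, Cmod_RtoC, Rabs_pos_eq by (try apply RtoC_neq0; lra). apply (Rmult_le_reg_r (INR (S m))); auto.
    unfold Rdiv. rewrite Rmult_assoc, Rinv_l, Rmult_1_r by lra.
    assert (Pr : 0 < r ^ m) by (apply pow_lt; unfold r; lra).
    assert (S1 : Cmod (gam * ps gam m) <= G * r ^ m). { rewrite Cmod_mult. apply Rmult_le_compat; auto using Cmod_ge_0. }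
    assert (S2 : Cmod (Csum (fun i => RtoC (INR (m + 2 + i) * vs (S i)) * ps gam (m - i))%C (S m)) <= 2 * INR (S m) * sum_f_R0 (fun i => 32 ^ S i * r ^ (m - i)) m).
    { eapply Rle_trans. apply Cmod_Csum. rewrite scal_sum. apply sum_Rle. intros i Hi. rewrite Cmod_mult, Cmod_RtoC, Rabs_mult, (Rabs_pos_eq (INR _)) by apply pos_INR.
      assert (V := vs_le (S i)). assert (Q := IH (m - i)%nat ltac:(lia)).
      assert (I1 : INR (m + 2 + i) <= 2 * INR (S m)). { replace (2 * INR (S m)) with (INR (2 * S m)) by (rewrite mult_INR; simpl; ring). apply le_INR. lia. }
      assert (X := Rmult_le_compat _ _ _ _ (pos_INR _) (Rabs_pos _) I1 V).
      assert (Y := Rmult_le_compat _ _ _ _ (Rmult_le_pos _ _ (pos_INR _) (Rabs_pos _)) (Cmod_ge_0 _) X Q). lra. }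
    assert (S3 : forall k, sum_f_R0 (fun i => 32 ^ S i * r ^ (k - i)) k * (r - 32) = 32 * (r ^ S k - 32 ^ S k)).
    { induction k. simpl. ring. rewrite tech5, Nat.sub_diag. rewrite (sum_eq _ (fun i => 32 ^ S i * r ^ (k - i) * r)).
      rewrite <- scal_sum. replace ((r * sum_f_R0 (fun i : nat => 32 ^ S i * r ^ (k - i)) k + 32 ^ S (S k) * r ^ 0) * (r - 32)) with (r * (sum_f_R0 (fun i : nat => 32 ^ S i * r ^ (k - i)) k * (r - 32)) + 32 ^ S (S k) * (r - 32)) by (simpl; ring).
      rewrite IHk. simpl. ring.
      intros i Hi. replace (S k - i)%nat with (S (k - i)) by lia. simpl. ring. }
    assert (S4 : sum_f_R0 (fun i => 32 ^ S i * r ^ (m - i)) m <= r ^ S m / 4).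
    { apply (Rmult_le_reg_r (r - 32)). unfold r; lra. rewrite S3. assert (0 < 32 ^ S m) by (apply pow_lt; lra). assert (0 < r ^ S m) by (apply pow_lt; unfold r; lra).
      replace (r ^ S m / 4 * (r - 32)) with (32 * r ^ S m + r ^ S m / 4 * (r - 160)) by field.
      assert (0 <= r ^ S m / 4 * (r - 160)) by (apply Rmult_le_pos; unfold r in *; lra). lra. }
    eapply Rle_trans. apply Cmod_triang_minus.
    assert (S5 : 2 * INR (S m) * sum_f_R0 (fun i : nat => 32 ^ S i * r ^ (m - i)) m <= 2 * INR (S m) * (r ^ S m / 4)) by (apply Rmult_le_compat_l; lra).
    assert (1 <= INR (S m)) by (rewrite S_INR; generalize (pos_INR m); lra).
    assert (S6 : G * r ^ m * 1 <= r ^ S m / 2 * INR (S m)). { apply Rmult_le_compat; try lra. apply Rmult_le_pos; lra. simpl. unfold r at 2. nra. }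
    lra.
Qed.

Lemma ps_inside (a : nat -> R) C r x : (forall n, Rabs (a n) <= C * r ^ n) -> 0 < r -> Rabs x * r < 1 -> Rbar_lt (Rabs x) (CV_radius a).
Proof.
  intros H Hr Hx. apply (Rbar_lt_le_trans _ (/ r)).
  - simpl. apply (Rmult_lt_reg_r r); auto. rewrite Rinv_l; lra.
  - apply (proj1 (CV_radius_bounded a)). exists C. intros n. rewrite Rabs_mult, (Rabs_pos_eq ((/ r) ^ n)) by (apply pow_le; left; apply Rinv_0_lt_compat; auto).
    rewrite pow_inv. assert (P : 0 < r ^ n) by (apply pow_lt; auto). apply (Rmult_le_reg_r (r ^ n)); auto. rewrite Rmult_assoc, Rinv_l, Rmult_1_r by lra. auto.
Qed.

(** The ratio r |x| <= 1/2 makes the geometric remainder at most twice its first term. The [match]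
    encodes the sum of the first n terms, which is empty for n = 0. *)
Lemma ps_tail n : forall (a : nat -> R) C r x, (forall n, Rabs (a n) <= C * r ^ n) -> 0 < r -> Rabs x * r <= / 2 ->
  Rabs (PSeries a x - match n with O => 0 | S m => sum_f_R0 (fun k => a k * x ^ k) m end) <= 2 * C * (r * Rabs x) ^ n.
Proof.
  induction n as [|n IH]; intros a C r x H Hr Hx.
  - rewrite Rminus_0_r. simpl. rewrite Rmult_1_r.
    assert (HC : 0 <= C). { specialize (H O). simpl in H. generalize (Rabs_pos (a O)); lra. }
    assert (Q : Rabs (/ 2) < 1) by (rewrite Rabs_pos_eq; lra).
    assert (E : ex_series (fun k => C * (/ 2) ^ k)). { apply (ex_series_scal C (fun k => (/ 2) ^ k)). exists (/ (1 - / 2)). apply is_series_geom; auto. }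
    assert (B : forall k, 0 <= Rabs (a k * x ^ k) <= C * (/ 2) ^ k).
    { intros k. split. apply Rabs_pos. rewrite Rabs_mult, <- RPow_abs. apply Rle_trans with (C * r ^ k * Rabs x ^ k).
      apply Rmult_le_compat_r; auto. apply pow_le, Rabs_pos. rewrite Rmult_assoc, <- Rpow_mult_distr. apply Rmult_le_compat_l; auto.
      apply pow_incr. split. apply Rmult_le_pos. lra. apply Rabs_pos. lra. }
    assert (E2 : ex_series (fun k => Rabs (a k * x ^ k))).
    { apply (ex_series_le (V:=RV) _ (fun k => C * (/ 2) ^ k)); auto. intros k. unfold norm; simpl. unfold abs; simpl. rewrite Rabs_Rabsolu. apply B. }
    unfold PSeries. eapply Rle_trans. apply Series_Rabs; auto. eapply Rle_trans. apply Series_le; [apply B|auto].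
    rewrite Series_scal_l, Series_geom by auto. right; field.
  - assert (X : PSeries a x = a O + x * PSeries (PS_decr_1 a) x).
    { apply PSeries_decr_1. apply CV_radius_inside. apply (ps_inside a C r); auto. lra. }
    assert (Q := IH (PS_decr_1 a) (C * r) r x).
    rewrite X. replace (a O + x * PSeries (PS_decr_1 a) x - sum_f_R0 (fun k => a k * x ^ k) n) with (x * (PSeries (PS_decr_1 a) x - match n with O => 0 | S m => sum_f_R0 (fun k => PS_decr_1 a k * x ^ k) m end)).
    + rewrite Rabs_mult. apply Rle_trans with (Rabs x * (2 * (C * r) * (r * Rabs x) ^ n)).
      * apply Rmult_le_compat_l. apply Rabs_pos. apply Q; auto. intros k. unfold PS_decr_1. eapply Rle_trans. apply H. simpl. right; ring.
      * simpl. right; ring.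
    + destruct n. simpl. ring. rewrite (decomp_sum _ (S n)) by lia. simpl pred. unfold PS_decr_1.
      rewrite (sum_eq (fun i => a (S i) * x ^ S i) (fun i => (a (S i) * x ^ i) * x)) by (intros; simpl; ring). rewrite <- scal_sum. simpl. ring.
Qed.

Definition vf (w : R) : R := PSeries vs w.
Definition vf' (w : R) : R := PSeries (PS_derive vs) w.
Definition tauf (w : R) : R := 1 + w * vf w.
Definition uu (w : R) : R := ln (tauf w).

Lemma vs_le' n : Rabs (vs n) <= 1 * 32 ^ n.
Proof. rewrite Rmult_1_l. apply vs_le. Qed.

Lemma vf_bounds w : Rabs w <= / 128 -> / 2 <= vf w <= 3 / 2 /\ 0 < tauf w.
Proof.
  intros H. assert (Q := ps_tail 1 vs 1 32 w vs_le' ltac:(lra) ltac:(lra)). simpl in Q. change (vs 0) with 1 in Q. fold (vf w) in Q.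
  assert (B : Rabs (vf w - 1) <= / 2). { eapply Rle_trans. rewrite <- (Rmult_1_r 1) at 1. apply Q. lra. }
  apply Rabs_le_between in B. split. lra. unfold tauf. apply Rabs_le_between in H. nra.
Qed.

Lemma vf_derive w : Rabs w <= / 128 -> is_derive vf w (vf' w).
Proof. intros H. apply is_derive_PSeries. apply (ps_inside vs 1 32); auto using vs_le'; lra. Qed.

Lemma Rabs_open w d : Rabs w < d -> locally w (fun t => Rabs t < d).
Proof.
  intros H. assert (P : 0 < d - Rabs w) by lra. exists (mkposreal _ P).
  assert (X : forall y : R, Rabs (y - w) < d - Rabs w -> Rabs y < d).
  { intros y Hy. generalize (Rabs_triang (y - w) w). replace (y - w + w) with y by ring. lra. }
  intros y Hy. apply X, Hy.
Qed.

(** This is tau = v tau', the differential equation of the branch, obtained by summing the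
    coefficient relation [vs_sq]. *)
Lemma vf_ode w : Rabs w < / 128 -> tauf w = vf w * (vf w + w * vf' w).
Proof.
  intros H. set (s := PS_mult vs vs).
  assert (Sb : forall n, Rabs (s n) <= 1 * 32 ^ n).
  { intros [|n]. unfold s, PS_mult. simpl. change (vs 0) with 1. rewrite !Rmult_1_l, Rabs_R1. lra.
    unfold s. rewrite vs_sq, Rabs_mult. assert (Hn : 2 < INR (n + 3)) by (rewrite plus_INR; simpl; generalize (pos_INR n); lra).
    rewrite Rabs_pos_eq by (apply Rlt_le, Rdiv_lt_0_compat; lra). assert (V := vs_le n). assert (P := Rabs_pos (vs n)).
    assert (Q : 2 / INR (n + 3) <= 1) by (apply (Rmult_le_reg_r (INR (n + 3))); [lra|]; unfold Rdiv; rewrite Rmult_assoc, Rinv_l by lra; lra).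
    assert (0 < 32 ^ n) by (apply pow_lt; lra). simpl. assert (Q2 : 0 <= 2 / INR (n + 3)) by (apply Rlt_le, Rdiv_lt_0_compat; lra). nra. }
  assert (I : forall t, Rabs t < / 128 -> Rbar_lt (Rabs t) (CV_radius s) /\ Rbar_lt (Rabs t) (CV_radius vs)).
  { intros t Ht. split; [apply (ps_inside s 1 32)|apply (ps_inside vs 1 32)]; auto using vs_le'; lra. }
  destruct (I w H) as [I1 I2].
  assert (E1 : PSeries (PS_derive s) w = 2 * vf w * vf' w).
  { rewrite <- (is_derive_unique _ _ _ (is_derive_PSeries s w I1)).
    rewrite (Derive_ext_loc _ (fun t => vf t * vf t)).
    - apply is_derive_unique. evar_last. apply dR_mult; apply vf_derive; lra. ring.
    - apply (filter_imp _ _ (fun t Ht => PSeries_mult vs vs t (proj2 (I t Ht)) (proj2 (I t Ht)))). apply Rabs_open; auto. }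
  assert (E2 : vf w * vf w = 1 + w * PSeries (PS_decr_1 s) w).
  { unfold vf. rewrite <- PSeries_mult by auto. fold s. rewrite (PSeries_decr_1 s w (CV_radius_inside s w I1)). f_equal. unfold s, PS_mult. simpl. change (vs 0) with 1. ring. }
  assert (E3 : vf w = PSeries (PS_decr_1 s) w + / 2 * PSeries (PS_derive s) w).
  { rewrite <- PSeries_scal, <- PSeries_plus.
    - unfold vf. apply PSeries_ext. intros n. unfold PS_plus, PS_scal, PS_decr_1, PS_derive, plus, scal; simpl plus. unfold s. rewrite vs_sq. simpl. unfold mult; simpl.
      change (match n with O => 1 | S _ => INR n + 1 end) with (INR (S n)). rewrite S_INR, plus_INR. simpl. generalize (pos_INR n); intros. field. lra.
    - apply CV_radius_inside. apply (ps_inside _ 32 32); try lra. intros n. unfold PS_decr_1. eapply Rle_trans. apply Sb. simpl. lra.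
    - apply ex_pseries_scal. apply Rmult_comm. apply CV_radius_inside. rewrite CV_radius_derive. auto. }
  unfold tauf. rewrite E3 at 1. rewrite E1. transitivity (1 + w * PSeries (PS_decr_1 s) w + w * vf w * vf' w). field. rewrite <- E2. ring.
Qed.

Lemma tauf_derive w : Rabs w < / 128 -> is_derive tauf w (tauf w / vf w).
Proof.
  intros H. destruct (vf_bounds w ltac:(lra)) as [B _]. unfold tauf at 1. evar_last.
  - apply (is_derive_plus (fun _ => 1)). apply is_derive_const. apply dR_mult. apply is_derive_id. apply vf_derive. lra.
  - rewrite (vf_ode w H). unfold plus, zero, one; simpl. field. lra.
Qed.

Lemma uu_derive w : Rabs w < / 128 -> is_derive uu w (/ vf w).
Proof.
  intros H. destruct (vf_bounds w ltac:(lra)) as [B T]. unfold uu. evar_last.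
  - apply (dR_comp ln tauf). apply tauf_derive; auto. apply is_derive_ln; auto.
  - field. split; lra.
Qed.

Lemma exp_uu w : Rabs w <= / 128 -> exp (uu w) = tauf w.
Proof. intros H. apply exp_ln. apply vf_bounds; auto. Qed.

Lemma seg_abs (w t d : R) : Rabs w < d -> Rmin 0 w <= t <= Rmax 0 w -> Rabs t < d.
Proof. intros H Ht. apply Rabs_def2 in H. unfold Rmin, Rmax in Ht. destruct (Rle_dec 0 w); apply Rabs_def1; lra. Qed.

Lemma dC_const_on (f : R -> C) w : (forall t, Rmin 0 w <= t <= Rmax 0 w -> dC f t 0%C) -> f w = f 0.
Proof.
  intros H. assert (M := dC_mvt f (fun _ => 0%C) 0 (Rmin 0 w) (Rmax 0 w) ltac:(apply Rminmax)).
  assert (Z : Cmod (f (Rmax 0 w) - f (Rmin 0 w)) <= 2 * 0 * (Rmax 0 w - Rmin 0 w)). { apply M. intros t Ht. split; auto. rewrite Cmod_0; lra. }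
  assert (Z' : (f (Rmax 0 w) - f (Rmin 0 w))%C = 0%C). { apply Cmod_eq_0. apply Rle_antisym; [lra|apply Cmod_ge_0]. }
  unfold Rmin, Rmax in Z'. destruct (Rle_dec 0 w).
  transitivity (f w - f 0 + f 0)%C; [ring|rewrite Z'; ring]. transitivity (f 0 - (f 0 - f w))%C; [ring|rewrite Z'; ring].
Qed.

Lemma tau_eq w : Rabs w < / 128 -> w ^ 2 / 2 = tauf w - ln (tauf w) - 1.
Proof.
  intros H. assert (E : RtoC (tauf w - uu w - w ^ 2 / 2) = RtoC (tauf 0 - uu 0 - 0 ^ 2 / 2)).
  { apply (dC_const_on (fun w => RtoC (tauf w - uu w - w ^ 2 / 2)) w). intros t Ht. assert (Ht' := seg_abs w t _ H Ht).
    destruct (vf_bounds t ltac:(lra)) as [B T]. evar_last.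
    - apply dC_RtoC. apply @is_derive_minus. apply @is_derive_minus. apply tauf_derive; auto. apply uu_derive; auto. auto_derive; auto.
    - apply f_equal. unfold minus, plus, opp; simpl. unfold tauf. field. lra. }
  apply (f_equal Re) in E. simpl in E. unfold uu, tauf in *. rewrite Rmult_0_l, Rplus_0_r, ln_1 in E. lra.
Qed.

Definition PF (gam : C) (w : R) : C := (PSeries (fun n => Re (ps gam n)) w, PSeries (fun n => Im (ps gam n)) w).
Definition PF' (gam : C) (w : R) : C := (PSeries (PS_derive (fun n => Re (ps gam n))) w, PSeries (PS_derive (fun n => Im (ps gam n))) w).

Lemma ps_comp_bound gam G n : Cmod gam <= G -> Rabs (Re (ps gam n)) <= 1 * (160 + 3 * G) ^ n /\ Rabs (Im (ps gam n)) <= 1 * (160 + 3 * G) ^ n.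
Proof.
  intros H. assert (Q := ps_bound gam G n H). split; rewrite Rmult_1_l. eapply Rle_trans; [apply Re_le_Cmod|auto]. eapply Rle_trans; [apply Im_le_Cmod|auto].
Qed.

Lemma ps_conv gam n : (Csum (fun i => RtoC (vs i * INR (S (n - i))) * ps gam (S (n - i))) (S n) =
  gam * ps gam n - 2 * Csum (fun i => RtoC (INR (S i) * vs (S i)) * ps gam (n - i)) (S n))%C.
Proof.
  assert (Hn : RtoC (INR (S n)) <> 0%C) by (apply RtoC_neq0, not_0_INR; lia).
  rewrite Csum_S_l. rewrite Nat.sub_0_r. change (vs 0) with 1. rewrite ps_S. unfold pstep at 1.
  assert (E : Csum (fun k => RtoC (vs (S k) * INR (S (n - S k))) * ps gam (S (n - S k)))%C n = Csum (fun k => RtoC (vs (S k) * INR (n - k)) * ps gam (n - k))%C (S n)).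
  { set (g := fun k => (RtoC (vs (S k) * INR (n - k)) * ps gam (n - k))%C). change (Csum g (S n)) with (Csum g n + g n)%C. unfold g at 2. rewrite Nat.sub_diag. change (INR 0) with 0. rewrite Rmult_0_r, Cmult_0_l, Cplus_0_r. unfold g. apply Csum_ext. intros k Hk. replace (S (n - S k)) with (n - k)%nat by lia. auto. }
  rewrite E. rewrite Rmult_1_l.
  assert (E2 : Csum (fun i : nat => RtoC (INR (n + 2 + i) * vs (S i)) * ps gam (n - i))%C (S n) =
     (Csum (fun k => RtoC (vs (S k) * INR (n - k)) * ps gam (n - k)) (S n) + 2 * Csum (fun i => RtoC (INR (S i) * vs (S i)) * ps gam (n - i)) (S n))%C).
  { rewrite <- Csum_scal, <- Csum_plus. apply Csum_ext. intros k Hk. replace (n + 2 + k)%nat with ((n - k) + 2 * S k)%nat by lia.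
    rewrite plus_INR, mult_INR. set (q := ps gam _). apply C_ext; simpl; ring. }
  rewrite E2. field; auto.
Qed.

Lemma Csum_sum f n : Re (Csum f (S n)) = sum_f_R0 (fun k => Re (f k)) n /\ Im (Csum f (S n)) = sum_f_R0 (fun k => Im (f k)) n.
Proof. rewrite <- Csum_Re, <- Csum_Im, !sum_n_Reals. auto. Qed.

(** The relation v P' = (gam - 2 v') P is the equation satisfied by tau^gam / v^2, because (log
    tau)' = 1 / v; [ps_conv] is its coefficient form. [PF_eq] then concludes by differentiating a
    quotient. *)
Lemma PF_facts gam G w : Cmod gam <= G -> Rabs w * (160 + 3 * G) < 1 -> Rabs w < / 128 ->
  dC (PF gam) w (PF' gam w) /\ (RtoC (vf w) * PF' gam w = (gam - 2 * RtoC (vf' w)) * PF gam w)%C.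
Proof.
  intros HG Hw Hw2. assert (G0 := Rle_trans _ _ _ (Cmod_ge_0 _) HG).
  assert (IR : Rbar_lt (Rabs w) (CV_radius (fun n => Re (ps gam n)))) by (apply (ps_inside _ 1 (160 + 3 * G)); try lra; intros; apply ps_comp_bound; auto).
  assert (II : Rbar_lt (Rabs w) (CV_radius (fun n => Im (ps gam n)))) by (apply (ps_inside _ 1 (160 + 3 * G)); try lra; intros; apply ps_comp_bound; auto).
  assert (IV : Rbar_lt (Rabs w) (CV_radius vs)) by (apply (ps_inside vs 1 32); auto using vs_le'; lra).
  assert (ID : forall a, Rbar_lt (Rabs w) (CV_radius a) -> Rbar_lt (Rabs w) (CV_radius (PS_derive a))) by (intros a; rewrite CV_radius_derive; auto).
  split. split; simpl; apply is_derive_PSeries; auto.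
  assert (K : forall (c d : R) (a b e : nat -> R), Rbar_lt (Rabs w) (CV_radius a) -> Rbar_lt (Rabs w) (CV_radius b) ->
     Rbar_lt (Rabs w) (CV_radius e) ->
     (forall n, PS_mult vs (PS_derive e) n = c * a n + d * b n - 2 * PS_mult (PS_derive vs) e n) ->
     vf w * PSeries (PS_derive e) w = c * PSeries a w + d * PSeries b w - 2 * (vf' w * PSeries e w)).
  { intros c d a b e Ha Hb He Hn. unfold vf, vf'. rewrite <- !PSeries_mult by auto.
    rewrite (PSeries_ext _ (PS_plus (PS_plus (PS_scal c a) (PS_scal d b)) (PS_scal (- 2) (PS_mult (PS_derive vs) e)))).
    - assert (Xa : ex_pseries (PS_scal c a) w) by (apply ex_pseries_scal; [apply Rmult_comm|apply CV_radius_inside; auto]).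
      assert (Xb : ex_pseries (PS_scal d b) w) by (apply ex_pseries_scal; [apply Rmult_comm|apply CV_radius_inside; auto]).
      assert (Xe : ex_pseries (PS_scal (- 2) (PS_mult (PS_derive vs) e)) w) by (apply ex_pseries_scal; [apply Rmult_comm|apply ex_pseries_mult; auto]).
      rewrite (PSeries_plus _ _ _ (ex_pseries_plus _ _ _ Xa Xb) Xe), (PSeries_plus _ _ _ Xa Xb), !PSeries_scal. ring.
    - intros n. rewrite Hn. unfold PS_plus, PS_scal, plus, scal; simpl. unfold mult; simpl. ring. }
  assert (CR : forall a b c, Re (a * b - 2 * c)%C = Re a * Re b - Im a * Im b - 2 * Re c /\ Im (a * b - 2 * c)%C = Re a * Im b + Im a * Re b - 2 * Im c).
  { intros. split; simpl; unfold Re, Im; ring. }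
  apply C_ext.
  - assert (X := K (Re gam) (- Im gam) (fun n => Re (ps gam n)) (fun n => Im (ps gam n)) (fun n => Re (ps gam n)) IR II IR).
    unfold PF, PF'. simpl. rewrite Rmult_0_l, Rminus_0_r. rewrite X.
    + unfold Re, Im. ring.
    + intros n. assert (E := f_equal Re (ps_conv gam n)). rewrite (proj1 (Csum_sum _ n)) in E.
      unfold PS_mult, PS_derive. rewrite (sum_eq _ (fun k => Re (RtoC (vs k * INR (S (n - k))) * ps gam (S (n - k)))%C)) by (intros; simpl; unfold Re; ring).
      rewrite E, (proj1 (CR _ _ _)), (proj1 (Csum_sum _ n)).
      rewrite (sum_eq (fun k => INR (S k) * vs (S k) * Re (ps gam (n - k))) (fun k => Re (RtoC (INR (S k) * vs (S k)) * ps gam (n - k))%C)) by (intros; simpl; unfold Re; ring). ring.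
  - assert (X := K (Re gam) (Im gam) (fun n => Im (ps gam n)) (fun n => Re (ps gam n)) (fun n => Im (ps gam n)) II IR II).
    unfold PF, PF'. simpl. rewrite Rmult_0_l, Rplus_0_r. rewrite X.
    + unfold Re, Im. ring.
    + intros n. assert (E := f_equal Im (ps_conv gam n)). rewrite (proj2 (Csum_sum _ n)) in E.
      unfold PS_mult, PS_derive. rewrite (sum_eq _ (fun k => Im (RtoC (vs k * INR (S (n - k))) * ps gam (S (n - k)))%C)) by (intros; simpl; unfold Im; ring).
      rewrite E, (proj2 (CR _ _ _)), (proj2 (Csum_sum _ n)).
      rewrite (sum_eq (fun k => INR (S k) * vs (S k) * Im (ps gam (n - k))) (fun k => Im (RtoC (INR (S k) * vs (S k)) * ps gam (n - k))%C)) by (intros; simpl; unfold Im; ring). ring.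
Qed.

Lemma PF_eq gam G w : Cmod gam <= G -> Rabs w * (160 + 3 * G) < 1 -> Rabs w < / 128 ->
  PF gam w = (Cexp (gam * RtoC (uu w)) / (RtoC (vf w) * RtoC (vf w)))%C.
Proof.
  intros HG Hw H. assert (G0 := Rle_trans _ _ _ (Cmod_ge_0 _) HG).
  assert (E : (PF gam w * Cexp (- gam * RtoC (uu w)) * (RtoC (vf w) * RtoC (vf w)))%C = (PF gam 0 * Cexp (- gam * RtoC (uu 0)) * (RtoC (vf 0) * RtoC (vf 0)))%C).
  { apply (dC_const_on (fun w => PF gam w * Cexp (- gam * RtoC (uu w)) * (RtoC (vf w) * RtoC (vf w)))%C w). intros t Ht. assert (Ht' := seg_abs w t _ H Ht).
    destruct (vf_bounds t ltac:(lra)) as [B T].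
    assert (Hw' : Rabs t * (160 + 3 * G) < 1).
    { assert (Z := seg_abs w t (/ (160 + 3 * G))). apply (Rmult_lt_reg_r (/ (160 + 3 * G))). apply Rinv_0_lt_compat; lra. rewrite Rmult_assoc, Rinv_r, Rmult_1_r, Rmult_1_l by lra.
      apply Z; auto. apply (Rmult_lt_reg_r (160 + 3 * G)). lra. rewrite Rinv_l; lra. }
    destruct (PF_facts gam G t HG Hw' Ht') as [D O]. evar_last.
    - apply dC_mult. apply dC_mult. apply D. apply dC_Cexp. apply dC_mult. apply dC_const. apply dC_RtoC. apply uu_derive; auto.
      apply dC_mult; apply dC_RtoC; apply vf_derive; lra.
    - cbv beta. rewrite RtoC_inv by lra. set (e := Cexp _). set (v := RtoC (vf t)) in *. assert (Hv : v <> 0%C) by (apply RtoC_neq0; lra).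
      transitivity (e * v * (v * PF' gam t - (gam - 2 * RtoC (vf' t)) * PF gam t))%C. field; auto. rewrite O. ring. }
  replace (- gam * RtoC (uu w))%C with (- (gam * RtoC (uu w)))%C in E by ring. rewrite Cexp_opp in E.
  assert (E0 : (PF gam 0 * Cexp (- gam * RtoC (uu 0)) * (RtoC (vf 0) * RtoC (vf 0)))%C = 1%C).
  { unfold PF, vf, uu, tauf. rewrite !PSeries_0, Rmult_0_l, Rplus_0_r, ln_1, Cmult_0_r, Cexp_0. unfold ps, vs, cseq. simpl. apply C_ext; simpl; ring. }
  rewrite E0 in E. destruct (vf_bounds w ltac:(lra)) as [B T]. assert (RtoC (vf w) <> 0%C) by (apply RtoC_neq0; lra).
  transitivity ((PF gam w * / Cexp (gam * RtoC (uu w)) * (RtoC (vf w) * RtoC (vf w))) * Cexp (gam * RtoC (uu w)) / (RtoC (vf w) * RtoC (vf w)))%C.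
  field. split; auto. apply Cexp_neq0. rewrite E. field. auto.
Qed.

(** * Uniqueness of the branch and of the coefficients G *)

Lemma pow_n_RtoC w k : @pow_n C_Ring (RtoC w) k = RtoC (@pow_n R_Ring w k).
Proof. induction k. reflexivity. simpl. rewrite IHk. unfold mult; simpl. rewrite RtoC_mult. reflexivity. Qed.

Lemma is_pseries_C (g : nat -> C) w l : @is_pseries C_AbsRing C_NormedModule g (RtoC w) l <->
  is_pseries (fun n => Re (g n)) w (Re l) /\ is_pseries (fun n => Im (g n)) w (Im l).
Proof.
  assert (E : forall n, @sum_n C_AbelianMonoid (fun k => @scal C_AbsRing C_NormedModule (@pow_n C_Ring (RtoC w) k) (g k)) n =
     (sum_n (fun k => scal (pow_n w k) (Re (g k))) n, sum_n (fun k => scal (pow_n w k) (Im (g k))) n)).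
  { assert (SC : forall k c, @scal C_AbsRing C_NormedModule (@pow_n C_Ring (RtoC w) k) c = (scal (pow_n w k) (Re c), scal (pow_n w k) (Im c))).
    { intros k c. rewrite pow_n_RtoC. generalize (@pow_n R_Ring w k). intros p. revert c. change (forall c : C, (RtoC p * c)%C = (p * Re c, p * Im c)). intros. apply C_ext; simpl; unfold Re, Im; ring. }
    induction n; [rewrite !sum_O; apply SC|rewrite !sum_Sn, IHn]. etransitivity. apply (f_equal (plus _)). apply SC. reflexivity. }
  unfold is_pseries, is_series. split.
  - intros H. split; (apply filterlim_locally; intros eps; assert (X := proj1 (filterlim_locally _ _) H eps); revert X; apply filter_imp; intros n [A B]).
    rewrite E in A; exact A. rewrite E in B; exact B.
  - intros [A B]. apply filterlim_locally. intros eps.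
    assert (X := proj1 (filterlim_locally _ _) A eps). assert (Y := proj1 (filterlim_locally _ _) B eps).
    generalize (filter_and _ _ X Y). apply filter_imp. intros n [U V]. rewrite E. split; auto.
Qed.

Lemma ps_radius_pos (a : nat -> R) w l : w <> 0 -> is_pseries a w l -> Rbar_lt 0 (CV_radius a).
Proof.
  intros Hw H. destruct (Rbar_lt_dec (CV_radius a) (Rabs w)) as [L|L].
  - exfalso. apply (CV_disk_outside a w L). apply (is_lim_seq_ext (fun n => scal (pow_n w n) (a n))).
    intros n. rewrite pow_n_pow. unfold scal; simpl. unfold mult; simpl. ring. apply ex_series_lim_0. exists l. exact H.
  - apply Rbar_not_lt_le in L. apply (Rbar_lt_le_trans _ (Rabs w)); auto. simpl. apply Rabs_pos_lt; auto.
Qed.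

(** Equality of the sums is known only for w different from 0. Multiplying both series by w makes
    them agree at 0 as well, and the coefficients move up by one index. *)
Lemma ps_unique (a b : nat -> R) : locally' 0 (fun w => exists l, is_pseries a w l /\ is_pseries b w l) -> forall n, a n = b n.
Proof.
  intros [eps H] n. assert (He := cond_pos eps).
  assert (W : forall w, w <> 0 -> Rabs w < eps -> exists l, is_pseries a w l /\ is_pseries b w l).
  { intros w Hw Hb. apply H; auto. unfold ball; simpl. unfold AbsRing_ball, abs, minus, plus, opp; simpl. rewrite Ropp_0, Rplus_0_r. auto. }
  destruct (W (eps / 2) ltac:(lra) ltac:(rewrite Rabs_pos_eq; lra)) as [l [A B]].
  assert (RA := ps_radius_pos a (eps / 2) l ltac:(lra) A). assert (RB := ps_radius_pos b (eps / 2) l ltac:(lra) B).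
  change (a n) with (PS_incr_1 a (S n)). change (b n) with (PS_incr_1 b (S n)).
  apply PSeries_ext_recip; try (rewrite CV_radius_incr_1; auto).
  exists eps. intros w Hb. rewrite !PSeries_incr_1. destruct (Req_dec w 0) as [->|Hw]. ring.
  unfold ball in Hb; simpl in Hb. unfold AbsRing_ball, abs, minus, plus, opp in Hb; simpl in Hb. rewrite Ropp_0, Rplus_0_r in Hb. destruct (W w Hw Hb) as [k [P Q]].
  rewrite (is_pseries_unique _ _ _ P), (is_pseries_unique _ _ _ Q). auto.
Qed.

Lemma ln_lt_sub1 t : 0 < t -> t <> 1 -> ln t < t - 1.
Proof.
  intros H N. assert (X := exp_ineq1 (ln t)). rewrite exp_ln in X by auto. assert (ln t <> 0). { intros E. apply N. rewrite <- (exp_ln t), E, exp_0; auto. } specialize (X H0). lra.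
Qed.

(** The function t - ln t is strictly monotone on either side of 1; the sign condition puts x and y
    on the same side. *)
Lemma saddle_inj x y : 0 < x -> 0 < y -> 0 < (x - 1) * (y - 1) -> x - ln x = y - ln y -> x = y.
Proof.
  assert (K : forall x y, 0 < x -> x < y -> 0 < (x - 1) * (y - 1) -> x - ln x = y - ln y -> False).
  { intros a c Ha Hac Hp E. assert (Hc : 0 < c) by lra.
    destruct (Rlt_dec 1 a).
    - assert (L := ln_lt_sub1 (c / a)). rewrite ln_div in L by auto. assert (Ht : 1 < c / a). { apply (Rmult_lt_reg_r a); auto. unfold Rdiv. rewrite Rmult_assoc, Rinv_l; lra. }
      specialize (L ltac:(lra) ltac:(lra)). assert (c = c / a * a) by (field; lra). nra.
    - assert (c < 1) by nra. assert (L := ln_lt_sub1 (a / c)). rewrite ln_div in L by auto.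
      assert (Ht : a / c < 1). { apply (Rmult_lt_reg_r c); auto. unfold Rdiv. rewrite Rmult_assoc, Rinv_l; lra. }
      assert (0 < a / c) by (apply Rdiv_lt_0_compat; auto).
      specialize (L ltac:(lra) ltac:(lra)). assert (a = a / c * c) by (field; lra). nra. }
  intros Hx Hy Hp E. destruct (Rtotal_order x y) as [L|[L|L]]; auto; exfalso.
  apply (K x y); auto. apply (K y x); auto. lra.
Qed.

Lemma tauf_branch : is_tau_branch tauf.
Proof.
  assert (N : Rabs 0 < / 128) by (rewrite Rabs_R0; lra). split.
  - apply (filter_imp (fun t => Rabs t < / 128)); [|apply Rabs_open; auto].
    intros t Ht. split. apply vf_bounds; lra. apply tau_eq; auto.
  - apply (is_lim_ext_loc vf).
    + exists (mkposreal 1 ltac:(lra)). intros t _ Ht. unfold tauf. field. auto.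
    + replace (Finite 1) with (Finite (vf 0)). apply is_lim_continuity. apply derivable_continuous_pt. exists (vf' 0). apply is_derive_Reals. apply vf_derive. lra.
      unfold vf. rewrite PSeries_0. reflexivity.
Qed.

(** The limit (tau - 1) / w -> 1 forces tau - 1 to have the sign of w near 0, and [saddle_inj] then
    identifies tau with [tauf]. *)
Lemma tau_branch_unique tau : is_tau_branch tau -> locally 0 (fun w => tau w = tauf w).
Proof.
  intros [[e1 H1] H2].
  assert (L : locally' 0 (fun w => 0 < (tau w - 1) / w)). { apply (H2 (fun y => 0 < y)). exists (mkposreal 1 ltac:(lra)). intros y Hy. apply Rabs_def2 in Hy. unfold minus, plus, opp in Hy; simpl in Hy. lra. }
  destruct L as [e2 H3].
  assert (N : Rabs 0 < / 128) by (rewrite Rabs_R0; lra).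
  assert (L3 : locally 0 (fun w => ball 0 e1 w /\ ball 0 e2 w /\ Rabs w < / 128)).
  { apply filter_and. apply locally_ball. apply filter_and. apply locally_ball. apply Rabs_open; auto. }
  revert L3. apply filter_imp. intros w [B1 [B2 Hw]]. destruct (H1 w B1) as [T0 T1]. assert (E := tau_eq w Hw). destruct (vf_bounds w ltac:(lra)) as [V T].
  destruct (Req_dec w 0) as [->|Hw0].
  - assert (tauf 0 = 1) by (unfold tauf; ring). destruct (Req_dec (tau 0) 1) as [|Q]; [congruence|]. assert (X := ln_lt_sub1 _ T0 Q). simpl in T1. lra.
  - specialize (H3 w B2 Hw0). apply saddle_inj; auto; [|lra]. unfold tauf. replace (1 + w * vf w - 1) with (w * vf w) by ring.
    replace ((tau w - 1) * (w * vf w)) with ((tau w - 1) / w * (w * w * vf w)) by (field; auto). apply Rmult_lt_0_compat; auto. apply Rmult_lt_0_compat; nra.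
Qed.

Definition Gval (gam : C) (tau : R -> R) (w : R) : C := (Rcpow (tau w) (gam - 1) / RtoC (1 - tau w) * RtoC (Derive tau w) + 1 / RtoC w)%C.

(** With tau' = tau / v and 1 - tau = - w v, the expanded function equals (1 - P) / w for P =
    tau^gam / v^2 = [PF gam]. So the constant coefficient 1 of P accounts for the polar part and G_k
    is minus the coefficient k + 1. *)
Lemma tauf_expansion gam : locally' 0 (fun w => @is_pseries C_AbsRing C_NormedModule (fun k => - ps gam (S k))%C (RtoC w) (Gval gam tauf w)).
Proof.
  set (r := 160 + 3 * Cmod gam). assert (HG := Cmod_ge_0 gam).
  assert (X : locally 0 (fun w => Rabs w < / r)). { apply Rabs_open. rewrite Rabs_R0. apply Rinv_0_lt_compat. unfold r; lra. }
  destruct X as [e He]. exists e. intros w Hb Hw0. specialize (He w Hb). simpl in He.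
  assert (Hr : / r <= / 160) by (apply Rinv_le_contravar; unfold r; lra).
  assert (Hwr : Rabs w * r < 1). { apply (Rmult_lt_reg_r (/ r)). apply Rinv_0_lt_compat; unfold r; lra. rewrite Rmult_assoc, Rinv_r, Rmult_1_r, Rmult_1_l; auto. unfold r; lra. }
  assert (Hw : Rabs w < / 128) by lra.
  destruct (vf_bounds w ltac:(lra)) as [V T]. assert (Vc : RtoC (vf w) <> 0%C) by (apply RtoC_neq0; lra). assert (Wc : RtoC w <> 0%C) by (apply RtoC_neq0; auto).
  assert (EV : Gval gam tauf w = ((1 - PF gam w) / RtoC w)%C).
  { rewrite (PF_eq gam (Cmod gam) w) by (auto; lra). unfold Gval. rewrite (is_derive_unique _ _ _ (tauf_derive w Hw)). unfold Rcpow. change (ln (tauf w)) with (uu w).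
    rewrite <- (exp_uu w) at 2 by lra. replace (1 - tauf w) with (- (w * vf w)) by (unfold tauf; ring).
    rewrite RtoC_opp, RtoC_mult, RtoC_div, <- Cexp_R by lra.
    transitivity (- (Cexp ((gam - 1) * RtoC (uu w)) * Cexp (RtoC (uu w))) / (RtoC w * RtoC (vf w) * RtoC (vf w)) + 1 / RtoC w)%C. field; auto.
    rewrite <- Cexp_add. replace ((gam - 1) * RtoC (uu w) + RtoC (uu w))%C with (gam * RtoC (uu w))%C by ring. field; auto. }
  rewrite EV. apply is_pseries_C.
  assert (IR : forall n, Rabs (Re (ps gam n)) <= 1 * r ^ n) by (intros; apply ps_comp_bound; lra).
  assert (II : forall n, Rabs (Im (ps gam n)) <= 1 * r ^ n) by (intros; apply ps_comp_bound; lra).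
  assert (K : forall a, (forall n, Rabs (a n) <= 1 * r ^ n) -> is_pseries (fun k => - a (S k)) w ((a O - PSeries a w) / w)).
  { intros a Ha. assert (P := PSeries_correct a w (CV_radius_inside a w (ps_inside a 1 r w Ha ltac:(unfold r; lra) Hwr))).
    apply (is_pseries_decr_1 _ w (/ w)) in P. 2: { unfold mult, one; simpl. field; auto. }
    apply is_pseries_opp in P. evar_last. exact P. unfold opp, scal, plus, mult; simpl. unfold mult; simpl. field; auto. }
  split; [evar_last; [apply (K _ IR)|]|evar_last; [apply (K _ II)|]]; unfold Cdiv; rewrite <- RtoC_inv by auto; unfold PF, ps, cseq; simpl; field; auto.
Qed.

(** [epsilon] may have chosen another function tau as witness, but its germ is that of [tauf],
    derivative included, and the coefficients of the expansion are unique. *)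
Theorem Gseq_eq gam k : Gseq gam k = (- ps gam (S k))%C.
Proof.
  assert (EX : is_G_expansion gam (fun k => - ps gam (S k))%C). { exists tauf. split. apply tauf_branch. apply tauf_expansion. }
  assert (H := epsilon_spec (inhabits (fun _ : nat => RtoC 0)) (is_G_expansion gam) (ex_intro _ _ EX)). fold (Gseq gam) in H.
  destruct H as [tau [HT HP]].
  assert (L : locally' 0 (fun w => @is_pseries C_AbsRing C_NormedModule (Gseq gam) (RtoC w) (Gval gam tauf w))).
  { assert (Y := tau_branch_unique tau HT). apply locally_locally in Y.
    assert (Y' : locally' 0 (fun w => locally w (fun t => tau t = tauf t))) by (destruct Y as [e Y]; exists e; intros; apply Y; auto).
    generalize (filter_and _ _ HP Y'). apply filter_imp. intros w [A B]. evar_last. exact A. unfold Gval.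
    rewrite (locally_singleton _ _ B). rewrite (Derive_ext_loc _ _ _ B). reflexivity. }
  assert (L2 := tauf_expansion gam). generalize (filter_and _ _ L L2). intros F.
  apply C_ext.
  - apply (ps_unique (fun n => Re (Gseq gam n)) (fun n => Re (- ps gam (S n))%C)). revert F. apply filter_imp. intros w [A B].
    apply is_pseries_C in A. apply is_pseries_C in B. exists (Re (Gval gam tauf w)). split; [apply A|apply B].
  - apply (ps_unique (fun n => Im (Gseq gam n)) (fun n => Im (- ps gam (S n))%C)). revert F. apply filter_imp. intros w [A B].
    apply is_pseries_C in A. apply is_pseries_C in B. exists (Im (Gval gam tauf w)). split; [apply A|apply B].
Qed.

(** * Moments of the Gaussian weight *)

Definition gf (n : nat) (Z r : R) : R := r ^ n * exp (- Z * r ^ 2).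
Definition gI (n : nat) (Z : R) : C := IntW WR (fun r => RtoC (gf n Z r)).
Fixpoint hp (k : nat) : R := match k with O => 1 | S i => hp i * (1 / 2 + INR i) end.

Lemma hp_pos k : 0 < hp k.
Proof. induction k; simpl. lra. apply Rmult_lt_0_compat; auto. generalize (pos_INR k); lra. Qed.

Lemma hp_poch k : poch (RtoC (1 / 2)) k = RtoC (hp k).
Proof. induction k; simpl. reflexivity. rewrite IHk, <- RtoC_plus, <- RtoC_mult. reflexivity. Qed.

Lemma abs_pow_exp n r : Rabs r ^ n <= INR (fact n) * exp (Rabs r).
Proof.
  assert (P := pow_fact_le (Rabs r) n (Rabs_pos r)). assert (F := INR_fact_lt_0 n).
  apply (Rmult_le_compat_l (INR (fact n))) in P; [|lra]. replace (INR (fact n) * (Rabs r ^ n / INR (fact n))) with (Rabs r ^ n) in P by (field; lra). auto.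
Qed.

Lemma gf_ok n Z : 0 < Z -> Rok WR (fun r => Rabs r ^ n * exp (- Z * r ^ 2)).
Proof.
  intros HZ. apply (Rok_le _ _ _ (Rok_scal _ _ (INR (fact n)) ltac:(apply pos_INR) (Rok_gauss 1 Z HZ))).
  - intros; cont.
  - intros r _. assert (E := exp_pos (- Z * r ^ 2)). split. apply Rmult_le_pos; [apply pow_le, Rabs_pos|lra].
    replace (1 * Rabs r - Z * r ^ 2) with (Rabs r + - Z * r ^ 2) by ring. rewrite exp_plus, <- Rmult_assoc. apply Rmult_le_compat_r. lra. apply abs_pow_exp.
Qed.

Lemma gf_cok n Z : 0 < Z -> Cok WR (fun r => RtoC (gf n Z r)) (fun r => Rabs r ^ n * exp (- Z * r ^ 2)).
Proof.
  intros HZ. split; [apply gf_ok; auto|split]; intros r _. unfold gf. cont.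
  rewrite Cmod_RtoC. unfold gf. rewrite Rabs_mult, <- RPow_abs, (Rabs_pos_eq (exp _)). lra. left; apply exp_pos.
Qed.

Lemma gf_end n Z : 0 < Z -> limC (fun k => RtoC (gf n Z (- INR k))) 0%C /\ limC (fun k => RtoC (gf n Z (INR k))) 0%C.
Proof.
  intros HZ. assert (B : forall r, Cmod (RtoC (gf n Z r)) <= INR (fact n) * exp (1 * Rabs r - Z * r ^ 2)).
  { intros r. eapply Rle_trans; [apply (proj2 (proj2 (gf_cok n Z HZ)) r (inWR r))|].
    replace (1 * Rabs r - Z * r ^ 2) with (Rabs r + - Z * r ^ 2) by ring. rewrite exp_plus, <- Rmult_assoc. apply Rmult_le_compat_r. left; apply exp_pos. apply abs_pow_exp. }
  split; apply (limC_0_bound _ _ (lim_gauss_end (INR (fact n)) 1 Z HZ)); intros k; eapply Rle_trans; [apply B| |apply B|]; rewrite ?Rabs_Ropp, (Rabs_pos_eq (INR k)) by apply pos_INR; right; f_equal; f_equal; ring.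
Qed.

Lemma gI_0 Z : 0 < Z -> gI 0 Z = RtoC (sqrt (PI / Z)).
Proof.
  intros HZ. assert (S := sqrt_lt_R0 Z HZ). assert (SZ := sqrt_sqrt Z ltac:(lra)).
  assert (O : Cok WR (fun r => RtoC (exp (- r ^ 2))) (fun r => exp (- r ^ 2))) by (apply Cok_real, gauss_ext1).
  destruct (IntW_subst_lin _ _ (sqrt Z) 0 S O) as [O2 E]. rewrite (IntW_real _ _ gauss_ext1), gauss_int in E.
  unfold gI. rewrite sqrt_div_alt by auto. rewrite (IntW_ext _ _ (fun r => RtoC (/ sqrt Z) * (RtoC (sqrt Z) * RtoC (exp (- (sqrt Z * r + 0) ^ 2))))%C).
  - rewrite (IntW_scal _ _ _ _ O2), E, <- RtoC_mult. apply f_equal. field. lra.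
  - intros r _. rewrite <- !RtoC_mult. apply f_equal. unfold gf. rewrite <- Rmult_assoc, Rinv_l by lra. simpl. f_equal. f_equal. rewrite <- SZ at 1. ring.
Qed.

Lemma gI_1 Z : 0 < Z -> gI 1 Z = 0%C.
Proof.
  intros HZ. transitivity (RtoC (- / (2 * Z)) * 0 - RtoC (- / (2 * Z)) * 0)%C; [|ring].
  apply (IntW_FTC WR (fun r => RtoC (- / (2 * Z)) * RtoC (gf 0 Z r))%C _ _ _ _ (gf_cok 1 Z HZ)).
  - intros r _. evar_last. apply dC_mult. apply dC_const. apply dC_RtoC. unfold gf. auto_derive; auto.
    rewrite Cmult_0_l, Cplus_0_l, <- RtoC_mult. apply f_equal. unfold gf. simpl. field. lra.
  - apply limC_mult. apply limC_const. apply gf_end; auto.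
  - apply limC_mult. apply limC_const. apply gf_end; auto.
Qed.

Lemma gI_rec n Z : 0 < Z -> gI (S (S n)) Z = (RtoC ((INR n + 1) / (2 * Z)) * gI n Z)%C.
Proof.
  intros HZ. assert (O1 := Cok_scal _ _ _ (RtoC (INR n + 1)) (gf_cok n Z HZ)). assert (O2 := Cok_scal _ _ _ (RtoC (- (2 * Z))) (gf_cok (S (S n)) Z HZ)).
  assert (E : IntW WR (fun r => RtoC (INR n + 1) * RtoC (gf n Z r) + RtoC (- (2 * Z)) * RtoC (gf (S (S n)) Z r))%C = (0 - 0)%C).
  { apply (IntW_FTC WR (fun r => RtoC (gf (S n) Z r)) _ _ _ _ (Cok_plus _ _ _ _ _ O1 O2)).
    - intros r _. evar_last. apply dC_RtoC. unfold gf. auto_derive; auto.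
      rewrite <- !RtoC_mult, <- RtoC_plus. apply f_equal. unfold gf. change (match n with O => 1 | S _ => INR n + 1 end) with (INR (S n)). rewrite S_INR. simpl. ring.
    - apply gf_end; auto.
    - apply gf_end; auto. }
  rewrite (IntW_plus _ _ _ _ _ O1 O2), (IntW_scal _ _ _ _ (gf_cok n Z HZ)), (IntW_scal _ _ _ _ (gf_cok (S (S n)) Z HZ)) in E. fold (gI n Z) (gI (S (S n)) Z) in E.
  assert (Zc : RtoC Z <> 0%C) by (apply RtoC_neq0; lra).
  rewrite RtoC_div, !RtoC_mult by lra. rewrite RtoC_opp, RtoC_mult in E.
  apply (Cmult_reg_l' (2 * RtoC Z)). intros Q. apply Zc. replace (RtoC Z) with (half * (2 * RtoC Z))%C. rewrite Q; ring. rewrite Cmult_assoc, (Cmult_comm half), half_2; ring.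
  transitivity (RtoC (INR n + 1) * gI n Z - (RtoC (INR n + 1) * gI n Z + - (2 * RtoC Z) * gI (S (S n)) Z))%C. ring. rewrite E. field; auto.
Qed.

Lemma gI_even k Z : 0 < Z -> gI (2 * k) Z = RtoC (sqrt (PI / Z) * hp k * (/ Z) ^ k) /\ gI (2 * k + 1) Z = 0%C.
Proof.
  intros HZ. induction k as [|k [IH1 IH2]].
  - split. simpl (2 * 0)%nat. rewrite gI_0 by auto. apply f_equal. simpl; ring. apply gI_1; auto.
  - replace (2 * S k)%nat with (S (S (2 * k))) by lia. replace (S (S (2 * k)) + 1)%nat with (S (S (2 * k + 1))) by lia. rewrite !gI_rec, IH1, IH2 by auto. split; [|ring].
    rewrite <- RtoC_mult. apply f_equal. rewrite mult_INR. simpl. field. lra.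
Qed.

(** Odd moments vanish, so of the 2 K terms only the K even ones survive. This is why only the
    G-coefficients of even index occur in B_j. *)
Lemma gauss_poly (c : nat -> C) K Z : 0 < Z ->
  (exists g, Cok WR (fun r => Csum (fun k => c k * RtoC (r ^ k)) (2 * K) * RtoC (exp (- Z * r ^ 2)))%C g) /\
  IntW WR (fun r => Csum (fun k => c k * RtoC (r ^ k)) (2 * K) * RtoC (exp (- Z * r ^ 2)))%C =
  Csum (fun k => c (2 * k)%nat * RtoC (sqrt (PI / Z) * hp k * (/ Z) ^ k))%C K.
Proof.
  intros HZ.
  assert (X : forall N, exists g, Cok WR (fun r => Csum (fun k => c k * RtoC (r ^ k)) N * RtoC (exp (- Z * r ^ 2)))%C g /\
     IntW WR (fun r => Csum (fun k => c k * RtoC (r ^ k)) N * RtoC (exp (- Z * r ^ 2)))%C = Csum (fun k => c k * gI k Z)%C N).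
  { induction N as [|N [g [O E]]].
    - exists (fun r => 0 * (Rabs r ^ 0 * exp (- Z * r ^ 2))). assert (O0 := Cok_scal _ _ _ 0%C (gf_cok 0 Z HZ)). rewrite Cmod_0 in O0.
      assert (EQ : (fun r => Csum (fun k => c k * RtoC (r ^ k)) 0 * RtoC (exp (- Z * r ^ 2)))%C = (fun r => 0 * RtoC (gf 0 Z r))%C) by (apply functional_extensionality; intros; simpl; ring).
      rewrite EQ. split; auto. rewrite (IntW_scal _ _ _ _ (gf_cok 0 Z HZ)). simpl. ring.
    - assert (O1 := Cok_scal _ _ _ (c N) (gf_cok N Z HZ)).
      assert (EQ : (fun r => Csum (fun k => c k * RtoC (r ^ k)) (S N) * RtoC (exp (- Z * r ^ 2)))%C = (fun r => Csum (fun k => c k * RtoC (r ^ k)) N * RtoC (exp (- Z * r ^ 2)) + c N * RtoC (gf N Z r))%C).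
      { apply functional_extensionality; intros r. simpl Csum. unfold gf. rewrite (RtoC_mult (r ^ N)). ring. }
      eexists. rewrite EQ. split. apply (Cok_plus _ _ _ _ _ O O1). rewrite (IntW_plus _ _ _ _ _ O O1), E, (IntW_scal _ _ _ _ (gf_cok N Z HZ)). reflexivity. }
  destruct (X (2 * K)%nat) as [g [O E]]. split. exists g; auto. rewrite E. clear - HZ.
  induction K. reflexivity. replace (2 * S K)%nat with (S (S (2 * K))) by lia. simpl Csum.
  assert (H := gI_even K Z HZ). replace (2 * K + 1)%nat with (S (2 * K)) in H by lia. destruct H as [H1 H2].
  simpl in IHK, H1, H2 |- *. rewrite IHK, H1, H2. ring.
Qed.

Lemma gauss_even_bound Z k : 0 < Z -> RIntW WR (fun r => Rabs r ^ (2 * k) * exp (- Z * r ^ 2)) = sqrt (PI / Z) * hp k * (/ Z) ^ k.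
Proof.
  intros HZ. destruct (gI_even k Z HZ) as [H _]. unfold gI in H. rewrite (IntW_ext _ _ (fun r => RtoC (Rabs r ^ (2 * k) * exp (- Z * r ^ 2)))) in H.
  rewrite IntW_real in H by (apply gf_ok; auto). apply (f_equal Re) in H. exact H.
  intros r _. unfold gf. rewrite !pow_mult, pow2_abs. reflexivity.
Qed.

(** * Expansion of the saddle-point integral *)

(** The generalised binomial coefficients, that is, the Taylor coefficients of (1 + u)^lam. *)
Fixpoint bc (lam : C) (k : nat) : C := match k with O => 1%C | S i => (bc lam i * (lam - RtoC (INR i)) / RtoC (INR (S i)))%C end.

Lemma bc_shift lam k : (RtoC (INR (S k)) * bc lam (S k) = lam * bc (lam - 1) k)%C.
Proof.
  induction k. simpl. field.
  assert (N1 : RtoC (INR (S k)) <> 0%C) by (apply RtoC_neq0, not_0_INR; lia). assert (N2 : RtoC (INR (S (S k))) <> 0%C) by (apply RtoC_neq0, not_0_INR; lia).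
  change (bc lam (S (S k))) with (bc lam (S k) * (lam - RtoC (INR (S k))) / RtoC (INR (S (S k))))%C.
  change (bc (lam - 1) (S k)) with (bc (lam - 1) k * (lam - 1 - RtoC (INR k)) / RtoC (INR (S k)))%C.
  transitivity ((RtoC (INR (S k)) * bc lam (S k)) * (lam - RtoC (INR (S k))) / RtoC (INR (S k)))%C. field; auto.
  rewrite IHk. replace (lam - RtoC (INR (S k)))%C with (lam - 1 - RtoC (INR k))%C by (rewrite S_INR, RtoC_plus; ring). field; auto.
Qed.

Definition Rm (n : nat) (lam : C) (r : R) : C := (Cexp (lam * cl r) - Csum (fun k => bc lam k * Ci ^ k * RtoC (r ^ k)) n)%C.

Lemma dC_poly (c : nat -> C) n r : dC (fun r => Csum (fun k => c k * RtoC (r ^ k)) (S n))%C r (Csum (fun k => RtoC (INR (S k)) * c (S k) * RtoC (r ^ k)) n)%C.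
Proof.
  induction n.
  - simpl. evar_last. apply dC_plus. apply dC_const. apply dC_const. ring.
  - evar_last. apply (dC_plus _ (fun r => c (S n) * RtoC (r ^ S n))%C). apply IHn. apply dC_mult. apply dC_const. apply dC_RtoC. apply is_derive_pow. apply is_derive_id.
    cbn [Csum pred]. rewrite Rmult_1_r. rewrite (RtoC_mult (INR (S n))). ring.
Qed.

Lemma Rm_dC n lam r : dC (Rm (S n) lam) r (lam * Ci * Rm n (lam - 1) r)%C.
Proof.
  unfold Rm. evar_last. apply dC_minus. apply dC_Cexp. apply dC_mult. apply dC_const. apply dC_cl. apply dC_poly. cbv beta.
  rewrite (Csum_ext (fun k => RtoC (INR (S k)) * (bc lam (S k) * Ci ^ S k) * RtoC (r ^ k))%C (fun k => (lam * Ci) * (bc (lam - 1) k * Ci ^ k * RtoC (r ^ k)))%C).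
  - rewrite Csum_scal. replace (lam * cl r)%C with ((lam - 1) * cl r + cl r)%C by ring. rewrite Cexp_add, Cexp_cl. field. intros E; inversion E; lra.
  - intros k _. transitivity ((RtoC (INR (S k)) * bc lam (S k)) * Ci ^ S k * RtoC (r ^ k))%C. ring. rewrite bc_shift. simpl. ring.
Qed.

Lemma Rm_cont n lam r : contC (Rm n lam) r.
Proof.
  unfold Rm. apply cC_minus. apply cC_Cexp. apply cC_mult. apply cC_const. apply contC_cl.
  destruct n. simpl; cont. apply (dC_cont _ _ _ (dC_poly (fun k => bc lam k * Ci ^ k)%C n r)).
Qed.

(** Induction on n: the Taylor remainder of (1 + i r)^lam vanishes at 0 and has derivative i lam
    times the remainder of one order less for lam - 1. Lowering the exponent preserves Re lam <= A,
    so one polynomial weight serves all orders. *)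
Lemma Rm_bound n (A : nat) : forall lam, Re lam <= INR A -> exists K, 0 <= K /\ forall r, Cmod (Rm n lam r) <= K * (Rabs r ^ n * (1 + Rabs r) ^ A).
Proof.
  induction n; intros lam HA.
  - exists (exp (2 * Rabs (Im lam))). split. left; apply exp_pos. intros r. unfold Rm. simpl Csum. replace (Cexp (lam * cl r) - 0)%C with (Cexp (lam * cl r)) by ring. rewrite Cmod_Cexp. simpl (_ ^ 0). rewrite Rmult_1_l.
    assert (Pr := Rabs_pos r). rewrite <- Rpower_pow by lra. unfold Rpower. rewrite <- exp_plus. apply exp_le.
    assert (L0 : 0 <= ln (1 + r ^ 2) / 2) by apply ln1r2_bound.
    assert (L1 : ln (1 + r ^ 2) / 2 <= ln (1 + Rabs r)).
    { assert (ln (1 + r ^ 2) <= ln ((1 + Rabs r) ^ 2)). { apply ln_le. generalize (pow2_ge_0 r); lra. rewrite <- (pow2_abs r). nra. } rewrite ln_pow in H by lra. simpl INR in H. lra. }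
    assert (AT := atan_lt2 r). assert (X : - (Im lam * atan r) <= 2 * Rabs (Im lam)).
    { eapply Rle_trans; [apply Rle_abs|]. rewrite Rabs_Ropp, Rabs_mult. rewrite (Rmult_comm 2); apply Rmult_le_compat_l; [apply Rabs_pos|lra]. }
    assert (Y : Re lam * (ln (1 + r ^ 2) / 2) <= INR A * ln (1 + Rabs r)).
    { apply Rle_trans with (INR A * (ln (1 + r ^ 2) / 2)). apply Rmult_le_compat_r; auto. apply Rmult_le_compat_l; auto. apply pos_INR. }
    unfold cl. simpl. unfold Re, Im in *. simpl in *. lra.
  - destruct (IHn (lam - 1)%C) as [K [HK B]]. { simpl; unfold Re in *; lra. }
    exists (2 * Cmod lam * K). assert (Hl := Cmod_ge_0 lam). split. repeat apply Rmult_le_pos; lra. intros r.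
    assert (Z0 : Rm (S n) lam 0 = 0%C).
    { unfold Rm. rewrite Csum_S_l. rewrite (Csum_ext _ (fun _ => 0 * 0)%C). rewrite Csum_scal. simpl bc. replace (cl 0) with (RtoC 0). rewrite Cmult_0_r, Cexp_0. simpl. ring.
      unfold cl. rewrite atan_0. replace (1 + 0 ^ 2) with 1 by ring. rewrite ln_1. apply C_ext; simpl; field. intros k _. rewrite pow_i by lia. ring. }
    set (D := Cmod lam * (K * (Rabs r ^ n * (1 + Rabs r) ^ A))).
    assert (DB : forall t, Rabs t <= Rabs r -> dC (Rm (S n) lam) t (lam * Ci * Rm n (lam - 1) t)%C /\ Cmod (lam * Ci * Rm n (lam - 1) t) <= D).
    { intros t Ht. split. apply Rm_dC. rewrite !Cmod_mult, Cmod_Ci, Rmult_1_r. unfold D. apply Rmult_le_compat_l; auto. eapply Rle_trans; [apply B|]. apply Rmult_le_compat_l; auto.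
      assert (Pt := Rabs_pos t). apply Rmult_le_compat; try (apply pow_le; lra); apply pow_incr; lra. }
    assert (X : Cmod (Rm (S n) lam r) <= 2 * D * Rabs r).
    { destruct (Rle_dec 0 r).
      - rewrite (Rabs_pos_eq r) in * by auto. assert (M := dC_mvt _ _ D 0 r r0 (fun t Ht => DB t ltac:(rewrite Rabs_pos_eq; lra))). rewrite Z0 in M. replace (Rm (S n) lam r) with (Rm (S n) lam r - 0)%C by ring. lra.
      - rewrite (Rabs_left r) in * by lra. assert (M := dC_mvt _ _ D r 0 ltac:(lra) (fun t Ht => DB t ltac:(rewrite Rabs_left1; lra))). rewrite Z0, Cmod_minus_sym in M. replace (Rm (S n) lam r) with (Rm (S n) lam r - 0)%C by ring. lra. }
    eapply Rle_trans; [apply X|]. unfold D. right. simpl. ring.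
Qed.

Lemma pow_1p_even a r : (1 + Rabs r) ^ (2 * a) <= 4 ^ a * (1 + Rabs r ^ (2 * a)).
Proof.
  assert (P := Rabs_pos r). replace (4 ^ a) with (2 ^ (2 * a)) by (rewrite pow_mult; f_equal; ring).
  assert (P2 : 0 < 2 ^ (2 * a)) by (apply pow_lt; lra). assert (P3 : 0 <= Rabs r ^ (2 * a)) by (apply pow_le; lra).
  destruct (Rle_dec (Rabs r) 1).
  - apply Rle_trans with (2 ^ (2 * a)). apply pow_incr; lra. nra.
  - apply Rle_trans with ((2 * Rabs r) ^ (2 * a)). apply pow_incr; lra. rewrite Rpow_mult_distr. nra.
Qed.

Definition Wsum (lam : C) (J : nat) (Z : R) : C := Csum (fun j => bc lam (2 * j) * Ci ^ (2 * j) * RtoC (sqrt (PI / Z) * hp j * (/ Z) ^ j))%C J.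

(** Watson's lemma with a derivative bound on the remainder, which the principal value of the
    remainder requires. The second power J + a comes from splitting (1 + |r|)^(2 a) into 1 and
    |r|^(2 a). *)
Lemma Wf_expansion lam J : exists (rho rho' : R -> C) (K : R) (a : nat), 0 <= K /\ forall Z, 0 < Z ->
  (Wf lam Z = Wsum lam J Z + rho Z)%C /\
  dC rho Z (rho' Z) /\
  Cmod (rho Z) <= K * sqrt (/ Z) * ((/ Z) ^ J + (/ Z) ^ (J + a)) /\
  Cmod (rho' Z) * Z <= K * sqrt (/ Z) * ((/ Z) ^ J + (/ Z) ^ (J + a)).
Proof.
  destruct (INR_unbounded (Rabs (Re lam))) as [a Ha].
  destruct (Rm_bound (2 * J) (2 * a) lam) as [K0 [HK0 B0]].
  { rewrite mult_INR. generalize (Rle_abs (Re lam)) (pos_INR a). simpl; lra. }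
  set (K1 := K0 * 4 ^ a). assert (P4 : 0 < 4 ^ a) by (apply pow_lt; lra). assert (HK1 : 0 <= K1) by (apply Rmult_le_pos; lra).
  assert (B1 : forall r, Cmod (Rm (2 * J) lam r) <= K1 * (Rabs r ^ (2 * J) + Rabs r ^ (2 * (J + a)))).
  { intros r. eapply Rle_trans; [apply B0|]. unfold K1. rewrite Rmult_assoc. apply Rmult_le_compat_l; auto.
    replace (2 * (J + a))%nat with (2 * J + 2 * a)%nat by lia. rewrite pow_add.
    replace (4 ^ a * (Rabs r ^ (2 * J) + Rabs r ^ (2 * J) * Rabs r ^ (2 * a))) with (Rabs r ^ (2 * J) * (4 ^ a * (1 + Rabs r ^ (2 * a)))) by ring.
    apply Rmult_le_compat_l. apply pow_le, Rabs_pos. apply pow_1p_even. }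
  (* The index i counts Z-derivatives: i = 0 gives [rho], i = 1 its derivative. Each derivative
     brings down - r^2 and gains a factor 1 / Z. *)
  set (F := fun i Z r => (RtoC (exp (- Z * r ^ 2)) * (RtoC ((- r ^ 2) ^ i) * Rm (2 * J) lam r))%C).
  assert (FO : forall i Z, 0 < Z -> Cok WR (F i Z) (fun r => K1 * (Rabs r ^ (2 * (J + i)) * exp (- Z * r ^ 2) + Rabs r ^ (2 * (J + a + i)) * exp (- Z * r ^ 2)))).
  { intros i Z HZ. split; [|split].
    - apply Rok_scal; auto. apply Rok_plus; apply gf_ok; auto.
    - intros r _. unfold F. apply cC_mult. cont. apply cC_mult. cont. apply Rm_cont.
    - intros r _. unfold F. rewrite !Cmod_mult, !Cmod_RtoC, (Rabs_pos_eq (exp _)) by (left; apply exp_pos). rewrite <- RPow_abs, Rabs_Ropp, <- RPow_abs.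
      assert (E := exp_pos (- Z * r ^ 2)). replace (2 * (J + i))%nat with (2 * J + 2 * i)%nat by lia. replace (2 * (J + a + i))%nat with (2 * (J + a) + 2 * i)%nat by lia.
      rewrite !pow_add, (pow_mult _ 2 i). set (q := (Rabs r ^ 2) ^ i). assert (0 <= q) by (apply pow_le, pow_le, Rabs_pos).
      replace (K1 * (Rabs r ^ (2 * J) * q * exp (- Z * r ^ 2) + Rabs r ^ (2 * (J + a)) * q * exp (- Z * r ^ 2))) with (exp (- Z * r ^ 2) * (q * (K1 * (Rabs r ^ (2 * J) + Rabs r ^ (2 * (J + a)))))) by ring.
      apply Rmult_le_compat_l. lra. apply Rmult_le_compat_l; auto. }
  set (h := Rmax (Rmax (hp J) (hp (J + a))) (Rmax (hp (J + 1)) (hp (J + a + 1)))).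
  assert (Hh : hp J <= h /\ hp (J + a) <= h /\ hp (J + 1) <= h /\ hp (J + a + 1) <= h).
  { unfold h. generalize (Rmax_l (Rmax (hp J) (hp (J + a))) (Rmax (hp (J + 1)) (hp (J + a + 1)))) (Rmax_r (Rmax (hp J) (hp (J + a))) (Rmax (hp (J + 1)) (hp (J + a + 1))))
      (Rmax_l (hp J) (hp (J + a))) (Rmax_r (hp J) (hp (J + a))) (Rmax_l (hp (J + 1)) (hp (J + a + 1))) (Rmax_r (hp (J + 1)) (hp (J + a + 1))). lra. }
  assert (hp0 := hp_pos J).
  assert (FB : forall i Z, 0 < Z -> hp (J + i) <= h -> hp (J + a + i) <= h -> Cmod (IntW WR (F i Z)) <= (2 * K1 * h * sqrt PI) * sqrt (/ Z) * ((/ Z) ^ (J + i) + (/ Z) ^ (J + a + i))).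
  { intros i Z HZ H1 H2. eapply Rle_trans. apply (IntW_bound _ _ _ (FO i Z HZ)).
    rewrite (RIntW_scal WR (fun r => Rabs r ^ (2 * (J + i)) * exp (- Z * r ^ 2) + Rabs r ^ (2 * (J + a + i)) * exp (- Z * r ^ 2))) by (apply Rok_plus; apply gf_ok; auto).
    rewrite RIntW_plus by (apply gf_ok; auto). rewrite !gauss_even_bound by auto. unfold Rdiv. rewrite sqrt_mult by (generalize PI_RGT_0 (Rinv_0_lt_compat Z HZ); lra).
    set (s := sqrt PI * sqrt (/ Z)). assert (Hs : 0 <= s) by (apply Rmult_le_pos; apply sqrt_pos).
    assert (IZ := Rinv_0_lt_compat Z HZ).
    assert (P1 : 0 < (/ Z) ^ (J + i)) by (apply pow_lt; auto). assert (P2 : 0 < (/ Z) ^ (J + a + i)) by (apply pow_lt; auto).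
    replace (2 * K1 * h * sqrt PI * sqrt (/ Z) * ((/ Z) ^ (J + i) + (/ Z) ^ (J + a + i))) with (2 * (K1 * (s * h * (/ Z) ^ (J + i) + s * h * (/ Z) ^ (J + a + i)))) by (unfold s; ring).
    apply Rmult_le_compat_l. lra. apply Rmult_le_compat_l; auto. apply Rplus_le_compat; (apply Rmult_le_compat_r; [lra|]); apply Rmult_le_compat_l; auto. }
  exists (fun Z => IntW WR (F 0%nat Z)), (fun Z => IntW WR (F 1%nat Z)), (2 * K1 * h * sqrt PI), a.
  split. { repeat apply Rmult_le_pos; try lra. apply sqrt_pos. }
  intros Z HZ. split; [|split; [|split]].
  - destruct (gauss_poly (fun k => bc lam k * Ci ^ k)%C J Z HZ) as [[g O] E]. unfold Wsum. rewrite <- E.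
    rewrite <- (IntW_plus _ _ _ _ _ O (FO 0%nat Z HZ)). unfold Wf. apply IntW_ext. intros r _. unfold F, Rm. rewrite Cexp_add, Cexp_R. simpl (_ ^ 0). ring.
  - apply (dC_IntW WR (F 0%nat) (F 1%nat) (fun r => K1 * (Rabs r ^ (2 * (J + 1)) * exp (- (Z / 2) * r ^ 2) + Rabs r ^ (2 * (J + a + 1)) * exp (- (Z / 2) * r ^ 2))) (Z / 2) (2 * Z)).
    + lra.
    + intros x Hx. eexists. apply FO. lra.
    + intros x r Hx _. unfold F. evar_last. apply dC_mult. apply dC_RtoC. auto_derive; auto. apply dC_const. cbv beta.
      generalize (Rm (2 * J) lam r). intros q. apply C_ext; simpl; ring.
    + intros x r Hx _. unfold F. apply cC_mult. cont. apply cC_mult. cont. apply (cC_comp snd (Rm (2 * J) lam)). cont. apply Rm_cont.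
    + apply FO. lra.
    + intros x r Hx _. eapply Rle_trans. apply (FO 1%nat x); [lra|apply inWR]. apply Rmult_le_compat_l; auto.
      assert (exp (- x * r ^ 2) <= exp (- (Z / 2) * r ^ 2)) by (apply exp_le; generalize (pow2_ge_0 r); nra).
      apply Rplus_le_compat; (apply Rmult_le_compat_l; [apply pow_le, Rabs_pos|auto]).
  - assert (X := FB 0%nat Z HZ). rewrite !Nat.add_0_r in X. apply X; apply Hh.
  - assert (X := FB 1%nat Z HZ). apply (Rmult_le_compat_r Z) in X; [|lra|apply Hh|apply Hh]. eapply Rle_trans; [apply X|]. right. rewrite !pow_add, pow_1. field. lra.
Qed.

(** * The substitution to w on the two sides of the saddle point, and the remainder of the
    expansion *)

Definition Sv (v : R) : R := exp v - 1 - v.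
(** The modulus |w| at tau = e^(2 s y), where w^2 / 2 = tau - log tau - 1 = [Sv (2 * s * y)]; the
    sign s = 1 or -1 selects the side of tau = 1, so that w = s [ws s y] for y > 0. *)
Definition ws (s y : R) : R := sqrt (2 * Sv (2 * s * y)).
Definition ws' (s y : R) : R := 2 * s * (exp (2 * s * y) - 1) / ws s y.

Lemma Sv_pos v : v <> 0 -> 0 < Sv v.
Proof. intros H. generalize (exp_ineq1 v H). unfold Sv; lra. Qed.

Lemma Sv_lower v : -2 <= v -> v ^ 2 / 4 <= Sv v.
Proof.
  intros H. assert (X := exp_ineq1_le (v / 2)). assert (E : exp v = exp (v / 2) * exp (v / 2)) by (rewrite <- exp_plus; f_equal; field).
  unfold Sv. rewrite E. assert (0 <= 1 + v / 2) by lra. nra.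
Qed.

(** The lower bound at - v, inverted through e^(- v) = 1 / e^v. *)
Lemma Sv_upper v : Rabs v <= 1 -> Sv v <= 2 * v ^ 2.
Proof.
  intros H. apply Rabs_le_between in H. assert (L := Sv_lower (- v) ltac:(lra)). unfold Sv in *. rewrite exp_Ropp in L.
  assert (P := exp_pos v). set (e := exp v) in *. assert (Q : 1 - v + v ^ 2 / 4 <= / e) by nra.
  assert (Q2 : e * (1 - v + v ^ 2 / 4) <= 1). { apply (Rmult_le_compat_l e) in Q; [|lra]. rewrite Rinv_r in Q; lra. }
  assert (Q3 : 0 < 1 - v + v ^ 2 / 4) by nra.
  apply (Rmult_le_reg_r (1 - v + v ^ 2 / 4)); auto.
  assert (1 <= (1 + v + 2 * v ^ 2) * (1 - v + v ^ 2 / 4)).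
  { replace ((1 + v + 2 * v ^ 2) * (1 - v + v ^ 2 / 4)) with (1 + v ^ 2 * ((1 - v) * (5 / 4 - v / 2))) by field.
    assert (0 <= v ^ 2 * ((1 - v) * (5 / 4 - v / 2))) by (apply Rmult_le_pos; [apply pow2_ge_0|apply Rmult_le_pos; lra]). lra. }
  lra.
Qed.

Lemma Sv_large v : 1 <= Rabs v -> Rabs v / 4 <= Sv v.
Proof.
  intros H. destruct (Rle_dec (-2) v).
  - assert (L := Sv_lower v r). rewrite <- (pow2_abs v) in L. nra.
  - rewrite Rabs_left in * by lra. unfold Sv. generalize (exp_pos v). lra.
Qed.

Section Branch.
Variable s : R.
Hypothesis Hs : s = 1 \/ s = -1.

Lemma s_ne y : 0 < y -> 2 * s * y <> 0.
Proof. destruct Hs as [-> | ->]; lra. Qed.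

Lemma s_abs y : 0 < y -> Rabs (2 * s * y) = 2 * y.
Proof. intros. destruct Hs as [-> | ->]. rewrite Rabs_pos_eq; lra. rewrite Rabs_left; lra. Qed.

Lemma ws_pos y : 0 < y -> 0 < ws s y.
Proof. intros H. apply sqrt_lt_R0. generalize (Sv_pos _ (s_ne y H)). lra. Qed.

Lemma ws_sq y : 0 < y -> ws s y ^ 2 = 2 * Sv (2 * s * y).
Proof. intros H. unfold ws. rewrite pow2_sqrt; auto. generalize (Sv_pos _ (s_ne y H)). lra. Qed.

Lemma ws'_pos y : 0 < y -> 0 < s * (exp (2 * s * y) - 1) /\ 0 < ws' s y.
Proof.
  intros H. assert (P : 0 < s * (exp (2 * s * y) - 1)).
  { destruct Hs as [-> | ->]. assert (X := exp_ineq1 (2 * 1 * y) ltac:(lra)). lra.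
    assert (exp (2 * -1 * y) < 1). { rewrite <- exp_0. apply exp_increasing. lra. } lra. }
  split; auto. unfold ws'. apply Rdiv_lt_0_compat; [lra|apply ws_pos; auto].
Qed.

Lemma ws_derive y : 0 < y -> is_derive (ws s) y (ws' s y).
Proof.
  intros H. assert (P := Sv_pos _ (s_ne y H)). assert (Q := ws_pos y H). unfold ws at 1. evar_last.
  - apply (dR_comp sqrt (fun y => 2 * Sv (2 * s * y))). unfold Sv. auto_derive; auto. apply is_derive_Reals, derivable_pt_lim_sqrt. lra.
  - unfold ws'. fold (ws s y). field. lra.
Qed.

Lemma ws_cont y : 0 < y -> continuous (ws s) y.
Proof. intros H. apply (ex_derive_continuous (ws s)). eexists. apply ws_derive; auto. Qed.

Lemma ws'_cont y : 0 < y -> continuous (ws' s) y.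
Proof. intros H. assert (Q := ws_pos y H). assert (C := ws_cont y H). unfold ws'. cont; try lra. Qed.

Lemma ws_small y : 0 < y <= 1 / 2 -> y <= ws s y <= 4 * y.
Proof.
  intros H. assert (Q := ws_pos y ltac:(lra)). assert (E := ws_sq y ltac:(lra)). assert (A := s_abs y ltac:(lra)).
  assert (U := Sv_upper (2 * s * y) ltac:(lra)). assert (L := Sv_lower (2 * s * y)).
  assert (X : (2 * s * y) ^ 2 = 4 * y ^ 2) by (rewrite <- pow2_abs, A; ring). rewrite X in *.
  assert (-2 <= 2 * s * y) by (apply Rabs_le_between in A || idtac; destruct Hs as [-> | ->]; lra). specialize (L H0).
  split; nra.
Qed.

Lemma ws_large y : 1 <= y -> y <= ws s y ^ 2.
Proof. intros H. rewrite ws_sq by lra. assert (L := Sv_large (2 * s * y)). rewrite s_abs in L by lra. lra. Qed.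

Lemma ws_subst (f : R -> C) g : Cok W0 f g ->
  Cok W0 (fun y => RtoC (ws' s y) * f (ws s y))%C (fun y => ws' s y * g (ws s y)) /\
  IntW W0 (fun y => RtoC (ws' s y) * f (ws s y))%C = IntW W0 f.
Proof.
  intros H. apply (IntW_subst W0 W0 f g (ws s) (ws' s) H).
  - intros x Hx. apply inW0 in Hx. apply inW0. apply ws_pos; auto.
  - intros x Hx. apply inW0 in Hx. split; [apply ws_derive; auto|split]. apply ws'_cont; auto. left; apply ws'_pos; auto.
  - intros n. set (N := INR n + 1). assert (HN : 1 <= N) by (unfold N; generalize (pos_INR n); lra).
    destruct (INR_unbounded (4 * N + N ^ 2)) as [m Hm]. exists m. change (wl W0 m) with (/ (INR m + 1)). change (wr W0 m) with (INR m + 1). change (wl W0 n) with (/ N). change (wr W0 n) with N.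
    assert (HN2 : N <= N ^ 2) by nra. split.
    + assert (H1 : / (INR m + 1) <= / (4 * N)) by (apply Rinv_le_contravar; lra).
      assert (H2 : / (4 * N) = / 4 * / N) by (field; lra). assert (H3 : / N <= 1) by (rewrite <- Rinv_1; apply Rinv_le_contravar; lra).
      assert (H4 : 0 < / (INR m + 1)) by (apply Rinv_0_lt_compat; lra).
      eapply Rle_trans. apply ws_small. lra. lra.
    + assert (L := ws_large (INR m + 1) ltac:(lra)). assert (P := ws_pos (INR m + 1) ltac:(lra)). nra.
Qed.

Definition phi (gam : C) (y : R) : C := (Cexp (gam * RtoC (2 * s * y)) / RtoC (exp (2 * s * y) - 1))%C.
Definition Pg (gam : C) (K : nat) (w : R) : C := Csum (fun k => - ps gam (S k) * RtoC (w ^ k))%C (2 * K).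
(** The error of the truncated expansion of tau^(gam - 1) / (1 - tau) dtau/dw, up to sign and
    rewritten in y: [phi] is the function itself, s ws' / ws the polar part 1 / w, and [Pg] the
    first 2 K regular terms. *)
Definition Rs (gam : C) (K : nat) (y : R) : C := (2 * phi gam y - RtoC (s * ws' s y / ws s y) + RtoC (ws' s y) * Pg gam K (s * ws s y)%R)%C.

(** Within the disc |w| r <= 1/2 the power series of [PF] applies; [saddle_inj] identifies e^(2 s y)
    with [tauf (s * ws s y)], and [ps_tail] bounds the rest of the series. *)
Lemma Rs_near gam G K y : Cmod gam <= G -> 0 < y -> ws s y * (160 + 3 * G) <= / 2 ->
  Cmod (Rs gam K y) <= 4 * (160 + 3 * G) ^ (2 * K + 1) * (ws s y ^ (2 * K) * ws' s y).
Proof.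
  intros HG Hy Hn. assert (G0 := Rle_trans _ _ _ (Cmod_ge_0 _) HG). set (r := 160 + 3 * G) in *.
  assert (Wp := ws_pos y Hy). set (w := s * ws s y). assert (s2 : s * s = 1) by (destruct Hs as [-> | ->]; ring).
  assert (Aw : Rabs w = ws s y). { unfold w. destruct Hs as [-> | ->]. rewrite Rabs_pos_eq; lra. rewrite Rabs_left; lra. }
  assert (Hr : 160 <= r) by (unfold r; lra).
  assert (Hw : Rabs w < / 128) by (rewrite Aw; nra).
  destruct (vf_bounds w ltac:(lra)) as [V T]. destruct (ws'_pos y Hy) as [P1 P2].
  assert (Et : exp (2 * s * y) = tauf w).
  { apply saddle_inj; auto. apply exp_pos.
    - assert (Z := Rmult_lt_0_compat _ _ P1 (Rmult_lt_0_compat (ws s y) (vf w) Wp ltac:(lra))).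
      replace (s * (exp (2 * s * y) - 1) * (ws s y * vf w)) with ((exp (2 * s * y) - 1) * (tauf w - 1)) in Z; [exact Z|]. unfold tauf. replace (1 + w * vf w - 1) with (s * ws s y * vf w) by (fold w; ring). ring.
    - assert (E := tau_eq w Hw). assert (E2 := ws_sq y Hy). unfold Sv in E2. rewrite ln_exp. rewrite <- (pow2_abs w), Aw, E2 in E. lra. }
  assert (Ev : 2 * s * y = uu w) by (unfold uu; rewrite <- Et, ln_exp; auto).
  assert (Ew' : ws' s y = 2 * vf w). { unfold ws'. rewrite Et. unfold tauf. replace (2 * s * (1 + w * vf w - 1)) with (2 * (s * s) * ws s y * vf w) by (unfold w; ring). rewrite s2. field. lra. }
  assert (Vc : RtoC (vf w) <> 0%C) by (apply RtoC_neq0; lra).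
  assert (w0 : w <> 0) by (intros E; rewrite E, Rabs_R0 in Aw; lra). assert (Wc : RtoC w <> 0%C) by (apply RtoC_neq0; auto).
  assert (Eph : phi gam y = (PF gam w * RtoC (vf w) / RtoC w)%C).
  { unfold phi. rewrite (PF_eq gam G w HG) by (fold r; nra). rewrite Et, Ev. replace (tauf w - 1) with (w * vf w) by (unfold tauf; ring). rewrite RtoC_mult. field. auto. }
  assert (Esw : RtoC (s * ws' s y / ws s y) = (2 * RtoC (vf w) / RtoC w)%C).
  { rewrite Ew', <- RtoC_mult, <- RtoC_div by auto. apply f_equal. generalize (vf w). intros q. unfold w. revert Wp. generalize (ws s y). intros t Ht. destruct Hs as [E|E]; rewrite E; field; lra. }
  assert (ER : Rs gam K y = (RtoC (ws' s y) / RtoC w * (PF gam w - Csum (fun k => ps gam k * RtoC (w ^ k)) (S (2 * K))))%C).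
  { unfold Rs. rewrite Eph, Esw, Ew'. fold w. rewrite Csum_S_l. unfold Pg. change (ps gam 0) with (RtoC 1).
    rewrite (Csum_ext (fun k => ps gam (S k) * RtoC (w ^ S k))%C (fun k => - RtoC w * (- ps gam (S k) * RtoC (w ^ k)))%C).
    rewrite Csum_scal, RtoC_mult. simpl (w ^ 0). field; auto. intros k _. simpl. rewrite RtoC_mult. ring. }
  assert (PB : Cmod (PF gam w - Csum (fun k => ps gam k * RtoC (w ^ k))%C (S (2 * K))) <= 4 * (r * ws s y) ^ (2 * K + 1)).
  { eapply Rle_trans. apply Cmod_le_sum. replace (4 * (r * ws s y) ^ (2 * K + 1)) with (2 * 1 * (r * Rabs w) ^ S (2 * K) + 2 * 1 * (r * Rabs w) ^ S (2 * K)) by (rewrite Aw; replace (2 * K + 1)%nat with (S (2 * K)) by lia; ring).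
    assert (X1 := ps_tail (S (2 * K)) (fun n => Re (ps gam n)) 1 r w ltac:(intros; apply ps_comp_bound; auto) ltac:(lra) ltac:(rewrite Aw; lra)).
    assert (X2 := ps_tail (S (2 * K)) (fun n => Im (ps gam n)) 1 r w ltac:(intros; apply ps_comp_bound; auto) ltac:(lra) ltac:(rewrite Aw; lra)).
    cbv beta iota in X1, X2.
    apply Rplus_le_compat; [eapply Rle_trans; [|exact X1]|eapply Rle_trans; [|exact X2]]; right; f_equal.
    - assert (E := proj1 (Csum_sum (fun k => ps gam k * RtoC (w ^ k))%C (2 * K))). rewrite (sum_eq _ (fun k => Re (ps gam k) * w ^ k)) in E by (intros; simpl; unfold Re; ring).
      rewrite <- E. reflexivity.
    - assert (E := proj2 (Csum_sum (fun k => ps gam k * RtoC (w ^ k))%C (2 * K))). rewrite (sum_eq _ (fun k => Im (ps gam k) * w ^ k)) in E by (intros; simpl; unfold Im; ring).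
      rewrite <- E. reflexivity. }
  rewrite ER, Cmod_mult, Cmod_div, !Cmod_RtoC, Aw, (Rabs_pos_eq (ws' s y)) by (auto; lra).
  eapply Rle_trans. apply Rmult_le_compat_l; [|apply PB]. apply Rlt_le, Rdiv_lt_0_compat; auto.
  right. rewrite Rpow_mult_distr, (pow_add (ws s y)), pow_1. field. lra.
Qed.
End Branch.

Lemma Csum_geom f n a : (forall k, (k < n)%nat -> Cmod (f k) <= a * (/ 2) ^ k) -> Cmod (Csum f n) <= 2 * a * (1 - (/ 2) ^ n).
Proof.
  induction n; intros H; simpl. rewrite Cmod_0. lra.
  eapply Rle_trans. apply Cmod_triangle. specialize (IHn ltac:(intros; apply H; lia)). specialize (H n ltac:(lia)). lra.
Qed.

Lemma sAbs1 s : s = 1 \/ s = -1 -> Rabs s = 1.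
Proof. intros [-> | ->]. apply Rabs_R1. rewrite Rabs_left; lra. Qed.

(** Away from the saddle point no cancellation is used: the three terms are bounded one by one.
    Since 2 r |w| > 1 there, the power |w|^(2 K) costs only a constant, and e^(c Sv) absorbs the
    growth of tau^gam. *)
Lemma Rs_far s gam G K y : s = 1 \/ s = -1 -> Cmod gam <= G -> 0 < y -> / 2 < ws s y * (160 + 3 * G) ->
  Cmod (Rs s gam K y) <= (2 * (160 + 3 * G)) ^ (2 * K) * (64 * (160 + 3 * G) ^ 2 * exp G + 4 * (160 + 3 * G)) * (ws s y ^ (2 * K) * ws' s y) * exp ((4 * G + 1) * Sv (2 * s * y)).
Proof.
  intros Hs HG Hy Hf. assert (G0 := Rle_trans _ _ _ (Cmod_ge_0 _) HG). set (r := 160 + 3 * G) in *. assert (Hr : 160 <= r) by (unfold r; lra).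
  assert (Wp := ws_pos s Hs y Hy). destruct (ws'_pos s Hs y Hy) as [D0 W'p]. assert (Wsq := ws_sq s Hs y Hy). set (W := ws s y) in *. set (S := Sv (2 * s * y)) in *.
  assert (Ab := s_abs s Hs y Hy). set (d := s * (exp (2 * s * y) - 1)) in *.
  assert (HS : 0 < S) by (apply Sv_pos, s_ne; auto).
  (* In this range |w| exceeds h, which forces 2 y >= h / 2 and |tau - 1| >= h / 4; the constant 64
     r^2 is (4 / h)^2. *)
  set (h := / (2 * r)). assert (Hh : 0 < h <= / 320). { unfold h. split. apply Rinv_0_lt_compat; lra. apply Rinv_le_contravar; lra. }
  assert (HW : h < W). { unfold h. apply (Rmult_lt_reg_r (2 * r)). lra. rewrite Rinv_l; lra. }
  assert (Hy2 : h / 2 <= 2 * y).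
  { destruct (Rle_dec (2 * y) 1); [|lra]. assert (U := Sv_upper (2 * s * y) ltac:(lra)). fold S in U. rewrite <- pow2_abs, Ab in U.
    assert (h ^ 2 < W ^ 2) by (simpl; nra). nra. }
  assert (Hd : h / 4 <= d).
  { unfold d. destruct Hs as [-> | ->]. assert (X := exp_ineq1_le (2 * 1 * y)). lra.
    assert (X := exp_ineq1_le (2 * y)). replace (2 * -1 * y) with (- (2 * y)) by ring. rewrite exp_Ropp.
    assert (Q : / exp (2 * y) <= / (1 + h / 2)) by (apply Rinv_le_contravar; lra).
    assert (Q2 : / (1 + h / 2) <= 1 - h / 4). { apply (Rmult_le_reg_r (1 + h / 2)). lra. rewrite Rinv_l by lra. nra. } lra. }
  assert (Ew' : ws' s y * W = 2 * d). { unfold ws'. fold W. unfold d. field. lra. }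
  assert (WS : W <= exp S). { eapply Rle_trans; [|apply exp_ineq1_le]. nra. }
  (* For 2 y >= 1 one has 2 y <= 4 Sv, and for 2 y < 1 the exponential is at most e^G; the
     additional 1 pays for |w| <= e^Sv. *)
  set (c := 4 * G + 1). assert (EG : exp (G * (2 * y)) * W <= exp G * exp (c * S)).
  { replace (c * S) with (4 * G * S + S) by (unfold c; ring). rewrite exp_plus, <- (Rmult_assoc (exp G)).
    apply Rmult_le_compat; [left; apply exp_pos|lra| |auto]. rewrite <- exp_plus. apply exp_le.
    destruct (Rle_dec 1 (2 * y)). assert (L := Sv_large (2 * s * y) ltac:(lra)). fold S in L. rewrite Ab in L. nra. nra. }
  assert (E1 : 1 <= exp (c * S)) by (apply exp_ge1; unfold c; nra). set (e := exp (c * S)) in *.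
  set (q := (2 * r) ^ (2 * K) * W ^ (2 * K)).
  assert (qk : forall k, (k <= 2 * K)%nat -> (2 * r * W) ^ k <= q). { intros k Hk. unfold q. rewrite <- Rpow_mult_distr. apply Rle_pow; auto. unfold h in HW. apply (Rmult_lt_compat_r (2 * r)) in HW; [|lra]. rewrite Rinv_l in HW; lra. }
  assert (q1 : 1 <= q) by (apply (qk 0%nat); lia).
  assert (T1 : Cmod (2 * phi s gam y) <= ws' s y * (64 * r ^ 2 * exp G) * e * q).
  { unfold phi. rewrite Cmod_mult, Cmod_div by (apply RtoC_neq0; intros Z; unfold d in D0; rewrite Z in D0; lra).
    rewrite !Cmod_RtoC, (Rabs_pos_eq 2), Cmod_Cexp by lra.
    replace (Rabs (exp (2 * s * y) - 1)) with d. 2: { unfold d in D0 |- *. clear - D0 Hs. destruct Hs as [-> | ->]. rewrite Rabs_pos_eq; lra. rewrite Rabs_left; lra. }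
    assert (X : exp (Re (gam * RtoC (2 * s * y))%C) <= exp (G * (2 * y))).
    { apply exp_le. simpl. rewrite Rmult_0_r, Rminus_0_r. eapply Rle_trans; [apply Rle_abs|]. rewrite Rabs_mult, Ab. apply Rmult_le_compat_r. lra. eapply Rle_trans; [apply Re_le_Cmod|auto]. }
    assert (Dd : / (d * d) <= 64 * r ^ 2).
    { replace (64 * r ^ 2) with (/ ((h / 4) * (h / 4))) by (unfold h; field; lra). apply Rinv_le_contravar; nra. }
    apply Rle_trans with (ws' s y * (exp (G * (2 * y)) * W) * / (d * d)).
    - replace (ws' s y * (exp (G * (2 * y)) * W) * / (d * d)) with ((ws' s y * W) * exp (G * (2 * y)) * / (d * d)) by ring. rewrite Ew'.
      replace (2 * d * exp (G * (2 * y)) * / (d * d)) with (2 * (exp (G * (2 * y)) / d)) by (field; lra). apply Rmult_le_compat_l. lra. apply Rmult_le_compat_r; auto. left; apply Rinv_0_lt_compat; lra.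
    - apply Rle_trans with (ws' s y * (exp G * e) * (64 * r ^ 2)).
      + assert (0 < exp (G * (2 * y))) by apply exp_pos. assert (0 < / (d * d)) by (apply Rinv_0_lt_compat; nra).
        apply Rmult_le_compat; auto; try lra. apply Rmult_le_pos; [lra|apply Rmult_le_pos; lra]. apply Rmult_le_compat_l; lra.
      + assert (0 <= ws' s y * (exp G * e) * (64 * r ^ 2)). { assert (0 < exp G) by apply exp_pos. apply Rmult_le_pos; [apply Rmult_le_pos; [lra|apply Rmult_le_pos; lra]|generalize (pow2_ge_0 r); lra]. } nra. }
  assert (T2 : Cmod (RtoC (s * ws' s y / W)) <= ws' s y * (2 * r) * e * q).
  { rewrite Cmod_RtoC. unfold Rdiv. rewrite !Rabs_mult, (Rabs_pos_eq (ws' s y)), (Rabs_pos_eq (/ W)) by (try (left; apply Rinv_0_lt_compat); lra).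
    rewrite (sAbs1 s Hs).
    assert (IW : / W <= 2 * r) by (rewrite <- (Rinv_inv (2 * r)); fold h; apply Rinv_le_contravar; lra).
    assert (0 < / W) by (apply Rinv_0_lt_compat; lra). assert (ws' s y * / W <= ws' s y * (2 * r)) by (apply Rmult_le_compat_l; lra).
    assert (0 <= ws' s y * (2 * r)) by nra. assert (1 <= e * q) by nra. rewrite (Rmult_assoc _ e q). nra. }
  assert (T3 : Cmod (RtoC (ws' s y) * Pg gam K (s * W)%R) <= ws' s y * (2 * r) * e * q).
  { rewrite Cmod_mult, Cmod_RtoC, Rabs_pos_eq by lra. rewrite !Rmult_assoc. apply Rmult_le_compat_l. lra.
    apply Rle_trans with (2 * (r * q)); [|assert (0 <= 2 * (r * q)) by nra; replace (2 * (r * (e * q))) with (2 * (r * q) * e) by ring; nra].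
    assert (X := Csum_geom (fun k => - ps gam (Datatypes.S k) * RtoC ((s * W) ^ k))%C (2 * K) (r * q)).
    assert (P2 : 0 < (/ 2) ^ (2 * K)) by (apply pow_lt; lra). fold (Pg gam K (s * W)) in X.
    eapply Rle_trans. apply X. intros k Hk. rewrite Cmod_mult, Cmod_opp, Cmod_RtoC, <- RPow_abs, Rabs_mult.
    rewrite (sAbs1 s Hs). rewrite Rmult_1_l, (Rabs_pos_eq W) by lra.
    assert (B := ps_bound gam G (Datatypes.S k) HG). fold r in B.
    assert (Q := qk k ltac:(lia)). assert (PW : 0 < W ^ k) by (apply pow_lt; auto).
    apply Rle_trans with (r ^ Datatypes.S k * W ^ k). apply Rmult_le_compat_r; lra.
    replace (r ^ Datatypes.S k * W ^ k) with (r * (2 * r * W) ^ k * (/ 2) ^ k).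
    apply Rmult_le_compat_r. apply pow_le; lra. apply Rmult_le_compat_l; lra.
    rewrite (Rmult_assoc r), <- Rpow_mult_distr. replace (2 * r * W * / 2) with (r * W) by field. rewrite Rpow_mult_distr. simpl. ring.
    assert (Hrq : 0 <= r * q) by (apply Rmult_le_pos; lra). assert (0 <= r * q * (/ 2) ^ (2 * K)) by (apply Rmult_le_pos; lra). lra. }
  unfold Rs. fold W. eapply Rle_trans. apply Cmod_triangle. eapply Rle_trans. apply Rplus_le_compat_r. apply Cmod_triang_minus.
  replace ((2 * r) ^ (2 * K) * (64 * r ^ 2 * exp G + 4 * r) * (W ^ (2 * K) * ws' s y) * e) with (ws' s y * (64 * r ^ 2 * exp G) * e * q + ws' s y * (2 * r) * e * q + ws' s y * (2 * r) * e * q) by (unfold q; ring). lra.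
Qed.

Lemma Rs_bound G K : 0 <= G -> exists C c, 0 <= C /\ 0 <= c /\ forall s gam y, s = 1 \/ s = -1 -> Cmod gam <= G -> 0 < y ->
  Cmod (Rs s gam K y) <= C * (ws s y ^ (2 * K) * ws' s y) * exp (c * Sv (2 * s * y)).
Proof.
  intros HG. set (r := 160 + 3 * G). set (C1 := (2 * r) ^ (2 * K) * (64 * r ^ 2 * exp G + 4 * r)). set (C2 := 4 * r ^ (2 * K + 1)).
  assert (Hr : 160 <= r) by (unfold r; lra).
  assert (H1 : 0 <= C1). { apply Rmult_le_pos. apply pow_le; lra. assert (0 < exp G) by apply exp_pos. assert (0 <= 64 * r ^ 2 * exp G) by (apply Rmult_le_pos; [|lra]; nra). lra. }
  assert (H2 : 0 <= C2). { unfold C2. apply Rmult_le_pos. lra. apply pow_le; lra. }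
  exists (C1 + C2), (4 * G + 1). split; [lra|split; [lra|]]. intros s gam y Hs Hg Hy.
  assert (Wp := ws_pos s Hs y Hy). destruct (ws'_pos s Hs y Hy) as [_ W'p].
  assert (HS := Sv_pos _ (s_ne s Hs y Hy)). assert (E1 : 1 <= exp ((4 * G + 1) * Sv (2 * s * y))) by (apply exp_ge1; apply Rmult_le_pos; lra).
  set (e := exp ((4 * G + 1) * _)) in *. set (m := ws s y ^ (2 * K) * ws' s y). assert (Hm : 0 <= m) by (apply Rmult_le_pos; [apply pow_le|]; lra).
  destruct (Rle_dec (ws s y * r) (/ 2)) as [N|N].
  - eapply Rle_trans. apply (Rs_near s Hs gam G K y Hg Hy N). fold r. fold C2. fold m.
    assert (0 <= C2 * m) by (apply Rmult_le_pos; auto). assert (0 <= C1 * m * e) by (apply Rmult_le_pos; [apply Rmult_le_pos|]; lra). nra.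
  - eapply Rle_trans. apply (Rs_far s gam G K y Hs Hg Hy (Rnot_le_lt _ _ N)). fold r. fold C1 e m.
    assert (0 <= C2 * m) by (apply Rmult_le_pos; auto). assert (0 <= C2 * m * e) by (apply Rmult_le_pos; lra). lra.
Qed.

(** * The principal value of the odd part vanishes *)

Definition psi (X w : R) : R := exp (- (X / 2) * w ^ 2) / w.

Lemma psi_ex X a b : 0 < a -> 0 < b -> ex_RInt (psi X) a b.
Proof.
  intros Ha Hb. apply (ex_RInt_continuous (V:=RV)). intros z Hz. unfold psi.
  assert (0 < z) by (unfold Rmin in Hz; destruct (Rle_dec a b); lra). cont. lra.
Qed.

(** The first bound serves the lower ends near w = 0, where the interval is short; the second serves
    the upper ends, where the Gaussian is small. The order of a and b is left open because either
    branch may be ahead. *)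
Lemma psi_bounds X m a b : 0 < X -> 0 < m -> m <= a -> m <= b ->
  Rabs (RInt (psi X) a b) <= Rabs (b - a) / m /\ Rabs (RInt (psi X) a b) <= / (X * m ^ 2).
Proof.
  intros HX Hm. assert (K : forall a b, m <= a -> a <= b -> Rabs (RInt (psi X) a b) <= (b - a) / m /\ Rabs (RInt (psi X) a b) <= / (X * m ^ 2)).
  { clear a b. intros a b Ha Hab. assert (EX := psi_ex X a b ltac:(lra) ltac:(lra)).
    assert (PB : forall t, a <= t <= b -> 0 <= psi X t <= / m /\ psi X t <= / m ^ 2 * (t * exp (- (X / 2) * t ^ 2))).
    { intros t Ht. unfold psi. assert (E := exp_pos (- (X / 2) * t ^ 2)). assert (E2 : exp (- (X / 2) * t ^ 2) <= 1). { rewrite <- exp_0. apply exp_le. generalize (pow2_ge_0 t); nra. }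
      set (e := exp _) in *. assert (It : / t <= / m) by (apply Rinv_le_contravar; lra). assert (0 < / t) by (apply Rinv_0_lt_compat; lra).
      unfold Rdiv. split; [split; nra|]. apply (Rmult_le_reg_r (m ^ 2 * t)). apply Rmult_lt_0_compat; [apply pow_lt|]; lra.
      replace (e * / t * (m ^ 2 * t)) with (e * m ^ 2) by (field; lra). replace (/ m ^ 2 * (t * e) * (m ^ 2 * t)) with (e * t ^ 2) by (field; lra). apply Rmult_le_compat_l; [lra|]. apply pow_incr; lra. }
    assert (P0 : 0 <= RInt (psi X) a b) by (apply RInt_ge_0; auto; intros; apply PB; lra).
    split.
    - unfold Rdiv. apply abs_RInt_le_const; auto. intros t Ht. rewrite Rabs_pos_eq; apply PB; auto.
    - rewrite Rabs_pos_eq by auto.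
      assert (D : forall x, a <= x <= b -> is_derive (fun t => - exp (- (X / 2) * t ^ 2) / (X * m ^ 2)) x (/ m ^ 2 * (x * exp (- (X / 2) * x ^ 2)))).
      { intros x Hx. auto_derive; auto. simpl. field. lra. }
      assert (KC : forall x, a <= x <= b -> continuous (fun x => / m ^ 2 * (x * exp (- (X / 2) * x ^ 2))) x) by (intros; cont).
      apply Rle_trans with (RInt (fun x => / m ^ 2 * (x * exp (- (X / 2) * x ^ 2))) a b).
      apply RInt_le; auto. apply ex_RInt_cont; auto. intros; apply PB; lra.
      rewrite (R_FTC _ _ a b Hab D KC). assert (Ea := exp_pos (- (X / 2) * a ^ 2)). assert (Eb := exp_pos (- (X / 2) * b ^ 2)).
      assert (Ea1 : exp (- (X / 2) * a ^ 2) <= 1). { rewrite <- exp_0. apply exp_le. generalize (pow2_ge_0 a); nra. }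
      assert (I : 0 < / (X * m ^ 2)) by (apply Rinv_0_lt_compat, Rmult_lt_0_compat; auto; apply pow_lt; auto). unfold Rdiv. nra. }
  intros Ha Hb. destruct (Rle_dec a b).
  - rewrite (Rabs_pos_eq (b - a)) by lra. apply K; auto.
  - rewrite <- (opp_RInt_swap (psi X) b a) by (apply psi_ex; lra). change (opp (RInt (psi X) b a)) with (- RInt (psi X) b a). rewrite Rabs_Ropp, (Rabs_left (b - a)), Ropp_minus_distr by lra. apply K; lra.
Qed.

Definition qs (X s y : R) : R := exp (- X * Sv (2 * s * y)) * (ws' s y / ws s y).

Lemma qs_cont X s y : s = 1 \/ s = -1 -> 0 < y -> continuous (qs X s) y.
Proof. intros Hs Hy. assert (P := ws_pos s Hs y Hy). assert (C1 := ws_cont s Hs y Hy). assert (C2 := ws'_cont s Hs y Hy). unfold qs, Sv. cont. lra. Qed.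

Lemma qs_int X s a b : s = 1 \/ s = -1 -> 0 < a <= b -> RInt (qs X s) a b = RInt (psi X) (ws s a) (ws s b).
Proof.
  intros Hs Hab. rewrite <- (RInt_comp (V:=RV) (psi X) (ws s) (ws' s)).
  - apply RInt_ext_le. lra. intros y Hy. unfold qs, psi, scal; simpl. unfold mult; simpl. assert (P := ws_pos s Hs y ltac:(lra)).
    replace (ws s y * (ws s y * 1)) with (ws s y ^ 2) by ring. rewrite ws_sq by (auto; lra). replace (- (X / 2) * (2 * Sv (2 * s * y))) with (- X * Sv (2 * s * y)) by field. field. lra.
  - intros y Hy. rewrite Rmin_left, Rmax_right in Hy by lra. assert (P := ws_pos s Hs y ltac:(lra)). unfold psi. cont. lra.
  - intros y Hy. rewrite Rmin_left, Rmax_right in Hy by lra. split. apply ws_derive; auto; lra. apply ws'_cont; auto; lra.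
Qed.

(** The quadratic terms of Sv at 2 d and - 2 d agree, so the squares differ by O(d^3) and the two
    moduli by O(d^2). *)
Lemma ws_diff d : 0 < d <= 1 / 2 -> Rabs (ws (-1) d - ws 1 d) <= 32 * d ^ 2.
Proof.
  intros Hd. assert (H1 : 1 = 1 \/ 1 = -1) by auto. assert (H2 : -1 = 1 \/ -1 = -1) by auto.
  assert (A := ws_small 1 H1 d Hd). assert (B := ws_small (-1) H2 d Hd).
  assert (A2 := ws_sq 1 H1 d ltac:(lra)). assert (B2 := ws_sq (-1) H2 d ltac:(lra)).
  set (v := 2 * d). replace (2 * 1 * d) with v in A2 by (unfold v; ring). replace (2 * -1 * d) with (- v) in B2 by (unfold v; ring).
  assert (M := R_mvt_bound (fun t => Sv t - Sv (- t)) (fun t => Sv t + Sv (- t)) (4 * v ^ 2) 0 v ltac:(unfold v; lra)).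
  assert (Q : Rabs (Sv v - Sv (- v)) <= 4 * v ^ 2 * v).
  { replace (Sv v - Sv (- v)) with ((Sv v - Sv (- v)) - (Sv 0 - Sv (- 0))) by (rewrite Ropp_0; ring). rewrite <- (Rminus_0_r v) at 4. apply M.
    intros t Ht. unfold v in Ht. split. unfold Sv. auto_derive; auto. ring.
    assert (U1 := Sv_upper t ltac:(apply Rabs_le; lra)). assert (U2 := Sv_upper (- t) ltac:(apply Rabs_le; lra)).
    assert (L1 := Sv_lower t ltac:(lra)). assert (L2 := Sv_lower (- t) ltac:(lra)). assert (t ^ 2 <= v ^ 2) by (apply pow_incr; unfold v; lra). rewrite Rabs_pos_eq; nra. }
  assert (E : (ws (-1) d - ws 1 d) * (ws (-1) d + ws 1 d) = 2 * (Sv (- v) - Sv v)) by nra.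
  assert (E2 : Rabs (ws (-1) d - ws 1 d) * (ws (-1) d + ws 1 d) <= 2 * (4 * v ^ 2 * v)).
  { rewrite <- (Rabs_pos_eq (ws (-1) d + ws 1 d)) by lra. rewrite <- Rabs_mult, E, Rabs_mult, (Rabs_pos_eq 2), Rabs_minus_sym by lra. lra. }
  assert (P := Rabs_pos (ws (-1) d - ws 1 d)). set (x := Rabs (ws _ d - _)) in *.
  apply (Rmult_le_reg_r (2 * d)). lra. apply Rle_trans with (x * (ws (-1) d + ws 1 d)). apply Rmult_le_compat_l; lra. unfold v in E2. nra.
Qed.

(** In w both branches have the same integrand, but a window symmetric in y is not symmetric in w.
    The discrepancy at the lower end has length O(d^2) where 1 / w is O(1 / d), and at the upper end
    it is O(1 / (X N)). *)
Lemma qs_lim X : 0 < X -> limC (fun n => CInt (fun y => RtoC (qs X 1 y - qs X (-1) y)) (wl W0 n) (wr W0 n)) 0%C.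
Proof.
  intros HX. assert (H1 : 1 = 1 \/ 1 = -1) by auto. assert (H2 : -1 = 1 \/ -1 = -1) by auto.
  apply (limC_0_bound_ev _ (fun n => (32 + / X) * / (INR n + 1))).
  - replace (Finite 0) with (Rbar_mult (32 + / X) 0) by (simpl; f_equal; ring). apply is_lim_seq_scal_l. apply lim_inv_S.
  - exists 1%nat. intros n Hn. change (wl W0 n) with (/ (INR n + 1)). change (wr W0 n) with (INR n + 1).
    assert (Hn1 : 1 <= INR n) by (apply (le_INR 1); auto). set (N := INR n + 1). set (d := / N).
    assert (Hd : 0 < d <= 1 / 2). { unfold d. split. apply Rinv_0_lt_compat; unfold N; lra. replace (1 / 2) with (/ 2) by field. apply Rinv_le_contravar; unfold N; lra. }
    assert (HN : 2 <= N) by (unfold N; lra).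
    assert (EC : CInt (fun y => RtoC (qs X 1 y - qs X (-1) y)) d N = RtoC (RInt (qs X 1) d N - RInt (qs X (-1)) d N)).
    { unfold CInt. apply C_ext; simpl. apply (R_RInt_minus (qs X 1) (qs X (-1))); apply ex_RInt_cont; try lra; intros; apply qs_cont; auto; lra.
      rewrite RInt_const. unfold scal; simpl. unfold mult; simpl. ring. }
    rewrite EC, Cmod_RtoC, !qs_int by (auto; lra).
    assert (A1 := ws_small 1 H1 d Hd). assert (A2 := ws_small (-1) H2 d Hd).
    assert (B1 := ws_large 1 H1 N ltac:(lra)). assert (B2 := ws_large (-1) H2 N ltac:(lra)). assert (C1 := ws_pos 1 H1 N ltac:(lra)). assert (C2 := ws_pos (-1) H2 N ltac:(lra)).
    assert (E : RInt (psi X) (ws 1 d) (ws 1 N) - RInt (psi X) (ws (-1) d) (ws (-1) N) = RInt (psi X) (ws 1 d) (ws (-1) d) + RInt (psi X) (ws (-1) N) (ws 1 N)).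
    { rewrite <- (RInt_Chasles (psi X) (ws 1 d) (ws (-1) d) (ws 1 N)) by (apply psi_ex; lra).
      rewrite <- (RInt_Chasles (psi X) (ws (-1) d) (ws (-1) N) (ws 1 N)) by (apply psi_ex; lra). unfold plus; simpl. ring. }
    rewrite E. eapply Rle_trans. apply Rabs_triang.
    assert (D := ws_diff d Hd). destruct (psi_bounds X d (ws 1 d) (ws (-1) d) HX ltac:(lra) ltac:(lra) ltac:(lra)) as [P1 _].
    assert (SN : sqrt N ^ 2 = N) by (apply pow2_sqrt; lra). assert (SP : 0 < sqrt N) by (apply sqrt_lt_R0; lra).
    destruct (psi_bounds X (sqrt N) (ws (-1) N) (ws 1 N) HX SP) as [_ P2]; try (rewrite <- (sqrt_pow2 (ws _ N)) by lra; apply sqrt_le_1_alt; auto).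
    rewrite SN in P2. fold d. replace ((32 + / X) * d) with (32 * d ^ 2 / d + / (X * N)) by (unfold d; field; lra).
    apply Rplus_le_compat; auto. eapply Rle_trans; [apply P1|]. apply Rmult_le_compat_r; auto. left; apply Rinv_0_lt_compat; lra.
Qed.

Lemma Cok_restrict f g : Cok WR f g -> Rok WR g -> Cok W0 f (fun r => g r + g (- r)) /\ Cok W0 (fun r => f (- r)%R) (fun r => g r + g (- r)) /\
  IntW WR f = (IntW W0 f + IntW W0 (fun r => f (- r)%R))%C.
Proof.
  intros H Hg. destruct (IntW_fold _ _ H) as [O E]. destruct H as [_ [K B]].
  assert (P : forall r, 0 <= g r) by (intros; apply Hg, inWR).
  assert (A1 : Cok W0 f (fun r => g r + g (- r))).
  { split; [apply O|split]; intros r _. apply K, inWR. specialize (B r (inWR r)). specialize (P (- r)). lra. }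
  assert (A2 : Cok W0 (fun r => f (- r)%R) (fun r => g r + g (- r))).
  { split; [apply O|split]; intros r _. apply (cC_comp Ropp f). cont. apply K, inWR. specialize (B (- r) (inWR _)). specialize (P r). lra. }
  split; [auto|split; [auto|]]. rewrite E. apply (IntW_plus _ _ _ _ _ A1 A2).
Qed.

Lemma lim_ext0 f g l : (forall y, 0 < y -> f y = g y) -> limC (fun n => CInt f (wl W0 n) (wr W0 n)) l -> limC (fun n => CInt g (wl W0 n) (wr W0 n)) l.
Proof.
  intros H. apply limC_ext. intros n. apply CInt_ext. apply W0_lr. intros y Hy. apply H, inW0. exists n; auto.
Qed.

Lemma lim_lin (f g : R -> C) (F G c : C) : (forall y, 0 < y -> contC f y) -> (forall y, 0 < y -> contC g y) ->
  limC (fun n => CInt f (wl W0 n) (wr W0 n)) F -> limC (fun n => CInt g (wl W0 n) (wr W0 n)) G ->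
  limC (fun n => CInt (fun y => f y + c * g y)%C (wl W0 n) (wr W0 n)) (F + c * G)%C.
Proof.
  intros Kf Kg LF LG. apply (limC_ext (fun n => CInt f (wl W0 n) (wr W0 n) + c * CInt g (wl W0 n) (wr W0 n))%C).
  - intros n. assert (Hlr : wl W0 n <= wr W0 n) by apply W0_lr. assert (I : forall y, wl W0 n <= y <= wr W0 n -> 0 < y) by (intros y Hy; apply inW0; exists n; auto).
    rewrite (CInt_plus f (fun y => c * g y)%C), CInt_scal; auto; intros y Hy; auto. apply cC_mult; [cont|auto].
  - apply limC_plus; auto. apply limC_mult; auto. apply limC_const.
Qed.

(** * Asymptotics of the principal value with the saddle point at the pole *)

Definition kT (X : R) (gam : C) (y : R) : C := (RtoC (exp (- X * Sv (2 * y))) * Cexp ((2 * gam - 1) * RtoC y))%C.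
Definition hT (X : R) (gam : C) (y : R) : C := ((kT X gam (- y)%R - kT X gam y) / RtoC (sinh y))%C.

Lemma phi_eq s gam y : s = 1 \/ s = -1 -> 0 < y -> (2 * phi s gam y = RtoC s * Cexp ((2 * gam - 1) * RtoC (s * y)) / RtoC (sinh y))%C.
Proof.
  intros Hs Hy. assert (S := sinh_pos y Hy). assert (Sc : RtoC (sinh y) <> 0%C) by (apply RtoC_neq0; lra).
  assert (E : exp (2 * s * y) - 1 = s * 2 * exp (s * y) * sinh y).
  { unfold sinh. replace (2 * s * y) with (s * y + s * y) by ring. rewrite exp_plus.
    destruct Hs as [-> | ->]; [rewrite Rmult_1_l|replace (-1 * y) with (- y) by ring]; rewrite ?exp_Ropp; assert (P := exp_pos y); field; lra. }
  assert (Ec : RtoC (exp (s * y)) <> 0%C) by (apply RtoC_neq0; generalize (exp_pos (s * y)); lra).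
  assert (s2 : (RtoC s * RtoC s = 1)%C) by (rewrite <- RtoC_mult; apply f_equal; destruct Hs as [-> | ->]; ring).
  assert (sc : RtoC s <> 0%C) by (apply RtoC_neq0; destruct Hs; lra).
  unfold phi. rewrite E, !RtoC_mult.
  replace ((2 * gam - 1) * (RtoC s * RtoC y))%C with (gam * (2 * RtoC s * RtoC y) + - RtoC (s * y))%C by (rewrite RtoC_mult; ring).
  rewrite Cexp_add, Cexp_opp, Cexp_R. transitivity ((RtoC s * RtoC s) * Cexp (gam * (2 * RtoC s * RtoC y)) / (RtoC s * RtoC (exp (s * y)) * RtoC (sinh y)))%C.
  rewrite s2. field. repeat split; auto. field. repeat split; auto.
Qed.

Lemma Csum_cont (c : nat -> C) (u : R -> R) N y : continuous u y -> contC (fun y => Csum (fun k => c k * RtoC (u y ^ k)) N)%C y.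
Proof. intros H. induction N; simpl. cont. apply cC_plus; auto. apply cC_mult. cont. apply cC_RtoC, cR_pow; auto. Qed.

(** The Gaussian moments, at rate X / 2, of the even part of the truncated regular expansion; this
    is the value that the principal value of [kT] approaches. *)
Definition SG (gam : C) (X : R) (n : nat) : C := Csum (fun k => Gseq gam (2 * k) * RtoC (sqrt (PI / (X / 2)) * hp k * (/ (X / 2)) ^ k))%C n.

Section T.
Variables (X : R) (gam : C) (K : nat).
Let F (w : R) : C := (Pg gam K w * RtoC (exp (- (X / 2) * w ^ 2)))%C.
Let A s y : C := (RtoC (ws' s y) * F (s * ws s y)%R)%C.
Let B s y : C := (RtoC (exp (- X * Sv (2 * s * y))) * Rs s gam K y)%C.

(** On each branch, 2 [phi] is the sum of polar part and remainder minus the polynomial part, by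
    definition of [Rs]. With the exponential factor these become [qs], [B] and [A]. *)
Lemma hT_split y : 0 < y -> hT X gam y = (((A 1 y + A (-1) y) + (- 1) * (B 1 y + B (-1) y)) + (- 1) * RtoC (qs X 1 y - qs X (-1) y))%C.
Proof.
  intros Hy. assert (S := sinh_pos y Hy).
  assert (M : forall s, s = 1 \/ s = -1 -> (- (RtoC (exp (- X * Sv (2 * s * y))) * (2 * phi s gam y)) = A s y - B s y - RtoC (s * qs X s y))%C).
  { intros s Hs. unfold A, F, B, Rs, qs. assert (P := ws_pos s Hs y Hy). assert (s2 : s ^ 2 = 1) by (destruct Hs as [-> | ->]; ring).
    replace (- (X / 2) * (s * ws s y) ^ 2) with (- X * Sv (2 * s * y)).
    2: { rewrite Rpow_mult_distr, s2, (ws_sq s Hs y Hy). field. }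
    replace (s * (exp (- X * Sv (2 * s * y)) * (ws' s y / ws s y))) with (exp (- X * Sv (2 * s * y)) * (s * ws' s y / ws s y)) by (field; lra).
    rewrite (RtoC_mult (exp _)). ring. }
  assert (M1 := M 1 ltac:(auto)). assert (M2 := M (-1) ltac:(auto)). rewrite phi_eq in M1, M2 by auto.
  assert (Sc : RtoC (sinh y) <> 0%C) by (apply RtoC_neq0; lra).
  transitivity ((A 1 y - B 1 y - RtoC (1 * qs X 1 y)) + (A (-1) y - B (-1) y - RtoC (-1 * qs X (-1) y)))%C.
  - rewrite <- M1, <- M2. unfold hT, kT. replace (2 * 1 * y) with (2 * y) by ring. replace (2 * -1 * y) with (2 * - y) by ring. rewrite Rmult_1_l. replace (-1 * y) with (- y) by ring.
    replace (RtoC (-1)) with (- (1))%C by (apply C_ext; simpl; ring). field. auto.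
  - rewrite Rmult_1_l, RtoC_minus. replace (-1 * qs X (-1) y) with (- qs X (-1) y) by ring. rewrite RtoC_opp. ring.
Qed.

Lemma A_facts : 0 < X -> (forall s, s = 1 \/ s = -1 -> exists g, Cok W0 (A s) g) /\
  (IntW W0 (A 1) + IntW W0 (A (-1)) = SG gam X K)%C.
Proof.
  intros HX. destruct (gauss_poly (fun k => - ps gam (S k))%C K (X / 2) ltac:(lra)) as [[g O] E].
  destruct (Cok_restrict _ _ O (proj1 O)) as [O1 [O2 E2]]. change (fun r => (Csum (fun k => - ps gam (S k) * RtoC (r ^ k)) (2 * K) * RtoC (exp (- (X / 2) * r ^ 2)))%C) with F in *.
  change (fun r : R => (Csum (fun k : nat => - ps gam (S k) * RtoC ((- r) ^ k)) (2 * K) * RtoC (exp (- (X / 2) * (- r) ^ 2)))%C) with (fun r => F (- r)) in *.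
  assert (H1 : 1 = 1 \/ 1 = -1) by auto. assert (H2 : -1 = 1 \/ -1 = -1) by auto.
  destruct (ws_subst 1 H1 _ _ O1) as [S1 T1]. destruct (ws_subst (-1) H2 _ _ O2) as [S2 T2].
  assert (EA1 : (fun y => RtoC (ws' 1 y) * F (ws 1 y))%C = A 1) by (apply functional_extensionality; intros y; unfold A; rewrite Rmult_1_l; auto).
  assert (EA2 : (fun y => RtoC (ws' (-1) y) * F (- ws (-1) y))%C = A (-1)) by (apply functional_extensionality; intros y; unfold A; replace (-1 * ws (-1) y) with (- ws (-1) y) by ring; auto).
  rewrite EA1 in S1, T1. rewrite EA2 in S2, T2. split.
  - intros s [-> | ->]; eexists; [apply S1|apply S2].
  - rewrite T1, T2, <- E2, E. apply Csum_ext. intros k _. rewrite Gseq_eq. reflexivity.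
Qed.

(** Since - X Sv + c Sv = - ((X - c) / 2) w^2, the growth e^(c Sv) only lowers the Gaussian rate,
    and the bound is an even moment at that rate. *)
Lemma B_facts s C c : s = 1 \/ s = -1 -> 0 <= C -> c < X -> (forall y, 0 < y -> Cmod (Rs s gam K y) <= C * (ws s y ^ (2 * K) * ws' s y) * exp (c * Sv (2 * s * y))) ->
  exists g, Cok W0 (B s) g /\ RIntW W0 g <= C * (sqrt (PI / ((X - c) / 2)) * hp K * (/ ((X - c) / 2)) ^ K).
Proof.
  intros Hs HC HX H. set (Z := (X - c) / 2). assert (HZ : 0 < Z) by (unfold Z; lra).
  set (g0 := fun w => C * (Rabs w ^ (2 * K) * exp (- Z * w ^ 2))).
  assert (R0 : Rok WR g0) by (apply Rok_scal; auto; apply gf_ok; auto).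
  destruct (Cok_restrict _ _ (Cok_real _ _ R0) R0) as [O1 [_ _]].
  destruct (IntW_fold _ _ (Cok_real _ _ R0)) as [OF EF].
  assert (R1 : Rok W0 g0). { apply (Rok_le _ _ _ (proj1 O1)). intros; apply R0, inWR. intros x _. assert (P := proj1 (proj2 R0)). split. apply P, inWR. generalize (P (- x) (inWR _)); lra. }
  destruct (ws_subst s Hs _ _ (Cok_real _ _ R1)) as [O2 E2].
  exists (fun y => ws' s y * g0 (ws s y)). split.
  - split; [apply O2|split].
    + intros y Hy. apply inW0 in Hy. assert (P := ws_pos s Hs y Hy). assert (C1 := ws_cont s Hs y Hy). assert (C2 := ws'_cont s Hs y Hy). assert (D := ws'_pos s Hs y Hy).
      unfold B, Rs, phi, Pg, Sv. apply cC_mult. cont. apply cC_plus. apply cC_minus. cont. apply RtoC_neq0. intros Q. rewrite Q in D. lra. cont. lra.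
      apply cC_mult. cont. apply (Csum_cont (fun k => - ps gam (Datatypes.S k))%C (fun y => s * ws s y)). cont.
    + intros y Hy. apply inW0 in Hy. unfold B. rewrite Cmod_mult, Cmod_RtoC, Rabs_pos_eq by (left; apply exp_pos).
      eapply Rle_trans. apply Rmult_le_compat_l; [left; apply exp_pos|apply H; auto]. right. unfold g0. rewrite (Rabs_pos_eq (ws s y)) by (left; apply ws_pos; auto).
      replace (- Z * ws s y ^ 2) with (- X * Sv (2 * s * y) + c * Sv (2 * s * y)) by (rewrite (ws_sq s Hs y Hy); unfold Z; field). rewrite exp_plus. ring.
  - assert (E3 : RIntW W0 (fun y => ws' s y * g0 (ws s y)) = RIntW W0 g0).
    { apply (f_equal Re) in E2. rewrite (IntW_ext _ _ (fun y => RtoC (ws' s y * g0 (ws s y)))) in E2 by (intros; rewrite RtoC_mult; auto).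
      rewrite !IntW_real in E2; auto. apply O2. }
    rewrite E3. apply Rle_trans with (RIntW W0 (fun r => g0 r + g0 (- r))).
    + apply RIntW_le; auto. apply OF. intros x _. generalize (proj1 (proj2 R0) (- x) (inWR _)); lra.
    + right. apply (f_equal Re) in EF. rewrite (IntW_ext W0 _ (fun r => RtoC (g0 r + g0 (- r)))) in EF by (intros; rewrite RtoC_plus; auto). rewrite !IntW_real in EF; auto; [|apply OF].
      simpl in EF. rewrite <- EF. unfold g0. rewrite (RIntW_scal WR (fun w => Rabs w ^ (2 * K) * exp (- Z * w ^ 2))) by (apply gf_ok; auto). rewrite gauss_even_bound; auto.
Qed.

(** The polar parts of the two branches converge only in combination and along the windows, so the
    whole is stated as a limit over the windows of [W0]. *)
Lemma T_lim : 0 < X -> (forall s, s = 1 \/ s = -1 -> exists g, Cok W0 (B s) g) ->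
  limC (fun n => CInt (hT X gam) (wl W0 n) (wr W0 n)) ((IntW W0 (A 1) + IntW W0 (A (-1))) + (- 1) * (IntW W0 (B 1) + IntW W0 (B (-1))) + (- 1) * 0)%C.
Proof.
  intros HX HB. assert (H1 : 1 = 1 \/ 1 = -1) by auto. assert (H2 : -1 = 1 \/ -1 = -1) by auto.
  destruct (A_facts HX) as [HA _]. destruct (HA 1 H1) as [ga1 A1]. destruct (HA (-1) H2) as [ga2 A2]. destruct (HB 1 H1) as [gb1 B1]. destruct (HB (-1) H2) as [gb2 B2].
  rewrite <- (IntW_plus _ _ _ _ _ A1 A2), <- (IntW_plus _ _ _ _ _ B1 B2).
  assert (OA := Cok_plus _ _ _ _ _ A1 A2). assert (OB := Cok_plus _ _ _ _ _ B1 B2).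
  apply (lim_ext0 _ _ _ (fun y Hy => eq_sym (hT_split y Hy))).
  apply (lim_lin (fun y => (A 1 y + A (-1) y) + (- 1) * (B 1 y + B (-1) y))%C (fun y => RtoC (qs X 1 y - qs X (-1) y))).
  - intros y Hy. apply inW0 in Hy. apply cC_plus; [apply OA; auto|apply cC_mult; [cont|apply OB; auto]].
  - intros y Hy. apply cC_RtoC, cR_minus; apply qs_cont; auto.
  - refine (lim_lin (fun y => A 1 y + A (-1) y)%C (fun y => B 1 y + B (-1) y)%C _ _ (- 1)%C _ _ (IntW_lim _ _ _ OA) (IntW_lim _ _ _ OB)); intros y Hy; apply inW0 in Hy.
    exact (proj1 (proj2 OA) y Hy). exact (proj1 (proj2 OB) y Hy).
  - apply qs_lim; auto.
Qed.
End T.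

(** The threshold 2 c + 1 gives X - c >= X / 2, so that all powers of 2 / (X - c) are bounded by
    powers of 4 / X. The constants depend on G alone and not on gam. *)
Theorem T_asym G K : 0 <= G -> exists C X0, 0 <= C /\ 1 <= X0 /\ forall X gam, X0 <= X -> Cmod gam <= G ->
  exists T, limC (fun n => CInt (hT X gam) (wl W0 n) (wr W0 n)) T /\
  Cmod (T - SG gam X K) <= C * (sqrt (/ X) * (/ X) ^ K).
Proof.
  intros HG. destruct (Rs_bound G K HG) as [C0 [c [HC [Hc B]]]].
  exists (4 * (C0 * (sqrt (4 * PI) * hp K * 4 ^ K))), (2 * c + 1). assert (hp0 := hp_pos K). assert (SP := sqrt_pos (4 * PI)). assert (P4 : 0 < 4 ^ K) by (apply pow_lt; lra).
  split. { repeat apply Rmult_le_pos; lra. } split; [lra|]. intros X gam HX Hg.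
  assert (H1 : 1 = 1 \/ 1 = -1) by auto. assert (H2 : -1 = 1 \/ -1 = -1) by auto.
  destruct (B_facts X gam K 1 C0 c H1 HC ltac:(lra) (fun y Hy => B 1 gam y H1 Hg Hy)) as [g1 [O1 I1]].
  destruct (B_facts X gam K (-1) C0 c H2 HC ltac:(lra) (fun y Hy => B (-1) gam y H2 Hg Hy)) as [g2 [O2 I2]].
  eexists. split. apply (T_lim X gam K ltac:(lra)). intros s [-> | ->]; eexists; [apply O1|apply O2].
  destruct (A_facts X gam K ltac:(lra)) as [_ ->]. set (b1 := IntW W0 _) in *. set (b2 := IntW W0 _).
  assert (E1 := IntW_bound _ _ _ O1). assert (E2 := IntW_bound _ _ _ O2). fold b1 in E1. fold b2 in E2.
  assert (EM : forall m : C, (m + RtoC (-1) * (b1 + b2) + RtoC (-1) * 0 - m = - (b1 + b2))%C) by (intros; generalize b1 b2; intros; apply C_ext; simpl; ring). rewrite EM, Cmod_opp.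
  eapply Rle_trans. apply Cmod_triangle.
  assert (Q : C0 * (sqrt (PI / ((X - c) / 2)) * hp K * (/ ((X - c) / 2)) ^ K) <= C0 * (sqrt (4 * PI) * hp K * 4 ^ K) * (sqrt (/ X) * (/ X) ^ K)).
  { assert (HP := PI_RGT_0). assert (IX : 0 < / X) by (apply Rinv_0_lt_compat; lra).
    assert (IZ : / ((X - c) / 2) <= 4 * / X). { replace (4 * / X) with (/ (X / 4)) by (field; lra). apply Rinv_le_contravar; lra. }
    assert (IZ0 : 0 < / ((X - c) / 2)) by (apply Rinv_0_lt_compat; lra).
    assert (Y1 : sqrt (PI / ((X - c) / 2)) <= sqrt (4 * PI) * sqrt (/ X)). { rewrite <- sqrt_mult by lra. apply sqrt_le_1_alt. unfold Rdiv at 1. nra. }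
    assert (Y2 : (/ ((X - c) / 2)) ^ K <= 4 ^ K * (/ X) ^ K). { rewrite <- Rpow_mult_distr. apply pow_incr. lra. }
    replace (C0 * (sqrt (4 * PI) * hp K * 4 ^ K) * (sqrt (/ X) * (/ X) ^ K)) with (C0 * ((sqrt (4 * PI) * sqrt (/ X)) * hp K * (4 ^ K * (/ X) ^ K))) by ring.
    apply Rmult_le_compat_l; auto. apply Rmult_le_compat; auto. apply Rmult_le_pos; [apply sqrt_pos|lra]. apply pow_le; lra. apply Rmult_le_compat_r; lra. }
  lra.
Qed.

(** * The coefficients A_j, rearrangement of sums, and the principal value of the remainder *)

Lemma Ci_even j : (Ci ^ (2 * j))%C = RtoC ((-1) ^ j).
Proof.
  induction j. reflexivity. replace (2 * S j)%nat with (S (S (2 * j))) by lia. simpl Cpow. simpl Cpow in IHj. rewrite IHj. simpl. rewrite RtoC_mult. apply C_ext; simpl; ring.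
Qed.

(** Passing from 2 j to 2 j + 2 multiplies the binomial coefficient by (1 - 2 b - 2 j)(- 2 b - 2 j)
    = 4 (b + j)(b - 1/2 + j) over (2 j + 1)(2 j + 2); the half-integer factor of [hp] cancels the
    odd number. *)
Lemma Acoef_bc b j : Acoef b j = (RtoC (2 * sqrt PI) * (bc (1 - 2 * b) (2 * j) * RtoC (hp j)))%C.
Proof.
  unfold Acoef, Cdiv. rewrite <- Cmult_assoc. apply f_equal. induction j.
  - simpl. rewrite Cmult_1_l. apply C_ext; simpl; field.
  - replace (2 * S j)%nat with (S (S (2 * j))) by lia. simpl poch. cbn [bc hp].
    assert (N1 : RtoC (INR (S j)) <> 0%C) by (apply RtoC_neq0, not_0_INR; lia). assert (N2 := RtoC_fact_ne0 j).
    rewrite fact_simpl, mult_INR, RtoC_mult.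
    transitivity ((poch b j * poch (b - RtoC (1 / 2)) j * / RtoC (INR (fact j))) * ((b + RtoC (INR j)) * (b - RtoC (1 / 2) + RtoC (INR j)) / RtoC (INR (S j))))%C. field. auto.
    rewrite IHj. assert (Hj := pos_INR j). rewrite (RtoC_mult (hp j)).
    replace (INR (S (S (2 * j)))) with (2 * (INR j + 1)) by (rewrite !S_INR, mult_INR; simpl; ring). replace (INR (S (2 * j))) with (2 * INR j + 1) by (rewrite !S_INR, mult_INR; simpl; ring).
    replace (INR (2 * j)) with (2 * INR j) by (rewrite mult_INR; simpl; ring). rewrite !S_INR.
    rewrite !RtoC_plus, !RtoC_mult, RtoC_plus. set (t := RtoC (INR j)). rewrite RtoC_div by lra.
    assert (T1 : (t + 1)%C <> 0%C) by (unfold t; rewrite <- RtoC_plus; apply RtoC_neq0; lra). assert (T2 : (2 * t + 1)%C <> 0%C) by (unfold t; rewrite <- RtoC_mult, <- RtoC_plus; apply RtoC_neq0; lra).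
    field. auto.
Qed.

Lemma Csum_rev f n : Csum (fun i => f (n - i)%nat) (S n) = Csum f (S n).
Proof.
  induction n. reflexivity. rewrite Csum_S_l. replace (S n - 0)%nat with (S n) by lia.
  rewrite (Csum_ext _ (fun i => f (n - i)%nat)) by (intros; f_equal; lia). rewrite IHn. change (Csum f (S (S n))) with (Csum f (S n) + f (S n))%C. ring.
Qed.

Lemma Csum_triangle (f : nat -> nat -> C) M :
  Csum (fun j => Csum (fun k => f k (j - k)%nat) (S j)) M = Csum (fun i => Csum (fun k => f k i) (M - i)) (S M).
Proof.
  induction M. simpl. ring.
  change (Csum (fun j => Csum (fun k => f k (j - k)%nat) (S j)) (S M)) with (Csum (fun j => Csum (fun k => f k (j - k)%nat) (S j)) M + Csum (fun k => f k (M - k)%nat) (S M))%C.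
  rewrite IHM, <- (Csum_rev (fun k => f k (M - k)%nat)).
  set (g := fun i => Csum (fun k => f k i) (S M - i)). change (Csum g (S (S M))) with (Csum g (S M) + g (S M))%C. unfold g at 2. rewrite Nat.sub_diag. simpl (Csum _ 0). rewrite Cplus_0_r, <- Csum_plus.
  apply Csum_ext. intros i Hi. unfold g. replace (S M - i)%nat with (S (M - i)) by lia. simpl Csum. replace (M - (M - i))%nat with i by lia. reflexivity.
Qed.

Definition kR (rho : R -> C) (X : R) (al : C) (y : R) : C := (RtoC (sqrt X * exp (- X * Sv (2 * y))) * Cexp (2 * al * RtoC y) * rho (X * exp (2 * y))%R)%C.
Definition hR rho X al y : C := ((kR rho X al (- y)%R - kR rho X al y) / RtoC (sinh y))%C.

(** [PV_bound] needs the derivative of [kR]. Differentiating e^(- X Sv) costs a factor X, so a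
    remainder of order M + 1 in 1 / X yields only order M. *)
Lemma RR_bound (rho rho' : R -> C) K1 a M G : 0 <= K1 -> 0 <= G ->
  (forall Z, 0 < Z -> dC rho Z (rho' Z) /\ Cmod (rho Z) <= K1 * sqrt (/ Z) * ((/ Z) ^ S M + (/ Z) ^ (S M + a)) /\
    Cmod (rho' Z) * Z <= K1 * sqrt (/ Z) * ((/ Z) ^ S M + (/ Z) ^ (S M + a))) ->
  exists C X0, 0 <= C /\ 1 <= X0 /\ forall X al, X0 <= X -> Cmod al <= G ->
   (exists g, Cok W0 (hR rho X al) g) /\ Cmod (IntW W0 (hR rho X al)) <= C * (/ X) ^ M.
Proof.
  (* The negative powers of X e^(2 y) grow at most like e^(D |y|): 1 comes from the square root and
     2 from each power. *)
  intros HK HG HR. set (D := 1 + 2 * INR (S M + a)). assert (HD : 0 <= D) by (unfold D; generalize (pos_INR (S M + a)); lra).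
  assert (RB : forall X y, 1 <= X -> K1 * sqrt (/ (X * exp (2 * y))) * ((/ (X * exp (2 * y))) ^ S M + (/ (X * exp (2 * y))) ^ (S M + a)) <= 2 * K1 * (sqrt (/ X) * (/ X) ^ S M) * exp (D * Rabs y)).
  { intros X y HX. assert (Ey := exp_pos (2 * y)). assert (IX : 0 < / X <= 1) by (split; [apply Rinv_0_lt_compat; lra|rewrite <- Rinv_1; apply Rinv_le_contravar; lra]).
    rewrite Rinv_mult, <- exp_Ropp. rewrite sqrt_mult by (try (left; apply exp_pos); lra). assert (Py := Rabs_pos y). assert (Ry := Rle_abs (- y)). rewrite Rabs_Ropp in Ry.
    replace (sqrt (exp (- (2 * y)))) with (exp (- y)) by (rewrite <- (sqrt_pow2 (exp (- y))) by (left; apply exp_pos); f_equal; simpl; rewrite Rmult_1_r, <- exp_plus; f_equal; ring).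
    assert (EP : forall n, (n <= S M + a)%nat -> (S M <= n)%nat -> exp (- y) * (/ X * exp (- (2 * y))) ^ n <= (/ X) ^ S M * exp (D * Rabs y)).
    { intros n Hn Hn2. rewrite Rpow_mult_distr. rewrite <- (exp_ln (exp (- (2 * y)))) at 1 by apply exp_pos. rewrite ln_exp.
      replace (exp (- (2 * y)) ^ n) with (exp (INR n * (- (2 * y)))). 2: { rewrite <- Rpower_pow by apply exp_pos. unfold Rpower. rewrite ln_exp. reflexivity. }
      replace (exp (- y) * ((/ X) ^ n * exp (INR n * - (2 * y)))) with ((/ X) ^ n * exp (- y + INR n * - (2 * y))) by (rewrite exp_plus; ring).
      apply Rmult_le_compat. apply pow_le; lra. left; apply exp_pos.
      - replace n with (S M + (n - S M))%nat by lia. rewrite pow_add. assert (0 < (/ X) ^ S M) by (apply pow_lt; lra).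
        assert ((/ X) ^ (n - S M) <= 1) by (rewrite <- (pow1 (n - S M)); apply pow_incr; lra). nra.
      - apply exp_le. unfold D. assert (INR n <= INR (S M + a)) by (apply le_INR; auto). assert (P := pos_INR n). nra. }
    assert (E1 := EP (S M) ltac:(lia) ltac:(lia)). assert (E2 := EP (S M + a)%nat ltac:(lia) ltac:(lia)). assert (SX := sqrt_pos (/ X)).
    apply Rle_trans with (K1 * sqrt (/ X) * (exp (- y) * (/ X * exp (- (2 * y))) ^ S M + exp (- y) * (/ X * exp (- (2 * y))) ^ (S M + a))). right; ring.
    apply Rle_trans with (K1 * sqrt (/ X) * (2 * ((/ X) ^ S M * exp (D * Rabs y)))). apply Rmult_le_compat_l. apply Rmult_le_pos; lra. lra. right; ring. }
  (* For |y| >= 1 one has Sv (2 y) >= |y| / 2, so X / 2 >= 2 G + D lets e^(- X Sv) dominate the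
     growth of the exponential and of [rho]. *)
  set (X0 := Rmax 1 (2 * (2 * G + D))).
  set (e2 := exp 2). assert (He2 : 1 <= e2) by (apply exp_ge1; lra).
  set (K2 := 2 * K1 * exp (2 * G + D) * (2 * e2 + 2 * G + 2)). assert (HED : 1 <= exp (2 * G + D)) by (apply exp_ge1; lra).
  assert (HK2 : 0 <= K2) by (unfold K2; repeat apply Rmult_le_pos; lra).
  exists (2 * (8 * K2 * exp 1 * RIntW W0 (fun u => exp (- (1) * u)))), X0.
  assert (R1 : Rok W0 (fun u => exp (- (1) * u))) by (apply Rok_exp0; lra). assert (R1p := Rok_ge0 _ _ R1).
  split. { assert (0 < exp 1) by apply exp_pos. repeat apply Rmult_le_pos; lra. }
  split. { apply Rmax_l. } intros X al HX Hal.
  assert (HX1 : 1 <= X) by (eapply Rle_trans; [apply Rmax_l|apply HX]). assert (HX2 : 2 * (2 * G + D) <= X) by (eapply Rle_trans; [apply Rmax_r|apply HX]).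
  assert (SX : sqrt X * sqrt (/ X) = 1) by (rewrite <- sqrt_mult by (try (left; apply Rinv_0_lt_compat); lra); rewrite Rinv_r by lra; apply sqrt_1).
  assert (IX : 0 < / X <= 1) by (split; [apply Rinv_0_lt_compat; lra|rewrite <- Rinv_1; apply Rinv_le_contravar; lra]).
  assert (PM : 0 < (/ X) ^ M) by (apply pow_lt; lra).
  assert (SvN : forall v, 0 <= Sv v) by (intros; unfold Sv; generalize (exp_ineq1_le v); lra).
  assert (CE : forall y, Cmod (Cexp (2 * al * RtoC y)) <= exp (2 * G * Rabs y)).
  { intros y. rewrite Cmod_Cexp. apply exp_le. eapply Rle_trans; [apply Rle_abs|]. eapply Rle_trans; [apply Re_le_Cmod|]. rewrite !Cmod_mult, !Cmod_RtoC, (Rabs_pos_eq 2) by lra. generalize (Rabs_pos y); nra. }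
  assert (RX : forall y q, q <= K1 * sqrt (/ (X * exp (2 * y))) * ((/ (X * exp (2 * y))) ^ S M + (/ (X * exp (2 * y))) ^ (S M + a)) ->
    sqrt X * q <= 2 * K1 * (/ X) ^ S M * exp (D * Rabs y)).
  { intros y q Hq. apply Rle_trans with (sqrt X * (2 * K1 * (sqrt (/ X) * (/ X) ^ S M) * exp (D * Rabs y))).
    apply Rmult_le_compat_l. apply sqrt_pos. eapply Rle_trans; [apply Hq|apply RB; auto].
    right. transitivity ((sqrt X * sqrt (/ X)) * (2 * K1 * (/ X) ^ S M * exp (D * Rabs y))). ring. rewrite SX; ring. }
  assert (ZP : forall y, 0 < X * exp (2 * y)) by (intros; apply Rmult_lt_0_compat; [lra|apply exp_pos]).
  assert (RB1 := fun y => RX y _ (proj1 (proj2 (HR _ (ZP y))))). assert (RB2 := fun y => RX y _ (proj2 (proj2 (HR _ (ZP y))))).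
  set (dk := fun y => (RtoC (sqrt X * exp (- X * Sv (2 * y))) * Cexp (2 * al * RtoC y) *
     (rho (X * exp (2 * y))%R * (RtoC (- (2 * X * (exp (2 * y) - 1))) + 2 * al) + 2 * (RtoC (X * exp (2 * y)) * rho' (X * exp (2 * y))%R)))%C).
  assert (DK : forall y, dC (kR rho X al) y (dk y)).
  { intros y. unfold kR, dk. evar_last.
    - apply dC_mult. apply dC_mult. apply dC_RtoC. unfold Sv. auto_derive; auto. apply dC_Cexp. apply dC_mult. apply dC_const. apply dC_RtoC. apply dR_id.
      apply (dC_comp rho (fun y => X * exp (2 * y)) y (X * (2 * exp (2 * y)))). auto_derive; auto; ring. apply HR. apply Rmult_lt_0_compat; [lra|apply exp_pos].
    - cbv beta. unfold Sv. set (q := rho _). set (q' := rho' _). set (ce := Cexp _).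
      set (E := exp (2 * y)). set (F := exp (- X * (E - 1 - 2 * y))). replace (exp (- X * (E + - (1) + - (2 * y)))) with F by (unfold F; f_equal; ring).
      generalize q q' ce. intros. apply C_ext; simpl; ring. }
  assert (PB : forall y, 0 < y -> Cmod (hR rho X al y) <= 8 * (K2 * (/ X) ^ M) * exp 1 * exp (- (1) * y)).
  { apply (PV_bound (kR rho X al) dk (K2 * (/ X) ^ M) 1); [lra| |].
    - intros y Hy. split; auto. unfold dk. rewrite !Cmod_mult, Cmod_RtoC.
      set (E := exp (- X * Sv (2 * y))). assert (HE : 0 < E <= 1). { split. apply exp_pos. unfold E. rewrite <- exp_0. apply exp_le. generalize (SvN (2 * y)); nra. }
      rewrite Rabs_pos_eq by (apply Rmult_le_pos; [apply sqrt_pos|lra]).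
      assert (C1 := CE y). assert (B1 := RB1 y). assert (B2 := RB2 y). assert (Py := Rabs_pos y).
      set (r0 := Cmod (rho (X * exp (2 * y)))) in *. set (r1 := Cmod (rho' (X * exp (2 * y))) * (X * exp (2 * y))) in *.
      assert (Hr0 : 0 <= r0) by apply Cmod_ge_0. assert (Hr1 : 0 <= r1) by (apply Rmult_le_pos; [apply Cmod_ge_0|apply Rmult_le_pos; [lra|left; apply exp_pos]]).
      assert (Q1 : Cmod (rho (X * exp (2 * y))%R * (RtoC (- (2 * X * (exp (2 * y) - 1))) + 2 * al) + 2 * (RtoC (X * exp (2 * y)) * rho' (X * exp (2 * y))%R)) <= r0 * (2 * X * e2 + 2 * G) + 2 * r1).
      { eapply Rle_trans. apply Cmod_triangle. rewrite !Cmod_mult. fold r0. apply Rplus_le_compat.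
        - apply Rmult_le_compat_l; auto. eapply Rle_trans. apply Cmod_triangle. apply Rplus_le_compat.
          + rewrite Cmod_RtoC, Rabs_Ropp, Rabs_mult, Rabs_pos_eq by lra. apply Rmult_le_compat_l. lra.
            assert (exp (2 * y) <= e2) by (apply exp_le; generalize (Rle_abs y); lra). assert (P := exp_pos (2 * y)). apply Rabs_le; lra.
          + rewrite Cmod_mult, Cmod_RtoC, Rabs_pos_eq by lra. apply Rmult_le_compat_l; lra.
        - rewrite !Cmod_RtoC, (Rabs_pos_eq 2), (Rabs_pos_eq (X * _)) by (try apply Rmult_le_pos; try (left; apply exp_pos); lra). apply Req_le. unfold r1. ring. }
      assert (X1 : exp (2 * G * Rabs y) * exp (D * Rabs y) <= exp (2 * G + D)). { rewrite <- exp_plus. apply exp_le. nra. }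
      set (ce := Cmod (Cexp _)) in *. assert (Hce : 0 <= ce) by apply Cmod_ge_0. set (u := exp (D * Rabs y)) in *. set (u' := exp (2 * G * Rabs y)) in *.
      assert (Hu : 0 < u) by apply exp_pos. assert (Hu' : 0 < u') by apply exp_pos. assert (SXp := sqrt_pos X).
      apply Rle_trans with (1 * u' * (sqrt X * r0 * (2 * X * e2 + 2 * G) + 2 * (sqrt X * r1))).
      + match goal with |- _ * _ * ?a <= _ => set (c0 := a) in * end.
        assert (0 <= c0) by apply Cmod_ge_0.
        apply Rle_trans with (sqrt X * 1 * u' * (r0 * (2 * X * e2 + 2 * G) + 2 * r1)); [|right; ring].
        apply Rmult_le_compat; auto. repeat apply Rmult_le_pos; lra. apply Rmult_le_compat; auto. apply Rmult_le_pos; lra. apply Rmult_le_compat_l; lra.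
      + set (w := 2 * K1 * (/ X) ^ S M) in *. assert (Hw : 0 <= w). { unfold w. repeat apply Rmult_le_pos; try lra. apply pow_le; lra. }
        apply Rle_trans with (1 * u' * (w * u * (2 * X * e2 + 2 * G) + 2 * (w * u))).
        * apply Rmult_le_compat_l. lra. apply Rplus_le_compat; [apply Rmult_le_compat_r; auto; nra|apply Rmult_le_compat_l; lra].
        * replace (1 * u' * (w * u * (2 * X * e2 + 2 * G) + 2 * (w * u))) with (w * (u' * u) * (2 * X * e2 + 2 * G + 2)) by ring.
          apply Rle_trans with (w * exp (2 * G + D) * (X * (2 * e2 + 2 * G + 2))).
          { assert (0 <= X * e2) by (apply Rmult_le_pos; lra). assert (0 <= (X - 1) * (2 * G + 2)) by (apply Rmult_le_pos; lra).
            apply Rle_trans with (w * exp (2 * G + D) * (2 * X * e2 + 2 * G + 2)). apply Rmult_le_compat_r; [lra|apply Rmult_le_compat_l; lra].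
            apply Rmult_le_compat_l; [apply Rmult_le_pos|]; lra. }
          right. unfold w, K2. simpl. field. lra.
    - intros y Hy. unfold kR. rewrite !Cmod_mult, Cmod_RtoC.
      set (E := exp (- X * Sv (2 * y))). assert (HE : 0 < E) by apply exp_pos. rewrite Rabs_pos_eq by (apply Rmult_le_pos; [apply sqrt_pos|lra]).
      assert (C1 := CE y). assert (B1 := RB1 y). replace ((1 - 1) * Rabs y) with 0 by ring. rewrite exp_0, Rmult_1_r.
      assert (L := Sv_large (2 * y)). rewrite Rabs_mult, (Rabs_pos_eq 2) in L by lra. specialize (L ltac:(lra)).
      assert (X1 : E * (exp (2 * G * Rabs y) * exp (D * Rabs y)) <= 1).
      { unfold E. rewrite <- !exp_plus. rewrite <- exp_0. apply exp_le. assert (X * (2 * Rabs y / 4) <= X * Sv (2 * y)) by (apply Rmult_le_compat_l; lra). nra. }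
      assert (SXp := sqrt_pos X). set (w := 2 * K1 * (/ X) ^ S M) in *. assert (Hw : 0 <= w). { unfold w. repeat apply Rmult_le_pos; try lra. apply pow_le; lra. }
      apply Rle_trans with (E * (exp (2 * G * Rabs y) * (w * exp (D * Rabs y)))).
      + replace (sqrt X * E * Cmod (Cexp (2 * al * RtoC y)) * Cmod (rho (X * exp (2 * y)))) with (E * (Cmod (Cexp (2 * al * RtoC y)) * (sqrt X * Cmod (rho (X * exp (2 * y)))))) by ring.
        apply Rmult_le_compat_l. lra. apply Rmult_le_compat; auto. apply Cmod_ge_0. apply Rmult_le_pos; auto. apply Cmod_ge_0.
      + apply Rle_trans with (w * 1). replace (E * (exp (2 * G * Rabs y) * (w * exp (D * Rabs y)))) with (w * (E * (exp (2 * G * Rabs y) * exp (D * Rabs y)))) by ring. apply Rmult_le_compat_l; auto.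
        unfold w, K2. rewrite Rmult_1_r. simpl.
        replace (2 * K1 * (/ X * (/ X) ^ M)) with (2 * K1 * (/ X) ^ M * / X) by ring.
        replace (2 * K1 * exp (2 * G + D) * (2 * e2 + 2 * G + 2) * (/ X) ^ M) with (2 * K1 * (/ X) ^ M * (exp (2 * G + D) * (2 * e2 + 2 * G + 2))) by ring.
        apply Rmult_le_compat_l. repeat apply Rmult_le_pos; lra. nra. }
  assert (O : Cok W0 (hR rho X al) (fun y => (8 * (K2 * (/ X) ^ M) * exp 1) * exp (- (1) * y))).
  { split; [|split].
    - apply Rok_scal; auto. assert (0 < exp 1) by apply exp_pos. repeat apply Rmult_le_pos; lra.
    - intros y Hy. apply inW0 in Hy. assert (S := sinh_pos y Hy). unfold hR.
      apply cC_div. apply RtoC_neq0; lra. apply cC_minus. apply (cC_comp Ropp (kR rho X al)). cont. apply (dC_cont _ _ _ (DK _)). apply (dC_cont _ _ _ (DK _)). unfold sinh; cont; lra.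
    - intros y Hy. apply inW0 in Hy. apply PB; auto. }
  split. eexists; apply O. eapply Rle_trans. apply (IntW_bound _ _ _ O). rewrite (RIntW_scal _ (fun u => exp (- (1) * u))) by auto. right; ring.
Qed.

(** [IntW] is defined through limits over the windows, so a limit known by other means determines it
    even where no majorant is at hand. *)
Lemma IntW_limC w f l : limC (fun n => CInt f (wl w n) (wr w n)) l -> IntW w f = l.
Proof. intros [A B]. unfold IntW, RIntW. apply C_ext; [exact (f_equal real (is_lim_seq_unique _ _ A))|exact (f_equal real (is_lim_seq_unique _ _ B))]. Qed.

(** The j-th term of the expansion of N_m is expanded to the order M - j, so constants common to all
    orders up to n are required. *)
Lemma T_asym_all G n : 0 <= G -> exists C X0, 0 <= C /\ 1 <= X0 /\ forall K X gam, (K <= n)%nat -> X0 <= X -> Cmod gam <= G ->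
  limC (fun n => CInt (hT X gam) (wl W0 n) (wr W0 n)) (IntW W0 (hT X gam)) /\
  Cmod (IntW W0 (hT X gam) - SG gam X K) <= C * (sqrt (/ X) * (/ X) ^ K).
Proof.
  intros HG.
  assert (W : forall K, exists C X0, 0 <= C /\ 1 <= X0 /\ forall X gam, X0 <= X -> Cmod gam <= G ->
    limC (fun n => CInt (hT X gam) (wl W0 n) (wr W0 n)) (IntW W0 (hT X gam)) /\
    Cmod (IntW W0 (hT X gam) - SG gam X K) <= C * (sqrt (/ X) * (/ X) ^ K)).
  { intros K. destruct (T_asym G K HG) as [C [X0 [HC [HX0 H]]]]. exists C, X0. split; [auto|split; [auto|]]. intros X gam HX Hg.
    destruct (H X gam HX Hg) as [T [L B]]. rewrite (IntW_limC _ _ _ L). auto. }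
  induction n as [|n [C [X0 [HC [HX0 H]]]]].
  - destruct (W 0%nat) as [C [X0 [HC [HX0 H]]]]. exists C, X0. split; [auto|split; [auto|]]. intros K X gam HK. replace K with 0%nat by lia. apply H.
  - destruct (W (S n)) as [C' [X0' [HC' [HX0' H']]]]. exists (C + C'), (Rmax X0 X0'). split; [lra|split; [eapply Rle_trans; [|apply Rmax_l]; auto|]].
    intros K X gam HK HX Hg. assert (A1 := Rle_trans _ _ _ (Rmax_l X0 X0') HX). assert (A2 := Rle_trans _ _ _ (Rmax_r X0 X0') HX).
    assert (P : 0 <= sqrt (/ X) * (/ X) ^ K). { apply Rmult_le_pos. apply sqrt_pos. apply pow_le. left; apply Rinv_0_lt_compat; lra. }
    destruct (Nat.eq_dec K (S n)) as [->|N].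
    + destruct (H' X gam A2 Hg) as [L B]. split; auto. eapply Rle_trans; [apply B|]. apply Rmult_le_compat_r; lra.
    + destruct (H K X gam ltac:(lia) A1 Hg) as [L B]. split; auto. eapply Rle_trans; [apply B|]. apply Rmult_le_compat_r; lra.
Qed.

Lemma kT_cont X gam y : contC (kT X gam) y.
Proof. unfold kT, Sv. cont. Qed.

Lemma hT_cont X gam y : 0 < y -> contC (hT X gam) y.
Proof.
  intros Hy. assert (S := sinh_pos y Hy). unfold hT. apply cC_div. apply RtoC_neq0; lra. apply cC_minus; [apply (cC_comp Ropp (kT X gam)); [cont|]|]; apply kT_cont. unfold sinh; cont; lra.
Qed.

Lemma CInt_0 a b : CInt (fun _ => 0%C) a b = 0%C.
Proof. unfold CInt. simpl. rewrite RInt_const. unfold scal; simpl. unfold mult; simpl. apply C_ext; simpl; ring. Qed.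

Lemma limC_combination (c : nat -> C) (h : nat -> R -> C) (T : nat -> C) N :
  (forall j y, 0 < y -> contC (h j) y) -> (forall j, (j < N)%nat -> limC (fun n => CInt (h j) (wl W0 n) (wr W0 n)) (T j)) ->
  (forall y, 0 < y -> contC (fun y => Csum (fun j => c j * h j y) N)%C y) /\
  limC (fun n => CInt (fun y => Csum (fun j => c j * h j y) N)%C (wl W0 n) (wr W0 n)) (Csum (fun j => c j * T j)%C N).
Proof.
  intros Hc. induction N; intros HT.
  - split. intros; simpl; cont. simpl. apply (limC_ext (fun _ => 0%C)). 2: apply limC_const. intros n. rewrite CInt_0. reflexivity.
  - destruct IHN as [K L]. intros; apply HT; lia.
    split. intros y Hy. simpl. apply cC_plus; auto. apply cC_mult; [cont|auto].
    apply (lim_lin (fun y => Csum (fun j => c j * h j y) N)%C (h N)); auto.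
Qed.

(** Here 2 PI theta = PI - 2 PI b. *)
Lemma cos_sin_theta b : Ccos (RtoC (2 * PI) * (RtoC (1 / 2) - b)) = (- cb b)%C /\ Csin (RtoC (2 * PI) * (RtoC (1 / 2) - b)) = sb b.
Proof.
  assert (E : Cexp (Ci * (RtoC (2 * PI) * (RtoC (1 / 2) - b))) = (- / Cexp (Ci * (RtoC (2 * PI) * b)))%C).
  { replace (Ci * (RtoC (2 * PI) * (RtoC (1 / 2) - b)))%C with (Ci * RtoC (PI / 2) + Ci * RtoC (PI / 2) + - (Ci * (RtoC (2 * PI) * b)))%C by (apply C_ext; simpl; field).
    rewrite !Cexp_add, Cexp_PI2, Cexp_opp. set (o := Cexp _). replace (Ci * Ci)%C with (- (1))%C by (apply C_ext; simpl; ring). ring. }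
  unfold cb, sb, Ccos, Csin. rewrite !Cexp_opp, E. set (o := Cexp _). assert (o <> 0%C) by apply Cexp_neq0.
  assert (Ci <> 0%C) by (intros Z; inversion Z; lra). assert ((1 <> 0)%C) by (intros Z; inversion Z; lra). split; field; auto.
Qed.

(** * Insertion of the expansion of Psi(- x) into the exact identity *)

Section Assembly.
Variables (b : C) (M m : nat) (x : R) (al : C) (rho : R -> C).
Hypothesis Hx : 0 < x.
Let X := Xof x.
Hypothesis Hm : RtoC (INR m) = (RtoC X + 2 * b - RtoC (3 / 2) + al)%C.
Hypothesis HW : forall Z, 0 < Z -> Wf (1 - 2 * b) Z = (Wsum (1 - 2 * b) (S M) Z + rho Z)%C.

Definition aa (b : C) (X : R) (j : nat) : C := (Acoef b j * RtoC (/ (- X) ^ j))%C.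
Definition Pf (b : C) (X : R) : C := (Rcpow X (RtoC (1 / 2) - b) * RtoC (exp (- X)) / RtoC (2 * PI))%C.

Lemma X_pos : 0 < X.
Proof. unfold X, Xof. apply Rdiv_lt_0_compat; [apply pow_lt|]; lra. Qed.

(** The saddle-point form is used with z^2 = X e^(2 y), and X e^(2 y) = X + X Sv (2 y) + 2 X y
    splits off the constant e^(- X) and the exponent of the new saddle point. The powers e^(- 2 j y)
    of the expansion shift alpha to alpha - j. *)
Lemma gN_expand y : gN b m x y = (Pf b X * (Csum (fun j => aa b X j * kT X (al - RtoC (INR j)) y) (S M) + 2 * kR rho X al y))%C.
Proof.
  assert (XP := X_pos). assert (HP := PI_RGT_0). assert (Ey := exp_pos y).
  set (z := x / 2 * exp y). assert (Hz : 0 < z) by (apply Rmult_lt_0_compat; lra).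
  assert (Ez : z ^ 2 = X * exp (2 * y)) by (unfold z, X, Xof; replace (2 * y) with (y + y) by ring; rewrite exp_plus; field).
  unfold gN. replace (- (x * exp y)) with (- (2 * z)) by (unfold z; field). rewrite (Psi_saddle b z Hz), Ez, HW by (apply Rmult_lt_0_compat; [auto|apply exp_pos]).
  assert (SX : sqrt X = x / 2). { unfold X, Xof. replace (x ^ 2 / 4) with ((x / 2) ^ 2) by field. apply sqrt_pow2. lra. }
  assert (Ezs : z = sqrt X * exp y) by (rewrite SX; reflexivity).
  set (e0 := RtoC (exp (- X * Sv (2 * y)))).
  assert (E1 : (Cexp ((RtoC (2 * INR m + 1) - 2 * b) * RtoC y) * (RtoC (z / PI * exp (- (X * exp (2 * y)))) * Rcpow z (1 - 2 * b)) = 2 * Pf b X * (e0 * Cexp (2 * al * RtoC y) * RtoC (sqrt X)))%C).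
  { unfold Rcpow, Pf, e0, Rcpow. rewrite Ezs, ln_mult, ln_exp by (auto using sqrt_lt_R0; apply exp_pos).
    assert (LX : ln X = 2 * ln (sqrt X)). { rewrite <- (sqrt_sqrt X) at 1 by lra. rewrite ln_mult by (apply sqrt_lt_R0; auto). ring. } rewrite LX.
    replace (exp (- (X * exp (2 * y)))) with (exp (- X) * exp (- X * Sv (2 * y)) * exp (- X * (2 * y))) by (rewrite <- !exp_plus; f_equal; unfold Sv; ring).
    replace (RtoC (2 * INR m + 1)) with (2 * (RtoC X + 2 * b - RtoC (3 / 2) + al) + 1)%C by (rewrite <- Hm, RtoC_plus, RtoC_mult; ring).
    set (l := ln (sqrt X)). rewrite !(RtoC_mult (_ / _)), (RtoC_div (sqrt X * exp y) PI), !RtoC_mult by lra. rewrite <- (Cexp_R (- X * (2 * y))), <- (Cexp_R y).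
    replace ((RtoC (1 / 2) - b) * (2 * RtoC l))%C with ((1 - 2 * b) * RtoC l)%C by (apply C_ext; simpl; field).
    replace ((1 - 2 * b) * RtoC (l + y))%C with ((1 - 2 * b) * RtoC l + (1 - 2 * b) * RtoC y)%C by (rewrite RtoC_plus; ring). rewrite Cexp_add.
    set (q := RtoC (exp (- X))). set (e1 := RtoC (exp (- X * Sv (2 * y)))). set (sx := RtoC (sqrt X)). set (cl0 := Cexp ((1 - 2 * b) * RtoC l)).
    set (c1 := Cexp ((2 * (RtoC X + 2 * b - RtoC (3 / 2) + al) + 1 - 2 * b) * RtoC y)). set (c2 := Cexp (RtoC y)). set (c3 := Cexp (RtoC (- X * (2 * y)))). set (c4 := Cexp ((1 - 2 * b) * RtoC y)).
    (* This is where the optimal truncation acts: with m = X + 2 b - 3/2 + alpha, all linear terms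
       in y, including - 2 X y, add up to 2 alpha y. *)
    assert (EC : (c1 * c2 * c3 * c4)%C = Cexp (2 * al * RtoC y)). { unfold c1, c2, c3, c4. rewrite <- !Cexp_add. apply f_equal. apply C_ext; simpl; field. }
    rewrite <- EC. assert (RtoC PI <> 0%C) by (apply RtoC_neq0; lra). field. auto. }
  transitivity ((Cexp ((RtoC (2 * INR m + 1) - 2 * b) * RtoC y) * (RtoC (z / PI * exp (- (X * exp (2 * y)))) * Rcpow z (1 - 2 * b))) * (Wsum (1 - 2 * b) (S M) (X * exp (2 * y)) + rho (X * exp (2 * y))%R))%C.
  ring. rewrite E1.
  assert (E2 : (2 * (e0 * Cexp (2 * al * RtoC y) * RtoC (sqrt X)) * Wsum (1 - 2 * b) (S M) (X * exp (2 * y)) = Csum (fun j => aa b X j * kT X (al - RtoC (INR j)) y) (S M))%C).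
  { unfold Wsum. rewrite <- Csum_scal. apply Csum_ext. intros j _. unfold aa, kT. fold e0. rewrite Acoef_bc, Ci_even.
    replace ((2 * (al - RtoC (INR j)) - 1) * RtoC y)%C with (2 * al * RtoC y + RtoC (- y + INR j * (- (2 * y))))%C by (apply C_ext; simpl; ring). rewrite Cexp_add, Cexp_R, exp_plus.
    assert (Es : sqrt (PI / (X * exp (2 * y))) = sqrt PI * / sqrt X * exp (- y)).
    { assert (Q1 : 0 <= PI) by lra. assert (Q2 : 0 <= / X) by (left; apply Rinv_0_lt_compat; auto). assert (Q3 : 0 <= exp (- (2 * y))) by (left; apply exp_pos).
      unfold Rdiv. rewrite Rinv_mult, <- exp_Ropp, (sqrt_mult PI), (sqrt_mult (/ X)), sqrt_inv by auto using Rmult_le_pos.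
      rewrite Rmult_assoc. do 2 f_equal. rewrite <- (sqrt_pow2 (exp (- y))) by (left; apply exp_pos). f_equal. simpl. rewrite Rmult_1_r, <- exp_plus. f_equal. ring. }
    rewrite Es. rewrite Rinv_mult, Rpow_mult_distr, <- exp_Ropp.
    replace (exp (- (2 * y)) ^ j) with (exp (INR j * - (2 * y))). 2: { rewrite <- Rpower_pow by apply exp_pos. unfold Rpower. rewrite ln_exp. reflexivity. }
    replace (/ (- X) ^ j) with ((-1) ^ j * (/ X) ^ j).
    2: { replace (- X) with (-1 * X) by ring. rewrite Rpow_mult_distr, Rinv_mult, pow_inv. f_equal. rewrite <- pow_inv. f_equal. field. }
    assert (SP : sqrt X <> 0) by (apply Rgt_not_eq, sqrt_lt_R0; auto).
    transitivity (e0 * Cexp (2 * al * RtoC y) * bc (1 - 2 * b) (2 * j) * RtoC (2 * sqrt X * (-1) ^ j * (sqrt PI * / sqrt X * exp (- y) * hp j * ((/ X) ^ j * exp (INR j * - (2 * y))))))%C.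
    rewrite !RtoC_mult. ring.
    transitivity (e0 * Cexp (2 * al * RtoC y) * bc (1 - 2 * b) (2 * j) * RtoC (2 * sqrt PI * hp j * ((-1) ^ j * (/ X) ^ j) * (exp (- y) * exp (INR j * - (2 * y)))))%C.
    apply f_equal. apply f_equal. field. auto. rewrite !RtoC_mult. ring. }
  rewrite <- E2. unfold kR. rewrite RtoC_mult. fold e0. ring.
Qed.

Lemma Psi_neg_expand : Psi b (- x) = (Pf b X * (Csum (aa b X) (S M) + 2 * (RtoC (sqrt X) * rho X)))%C.
Proof.
  assert (E := gN_expand 0). unfold gN in E. rewrite exp_0, Rmult_1_r, Cmult_0_r, Cexp_0, Cmult_1_l in E. rewrite E.
  assert (S0 : exp (- X * Sv (2 * 0)) = 1) by (unfold Sv; rewrite Rmult_0_r, exp_0; replace (- X * (1 - 1 - 0)) with 0 by ring; apply exp_0).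
  unfold kR. rewrite S0, Rmult_0_r, exp_0, !Rmult_1_r, Cmult_0_r, Cexp_0, Cmult_1_r.
  rewrite (Csum_ext _ (aa b X)). reflexivity. intros j _. unfold kT. rewrite S0, Cmult_0_r, Cexp_0. ring.
Qed.

Lemma Nn_expand : (forall j, (j < S M)%nat -> limC (fun n => CInt (hT X (al - RtoC (INR j))%C) (wl W0 n) (wr W0 n)) (IntW W0 (hT X (al - RtoC (INR j))%C))) ->
  (exists g, Cok W0 (hR rho X al) g) ->
  Nn b m x = (Pf b X * (Csum (fun j => aa b X j * IntW W0 (hT X (al - RtoC (INR j)))) (S M) + 2 * IntW W0 (hR rho X al)))%C.
Proof.
  intros HT [g OR]. apply (IntW_limC W0 (fun y => (gN b m x (- y)%R - gN b m x y) / RtoC (sinh y))%C).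
  destruct (limC_combination (aa b X) (fun j => hT X (al - RtoC (INR j))%C) (fun j => IntW W0 (hT X (al - RtoC (INR j))%C)) (S M) (fun j y Hy => hT_cont X _ y Hy) HT) as [K L].
  assert (L2 := lim_lin _ (hR rho X al) _ _ 2%C K (fun y Hy => proj1 (proj2 OR) y (proj2 (inW0 y) Hy)) L (IntW_lim _ _ _ OR)).
  assert (K2 : forall y, 0 < y -> contC (fun y => Csum (fun j => aa b X j * hT X (al - RtoC (INR j)) y) (S M) + 2 * hR rho X al y)%C y).
  { intros y Hy. apply cC_plus; auto. apply cC_mult; [cont|]. apply inW0 in Hy. apply OR; auto. }
  assert (L3 := lim_lin _ _ _ _ (Pf b X) (fun y Hy => cC_const 0%C y) K2 (limC_ext _ _ _ (fun n => eq_sym (CInt_0 _ _)) (limC_const 0%C)) L2).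
  rewrite Cplus_0_l in L3. revert L3. apply lim_ext0. intros y Hy. assert (S := sinh_pos y Hy). rewrite !gN_expand. unfold hR.
  rewrite (Csum_ext (fun j => aa b X j * hT X (al - RtoC (INR j))%C y)%C (fun j => / RtoC (sinh y) * (aa b X j * kT X (al - RtoC (INR j)) (- y) + - (1) * (aa b X j * kT X (al - RtoC (INR j)) y)))%C).
  2: { intros j _. unfold hT, Cdiv. ring. }
  rewrite Csum_scal, Csum_plus, Csum_scal. unfold Cdiv. ring.
Qed.

(** B_j is a convolution over j = i + k, where i numbers the expansion of Psi(- x) and k the
    Gaussian moment. Summing over j < M gives, for each i, the first M - i moments; the term i = M
    is an empty sum. The power of -2 in B_j comes from (X / 2)^(- k) = (-2)^k (- X)^(- k). *)
Lemma Bcoef_sum : (RtoC (sqrt (PI / (X / 2))) * Csum (fun j => Bcoef b al j * RtoC (/ (- X) ^ j)) M = Csum (fun j => aa b X j * SG (al - RtoC (INR j)) X (M - j)) (S M))%C.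
Proof.
  assert (XP := X_pos).
  set (f := fun k i => (aa b X i * (Gseq (al - RtoC (INR i)) (2 * k) * RtoC (sqrt (PI / (X / 2)) * hp k * (/ (X / 2)) ^ k)))%C).
  transitivity (Csum (fun j => Csum (fun k => f k (j - k)%nat) (S j)) M).
  - rewrite <- Csum_scal. apply Csum_ext. intros j _. unfold Bcoef. rewrite Cmult_comm, <- Cmult_assoc, Cmult_comm, <- Csum_scal. apply Csum_ext. intros k Hk. unfold f, aa, Gcoef. rewrite hp_poch.
    replace (/ (- X) ^ j) with (/ (- X) ^ (j - k) * / (- X) ^ k). 2: { rewrite <- Rinv_mult, <- pow_add. do 2 f_equal. lia. }
    replace ((/ (X / 2)) ^ k) with ((-2) ^ k * / (- X) ^ k). 2: { rewrite <- pow_inv, <- Rpow_mult_distr. f_equal. field. lra. }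
    rewrite !RtoC_mult. ring.
  - rewrite Csum_triangle. apply Csum_ext. intros i _. unfold f. rewrite Csum_scal. reflexivity.
Qed.
End Assembly.

Theorem theorem5 (b : C) (M : nat) (hM : (1 <= M)%nat)
    (mo : R -> nat) (alpha : R -> C)
    (halpha : forall x : R, 0 < x ->
       RtoC (INR (mo x)) = (RtoC (Xof x) + 2 * b - RtoC (3 / 2) + alpha x)%C)
    (halpha_bounded : exists K : R,
       Rbar_locally p_infty (fun x => Cmod (alpha x) <= K)) :
  let theta : C := (RtoC (1 / 2) - b)%C in
  exists E : R -> C,
    (exists K : R,
       Rbar_locally p_infty (fun x => Cmod (E x) <= K * / (Xof x ^ M)))
    /\
    Rbar_locally p_infty (fun x =>
      Psi01 (- (1 / 2)) b x
      = (Hopt b (mo x) x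
         + Rcpow (Xof x) theta * RtoC (exp (- Xof x)) / RtoC (2 * PI)
           * (Csum (fun j =>
                (Ccos (RtoC (2 * PI) * theta) * Acoef b j
                 - 2 * Csin (RtoC (2 * PI) * theta) * Bcoef b (alpha x) j
                   / RtoC (sqrt (2 * PI * Xof x)))
                * RtoC (/ ((- Xof x) ^ j))) M
              + E x))%C).
Proof.
  intros theta. destruct halpha_bounded as [Ka [xa Ha]].
  destruct (cos_sin_theta b) as [Ec Es]. fold theta in Ec, Es.
  destruct (Wf_expansion (1 - 2 * b) (S M)) as [rho [rho' [K1 [a [HK1 HW]]]]].
  (* A common bound for |alpha - j| over all j <= M. *)
  set (G := Rabs Ka + INR (S M)). assert (HG : 0 <= G) by (unfold G; generalize (Rabs_pos Ka) (pos_INR (S M)); lra).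
  destruct (RR_bound rho rho' K1 a M G HK1 HG (fun Z HZ => proj2 (HW Z HZ))) as [CR [XR [HCR [HXR HR]]]].
  destruct (T_asym_all G M HG) as [CT [XT [HCT [HXT HT]]]].
  set (AS := sum_f_R0 (fun j => Cmod (Acoef b j)) M).
  (* For x >= 4 one has X >= x, which yields the thresholds on X; the terms 2 |b| + 2 G force Re b <
     m + 1 through the formula for m. *)
  set (X0 := Rabs xa + XR + XT + 4 + 2 * Cmod b + 2 * G).
  assert (Big : forall x, X0 < x -> 0 < x /\ xa < x /\ 1 <= Xof x /\ XR <= Xof x /\ XT <= Xof x /\ Re b < INR (mo x) + 1 /\
     Cmod (alpha x) <= G /\ forall j, (j < S M)%nat -> Cmod (alpha x - RtoC (INR j)) <= G).
  { intros x Hx. unfold X0 in Hx. assert (B0 := Cmod_ge_0 b). generalize (Rabs_pos xa) (Rle_abs xa); intros P1 P2.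
    assert (HXx : x <= Xof x) by (unfold Xof; nra). specialize (Ha x ltac:(lra)). assert (P3 := Rle_abs Ka).
    assert (N0 := pos_INR (S M)).
    assert (AG : Cmod (alpha x) <= G) by (unfold G; lra).
    repeat split; try lra.
    - assert (Hm := f_equal Re (halpha x ltac:(lra))). unfold Re in Hm; simpl in Hm.
      assert (Q1 := Re_le_Cmod b). assert (Q2 := Re_le_Cmod (alpha x)). apply Rabs_le_between in Q1. apply Rabs_le_between in Q2. unfold Re in *. lra.
    - intros j Hj. eapply Rle_trans. apply Cmod_triang_minus. rewrite Cmod_RtoC, Rabs_pos_eq by apply pos_INR. unfold G. assert (INR j <= INR (S M)) by (apply le_INR; lia). lra. }
  (* Three sources of error: the term j = M of the expansion of Psi(- x), the remainder [rho] at y =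
     0, and in N_m both the moment errors of orders M - j and the principal value of the
     remainder. *)
  set (E := fun x => (- (cb b * aa b (Xof x) M) - 2 * cb b * (RtoC (sqrt (Xof x)) * rho (Xof x))
     - sb b / RtoC PI * (Csum (fun j => aa b (Xof x) j * (IntW W0 (hT (Xof x) (alpha x - RtoC (INR j))) - SG (alpha x - RtoC (INR j)) (Xof x) (M - j))) (S M)
        + 2 * IntW W0 (hR rho (Xof x) (alpha x))))%C).
  assert (HP := PI_RGT_0). assert (PIc : RtoC PI <> 0%C) by (apply RtoC_neq0; lra).
  exists E. split.
  - exists (Cmod (cb b) * Cmod (Acoef b M) + 2 * Cmod (cb b) * (2 * K1) + Cmod (sb b / RtoC PI) * (CT * AS + 2 * CR)). exists X0. intros x Hx.
    destruct (Big x Hx) as [Hx0 [_ [X1 [XRx [XTx [_ [AG AJ]]]]]]]. set (X := Xof x) in *.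
    rewrite <- pow_inv. set (u := (/ X) ^ M). assert (IX : 0 < / X <= 1) by (split; [apply Rinv_0_lt_compat; lra|rewrite <- Rinv_1; apply Rinv_le_contravar; lra]).
    assert (Hu : 0 < u) by (apply pow_lt; lra).
    assert (AAj : forall j, Cmod (aa b X j) = Cmod (Acoef b j) * (/ X) ^ j).
    { intros j. unfold aa. rewrite Cmod_mult, Cmod_RtoC. f_equal. rewrite <- pow_inv, <- RPow_abs. f_equal. rewrite Rabs_inv, Rabs_Ropp, Rabs_pos_eq; lra. }
    assert (Q1 : Cmod (cb b * aa b X M) = Cmod (cb b) * Cmod (Acoef b M) * u) by (rewrite Cmod_mult, AAj; unfold u; ring).
    assert (SX : sqrt X * sqrt (/ X) = 1) by (rewrite <- sqrt_mult by lra; rewrite Rinv_r by lra; apply sqrt_1).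
    assert (Q2 : Cmod (RtoC (sqrt X) * rho X) <= 2 * K1 * u).
    { rewrite Cmod_mult, Cmod_RtoC, Rabs_pos_eq by apply sqrt_pos. destruct (HW X ltac:(lra)) as [_ [_ [B _]]].
      apply Rle_trans with (sqrt X * (K1 * sqrt (/ X) * ((/ X) ^ S M + (/ X) ^ (S M + a)))). apply Rmult_le_compat_l; auto. apply sqrt_pos.
      replace (sqrt X * (K1 * sqrt (/ X) * ((/ X) ^ S M + (/ X) ^ (S M + a)))) with ((sqrt X * sqrt (/ X)) * (K1 * ((/ X) ^ S M + (/ X) ^ (S M + a)))) by ring. rewrite SX.
      assert (L1 : (/ X) ^ S M <= u) by (change ((/ X) ^ S M) with (/ X * u); rewrite <- (Rmult_1_l u) at 2; apply Rmult_le_compat_r; lra).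
      assert (L2 : (/ X) ^ (S M + a) <= u). { rewrite pow_add. assert ((/ X) ^ a <= 1) by (rewrite <- (pow1 a); apply pow_incr; lra). assert (0 < (/ X) ^ S M) by (apply pow_lt; lra). nra. }
      nra. }
    assert (Q3 : Cmod (Csum (fun j => aa b X j * (IntW W0 (hT X (alpha x - RtoC (INR j))) - SG (alpha x - RtoC (INR j)) X (M - j)))%C (S M)) <= CT * AS * u).
    { eapply Rle_trans. apply Cmod_Csum. unfold AS. replace (CT * sum_f_R0 (fun j => Cmod (Acoef b j)) M * u) with ((CT * u) * sum_f_R0 (fun j => Cmod (Acoef b j)) M) by ring.
      rewrite scal_sum. apply sum_Rle. intros j Hj. rewrite Cmod_mult, AAj. destruct (HT (M - j)%nat X (alpha x - RtoC (INR j))%C ltac:(lia) XTx (AJ j ltac:(lia))) as [_ B].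
      rewrite Rmult_assoc. apply Rmult_le_compat_l. apply Cmod_ge_0.
      (* The extra 1 / sqrt X from [T_asym_all] is given away; order j from the coefficient and
         order M - j from the principal value add up to M. *)
      assert (S1 : sqrt (/ X) <= 1) by (rewrite <- sqrt_1; apply sqrt_le_1_alt; lra). assert (S0 := sqrt_pos (/ X)).
      assert (Pj : 0 < (/ X) ^ j) by (apply pow_lt; lra). assert (Pm : 0 < (/ X) ^ (M - j)) by (apply pow_lt; lra).
      apply Rle_trans with ((/ X) ^ j * (CT * (1 * (/ X) ^ (M - j)))).
      - apply Rmult_le_compat_l. lra. eapply Rle_trans; [apply B|]. apply Rmult_le_compat_l; auto. apply Rmult_le_compat_r; lra.
      - right. unfold u. replace M with (j + (M - j))%nat at 2 by lia. rewrite pow_add. ring. }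
    destruct (HR X (alpha x) XRx AG) as [_ Q4]. fold u in Q4.
    unfold E. fold X. eapply Rle_trans. apply Cmod_triang_minus. eapply Rle_trans. apply Rplus_le_compat_r. apply Cmod_triang_minus.
    rewrite Cmod_opp, Q1, !(Cmod_mult (2 * cb b)), (Cmod_mult 2 (cb b)), (Cmod_mult (sb b / RtoC PI)), (Cmod_RtoC 2), (Rabs_pos_eq 2) by lra.
    assert (Q5 := Cmod_triangle (Csum (fun j => aa b X j * (IntW W0 (hT X (alpha x - RtoC (INR j))) - SG (alpha x - RtoC (INR j)) X (M - j)))%C (S M)) (2 * IntW W0 (hR rho X (alpha x)))).
    rewrite (Cmod_mult 2), (Cmod_RtoC 2), (Rabs_pos_eq 2) in Q5 by lra.
    assert (B1 := Cmod_ge_0 (cb b)). assert (B2 := Cmod_ge_0 (sb b / RtoC PI)).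
    rewrite !Rmult_plus_distr_r. apply Rplus_le_compat. apply Rplus_le_compat. lra.
    + rewrite (Rmult_assoc (2 * Cmod (cb b))). apply Rmult_le_compat_l; lra.
    + rewrite (Rmult_assoc (Cmod (sb b / RtoC PI))). apply Rmult_le_compat_l; auto. lra.
  - exists X0. intros x Hx. destruct (Big x Hx) as [Hx0 [_ [X1 [XRx [XTx [Hmo [AG AJ]]]]]]].
    assert (HWx : forall Z, 0 < Z -> Wf (1 - 2 * b) Z = (Wsum (1 - 2 * b) (S M) Z + rho Z)%C) by (intros Z HZ; apply (HW Z HZ)).
    assert (D := Dn_zero b (mo x) x Hmo Hx0). unfold Dn in D.
    rewrite (Psi_neg_expand b M (mo x) x (alpha x) rho Hx0 (halpha x Hx0) HWx) in D.
    rewrite (Nn_expand b M (mo x) x (alpha x) rho Hx0 (halpha x Hx0) HWx) in D.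
    2: { intros j Hj. apply (HT 0%nat); auto. lia. }
    2: { apply HR; auto. }
    assert (BS := Bcoef_sum b M x (alpha x) Hx0). set (X := Xof x) in *.
    assert (ES : Csum (fun j => aa b X j * (IntW W0 (hT X (alpha x - RtoC (INR j))) - SG (alpha x - RtoC (INR j)) X (M - j)))%C (S M) =
       (Csum (fun j => aa b X j * IntW W0 (hT X (alpha x - RtoC (INR j)))) (S M) - RtoC (sqrt (PI / (X / 2))) * Csum (fun j => Bcoef b (alpha x) j * RtoC (/ (- X) ^ j)) M)%C).
    { rewrite BS. rewrite (Csum_ext _ (fun j => aa b X j * IntW W0 (hT X (alpha x - RtoC (INR j))) + - (1) * (aa b X j * SG (alpha x - RtoC (INR j)) X (M - j)))%C) by (intros; ring).
      rewrite Csum_plus, Csum_scal. ring. }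
    assert (SQ : 0 < sqrt (2 * PI * X)) by (apply sqrt_lt_R0; apply Rmult_lt_0_compat; [apply Rmult_lt_0_compat|]; lra).
    (* The Gaussian factor 2 PI / sqrt (2 PI X), divided by the PI under sin (2 PI b), gives the
       coefficient 2 / sqrt (2 PI X) of B_j in the theorem. *)
    assert (SR : sqrt (PI / (X / 2)) = 2 * PI / sqrt (2 * PI * X)).
    { apply (Rmult_eq_reg_r (sqrt (2 * PI * X))); [|lra]. replace (2 * PI / sqrt (2 * PI * X) * sqrt (2 * PI * X)) with (2 * PI) by (field; lra).
      rewrite <- sqrt_mult_alt by (apply Rlt_le, Rdiv_lt_0_compat; lra). replace (PI / (X / 2) * (2 * PI * X)) with ((2 * PI) ^ 2) by (field; lra). apply sqrt_pow2. lra. }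
    rewrite Ec, Es. change (Rcpow X theta * RtoC (exp (- X)) / RtoC (2 * PI))%C with (Pf b X).
    rewrite (Csum_ext _ (fun j => - cb b * aa b X j + - (2 * sb b / RtoC (sqrt (2 * PI * X))) * (Bcoef b (alpha x) j * RtoC (/ (- X) ^ j)))%C).
    2: { intros j _. unfold aa. assert (RtoC (sqrt (2 * PI * X)) <> 0%C) by (apply RtoC_neq0; lra). field. auto. }
    rewrite Csum_plus, !Csum_scal. unfold E. fold X. rewrite ES, SR, RtoC_div, RtoC_mult by lra.
    fold (Psi b x).
    change (Csum (aa b X) (S M)) with (Csum (aa b X) M + aa b X M)%C in D.
    assert (SQc : RtoC (sqrt (2 * PI * X)) <> 0%C) by (apply RtoC_neq0; lra).
    set (S1 := Csum (aa b X) M) in *. set (S2 := Csum _ (S M)) in *. set (S3 := Csum _ M). set (RR := IntW W0 (hR _ _ _)) in *. set (sq := RtoC (sqrt (2 * PI * X))) in *.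
    set (P := Pf b X) in *. set (rr := (RtoC (sqrt X) * rho X)%C) in *. set (aM := aa b X M) in *.
    match type of D with (?q = _)%C => transitivity (q + (Hopt b (mo x) x - cb b * (P * (S1 + aM + 2 * rr)) - sb b / RtoC PI * (P * (S2 + 2 * RR))))%C end. ring.
    rewrite D. field. auto.
Qed.
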